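(* Let $a\ge2$, let $\bm{I}=\{f_i(x)=r_ix+t_i\}_{i=1}^a$ with $r_i\in(0,1)$ and $t_i\in\mathbb{R}$, let $\mu^+$ be a $\sigma$-ergodic probability measure on $\Sigma_a^+$, and let $V\ge0$ be a random variable with $\mathbb{E}(V)=1$ and $h_V:=\mathbb{E}(V\log V)<h_\mu$. Let $\widetilde\mu^+_{\bm{\omega}}$, $\bm{\omega}\in\Omega_a$, be the Mandelbrot cascade measure of $\mu^+$. Then for $\mathbb{P}_a$-a.e. $\bm{\omega}$ with $\|\widetilde{\mu}^+_{\bm{\omega}}\|>0$, the push-forward measure $\Phi_{\bm{I}}(\widetilde{\mu}^+_{\bm{\omega}})$ is exact-dimensional with dimension $$D_{\mu,V,\bm{I}}=\frac{h_{\mu}-h_V-h_{\mu,V,\bm{I}}}{\chi_{\mu,\bm{I}}}.$$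
   Context: Symbolic spaces: $\Sigma_a=\{1,\dots,a\}^{\mathbb{Z}}$; for $\bm{i}=(i_n)_{n\in\mathbb{Z}}$ write $\bm{i}^-=(i_n)_{n\le0}$ and $\bm{i}^+=(i_n)_{n\ge1}$, so $\Sigma_a=\Sigma_a^-\times\Sigma_a^+$; $\sigma$ is the left shift on $\Sigma_a$ and on $\Sigma_a^+=\{1,\dots,a\}^{\mathbb{N}}$. $\Sigma_a^{+,*}$ is the set of finite words (including the empty word), $[u]\subset\Sigma_a^+$ the cylinder of words with prefix $u$, and $\mathcal{P}_a^+=\{[i]\}_{i=1}^a$. Fibre measures: $\mu$ is the natural extension of $\mu^+$, i.e. the unique $\sigma$-invariant probability measure on $\Sigma_a$ projecting to $\mu^+$ under $\bm{i}\mapsto\bm{i}^+$; $\mu^-$ is its projection to $\Sigma_a^-$; and $\{\mu^+_{\bm{i}^-}\}$ is the disintegration into probability measures on $\Sigma_a^+$ with $\mu(\mathrm{d}\bm{i})=\mu^+_{\bm{i}^-}(\mathrm{d}\bm{i}^+)\mu^-(\mathrm{d}\bm{i}^-)$. Entropy: $h_\mu=\lim_{n}-\frac1n\sum_{u\in\{1,\dots,a\}^n}\mu^+([u])\log\mu^+([u])$. Cascades: $V$ is defined on a standard probability space $(\Omega,\mathcal{F},\mathbb{P})$; $(\Omega_a,\mathcal{F}_a,\mathbb{P}_a)$ is the product of copies of it indexed by $\Sigma_a^{+,*}$, and $V_u$ is $V$ composed with the projection to coordinate $u$ (so the $V_u$ are i.i.d. with the law of $V$). For a Borel probability measure $\lambda$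 on $\Sigma_a^+$, $\widetilde\lambda_{\bm{\omega}}$ is the weak limit as $k\to\infty$ of $V_{i_1}V_{i_1i_2}\cdots V_{i_1\cdots i_k}(\bm{\omega})\,\lambda(\mathrm{d}\bm{i}^+)$, which exists for $\mathbb{P}_a$-a.e. $\bm{\omega}$; $\|\widetilde\lambda_{\bm{\omega}}\|$ is its total mass and $\bar\lambda_{\bm{\omega}}=\widetilde\lambda_{\bm{\omega}}/\|\widetilde\lambda_{\bm{\omega}}\|$ when the mass is positive. In particular $\widetilde\mu^+_{\bm{\omega}}$, $\widetilde\mu^+_{\bm{i}^-,\bm{\omega}}$ and $\bar\mu^+_{\bm{i}^-,\bm{\omega}}$ are obtained from $\lambda=\mu^+$ and $\lambda=\mu^+_{\bm{i}^-}$. IFS: $\Phi_{\bm{I}}(i_1i_2\cdots)=\lim_{n}f_{i_1}\circ\cdots\circ f_{i_n}(0)$; $\mathcal{B}_{\bm{I}}=\Phi_{\bm{I}}^{-1}(\mathcal{B}(\mathbb{R}))$; $\Phi_{\bm{I}}(\lambda)=\lambda\circ\Phi_{\bm{I}}^{-1}$; $\chi_{\mu,\bm{I}}=-\sum_{i=1}^a\mu^+([i])\log r_i$. For a probability measure $\lambda$ on $\Sigma_a^+$, $H_\lambda(\mathcal{P}_a^+|\mathcal{B}_{\bm{I}})=\int\sum_{B\in\mathcal{P}_a^+}-\mathbf{1}_B\log\mathbb{E}_\lambda(\mathbf{1}_B|\mathcal{B}_{\bm{I}})\,\mathrm{d}\lambda$ is the conditional entropy, and $$h_{\mu,V,\bm{I}}=\int_{\Omega_a}\int_{\Sigma_a^-}H_{\bar\mu^+_{\bm{i}^-,\bm{\omega}}}(\mathcal{P}_a^+|\mathcal{B}_{\bm{I}})\cdot\|\widetilde\mu^+_{\bm{i}^-,\bm{\omega}}\|\,\mu^-(\mathrm{d}\bm{i}^-)\,\mathbb{P}_a(\mathrm{d}\bm{\omega}).$$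 A measure $\lambda$ on a metric space is exact-dimensional with dimension $D$ if $\lim_{r\to0}\frac{\log\lambda(B(x,r))}{\log r}=D$ for $\lambda$-a.e. $x$. Convention $0\log0=0$. *)

(* Defs.v *)
From HB Require Import structures.
From mathcomp Require Import all_boot all_order all_algebra.
From mathcomp Require Import all_classical all_reals all_analysis.

Set Implicit Arguments.
Unset Strict Implicit.
Unset Printing Implicit Defensive.
Import Order.TTheory GRing.Theory Num.Theory.
Import numFieldNormedType.Exports.

Local Open Scope classical_set_scope.
Local Open Scope ring_scope.

(* The alphabet {1, ..., a} is represented by {0, ..., a - 1}.  The proof of
   2 <= a is a parameter because measurable spaces are pointed types. *)
Definition letter (a : nat) (ha : (2 <= a)%N) : Type := 'I_a.

HB.instance Definition _ (a : nat) (ha : (2 <= a)%N) :=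
  Finite.on (letter ha).
HB.instance Definition _ (a : nat) (ha : (2 <= a)%N) :=
  isPointed.Build (letter ha) (Ordinal (ltnW ha)).

(* letter^I with the product of the discrete topologies, and its Borel
   sigma-algebra.
     symbolic nat ha, as Sigma^+ : coordinate n is the letter i_(n+1)
     symbolic nat ha, as Sigma^- : coordinate n is the letter i_(-n)
     symbolic int ha is Sigma. *)
Definition symbolic (I : Type) (a : nat) (ha : (2 <= a)%N) : Type :=
  {ptws I -> discrete_topology (letter ha)}.

HB.instance Definition _ (I : Type) (a : nat) (ha : (2 <= a)%N) :=
  Pointed.on (symbolic I ha).
HB.instance Definition _ (I : Type) (a : nat) (ha : (2 <= a)%N) :=
  Nbhs.on (symbolic I ha).
HB.instance Definition _ (I : Type) (a : nat) (ha : (2 <= a)%N) :=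
  Topological.on (symbolic I ha).
HB.instance Definition _ (I : Type) (a : nat) (ha : (2 <= a)%N) :=
  Measurable.copy (symbolic I ha)
    (g_sigma_algebraType (@open (symbolic I ha))).

Definition coordinate_sets (I : Type) d (T : measurableType d) :
    set (set (I -> T)) :=
  [set [set w | B (w i)] | i in [set: I] & B in @measurable d T].

Definition product_space (I : Type) d (T : measurableType d) : Type := I -> T.

HB.instance Definition _ (I : Type) d (T : measurableType d) :=
  Pointed.on (product_space I T).
HB.instance Definition _ (I : Type) d (T : measurableType d) :=
  Measurable.copy (product_space I T)
    (g_sigma_algebraType (@coordinate_sets I d T)).

Section Probability.
Context {R : realType}.
Local Open Scope ereal_scope.

(* Isomorphic modulo null sets to a Borel probability measure on the line;
   g is only required to be measurable for the completion of the image
   measure, so that both complete (Rokhlin) and standard Borel spaces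
   qualify. *)
Definition standard_probability d (Omega : measurableType d)
    (P : probability Omega R) : Prop :=
  exists (f : {mfun Omega >-> R}) (g : R -> Omega),
    {ae P, forall w, g (f w) = w} /\
    (forall A : set Omega, measurable A ->
       exists2 B : set R, measurable B &
         (distribution P f).-negligible (B `+` (g @^-1` A))).

Definition is_product_measure (I : eqType) d (T : measurableType d)
    (P : probability T R) (PI : probability (product_space I T) R) : Prop :=
  forall (s : seq I) (B : I -> set T),
    uniq s -> (forall i, measurable (B i)) ->
    PI [set w | forall i, i \in s -> B i (w i)] = \prod_(i <- s) P (B i).

Section ConditionalExpectation.
Context d (T : measurableType d).
Variables (lam : {measure set T -> \bar R}) (G : set (set T)) (f : T -> R).

Definition is_condexp (g : T -> R) : Prop :=
  [/\ forall B : set R, measurable B -> G (g @^-1` B),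
      lam.-integrable setT (EFin \o g) &
      forall A, G A ->
        \int[lam]_(x in A) (g x)%:E = \int[lam]_(x in A) (f x)%:E].

(* An arbitrary version: two versions agree lam-almost everywhere. *)
Definition condexp : T -> R := xget (cst 0%R) [set g | is_condexp g].

End ConditionalExpectation.

Definition exact_dimensional (m : set R -> \bar R) (D : R) : Prop :=
  {ae m, forall x : R,
    (ln (fine (m (ball x rho))) / ln rho)%R @[rho --> (0:R)^'+] --> D}.

End Probability.

Section Symbolic.
Context {R : realType} {a : nat} {ha : (2 <= a)%N}.
Local Notation letter := (letter ha).
Local Notation Sigma := (symbolic int ha).
Local Notation Sigmam := (symbolic nat ha).
Local Notation Sigmap := (symbolic nat ha).

Definition shift (x : Sigmap) : Sigmap := fun n => x n.+1.
Definition shiftZ (i : Sigma) : Sigma := fun n => i (n + 1).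
Definition past (i : Sigma) : Sigmam := fun n => i (- n%:Z).
Definition future (i : Sigma) : Sigmap := fun n => i n.+1%:Z.

Definition prefix_word (x : Sigmap) (n : nat) : seq letter := mkseq x n.

Definition cylinder (u : seq letter) : set Sigmap :=
  [set x | prefix_word x (size u) = u].

Local Open Scope ereal_scope.

Definition shift_ergodic (mup : probability Sigmap R) : Prop :=
  (forall A, measurable A -> mup (shift @^-1` A) = mup A) /\
  (forall A, measurable A -> shift @^-1` A = A -> mup A = 0 \/ mup A = 1).

Definition natural_extension (mup : probability Sigmap R)
    (mu : probability Sigma R) : Prop :=
  (forall A, measurable A -> mu (shiftZ @^-1` A) = mu A) /\
  (forall A, measurable A -> pushforward mu future A = mup A).

Definition past_measure (mu : probability Sigma R) : set Sigmam -> \bar R :=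
  pushforward mu past.

Definition is_disintegration (mu : probability Sigma R)
    (kappa : R.-pker Sigmam ~> Sigmap) : Prop :=
  forall (A : set Sigmam) (B : set Sigmap), measurable A -> measurable B ->
    mu (past @^-1` A `&` future @^-1` B) =
    \int[past_measure mu]_(im in A) kappa im B.

(* ln 0 = 0 in the library, so 0 log 0 = 0; the term n = 0 is 0. *)
Definition entropy (mup : probability Sigmap R) : R :=
  limn (fun n : nat =>
    - (n%:R^-1 * \sum_(u : n.-tuple letter)
         fine (mup (cylinder u)) * ln (fine (mup (cylinder u)))))%R.

Section Cascade.
Context d (Omega : measurableType d).
Local Notation Omegaa := (product_space (seq letter) Omega).
Variables (V : Omega -> R).

(* V_u(w) = V (w u), so this is V_(i_1) V_(i_1 i_2) ... V_(i_1 ... i_k)(w). *)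
Definition cascade_density (k : nat) (w : Omegaa) (x : Sigmap) : R :=
  (\prod_(j < k) V (w (prefix_word x j.+1)))%R.

Definition is_cascade (lam : {measure set Sigmap -> \bar R}) (w : Omegaa)
    (m : {finite_measure set Sigmap -> \bar R}) : Prop :=
  forall f : Sigmap -> R, continuous f ->
    (\int[lam]_x (f x * cascade_density k w x)%:E) @[k --> \oo] -->
    \int[m]_x (f x)%:E.

(* The weak limit; a finite Borel measure on the compact metrizable space
   Sigma^+ is determined by its integrals of continuous functions.  It is
   the zero measure on the null set of w where there is no weak limit. *)
Definition cascade (lam : {measure set Sigmap -> \bar R}) (w : Omegaa) :
    {finite_measure set Sigmap -> \bar R} :=
  match pselect (exists m, is_cascade lam w m) with
  | left h => projT1 (cid h)
  | right _ => mzero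
  end.

(* mnormalize returns the Dirac mass when the total mass is 0; this value is
   multiplied by 0 in cascade_conditional_entropy. *)
Definition cascade_bar (lam : {measure set Sigmap -> \bar R}) (w : Omegaa) :
    probability Sigmap R :=
  mnormalize (cascade lam w) (\d_ (point : Sigmap)).

End Cascade.

Section IFS.
Variables r t : letter -> R.

Definition coding (x : Sigmap) : R :=
  limn (fun n => foldr (fun i y => r i * y + t i)%R 0%R (prefix_word x n)).

Definition coding_algebra : set (set Sigmap) :=
  preimage_set_system setT coding (@measurable _ R).

Definition lyapunov (mup : probability Sigmap R) : R :=
  (- \sum_(i : letter) fine (mup (cylinder [:: i])) * ln (r i))%R.

Definition conditional_entropy (lam : probability Sigmap R) : \bar R :=
  \int[lam]_x (\sum_(i : letter)
    - (\1_(cylinder [:: i]) x *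
       ln (condexp lam coding_algebra \1_(cylinder [:: i]) x)))%R%:E.

Definition cascade_conditional_entropy d (Omega : measurableType d)
    (V : Omega -> R) (mu : probability Sigma R)
    (kappa : R.-pker Sigmam ~> Sigmap)
    (Pa : probability (product_space (seq letter) Omega) R) : \bar R :=
  \int[Pa]_w \int[past_measure mu]_im
    (conditional_entropy (cascade_bar V (kappa im) w) *
     cascade V (kappa im) w setT).

End IFS.
End Symbolic.

(* Main.v *)
(* A pair (past, tree) carries the cascade K of the fibre measure mu^+_past, root
   weight included.  The skew shift T moves the first letter of the future to the
   past and passes to the subtree above it; the product Q of mu^-, P_a and K is
   T-invariant.  Convexity of z ln z and h_V < h_mu give Q <> 0, a truncation gives
   Q(1) = 1, and Q is ergodic.  Along T, the logarithm of the K-mass of a ball whose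
   radius is the n-th scale is a Birkhoff sum, up to terms which converge by
   differentiation of measures, so Maker's theorem yields the dimension of almost
   every image of K.  The cascade of mu^+ is the mixture of the K over the past.
   The maximal inequality bounds balls of the mixture by balls of K, and a
   Borel-Cantelli argument with the entropy of mu gives K[x|n] <= e^(en) mix[x|n],
   which bounds them from below. *)
Require Import Defs.
From HB Require Import structures.
From mathcomp Require Import all_boot all_order all_algebra.
From mathcomp Require Import all_classical all_reals all_analysis.
From mathcomp Require Import measurable_realfun lra ring zify.

Set Implicit Arguments.
Unset Strict Implicit.
Unset Printing Implicit Defensive.
Set SsrOldRewriteGoalsOrder.
Import Order.TTheory GRing.Theory Num.Theory.
Import numFieldNormedType.Exports.

Local Open Scope classical_set_scope.
Local Open Scope ring_scope.

(** The recursion behind the proof, which writes the mass of [i] followed by B as a factor times a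
    mass of B, fails for mu^+ in general; the fibre measures satisfy it along the past, and this is
    why pasts belong to the phase space. The root weight is there because without it the subtree
    reached by T would have its root label biased by V, and the product would not be invariant. It
    has to be removed again at the end, where the root label may vanish. Only V ln V is integrable,
    so neither higher moments of the masses nor integrable logarithms are at hand. Square roots
    replace the former in the cross terms of the entropy inequality; the latter are avoided by
    treating the logarithm of the total mass as a function with integrable increments along T. An
    uncountable mixture of measures of dimension D may have a larger dimension. Hence the dimension
    of the fibre cascades alone gives no lower bound for the balls of the mixture; the comparison of
    cylinders through the entropy supplies it. *)

Local Notation mfunT := (measurable_fun setT).

(** * Measurability, dominated convergence, measure-preserving maps *)

Lemma measurable_EFin_indic d (T : measurableType d) (R : realType) (A : set T) :
  measurable A -> mfunT (fun x => (\1_A x)%:E : \bar R).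
Proof. by move=> mA; apply/measurable_EFinP; exact: measurable_indic. Qed.

Lemma measurable_preimage d d' (T : measurableType d) (U : measurableType d') (f : T -> U) B :
  mfunT f -> measurable B -> measurable (f @^-1` B).
Proof. by move=> mf mB; rewrite -[X in measurable X]setTI; exact: mf. Qed.

Section measurable_sets.
Context d (T : measurableType d) (R : realType).

Lemma measurable_pred (P : T -> bool) : mfunT P -> measurable [set x | P x].
Proof.
move=> mP; rewrite (_ : [set x | P x] = setT `&` P @^-1` [set true]).
  exact: mP.
by rewrite setTI.
Qed.

Lemma measurable_ltr_set (f g : T -> R) : mfunT f -> mfunT g -> measurable [set x | f x < g x].
Proof. by move=> mf mg; apply/measurable_pred/measurable_fun_ltr. Qed.

Lemma measurable_ler_set (f g : T -> R) : mfunT f -> mfunT g -> measurable [set x | f x <= g x].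
Proof. by move=> mf mg; apply/measurable_pred/measurable_fun_ler. Qed.

Lemma measurable_lte_set (f g : T -> \bar R) : mfunT f ->
  mfunT g -> measurable [set x | (f x < g x)%E].
Proof. by move=> mf mg; apply/measurable_pred/measurable_fun_lte. Qed.

End measurable_sets.

Section dominated_real.
Context d (T : measurableType d) (R : realType) (mu : {measure set T -> \bar R}).

Lemma measurable_funEFin (g : T -> R) : mfunT g -> mfunT (EFin \o g).
Proof. by move=> mg; exact/measurable_EFinP. Qed.

Lemma dominated_cvg_real (f_ : nat -> T -> R) (f g : T -> R) :
  (forall n, mfunT (f_ n)) -> mfunT f -> {ae mu, forall x, f_ n x @[n --> \oo] --> f x} ->
  mu.-integrable setT (EFin \o g) -> {ae mu, forall x, forall n, `|f_ n x| <= g x} ->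
  (\int[mu]_x (f_ n x)%:E @[n --> \oo] --> \int[mu]_x (f x)%:E)%E.
Proof.
move=> mf_ mf f_f gi f_g.
have f1 : {ae mu, forall x, setT x -> (f_ n x)%:E @[n --> \oo] --> (f x)%:E}.
  by apply: filterS f_f => x fx _; apply: cvg_EFin fx; exact: nearW.
have f2 : {ae mu, forall x, forall n, setT x -> (`|(f_ n x)%:E| <= (g x)%:E)%E}.
  by apply: filterS f_g => x fx n _; rewrite lee_fin.
by have [] := dominated_convergence measurableT
  (fun n => measurable_funEFin (mf_ n)) (measurable_funEFin mf) f1 gi f2.
Qed.

Lemma integrable_bounded (f : T -> R) (c : R) : (mu setT < +oo)%E ->
  mfunT f -> (forall x, `|f x| <= c) -> mu.-integrable setT (EFin \o f).
Proof.
move=> muoo mf fc; apply/integrableP; split; first exact/measurable_EFinP.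
apply: (@le_lt_trans _ _ (\int[mu]_x (cst (`|c|%:E) x))%E).
  apply: ge0_le_integral => //.
    by apply: measurableT_comp => //; exact/measurable_EFinP.
  by move=> x _; rewrite lee_fin (le_trans (fc x))// ler_norm.
by rewrite integral_cst// lte_mul_pinfty ?lee_fin.
Qed.

End dominated_real.

Section setC_full.
Context d (T : measurableType d) (R : realType).

Lemma measure_full_setC (mu : {measure set T -> \bar R}) (E : set T) :
  (mu setT < +oo)%E -> measurable E -> mu E = mu setT -> mu (~` E) = 0%E.
Proof.
move=> muoo mE muE; have mEC := measurableC mE.
have : mu setT = (mu E + mu (~` E))%E.
  by rewrite -measureU// ?setUv// setICr.
have muf : mu setT \is a fin_num by rewrite ge0_fin_numE.
rewrite muE -(fineK muf); have := measure_ge0 mu (~` E).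
by case: (mu (~` E)) => [t| |] //= _ [st]; congr EFin; lra.
Qed.

End setC_full.

Section measure_preserving.
Context d (T : measurableType d) (R : realType).
Variables (mu : {measure set T -> \bar R}) (th : T -> T).
Hypothesis mth : mfunT th.
Hypothesis inv : forall A, measurable A -> mu (th @^-1` A) = mu A.
Local Open Scope ereal_scope.

Lemma ge0_integral_inv (f : T -> \bar R) : mfunT f ->
  (forall x, 0 <= f x) -> \int[mu]_x f (th x) = \int[mu]_x f x.
Proof.
move=> mf f0; rewrite -[LHS]/(\int[mu]_(x in th @^-1` setT) (f \o th) x).
rewrite -ge0_integral_pushforward//.
by apply: eq_measure_integral => A mA _; exact: inv.
Qed.

Lemma integrable_inv (f : T -> \bar R) : mu.-integrable setT f -> mu.-integrable setT (f \o th).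
Proof.
move=> /integrableP[mf fi]; apply/integrableP; split.
  exact: measurableT_comp.
rewrite (@ge0_integral_inv (fun x => `|f x|))//.
exact: measurableT_comp.
Qed.

Lemma integral_inv (f : T -> \bar R) :
  mu.-integrable setT f -> \int[mu]_x f (th x) = \int[mu]_x f x.
Proof.
move=> fi; rewrite [RHS]integralE [LHS]integralE.
have mf := measurable_int _ fi.
congr (_ - _).
  rewrite -(ge0_integral_inv (measurable_funepos mf)) => [|x]; last first.
    exact: funepos_ge0.
  by apply: eq_integral => x _; rewrite !funeposE.
rewrite -(ge0_integral_inv (measurable_funeneg mf)) => [|x]; last first.
  exact: funeneg_ge0.
by apply: eq_integral => x _; rewrite !funenegE.
Qed.

Lemma measurable_iter n : mfunT (iter n th).
Proof.
elim: n => [|n ih]; first exact: measurable_id.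
by apply: (measurableT_comp mth ih).
Qed.

Lemma iter_inv n A : measurable A -> mu (iter n th @^-1` A) = mu A.
Proof.
elim: n A => [//|n ih] A mA.
rewrite -(inv mA) -(ih (th @^-1` A))//.
exact: (measurable_preimage mth).
Qed.

Lemma ae_inv (P : T -> Prop) : {ae mu, forall x, P x} -> {ae mu, forall x, P (th x)}.
Proof.
move=> [N [mN N0 PN]]; exists (th @^-1` N); split.
- exact: (measurable_preimage mth).
- by rewrite inv.
- by move=> x /= Px; exact: PN.
Qed.

Lemma ae_inv_iter (P : T -> Prop) : {ae mu, forall x, P x} ->
  {ae mu, forall x, forall n, P (iter n th x)}.
Proof.
move=> aeP; apply: ae_foralln => n; elim: n => [//|n ih].
by have := ae_inv ih; apply: filterS => x; rewrite -iterSr.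
Qed.

End measure_preserving.

(** * Pointwise ergodic theorems of Birkhoff and Maker *)

Section birkhoff.
Context d (T : measurableType d) (R : realType).
Variables (mu : {measure set T -> \bar R}) (th : T -> T).
Hypothesis mu1 : mu setT = 1%E.
Hypothesis mth : mfunT th.
Hypothesis inv : forall A, measurable A -> mu (th @^-1` A) = mu A.
Hypothesis erg : forall A, measurable A -> th @^-1` A = A -> mu A = 0%E \/ mu A = 1%E.

Definition birkhoff_sum (f : T -> R) n x := \sum_(k < n) f (iter k th x).

(** The maximum of the partial sums of orders 0 to n. The recursion on the first term makes its
    increment along [th] computable ([birkhoff_max_diff]). *)
Fixpoint birkhoff_max (f : T -> R) n x : R :=
  if n is n'.+1 then Num.max 0 (f x + birkhoff_max f n' (th x)) else 0.

Lemma birkhoff_sumS f n x : birkhoff_sum f n.+1 x = f x + birkhoff_sum f n (th x).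
Proof.
rewrite /birkhoff_sum big_ord_recl; congr (_ + _).
by apply: eq_bigr => i _; rewrite -iterSr.
Qed.

Lemma birkhoff_max_ge0 f n x : 0 <= birkhoff_max f n x.
Proof. by case: n => [|n] //=; rewrite le_max lexx. Qed.

Lemma birkhoff_sum_max f n x : birkhoff_sum f n x <= birkhoff_max f n x.
Proof.
elim: n x => [x|n ih x]; first by rewrite /birkhoff_sum big_ord0.
by rewrite birkhoff_sumS /= le_max lerD2l ih orbT.
Qed.

Lemma birkhoff_max_nd f n x : birkhoff_max f n x <= birkhoff_max f n.+1 x.
Proof.
elim: n x => [x|n ih x]; first by rewrite /= le_max lexx.
by rewrite [leRHS]/= ge_max le_max lexx/= le_max lerD2l (ih (th x)) orbT.
Qed.

Lemma birkhoff_max_nd_le f m n x : (m <= n)%N -> birkhoff_max f m x <= birkhoff_max f n x.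
Proof.
move=> /subnKC <-; elim: (n - m)%N => [|k ih]; first by rewrite addn0.
by rewrite addnS (le_trans ih)// birkhoff_max_nd.
Qed.

Lemma birkhoff_max_diff f n x : birkhoff_max f n.+1 x =
  birkhoff_max f n (th x) + Num.max (- birkhoff_max f n (th x)) (f x).
Proof. by rewrite /= addr_maxr subrr addrC. Qed.

Lemma measurable_birkhoff_max f n : mfunT f -> mfunT (birkhoff_max f n).
Proof.
move=> mf; elim: n => [|n ih]; first exact: measurable_cst.
apply: (@measurable_maxr _ _ _ _ (fun=> 0)); first exact: measurable_cst.
apply: measurable_funD => //.
exact: (measurableT_comp ih mth).
Qed.

Lemma integrable_birkhoff_max f n : mu.-integrable setT (EFin \o f) ->
  mu.-integrable setT (EFin \o birkhoff_max f n).
Proof.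
move=> fi; have mf : mfunT f.
  exact/measurable_EFinP/(measurable_int _ fi).
elim: n => [|n ih]; first exact: integrable0.
have i2 : mu.-integrable setT (EFin \o (birkhoff_max f n \o th)).
  exact: (integrable_inv mth inv ih).
apply: (le_integrable measurableT _ _ (integrableD measurableT (integrable_abse fi) i2)) => //.
- exact/measurable_EFinP/measurable_birkhoff_max.
- move=> x _ /=; rewrite lee_fin.
  rewrite (ger0_norm (_ : 0 <= Num.max _ _)) ?le_max ?lexx//.
  rewrite [leRHS]ger0_norm; last by rewrite addr_ge0// birkhoff_max_ge0.
  rewrite ge_max addr_ge0 ?birkhoff_max_ge0//= lerD2r.
  exact: ler_norm.
Qed.

(** The set [E] where the maxima are unbounded is invariant. If it had full measure, the increment
    [D n] of the maximum along [th] would tend to f while being dominated by |f|. By invariance its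
    integral is that of [birkhoff_max f n.+1 - birkhoff_max f n], hence nonnegative, which
    contradicts the negative integral of f. *)
Lemma birkhoff_sum_ae_ubound (f : T -> R) : mu.-integrable setT (EFin \o f) ->
  (\int[mu]_x (f x)%:E < 0)%E -> {ae mu, forall x, exists M, forall n, birkhoff_sum f n x <= M}.
Proof.
move=> fi f0; have mf : mfunT f.
  exact/measurable_EFinP/(measurable_int _ fi).
pose E := [set x | forall B : nat, exists n, B%:R < birkhoff_max f n x].
have mE : measurable E.
  rewrite (_ : E = \bigcap_B \bigcup_n [set x | B%:R < birkhoff_max f n x]).
    apply: bigcap_measurable => // B _; apply: bigcup_measurable => n _.
    apply: measurable_ltr_set => //; exact: measurable_birkhoff_max.
  apply/seteqP; split => x.
    by move=> Ex B _; have [n Bn] := Ex B; exists n.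
  by move=> Ex B; have [n _ Bn] := Ex B Logic.I; exists n.
have thE : th @^-1` E = E.
  apply/seteqP; split => x Ex B.
  - have [n Bn] := Ex (B + Num.bound `|f x|)%N.
    exists n.+1; rewrite /= lt_max; apply/orP; right.
    have := archi_boundP (normr_ge0 (f x)); have := ler_norm (- f x).
    by rewrite normrN; move: Bn; rewrite natrD; lra.
  - have [n Bn] := Ex (B + Num.bound `|f x|)%N.
    case: n Bn => [|n]; first by rewrite /= ltrn0.
    rewrite /= lt_max ltrn0/= => Bn; exists n.
    have := archi_boundP (normr_ge0 (f x)); have := ler_norm (f x).
    by move: Bn; rewrite natrD; lra.
have [E0|E1] := erg mE thE.
  exists E; split => // x /= nM B; apply: contrapT => nB; apply: nM.
  exists B%:R => n; rewrite (le_trans (birkhoff_sum_max _ _ _))// leNgt.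
  by apply/negP => ?; apply: nB; exists n.
pose D n x := Num.max (- birkhoff_max f n (th x)) (f x).
have mD n : mfunT (D n).
  apply: measurable_maxr => //; apply: measurableT_comp => //.
  exact: (measurableT_comp (measurable_birkhoff_max n mf) mth).
have aeE : {ae mu, forall x, E x}.
  exists (~` E); split => //; first exact: measurableC.
  by rewrite measure_full_setC// ?E1 ?mu1// ltry.
have Df : {ae mu, forall x, D n x @[n --> \oo] --> f x}.
  apply: filterS aeE => x Ex; apply: cvg_near_cst.
  rewrite -thE in Ex; have [N fN] := Ex (Num.bound `|f x|).
  near=> n; rewrite /D; apply/max_idPr.
  have := archi_boundP (normr_ge0 (f x)); have := ler_norm (- f x).
  have Nn : (N <= n)%N by near: n; exact: nbhs_infty_ge.
  have := birkhoff_max_nd_le f (th x) Nn; rewrite normrN; lra.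
have Dle : {ae mu, forall x, forall n, `|D n x| <= `|f x|}.
  apply: aeW => x n; rewrite /D.
  have := birkhoff_max_ge0 f n (th x); set b := birkhoff_max _ _ _ => b0.
  case: (leP (- b) (f x)) => // fb.
  rewrite normrN ger0_norm// -[leRHS]normrN (le_trans _ (ler_norm _))//.
  by move: fb; lra.
have Dc := dominated_cvg_real mD mf Df (integrable_norm fi) Dle.
suff : (0 <= \int[mu]_x (f x)%:E)%E by rewrite leNgt f0.
have <- := cvg_lim (@ereal_hausdorff _) Dc.
apply: lime_ge; first exact: cvgP Dc.
apply: nearW => n /=.
have iM k := integrable_birkhoff_max k fi.
have iMth : mu.-integrable setT (EFin \o (birkhoff_max f n \o th)).
  exact: (integrable_inv mth inv (iM n)).
rewrite [leRHS](_ : _ = \int[mu]_x (birkhoff_max f n.+1 x)%:E -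
    \int[mu]_x (birkhoff_max f n (th x))%:E)%E; last first.
  rewrite -integralB_EFin//; apply: eq_integral => x _.
  by rewrite birkhoff_max_diff /D -EFinB addrC addKr.
rewrite (integral_inv mth inv (iM n)) sube_ge0; last first.
  by rewrite (integrable_fin_num _ (iM n)).
apply: (le_integral measurableT (iM n) (iM n.+1)) => x _ /=.
by rewrite lee_fin birkhoff_max_nd.
Unshelve. all: by end_near.
Qed.

Lemma birkhoff_sumB f c n x : birkhoff_sum (fun y => f y - c) n x = birkhoff_sum f n x - n%:R * c.
Proof.
rewrite /birkhoff_sum big_split/= sumrN; congr (_ - _).
by rewrite sumr_const card_ord mulr_natl.
Qed.

Lemma birkhoff_sumN f n x : birkhoff_sum (fun y => - f y) n x = - birkhoff_sum f n x.
Proof. by rewrite /birkhoff_sum sumrN. Qed.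

Let integrable_cst1 (c : R) : mu.-integrable setT (EFin \o cst c).
Proof.
by apply: (@integrable_bounded _ _ _ _ _ `|c|); rewrite ?mu1 ?ltry.
Qed.

(** The upper bound is applied to f minus a constant slightly above its mean. *)
Let birkhoff_ubound (f : T -> R) (e : R) : 0 < e -> mu.-integrable setT (EFin \o f) ->
  {ae mu, forall x, exists M, forall n,
    birkhoff_sum f n x <= n%:R * (fine (\int[mu]_x (f x)%:E) + e) + M}.
Proof.
move=> e0 fi; set I := fine _.
have iI : (\int[mu]_x (f x)%:E)%E = I%:E.
  by rewrite fineK// integrable_fin_num.
have : {ae mu, forall x, exists M, forall n, birkhoff_sum (fun y => f y - (I + e)) n x <= M}.
  apply: birkhoff_sum_ae_ubound.
    exact: (integrableB measurableT fi (integrable_cst1 (I + e))).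
  under eq_integral do rewrite EFinB.
  rewrite integralB_EFin//; last exact: (integrable_cst1 (I + e)).
  rewrite iI (integral_cst _ measurableT ((I + e)%:E)) mu1 mule1 -EFinB lte_fin.
  lra.
apply: filterS => x [M HM]; exists M => n; have := HM n.
by rewrite birkhoff_sumB lerBlDl.
Qed.

Theorem birkhoff (f : T -> R) : mu.-integrable setT (EFin \o f) ->
  {ae mu, forall x, n%:R^-1 * birkhoff_sum f n x @[n --> \oo] --> fine (\int[mu]_x (f x)%:E)}.
Proof.
move=> fi; set I := fine _.
have fiN : mu.-integrable setT (EFin \o (fun x => - f x)).
  exact: (integrableN fi).
have NI : fine (\int[mu]_x (- f x)%:E) = - I.
  rewrite -fineN -integralN//; last exact: integrable_add_def.
have k0 (k : nat) : 0 < k.+1%:R^-1 :> R by rewrite invr_gt0.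
have := ae_foralln (fun k => birkhoff_ubound (k0 k) fi).
have := ae_foralln (fun k => birkhoff_ubound (k0 k) fiN).
apply: filterS2 => x lb ub; apply/cvgrPdist_le => e e0.
have [k ke] : exists k, k.+1%:R^-1 <= e / 2.
  exists (Num.bound (e / 2)^-1); rewrite invf_ple ?posrE//; last by lra.
  apply: ltW; apply: lt_le_trans (archi_boundP _) _; last by rewrite ler_nat.
  by rewrite invr_ge0; lra.
have [M1 H1] := lb k; have [M2 H2] := ub k.
near=> n.
have n0 : 0 < n%:R :> R by rewrite ltr0n; near: n; exact: nbhs_infty_gt.
have nM : (`|M1| + `|M2|) / (e / 2) <= n%:R by near: n; exact: nbhs_infty_ger.
rewrite ler_pdivrMr in nM; last by lra.
rewrite -(ler_pM2l n0) -[X in X * _](gtr0_norm n0) -normrM mulrBr mulVKf ?gt_eqF//.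
have := H1 n; rewrite NI birkhoff_sumN; have := H2 n; rewrite -/I.
have := ler_norm M1; have := ler_norm M2.
have := normr_ge0 M1; have := normr_ge0 M2.
have : n%:R * k.+1%:R^-1 <= n%:R * (e / 2) by rewrite ler_pM2l.
move: (birkhoff_sum f n x) (k.+1%:R^-1) (n%:R : R) n0 nM => S K N N0 nM.
rewrite !mulrDr !mulrN => ? ? ? ? ? ? ?; rewrite ler_norml.
by apply/andP; split; lra.
Unshelve. all: by end_near.
Qed.

(** Each term is the difference of two consecutive Birkhoff sums, whose averages have the same
    limit. *)
Lemma birkhoff_term (f : T -> R) : mu.-integrable setT (EFin \o f) ->
  {ae mu, forall x, n.+1%:R^-1 * f (iter n th x) @[n --> \oo] --> 0}.
Proof.
move=> /birkhoff; apply: filterS => x; set I := fine _ => cI.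
have c1 : n.+1%:R^-1 * birkhoff_sum f n.+1 x @[n --> \oo] --> I.
  by move: cI; rewrite -cvg_shiftS.
have c2 : n.+1%:R^-1 * n%:R * (n%:R^-1 * birkhoff_sum f n x) @[n --> \oo] --> 1 * I.
  apply: cvgM => //.
  rewrite (_ : (fun n => _) = (fun n => 1 - n.+1%:R^-1)); last first.
    apply/funext => n; apply/eqP; rewrite eq_sym subr_eq -[X in _ + X]mulr1 -mulrDr natr1 mulVf//.
  rewrite -[X in _ --> X](subr0 1); apply: cvgB; first exact: cvg_cst.
  exact: cvg_harmonic.
rewrite (_ : (fun n => _) = (fun n => n.+1%:R^-1 * birkhoff_sum f n.+1 x -
    n.+1%:R^-1 * n%:R * (n%:R^-1 * birkhoff_sum f n x))); last first.
  apply/funext => n; rewrite -!mulrA -mulrBr; congr (_ * _).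
  have [->|n0] := eqVneq n 0%N.
    by rewrite mul0r subr0 /birkhoff_sum big_ord1.
  by rewrite mulVKf ?pnatr_eq0// /birkhoff_sum big_ord_recr/= addrAC subrr add0r.
by rewrite -(subrr I) -[X in _ --> _ - X]mul1r; exact: cvgB.
Qed.

(** Integrate the Birkhoff averages of the indicator of A against rho: by invariance each integral
    is rho A, while the averages tend to mu A almost everywhere for mu, hence for rho, which mu
    dominates. *)
Lemma ergodic_invariant_measure (rho : {measure set T -> \bar R}) :
  (forall A, measurable A -> (rho A <= mu A)%E) ->
  (forall A, measurable A -> rho (th @^-1` A) = rho A) ->
  forall A, measurable A -> rho A = (rho setT * mu A)%E.
Proof.
move=> rholemu rhoinv A mA.
have rhoT : (rho setT < +oo)%E.
  by rewrite (le_lt_trans (rholemu _ measurableT))// mu1 ltry.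
have /birkhoff : mu.-integrable setT (EFin \o \1_A).
  apply: (@integrable_bounded _ _ _ _ _ 1); rewrite ?mu1 ?ltry//.
  by move=> x; rewrite ger0_norm// indicE; case: (_ \in _).
have -> : fine (\int[mu]_x (\1_A x)%:E) = fine (mu A).
  by rewrite integral_indic// setIT.
move=> [N [mN N0 HN]].
have cvgN : {ae rho, forall x, n%:R^-1 * birkhoff_sum \1_A n x @[n --> \oo] --> fine (mu A)}.
  exists N; split => //; apply/eqP; rewrite eq_le measure_ge0 andbT.
  by rewrite -N0 rholemu.
have mS n : mfunT (fun x => n%:R^-1 * birkhoff_sum \1_A n x).
  apply: measurable_funM => //; apply: measurable_sum => k.
  by apply: measurableT_comp => //; exact: measurable_iter.
have le1 : {ae rho, forall x, forall n, `|n%:R^-1 * birkhoff_sum \1_A n x| <= cst 1 x}.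
  apply: aeW => x n; rewrite ger0_norm; last first.
    by rewrite mulr_ge0// sumr_ge0.
  have [->|n0] := eqVneq n 0%N; first by rewrite /birkhoff_sum big_ord0 mulr0.
  rewrite ler_pdivrMl ?ltr0n ?lt0n// mulr1 /birkhoff_sum -[in leRHS](card_ord n) -sum1_card natr_sum.
  by apply: ler_sum => k _; rewrite indicE; case: (_ \in _).
have i1 : rho.-integrable setT (EFin \o cst 1).
  by apply: (@integrable_bounded _ _ _ _ _ 1) => // x; rewrite normr1.
have := dominated_cvg_real mS (measurable_cst _) cvgN i1 le1.
rewrite (integral_cst _ measurableT (fine (mu A))%:E) => cA.
have muA : (mu A < +oo)%E.
  by rewrite (@le_lt_trans _ _ (mu setT))// ?le_measure ?inE// mu1 ltry.
rewrite fineK ?ge0_fin_numE// muleC in cA.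
have : (\int[rho]_x (n%:R^-1 * birkhoff_sum \1_A n x)%:E)%E @[n --> \oo] --> rho A.
  apply: cvg_near_cst; near=> n.
  have n0 : (n != 0)%N by rewrite -lt0n; near: n; exact: nbhs_infty_gt.
  under eq_integral do rewrite EFinM.
  rewrite ge0_integralZl_EFin//; last 2 first.
    by move=> x _; rewrite lee_fin sumr_ge0.
    apply/measurable_EFinP; apply: measurable_sum => k.
    by apply: measurableT_comp => //; exact: measurable_iter.
  rewrite /birkhoff_sum; under eq_integral do rewrite -sumEFin.
  rewrite ge0_integral_sum//; last first.
    move=> k; apply/measurable_EFinP/measurableT_comp => //.
    exact: measurable_iter.
  under eq_bigr => k _.
    rewrite (_ : (\int[rho]_x _)%E = rho A); last first.
      have := @ge0_integral_inv _ _ _ rho _ (measurable_iter mth k)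
        (iter_inv mth rhoinv k) (fun x => (\1_A x)%:E).
      move=> -> //; last by apply/measurable_EFinP.
      by rewrite integral_indic// setIT.
    over.
  have rA : rho A \is a fin_num.
    by rewrite ge0_fin_numE// (le_lt_trans (rholemu _ mA)).
  rewrite -(fineK rA) /= (eq_bigr (fun=> (fine (rho A))%:E))//.
  by rewrite sumEFin sumr_const card_ord -EFinM -[fine _ *+ n]mulr_natl mulKf// pnatr_eq0.
by move=> cA'; exact: (cvg_unique (@ereal_hausdorff _) cA' cA).
Unshelve. all: by end_near.
Qed.

Lemma sum_ltn_minn n N : (\sum_(j < n) (j < N))%N = minn n N.
Proof.
elim: n => [|n ih]; first by rewrite big_ord0 min0n.
by rewrite big_ord_recr/= ih; lia.
Qed.

(** Replacing g_(n-k) by g costs at most [H N], the supremum of |g_m - g| over m >= N, when n - k >=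
    N, and at most an extra 2 h for the at most N other indices. The averages of [H N] tend to its
    integral, which is small for N large, and the last terms are negligible because h (th^k x) / (k
    + 1) tends to 0. *)
Lemma maker (g_ : nat -> T -> R) (g h : T -> R) : (forall n, mfunT (g_ n)) -> mfunT g ->
  mu.-integrable setT (EFin \o h) -> {ae mu, forall x, forall n, `|g_ n x| <= h x} ->
  {ae mu, forall x, g_ n x @[n --> \oo] --> g x} ->
  {ae mu, forall x, n%:R^-1 * \sum_(k < n) g_ (n - k)%N (iter k th x)
     @[n --> \oo] --> fine (\int[mu]_x (g x)%:E)}.
Proof.
move=> mg_ mg hi g_h g_g; set I := fine _.
have mh : mfunT h by exact/measurable_EFinP/(measurable_int _ hi).
have gh : {ae mu, forall x, `|g x| <= h x}.
  apply: filterS2 g_h g_g => x bx cx.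
  apply: (@closed_cvg _ _ \oo _ (fun n => `|g_ n x|) [set y | y <= h x]).
  - exact: closed_le.
  - by apply: nearW => n /=; exact: bx.
  - exact: cvg_norm.
have gi : mu.-integrable setT (EFin \o g).
  apply/integrableP; split; first exact/measurable_EFinP.
  have /integrableP[_] := hi; apply: le_lt_trans.
  apply: ae_ge0_le_integral => //.
  - by apply: measurableT_comp => //; exact/measurable_EFinP.
  - by apply: measurableT_comp => //; exact/measurable_EFinP.
  - apply: filterS gh => x gx _ /=; rewrite lee_fin.
    by rewrite (le_trans gx)// ler_norm.
(* The tail supremum is taken in the extended reals, since it may be infinite off the almost sure
   set [good]. *)
pose E N x := esups (fun m => (`|g_ m x - g x|)%:E) N.
pose H N x := fine (E N x).
have mE N : mfunT (E N).
  apply: measurable_fun_esups => m; apply/measurable_EFinP.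
  by apply: measurableT_comp => //; exact: measurable_funB.
have mH N : mfunT (H N).
  by apply: measurableT_comp => //; exact: measurable_fine.
pose good := fun x => [/\ forall n, `|g_ n x| <= h x, `|g x| <= h x & g_ n x @[n --> \oo] --> g x].
have aegood : {ae mu, forall x, good x}.
  by near=> x; split; near: x.
have Ebnd x : good x -> forall N, (0 <= E N x <= (2 * h x)%:E)%E.
  move=> [b1 b2 _] N; apply/andP; split.
    apply: (@le_trans _ _ (`|g_ N x - g x|%:E)); first by rewrite lee_fin.
    by apply: ereal_sup_ubound; exists N => //=.
  apply: ge_ereal_sup => _ [m _ <-]; rewrite lee_fin.
  rewrite (le_trans (ler_normB _ _))//; have := b1 m; have := b2; lra.
have EH x : good x -> forall N, E N x = (H N x)%:E.
  move=> gx N; rewrite /H fineK//; have /andP[e0 e1] := Ebnd x gx N.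
  by rewrite ge0_fin_numE// (le_lt_trans e1)// ltry.
have Hbnd x : good x -> forall N, 0 <= H N x <= 2 * h x.
  by move=> gx N; have := Ebnd x gx N; rewrite (EH x gx) !lee_fin.
have Hle x : good x -> forall N m, (N <= m)%N -> `|g_ m x - g x| <= H N x.
  move=> gx N m Nm; rewrite -lee_fin -(EH x gx).
  by apply: ereal_sup_ubound; exists m.
have Hcvg x : good x -> H N x @[N --> \oo] --> 0.
  move=> gx; apply/cvgrPdist_le => e e0; have [_ _] := gx.
  move=> /cvgrPdist_le /(_ _ e0) [N _ HN]; near=> n.
  rewrite sub0r normrN ger0_norm; last by have /andP[] := Hbnd x gx n.
  rewrite -lee_fin -(EH x gx); apply: ge_ereal_sup => _ [m /= nm <-].
  rewrite lee_fin distrC; apply: HN => /=; apply: leq_trans nm.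
  by near: n; exact: nbhs_infty_ge.
have h2i : mu.-integrable setT (EFin \o (fun x => 2 * h x)).
  exact: (integrableZl measurableT 2 hi).
have Hi N : mu.-integrable setT (EFin \o H N).
  apply/integrableP; split; first exact/measurable_EFinP.
  have /integrableP[_] := h2i; apply: le_lt_trans.
  apply: ae_ge0_le_integral => //.
  - by apply: measurableT_comp => //; exact/measurable_EFinP.
  - apply: measurableT_comp => //; apply/measurable_EFinP.
    exact: measurable_funM.
  - apply: filterS aegood => x /Hbnd/(_ N)/andP[H0 H2] _ /=; rewrite lee_fin.
    by rewrite ger0_norm// (le_trans H2)// ler_norm.
have intH0 : (\int[mu]_x (H N x)%:E)%E @[N --> \oo] --> 0%E.
  rewrite (_ : 0%E = (\int[mu]_x (cst 0 x)%:E)%E); last by rewrite integral0.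
  apply: (dominated_cvg_real mH _ _ h2i) => //.
  - by apply: filterS aegood => x /Hcvg.
  - apply: filterS aegood => x /Hbnd HN n; have /andP[H0 H2] := HN n.
    by rewrite ger0_norm.
have aB := filterI (birkhoff gi) (ae_foralln (fun N => birkhoff (Hi N))).
have aT := filterI (birkhoff_term hi) (ae_inv_iter mth inv aegood).
apply: filterS2 (aB _) (aT _) => x [cg cH] [ch gx].
apply/cvgrPdist_le => e e0.
have fH0 : fine (\int[mu]_x (H N x)%:E) @[N --> \oo] --> 0.
  exact: fine_cvg intH0.
move/cvgrPdist_le : fH0 => /(_ (e / 4)).
case; first by rewrite divr_gt0.
move=> N _ /(_ N (leqnn N)) /=; rewrite sub0r normrN => IHN.
have IHN' : fine (\int[mu]_x (H N x)%:E) <= e / 4.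
  exact: le_trans (ler_norm _) IHN.
(* Each of the at most N remaining terms is at most 2 n e / (8 (N + 1)), so that together they cost
   at most n e / 4. *)
have e8 : 0 < e / (8 * N.+1%:R) by rewrite divr_gt0// mulr_gt0.
have /cvgrPdist_le/(_ _ e8)[K _ hK] := ch.
have e4 : 0 < e / 4 by rewrite divr_gt0.
near=> n.
have n0 : 0 < n%:R :> R by rewrite ltr0n; near: n; exact: nbhs_infty_gt.
have HNn : n%:R^-1 * birkhoff_sum (H N) n x <= e / 2.
  have : `|fine (\int[mu]_x (H N x)%:E) - n%:R^-1 * birkhoff_sum (H N) n x|
      <= e / 4 by near: n; move/cvgrPdist_le: (cH N); exact.
  by rewrite ler_norml => /andP[? ?]; lra.
have gn : `|I - n%:R^-1 * birkhoff_sum g n x| <= e / 4.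
  by near: n; move/cvgrPdist_le: cg; exact.
have nK : (K + N <= n)%N by near: n; exact: nbhs_infty_ge.
have tn : \sum_(k < n) ((n - k < N)%N%:R * (2 * h (iter k th x))) <= n%:R * (e / 4).
  apply: (@le_trans _ _ (\sum_(k < n) ((n - k < N)%N%:R * (n%:R * (e / (4 * N.+1%:R)))))).
    apply: ler_sum => k _; case: ltnP => [nkN|]; rewrite ?mul0r// !mul1r.
    have kK : (K <= k)%N by clear -nkN nK; lia.
    have := hK k kK; rewrite /= sub0r normrN => /(le_trans (ler_norm _)).
    rewrite ler_pdivrMl ?ltr0n// => hk.
    have -> : n%:R * (e / (4 * N.+1%:R)) = 2 * (n%:R * (e / (8 * N.+1%:R))).
      have : N.+1%:R != 0 :> R by rewrite pnatr_eq0.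
      by move: (N.+1%:R : R) => M M0; field.
    rewrite ler_pM2l// (le_trans hk)// ler_pM2r// ler_nat.
    exact: ltn_ord.
  rewrite -mulr_suml -natr_sum.
  apply: (@le_trans _ _ (N.+1%:R * (n%:R * (e / (4 * N.+1%:R))))).
    rewrite ler_wpM2r//.
      by rewrite mulr_ge0// divr_ge0 ?mulr_ge0// ltW.
    rewrite ler_nat (reindex_inj rev_ord_inj)/=.
    apply: (@leq_trans (\sum_(j < n) (j < N))%N).
      by apply: leq_sum => j _; have := ltn_ord j; clear; lia.
    by rewrite sum_ltn_minn; clear; lia.
  have : N.+1%:R != 0 :> R by rewrite pnatr_eq0.
  move: (N.+1%:R : R) => M M0; rewrite le_eqVlt; apply/orP; left; apply/eqP.
  by field.
have key : `|n%:R^-1 * birkhoff_sum g n x -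
    n%:R^-1 * \sum_(k < n) g_ (n - k)%N (iter k th x)| <= e / 2 + e / 4.
  rewrite -mulrBr normrM gtr0_norm ?invr_gt0// ler_pdivrMl//.
  rewrite /birkhoff_sum -sumrB (le_trans (ler_norm_sum _ _ _))//.
  apply: (@le_trans _ _ (\sum_(k < n) (H N (iter k th x) +
      (n - k < N)%N%:R * (2 * h (iter k th x))))).
    apply: ler_sum => k _; rewrite distrC.
    have /andP[H0 _] := Hbnd _ (gx k) N.
    case: ltnP => [_|Nnk]; last by rewrite mul0r addr0; exact: Hle.
    have := Hle _ (gx k) 0%N (n - k)%N (leq0n _).
    by have /andP[_] := Hbnd _ (gx k) 0%N; rewrite mul1r; lra.
  by rewrite big_split/= mulrDr lerD// -ler_pdivrMl.
have -> : I - n%:R^-1 * \sum_(k < n) g_ (n - k)%N (iter k th x) =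
  (I - n%:R^-1 * birkhoff_sum g n x) + (n%:R^-1 * birkhoff_sum g n x -
   n%:R^-1 * \sum_(k < n) g_ (n - k)%N (iter k th x)) by rewrite addrA subrK.
by rewrite (le_trans (ler_normD _ _))//; move: gn key; lra.
Unshelve. all: by end_near.
Qed.

End birkhoff.

(** * Covering by intervals and the maximal inequality *)

Lemma finite_fin_num d (T : measurableType d) (R : realType)
    (mu : {measure set T -> \bar R}) (A : set T) :
  (mu setT < +oo)%E -> measurable A -> mu A \is a fin_num.
Proof.
move=> muoo mA; rewrite ge0_fin_numE// (le_lt_trans _ muoo)//.
by rewrite le_measure ?inE.
Qed.

Section interval_cover.
Context (R : realType).

Lemma itv_oo_bigcup (x y : R) : `]x, y[%classic =
  \bigcup_n `]x + n.+1%:R^-1, y - n.+1%:R^-1[%classic :> set R.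
Proof.
apply/seteqP; split => z /=.
  rewrite in_itv/= => /andP[xz zy].
  have d0 : (0 < Num.min (z - x) (y - z))%R by rewrite lt_min !subr_gt0 xz.
  have [n _ nd] := near_infty_natSinv_lt (PosNum d0).
  exists n => //=; have := nd n (leqnn n); rewrite /= lt_min in_itv/=.
  by move: (n.+1%:R^-1) => e /andP[? ?]; apply/andP; split; lra.
move=> [n _] /=; rewrite !in_itv/= => /andP[xz zy].
have n0 : (0 < n.+1%:R^-1 :> R)%R by rewrite invr_gt0.
by move: (n.+1%:R^-1) n0 xz zy => e *; apply/andP; split; lra.
Qed.

Local Open Scope ereal_scope.

(* A point lying in three intervals of a family lies in the union of the two
   that reach furthest to the left and to the right, so that a minimal subcover
   has multiplicity at most two. *)
Lemma interval_subcover n (a b : 'I_n -> R) : exists J : {set 'I_n},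
  (\bigcup_i `]a i, b i[%classic `<=` \bigcup_(i in [set i | i \in J]) `]a i, b i[%classic) /\
  forall x, (#|[set i in J | x \in `]a i, b i[%R]| <= 2)%N.
Proof.
pose cov (J : {set 'I_n}) := `[< \bigcup_i `]a i, b i[%classic `<=`
  \bigcup_(i in [set i | i \in J]) `]a i, b i[%classic >].
have covT : cov [set: 'I_n]%SET.
  by apply/asboolP => x [i _ xi]; exists i => //=; rewrite inE.
have [J /minsetP[/asboolP Jc Jmin] _] := minset_exists covT.
exists J; split => // x; rewrite leqNgt; apply/negP => c2.
set S := [set i in J | _] in c2.
have [i0 i0S] : exists i0, i0 \in S.
  by apply/set0Pn; rewrite -card_gt0 (leq_trans _ c2).
case: (@arg_minP _ _ _ i0 (mem S) a i0S) => l lS lmin.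
case: (@arg_maxP _ _ _ i0 (mem S) b i0S) => u uS umax.
have [c cS cN] : exists2 c, c \in S & c \notin [set l; u]%SET.
  apply/subsetPn; apply/negP => /subset_leq_card; rewrite leqNgt.
  by rewrite (leq_ltn_trans _ c2)// cards2; case: eqP.
have cJ : c \in J by move: cS; rewrite inE => /andP[].
have : (J :\ c)%SET = J.
  apply: Jmin; last exact: subsetDl.
  apply/asboolP => y /Jc[i /= iJ yi].
  have [ic|ic] := eqVneq i c; last by exists i => //=; rewrite !inE ic.
  move: cN; rewrite !inE negb_or => /andP[cl cu].
  have /andP[lJ xl] : (l \in J) && (x \in `]a l, b l[%R) by move: (lS : l \in S); rewrite inE.
  have /andP[uJ xu] : (u \in J) && (x \in `]a u, b u[%R) by move: (uS : u \in S); rewrite inE.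
  move: yi; rewrite ic /= in_itv/= => /andP[ay yb].
  have [yx|xy] := lerP y x.
  - exists l; first by rewrite /= !inE eq_sym cl.
    move: xl; rewrite !in_itv/= => /andP[_ xb].
    by rewrite in_itv/= (le_lt_trans yx xb) (le_lt_trans (lmin _ cS) ay).
  - exists u; first by rewrite /= !inE eq_sym cu.
    move: xu; rewrite !in_itv/= => /andP[ax _].
    by rewrite in_itv/= (lt_trans ax xy) (lt_le_trans yb (umax _ cS)).
by move=> /setP /(_ c); rewrite !inE eqxx cJ.
Qed.

(** The factor 2 is the multiplicity of the subcover: the sum over J of the be-masses is the
    integral of a function bounded by 2. *)
Lemma maximal_finite (al be : {measure set R -> \bar R}) (s : R) n (a b : 'I_n -> R) : (0 <= s)%R ->
  (forall i, al `]a i, b i[%classic <= s%:E * be `]a i, b i[%classic) ->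
  al (\bigcup_i `]a i, b i[%classic) <= (2 * s)%:E * be setT.
Proof.
move=> s0 ab; have [J [Jc J2]] := interval_subcover a b.
have mI i : measurable (`]a i, b i[%classic : set R) by exact: measurable_itv.
have mS (D : seq 'I_n) : mfunT (fun x => (\sum_(i <- D) \1_(`]a i, b i[%classic) x)%R : R).
  by apply: measurable_sum => i; exact: measurable_indic.
have sumE (mu : {measure set R -> \bar R}) : \sum_(i <- enum J) mu `]a i, b i[%classic =
    \int[mu]_x (\sum_(i <- enum J) \1_(`]a i, b i[%classic) x)%:E.
  under [RHS]eq_integral do rewrite -sumEFin.
  rewrite ge0_integral_sum//.
    by apply: eq_bigr => i _; rewrite integral_indic// setIT.
  by move=> i; exact/measurable_EFinP.
apply: (@le_trans _ _ (\sum_(i <- enum J) al `]a i, b i[%classic)).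
  rewrite sumE; have mU : measurable (\bigcup_i `]a i, b i[%classic : set R).
    by apply: fin_bigcup_measurable => //; exact: finite_finset.
  rewrite -[X in al X]setIT -integral_indic//; apply: ge0_le_integral => //.
  - exact/measurable_EFinP.
  - exact: (measurable_funEFin (mS _)).
  move=> x _; rewrite lee_fin; rewrite [leLHS]indicE.
  case: (boolP (x \in _)) => [|_]; last by rewrite sumr_ge0.
  rewrite inE => /Jc[i /= iJ xi].
  by rewrite (bigD1_seq i) ?enum_uniq ?mem_enum//= indicE mem_set// lerDl sumr_ge0.
apply: (@le_trans _ _ (\sum_(i <- enum J) s%:E * be `]a i, b i[%classic)).
  by apply: lee_sum => i _; exact: ab.
rewrite -ge0_sume_distrr// mulrC EFinM -muleA lee_wpmul2l ?lee_fin//.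
rewrite sumE -(integral_cst be measurableT 2%:E).
apply: ge0_le_integral => //.
- by move=> x _; rewrite lee_fin sumr_ge0.
- exact: (measurable_funEFin (mS _)).
move=> x _; rewrite lee_fin big_enum/=.
rewrite (eq_bigr (fun i => (x \in `]a i, b i[%R)%:R)); last first.
  by move=> i _; rewrite indicE; congr (_%:R); rewrite mem_setE.
rewrite -natr_sum ler_nat (leq_trans _ (J2 x))//.
rewrite -sum1_card [leqRHS]big_mkcond [leqLHS]big_mkcond; apply: leq_sum => i _.
by rewrite inE; case: (i \in J); case: (x \in _).
Qed.

End interval_cover.

Section maximal_inequality.
Context (R : realType).
Local Open Scope ereal_scope.
Variables (al be : {measure set R -> \bar R}) (s : R).
Hypothesis s0 : (0 <= s)%R.

(** The set where the uncentred maximal function of be relative to al exceeds 1 / s; the intervals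
    need only contain z. *)
Definition sparse_points : set R := [set z | exists a b : R,
  z \in `]a, b[%R /\ al `]a, b[%classic < s%:E * be `]a, b[%classic].

(** Shrinking the interval a little keeps z inside and preserves the strict inequality, because be
    is continuous from below and al only decreases; rational endpoints fit in the gap. The family of
    intervals thus becomes countable. *)
Lemma sparse_points_rat z : sparse_points z -> exists p q : rat, z \in `]ratr p, ratr q[%R /\
  al `]ratr p, ratr q[%classic < s%:E * be `]ratr p, ratr q[%classic.
Proof.
move=> [a [b [zab alb]]].
pose I n : set R := `](a + n.+1%:R^-1)%R, (b - n.+1%:R^-1)%R[%classic.
have ndI : nondecreasing_seq I.
  move=> m n mn; apply/subsetPset => y; rewrite /I/= !in_itv/= => /andP[ay yb].
  have : (n.+1%:R^-1 <= m.+1%:R^-1 :> R)%R by rewrite lef_pV2 ?posrE// ler_nat.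
  move: (n.+1%:R^-1)%R (m.+1%:R^-1)%R ay yb => u v *.
  by apply/andP; split; lra.
have mI n : measurable (I n) by exact: measurable_itv.
have cI : be (I n) @[n --> \oo] --> be `]a, b[%classic.
  rewrite itv_oo_bigcup; apply: nondecreasing_cvg_mu => //.
  exact: bigcup_measurable.
have csI : s%:E * be (I n) @[n --> \oo] --> s%:E * be `]a, b[%classic.
  by apply: cvgeZl => //.
have [N HN0] : exists n, al `]a, b[%classic < s%:E * be (I n).
  apply: contrapT => nal; move: alb; apply/negP; rewrite -leNgt.
  rewrite -(cvg_lim _ csI)//; apply: lime_le; first exact: cvgP csI.
  by apply: nearW => n; rewrite leNgt; apply/negP => ?; apply: nal; exists n.
have HN n : (N <= n)%N -> al `]a, b[%classic < s%:E * be (I n).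
  move=> Nn; rewrite (lt_le_trans HN0)// lee_wpmul2l ?lee_fin//.
  by rewrite le_measure ?inE//; apply/subsetPset/ndI.
have [M zM] : exists M, (z \in `](a + M.+1%:R^-1), (b - M.+1%:R^-1)[)%R.
  have : `]a, b[%classic z by [].
  by rewrite itv_oo_bigcup => -[M _ ?]; exists M.
pose n := maxn N M.
have n0 : (0 < n.+1%:R^-1 :> R)%R by rewrite invr_gt0.
have an : (a < a + n.+1%:R^-1)%R by rewrite ltrDl.
have bn : (b - n.+1%:R^-1 < b)%R by rewrite gtrDl oppr_lt0.
have [p] := rat_in_itvoo an; rewrite in_itv/= => /andP[ap pa].
have [q] := rat_in_itvoo bn; rewrite in_itv/= => /andP[bq qb].
exists p, q; split.
  have : (n.+1%:R^-1 <= M.+1%:R^-1 :> R)%R.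
    by rewrite lef_pV2 ?posrE// ler_nat ltnS leq_maxr.
  move: zM; rewrite !in_itv/= => /andP[].
  move: (n.+1%:R^-1)%R (M.+1%:R^-1)%R pa bq => u v *.
  by apply/andP; split; lra.
apply: (@le_lt_trans _ _ (al `]a, b[%classic)).
  rewrite le_measure ?inE//; try exact: measurable_itv.
  by move=> y /=; rewrite !in_itv/= => /andP[? ?]; apply/andP; split; lra.
apply: (@lt_le_trans _ _ (s%:E * be (I n))).
  by apply: HN => /=; exact: leq_maxl.
rewrite lee_wpmul2l ?lee_fin// le_measure ?inE//; try exact: measurable_itv.
move=> y; rewrite /I/= !in_itv/= => /andP[].
move: (n.+1%:R^-1)%R pa bq => v *.
by apply/andP; split; lra.
Qed.

(** The rational intervals that witness sparsity are enumerated, all other indices giving the empty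
    interval ]0, 0[. The finite case bounds every finite union, and continuity from below the whole
    union. *)
Lemma maximal_inequality : exists E : set R, [/\ measurable E,
  sparse_points `<=` E & al E <= (2 * s)%:E * be setT].
Proof.
pose good (pq : rat * rat) := `[< al `]ratr pq.1, ratr pq.2[%classic <
  s%:E * be `]ratr pq.1, ratr pq.2[%classic >].
pose lo (k : nat) : R := if unpickle k is Some pq then
  (if good pq then ratr pq.1 else 0%R) else 0%R.
pose hi (k : nat) : R := if unpickle k is Some pq then
  (if good pq then ratr pq.2 else 0%R) else 0%R.
have lohi k : al `]lo k, hi k[%classic <= s%:E * be `]lo k, hi k[%classic.
  rewrite /lo /hi; case: unpickle => [pq|]; last by rewrite set_itvoo0 ?measure0 ?mule0.
  case: (boolP (good pq)) => [/asboolP/ltW//|_].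
  by rewrite set_itvoo0 ?measure0 ?mule0.
pose F n : set R := \bigcup_(i : 'I_n) `]lo i, hi i[%classic.
have mF n : measurable (F n).
  apply: fin_bigcup_measurable => [|i _]; last exact: measurable_itv.
  exact: finite_finset.
exists (\bigcup_n F n); split.
- exact: bigcup_measurable.
- move=> z /sparse_points_rat[p [q [zpq alpq]]].
  exists (pickle (p, q)).+1 => //; exists (@Ordinal (pickle (p, q)).+1 (pickle (p, q)) (ltnSn _)) => //=.
  by rewrite /lo /hi pickleK/= (_ : good _ = true)//; exact/asboolP.
- have cF : al (F n) @[n --> \oo] --> al (\bigcup_n F n).
    apply: nondecreasing_cvg_mu => //; first exact: bigcup_measurable.
    move=> m n mn; apply/subsetPset => y [i _ yi].
    by exists (widen_ord mn i).
  rewrite -(cvg_lim _ cF)//; apply: lime_le; first exact: cvgP cF.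
  by apply: nearW => n; apply: maximal_finite => // i; exact: lohi.
Qed.

End maximal_inequality.

(** * Regularity, density points and differentiation on the line *)

Lemma ereal_cvg0_near (R : realType) (u : (\bar R)^nat) (e : R) : 0 < e ->
  u n @[n --> \oo] --> 0%E -> \forall n \near \oo, (u n < e%:E)%E.
Proof.
move=> e0 /(_ [set x | (x < e%:E)%E]); apply; apply: open_nbhs_nbhs.
by split; [exact: open_ereal_lt_ereal|rewrite /= lte_fin].
Qed.

Section regularity.
Context (R : realType) (mu : {measure set R -> \bar R}).
Hypothesis muoo : (mu setT < +oo)%E.

Definition closed_open_approx (A : set R) := forall e : R, 0 < e ->
  exists C U : set R, [/\ closed C, open U, C `<=` A, A `<=` U & (mu (U `\` C) <= e%:E)%E].

Lemma approx_setC A : closed_open_approx A -> closed_open_approx (~` A).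
Proof.
move=> cA e /cA[C [U [cC oU CA AU UC]]]; exists (~` U), (~` C); split.
- exact: open_closedC.
- exact: closed_openC.
- exact: subsetC.
- exact: subsetC.
- by rewrite setDE setCK setIC -setDE.
Qed.

(** An infinite union of closed sets need not be closed, so the inner approximation is a finite
    union [F N] that misses at most e / 2 of the mass of the full one. The errors of the pieces, e /
    2^(n+2), sum to the other e / 2. *)
Lemma approx_bigcup (A : (set R)^nat) :
  (forall n, closed_open_approx (A n)) -> closed_open_approx (\bigcup_n A n).
Proof.
move=> cA e e0.
have en n : 0 < (e / 2) / (2 ^ n.+1)%:R by rewrite !divr_gt0// ltr0n expn_gt0.
have /choice[CU HCU] : forall n, exists CU : set R * set R,
    [/\ closed CU.1, open CU.2, CU.1 `<=` A n, A n `<=` CU.2 &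
    (mu (CU.2 `\` CU.1) <= ((e / 2) / (2 ^ n.+1)%:R)%:E)%E].
  by move=> n; have [C [U H]] := cA n _ (en n); exists (C, U).
pose C n := (CU n).1; pose U n := (CU n).2.
pose F n := \bigcup_(i < n) C i.
have mC n : measurable (C n) by have [/closed_measurable] := HCU n.
have mU n : measurable (U n) by have [_ /open_measurable] := HCU n.
have mF n : measurable (F n) by exact: bigcup_measurable.
have mUU : measurable (\bigcup_n U n) by exact: bigcup_measurable.
have mCC : measurable (\bigcup_n C n) by exact: bigcup_measurable.
have cF : mu (\bigcup_n C n `\` F n) @[n --> \oo] --> mu set0.
  have -> : set0 = \bigcap_n (\bigcup_n C n `\` F n).
    apply/seteqP; split => // x Fx; have [[n _ Cx] _] := Fx 0%N Logic.I.
    by have [_ []] := Fx n.+1 Logic.I; exists n => //=.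
  apply: nonincreasing_cvg_mu => //.
  - by rewrite (le_lt_trans _ muoo)// le_measure ?inE//; exact: measurableD.
  - by move=> n; exact: measurableD.
  - by apply: bigcap_measurable => // n _; exact: measurableD.
  - move=> m n mn; apply/subsetPset; apply: setDS => x [i /= im Cx].
    by exists i => //=; exact: leq_trans im mn.
rewrite measure0 in cF.
have [N HN] : exists N, (mu (\bigcup_n C n `\` F N) <= (e / 2)%:E)%E.
  have e2 : 0 < e / 2 by rewrite divr_gt0.
  have [N _ HN] := ereal_cvg0_near e2 cF.
  by exists N; apply/ltW/HN => /=.
exists (F N), (\bigcup_n U n); split.
- apply: closed_bigcup => [|i _]; first exact: finite_II.
  by have [] := HCU i.
- by apply: bigcup_open => i _; have [] := HCU i.
- by move=> x [i _ Cx]; exists i => //; have [_ _ CA _ _] := HCU i; exact: CA.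
- by move=> x [i _ Ax]; exists i => //; have [_ _ _ AU _] := HCU i; exact: AU.
apply: (@le_trans _ _ (mu (\bigcup_n (U n `\` C n)) + mu (\bigcup_n C n `\` F N))%E).
  rewrite (le_trans _ (measureU2 _ _ _))//; last 2 first.
    by apply: bigcup_measurable => n _; exact: measurableD.
    exact: measurableD.
  rewrite le_measure ?inE//; first exact: measurableD.
    apply: measurableU; last exact: measurableD.
    by apply: bigcup_measurable => n _; exact: measurableD.
  move=> x [[n _ Ux] nF]; have [Cx|nC] := pselect ((\bigcup_n C n) x).
    by right.
  by left; exists n => //; split => // Cx; apply: nC; exists n.
rewrite (splitr e) EFinD leeD//.
apply: (@le_trans _ _ (\sum_(0 <= n <oo) mu (U n `\` C n))%E).
  apply: generalized_Boole_inequality => [n|]; first exact: measurableD.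
  by apply: bigcup_measurable => n _; exact: measurableD.
rewrite (le_trans _ (epsilon_trick0 xpredT (_ : 0 <= e / 2)))//.
  by apply: lee_nneseries => // n _; have [] := HCU n.
by rewrite divr_ge0// ltW.
Qed.

(** The approximable sets form a sigma-algebra, and it contains the open rays, which closed rays
    approximate from within. *)
Lemma approx_measurable A : measurable A -> closed_open_approx A.
Proof.
have sA : sigma_algebra setT closed_open_approx.
  split.
  - move=> e e0; exists set0, set0; rewrite setDv measure0 lee_fin ltW//.
    by split => //; exact: closed0.
  - by move=> B cB; rewrite setTD; exact: approx_setC.
  - exact: approx_bigcup.
move=> mA; have {}mA : <<s @RGenOInfty.G R >> A.
  have <- : @measurable _ R = <<s @RGenOInfty.G R >>.
    exact: RGenOInfty.measurableE.
  by [].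
apply: (smallest_sub sA _ mA) => _ [x ->] e e0.
have cF : mu (`]x, +oo[%classic `\` `[(x + n.+1%:R^-1), +oo[%classic) @[n --> \oo] --> mu set0.
  have -> : set0 = \bigcap_n (`]x, +oo[%classic `\` `[(x + n.+1%:R^-1), +oo[%classic) :> set R.
    apply/seteqP; split => // y Fy.
    have [/= ] := Fy 0%N Logic.I; rewrite in_itv/= andbT => xy _.
    have d0 : 0 < y - x by rewrite subr_gt0.
    have [n _ nd] := near_infty_natSinv_lt (PosNum d0).
    have [_ /=] := Fy n Logic.I; rewrite in_itv/= andbT => /negP.
    have /= := nd n (leqnn n); move: (n.+1%:R^-1) => u.
    by rewrite -ltNge; lra.
  apply: nonincreasing_cvg_mu => //.
  - by rewrite (le_lt_trans _ muoo)// le_measure ?inE//; exact: measurableD.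
  - by move=> n; exact: measurableD.
  - by apply: bigcap_measurable => // n _; exact: measurableD.
  - move=> m n mn; apply/subsetPset; apply: setDS => y /=.
    rewrite !in_itv/= !andbT; apply: le_trans; rewrite lerD2l.
    by rewrite lef_pV2 ?posrE// ler_nat.
rewrite measure0 in cF.
have [N _ HN] := ereal_cvg0_near e0 cF.
exists `[(x + N.+1%:R^-1), +oo[%classic, `]x, +oo[%classic; split => //.
- exact: itv_closed_ends_closed.
- move=> y /=; rewrite !in_itv/= !andbT; apply: lt_le_trans.
  by rewrite ltrDl invr_gt0.
- by apply/ltW/HN => /=.
Qed.

End regularity.

Section density.
Context (R : realType) (nu : {measure set R -> \bar R}).
Hypothesis nuoo : (nu setT < +oo)%E.

(** Let C be a closed subset of the complement of A that misses at most 1 / (n + 1) of its mass. A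
    point of A has small intervals disjoint from C; if the complement keeps a proportion above dl in
    such an interval, the point is sparse for the mass of the complement outside C. The maximal
    inequality bounds the mass of these points by 2 / (dl (n + 1)). *)
Lemma density_setC (A : set R) (dl : R) : 0 < dl -> measurable A ->
  {ae nu, forall z, A z -> \forall r \near 0^'+, (nu (`](z - r)%R, (z + r)%R[%classic `\` A) <=
      dl%:E * nu `](z - r)%R, (z + r)%R[%classic)%E}.
Proof.
move=> dl0 mA.
have en n : 0 < n.+1%:R^-1 :> R by rewrite invr_gt0.
have /choice[C HC] : forall n : nat, exists C : set R,
    [/\ closed C, C `<=` ~` A & (nu (~` A `\` C) <= (n.+1%:R^-1)%:E)%E].
  move=> n; have mAC := measurableC mA.
  have [C [U [cC oU CA AU UC]]] := approx_measurable nuoo mAC (en n).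
  exists C; split => //; apply: le_trans UC; rewrite le_measure ?inE//.
  - by apply: measurableD => //; exact: closed_measurable.
  - by apply: measurableD; [exact: open_measurable|exact: closed_measurable].
  - exact: setSD.
have mD n : measurable (~` A `\` C n).
  apply: measurableD; first exact: measurableC.
  by have [/closed_measurable] := HC n.
pose tau n := mrestr nu (mD n).
have dl0' : 0 <= dl^-1 by rewrite invr_ge0 ltW.
have /choice[E HE] : forall n, exists E : set R, [/\ measurable E,
    sparse_points nu (tau n) dl^-1 `<=` E & (nu E <= (2 * dl^-1)%:E * tau n setT)%E].
  by move=> n; exact: maximal_inequality.
exists (\bigcap_n E n); split.
- by apply: bigcap_measurable => // n _; have [] := HE n.
- apply/eqP; rewrite eq_le measure_ge0 andbT; apply/lee_addgt0Pr => e e0.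
  rewrite add0e.
  have [n ne] : exists n : nat, (2 * dl^-1) * n.+1%:R^-1 <= e.
    have e'0 : 0 < e / (2 * dl^-1) by rewrite divr_gt0// mulr_gt0// invr_gt0.
    have [n _ Hn] := near_infty_natSinv_lt (PosNum e'0).
    exists n; have /= := Hn n (leqnn n).
    by rewrite ltr_pdivlMr ?mulr_gt0 ?invr_gt0// mulrC => /ltW.
  apply: (@le_trans _ _ (nu (E n))).
    rewrite le_measure ?inE//.
    - by apply: bigcap_measurable => // k _; have [] := HE k.
    - by have [] := HE n.
    - by move=> z; apply.
  have [_ _] := HE n; move=> /le_trans; apply.
  apply: (@le_trans _ _ ((2 * dl^-1)%:E * (n.+1%:R^-1)%:E)%E).
    by rewrite lee_wpmul2l// ?lee_fin ?mulr_ge0// /tau /mrestr/= setTI; have [] := HC n.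
  by rewrite -EFinM lee_fin.
- move=> z /= /not_implyP[Az nz] n _; have [cC CA _] := HC n.
  have [_ sE _] := HE n; apply: contrapT => nE; apply: nz.
  have oC : open (~` C n) by exact: closed_openC.
  have nCz : (~` C n) z by move=> /CA.
  have rC := open_itvoo_subset oC nCz.
  near=> r.
  have r0 : 0 < r by near: r; exact: nbhs_right_gt.
  have rC' : `](z - r), (z + r)[%classic `<=` ~` C n by near: r.
  rewrite leNgt; apply/negP => lt1; apply: nE; apply: sE.
  exists (z - r), (z + r); split.
    by rewrite in_itv/= ltrBlDr ltrDl r0.
  rewrite -(@lte_pmul2l _ dl%:E) ?lte_fin// ?ltry// muleA -EFinM divff ?gt_eqF//.
  rewrite mul1e (lt_le_trans lt1)// /tau /mrestr/= le_measure ?inE//.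
  - exact: measurableD.
  - exact: measurableI.
  - by move=> y [yI nA]; split => //; split => //; exact: rC'.
Unshelve. all: by end_near.
Qed.

End density.

Section differentiation.
Context (R : realType) (nu nu1 : {measure set R -> \bar R}) (f : R -> R).
Hypothesis nuoo : (nu setT < +oo)%E.
Hypothesis mf : mfunT f.
Hypothesis f01 : forall x, 0 <= f x <= 1.
Hypothesis nu1E : forall A, measurable A -> nu1 A = (\int[nu]_(x in A) (f x)%:E)%E.
Local Notation I z r := (`](z - r)%R, (z + r)%R[%classic : set R).

Let mI z r : measurable (I z r). Proof. exact: measurable_itv. Qed.

Let mfA A : measurable_fun A (EFin \o f).
Proof. exact/measurable_EFinP/measurable_funTS. Qed.

Let int_split A B : measurable A -> measurable B -> nu1 A =
  (\int[nu]_(x in A `&` B) (f x)%:E + \int[nu]_(x in A `\` B) (f x)%:E)%E.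
Proof.
move=> mA mB; rewrite nu1E// -{1}(setUIDK A B) ge0_integral_setU//.
- exact: measurableI.
- exact: measurableD.
- by move=> x _; rewrite lee_fin; have /andP[] := f01 x.
- by apply/disj_setPS => x [[_ Bx] [_ /(_ Bx)]].
Qed.

(** Around almost every point of {f < q} the complement of this set has density 0, and there f is
    still at most 1; this part accounts for dl. *)
Let nu1_ubound q dl : 0 <= q -> 0 < dl -> {ae nu, forall z, f z < q -> \forall r \near 0^'+,
    (nu1 (I z r) <= (q + dl)%:E * nu (I z r))%E}.
Proof.
move=> q0 dl0; have mA : measurable [set z | f z < q].
  exact: measurable_ltr_set.
apply: filterS (density_setC nuoo dl0 mA) => z /[apply]; apply: filterS => r Hr.
rewrite (int_split (mI z r) mA) EFinD ge0_muleDl ?lee_fin ?(ltW dl0)//.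
apply: leeD; last first.
  apply: le_trans Hr; rewrite -[leRHS]mul1e.
  rewrite -(integral_cst nu _ 1%E); last exact: measurableD.
  apply: ge0_le_integral => //; first exact: measurableD.
  - by move=> x _; rewrite lee_fin; have /andP[] := f01 x.
  - by move=> x _; rewrite lee_fin; have /andP[] := f01 x.
apply: (@le_trans _ _ (q%:E * nu (I z r `&` [set z | (f z < q)%R]))%E).
  rewrite -(integral_cst nu _ q%:E); last exact: measurableI.
  apply: ge0_le_integral => //; first exact: measurableI.
  - by move=> x _; rewrite lee_fin; have /andP[] := f01 x.
  - by move=> x [_ /= /ltW]; rewrite lee_fin.
rewrite lee_wpmul2l ?lee_fin// le_measure ?inE//.
exact: measurableI.
Qed.

Let nu1_lbound q dl : 0 <= q -> 0 < dl -> {ae nu, forall z, q < f z -> \forall r \near 0^'+,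
    (q%:E * nu (I z r) <= nu1 (I z r) + (q * dl)%:E * nu (I z r))%E}.
Proof.
move=> q0 dl0; have mA : measurable [set z | q < f z].
  exact: measurable_ltr_set.
apply: filterS (density_setC nuoo dl0 mA) => z /[apply]; apply: filterS => r Hr.
have nuE := measureDI nu (mI z r) mA.
rewrite {1}nuE addeC ge0_muleDr//; apply: leeD.
  rewrite (int_split (mI z r) mA).
  apply: (@le_trans _ _ (\int[nu]_(x in I z r `&` [set z | (q < f z)%R]) (f x)%:E)%E).
    rewrite -(integral_cst nu _ q%:E); last exact: measurableI.
    apply: ge0_le_integral => //; first exact: measurableI.
    by move=> x [_ /= /ltW]; rewrite lee_fin.
  rewrite leeDl// integral_ge0// => x _.
  by rewrite lee_fin; have /andP[] := f01 x.
by rewrite EFinM -muleA lee_wpmul2l// lee_fin.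
Qed.

(** A point with a null neighbourhood lies in a null interval with rational endpoints, and there are
    countably many of these. *)
Lemma measure_itv_gt0 : {ae nu, forall z r, 0 < r -> (0 < nu (I z r))%E}.
Proof.
pose J k : set R := if @unpickle (rat * rat)%type k is Some pq then
  `]ratr pq.1, ratr pq.2[%classic else set0.
have mJ k : measurable (J k) by rewrite /J; case: unpickle.
have nJ : nu.-negligible (\bigcup_k (if `[< nu (J k) = 0%E >] then J k else set0)).
  apply: negligible_bigcup => k; case: ifPn => [/asboolP J0|_].
    exact/negligibleP.
  exact: negligible_set0.
apply: negligibleS nJ => z /= /existsNP[r /not_implyP[r0]].
rewrite lt0e measure_ge0 andbT => /negP; rewrite negbK => /eqP nu0.
have z1 : z - r < z by rewrite gtrBl.
have z2 : z < z + r by rewrite ltrDl.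
have [p] := rat_in_itvoo z1; rewrite in_itv/= => /andP[rp pz].
have [q] := rat_in_itvoo z2; rewrite in_itv/= => /andP[zq qr].
exists (pickle (p, q)) => //; rewrite /J pickleK.
case: asboolP; first by rewrite /= in_itv/= pz zq.
case; apply/eqP; rewrite -measure_le0 -nu0 le_measure ?inE//=.
move=> y /=; rewrite !in_itv/= => /andP[? ?].
by apply/andP; split; [exact: lt_trans rp _|exact: lt_trans qr].
Qed.

(** The value f z is squeezed between rational levels, so that countably many exceptional null sets
    suffice. *)
Lemma differentiation : {ae nu, forall z,
  fine (nu1 (I z r)) / fine (nu (I z r)) @[r --> 0^'+] --> f z}.
Proof.
(* The absolute value makes every level of the enumeration nonnegative, as both bounds require. *)
pose q (k : nat) : R := `|ratr (odflt 0 (@unpickle rat k))|.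
have q0 k : 0 <= q k by exact: normr_ge0.
have qE (p : rat) : 0 <= (ratr p : R) -> q (pickle p) = ratr p.
  by move=> p0; rewrite /q pickleK /= ger0_norm.
have d0 n : 0 < n.+1%:R^-1 :> R by rewrite invr_gt0.
have aU := ae_foralln (fun k => ae_foralln (fun n => nu1_ubound (q0 k) (d0 n))).
have aL := ae_foralln (fun k => ae_foralln (fun n => nu1_lbound (q0 k) (d0 n))).
apply: filterS3 measure_itv_gt0 aU aL => z pos U L.
have /andP[fz0 fz1] := f01 z.
apply/cvgrPdist_le => e e0.
have e2 : 0 < e / 2 by rewrite divr_gt0.
have [n _ Hn] := near_infty_natSinv_lt (PosNum e2).
have {Hn} ne : n.+1%:R^-1 < e / 2 := Hn n (leqnn n).
have [p1] : exists q : rat, ratr q \in `]f z, (f z + e / 2)[.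
  by apply: rat_in_itvoo; rewrite ltrDl.
rewrite in_itv/= => /andP[fp pf].
have p10 : 0 <= (ratr p1 : R) by rewrite (le_trans fz0)// ltW.
have {}U := U (pickle p1) n; rewrite (qE _ p10) in U.
have {}L : \forall r \near 0^'+, ((f z - e)%:E * nu (I z r) <= nu1 (I z r))%E.
  have [fe|fe] := leP (f z - e) 0.
    apply: nearW => r; apply: (@le_trans _ _ 0%E) => //.
    by rewrite mule_le0_ge0// lee_fin.
  have [p2] : exists q : rat, ratr q \in `](f z - e / 2), f z[.
    by apply: rat_in_itvoo; rewrite gtrBl.
  rewrite in_itv/= => /andP[fp2 pf2].
  have p20 : 0 <= (ratr p2 : R) by move: fe fp2; lra.
  have := L (pickle p2) n; rewrite (qE _ p20) => /(_ pf2).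
  apply: filterS => r; set N := nu _; set N1 := nu1 _ => H.
  have Nfin : N \is a fin_num by exact: finite_fin_num.
  have N1N : (N1 <= N)%E.
    rewrite /N1 nu1E// -[leRHS]mul1e -(integral_cst nu _ 1%E)//.
    apply: ge0_le_integral => //.
    - by move=> x _; rewrite lee_fin; have /andP[] := f01 x.
    - by move=> x _; rewrite lee_fin; have /andP[] := f01 x.
  have N1fin : N1 \is a fin_num.
    by rewrite ge0_fin_numE ?measure_ge0// (le_lt_trans N1N)// -(fineK Nfin) ltry.
  have N0 : 0 <= fine N by rewrite fine_ge0// measure_ge0.
  move: H; rewrite -(fineK Nfin) -(fineK N1fin) -!EFinM -EFinD !lee_fin.
  move: (fine N) (fine N1) N0 (n.+1%:R^-1) (d0 n) ne => u v u0 w w0 we H.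
  have : ratr p2 * w <= e / 2 by nra.
  by nra.
near=> r.
have r0 : 0 < r by near: r; exact: nbhs_right_gt.
have := pos r r0; have : ((f z - e)%:E * nu (I z r) <= nu1 (I z r))%E by near: r.
have : (nu1 (I z r) <= (ratr p1 + n.+1%:R^-1)%:E * nu (I z r))%E.
  by near: r; exact: U.
set N := nu _; set N1 := nu1 _.
have Nfin : N \is a fin_num by exact: finite_fin_num.
move=> H1.
have N1fin : N1 \is a fin_num.
  by rewrite ge0_fin_numE ?measure_ge0// (le_lt_trans H1)// -(fineK Nfin) -EFinM ltry.
move: H1; rewrite -(fineK Nfin) -(fineK N1fin) -!EFinM !lee_fin lte_fin.
move: (fine N) (fine N1) (n.+1%:R^-1) ne => u v w we H1 H2 u0.
rewrite ler_norml /=.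
have : f z - e <= v / u by rewrite ler_pdivlMr.
have : v / u <= ratr p1 + w by rewrite ler_pdivrMr.
by move=> *; apply/andP; split; lra.
Unshelve. all: by end_near.
Qed.

End differentiation.

(** * Convergence of nonnegative martingales *)

Section upcrossing.
Context d (T : measurableType d) (R : realType) (P : {measure set T -> \bar R}).
Variables (M : nat -> T -> R) (G : nat -> set (set T)).
Hypothesis Poo : (P setT < +oo)%E.
Hypothesis M0 : forall n x, 0 <= M n x.
Hypothesis Mi : forall n, P.-integrable setT (EFin \o M n).
Hypothesis Gm : forall n A, G n A -> measurable A.
Hypothesis GS : forall n A, G n A -> G n.+1 A.
Hypothesis GC : forall n A, G n A -> G n (~` A).
Hypothesis GI : forall n A B, G n A -> G n B -> G n (A `&` B).
Hypothesis GM : forall n a, G n [set x | M n x < a].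
Hypothesis GM' : forall n a, G n [set x | a < M n x].
Hypothesis Mmart : forall n A, G n A ->
  (\int[P]_(x in A) (M n.+1 x)%:E = \int[P]_(x in A) (M n x)%:E)%E.

Let mM n : mfunT (M n).
Proof. exact/measurable_EFinP/(measurable_int _ (Mi n)). Qed.

Section one_band.
Variables (a b : R).
Hypothesis ab : a < b.
Hypothesis a0 : 0 <= a.

(* [holding n] tells whether one share bought below [a] is held at time [n],
   to be sold above [b]; [gains n] bounds the number of sales from above. *)
Fixpoint holding n : set T := if n is k.+1 then ~` (~` (holding k `&` ~` [set x | b < M k.+1 x]) `&`
        ~` (~` holding k `&` [set x | M k.+1 x < a])) else [set x | M 0%N x < a].

Fixpoint sales n x : R := if n is k.+1 then
  sales k x + \1_(holding k `&` [set y | b < M k.+1 y]) x else 0.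

Fixpoint gains n x : R := if n is k.+1 then
  gains k x + \1_(holding k) x * (M k.+1 x - M k x) else 0.

Lemma holdingS n x : holding n.+1 x <->
  (holding n x /\ M n.+1 x <= b) \/ (~ holding n x /\ M n.+1 x < a).
Proof.
rewrite /=; split => [/not_andP[/contrapT[h k]|/contrapT[h k]]|[[h k]|[h k]]].
- by left; split => //; rewrite leNgt; apply/negP.
- by right.
- by move=> [+ _]; apply; split => //= ?; move: k; rewrite leNgt => /negP.
- by move=> [_]; apply; split.
Qed.

Lemma G_holding n : G n (holding n).
Proof.
elim: n => [|n ih]; first exact: GM.
apply: GC; apply: GI; apply: GC; apply: GI.
- exact: GS.
- by apply: GC; exact: GM'.
- by apply: GC; exact: GS.
- exact: GM.
Qed.

Let mh n : measurable (holding n). Proof. exact: Gm (G_holding n). Qed.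

(** Each completed sale earns at least b - a. A share still held was bought below a and, M being
    nonnegative, has lost at most a. *)
Lemma gains_sales n x : (b - a) * sales n x - a <= gains n x.
Proof.
have a0' := a0; have ab' := ab.
(* The invariant: while a share is held, its current value minus a comes on top of what the sales
   have secured. *)
suff [H1 H2] : (holding n x -> (b - a) * sales n x + (M n x - a) <= gains n x)
    /\ (~ holding n x -> (b - a) * sales n x <= gains n x).
  have [h|h] := pselect (holding n x); last by have := H2 h; nra.
  by have := H1 h; have := M0 n x; nra.
elim: n => [|n [ih1 ih2]].
  by split=> h; rewrite /= mulr0 //; move: (h : M 0%N x < a); lra.
have [h|h] := pselect (holding n x).
- have := ih1 h; case: (ltP b (M n.+1 x)) => bM H; split.
  + by move/holdingS => [[_]|[]//]; rewrite leNgt bM.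
  + move=> _; rewrite [leRHS]/= [sales _ _]/= !indicE !mem_set//=.
    by rewrite mul1r mulrDr mulr1; nra.
  + have nb : ~ (holding n `&` [set y | b < M n.+1 y]) x.
      by move=> [_] /=; rewrite ltNge bM.
    move=> _; rewrite [leRHS]/= [sales _ _]/= !indicE (memNset nb) mem_set//=.
    by rewrite mul1r addr0; nra.
  + by move=> nh; exfalso; apply: nh; apply/holdingS; left.
- have H := ih2 h; have nb : ~ (holding n `&` [set y | b < M n.+1 y]) x.
    by case.
  rewrite [sales _ _]/= [gains _ _]/= !indicE (memNset nb) memNset//= mul0r !addr0; split; last by [].
  by move/holdingS => [[]//|[_]]; nra.
Qed.

(** Whether a share is held at time n is decided by the information at time n, so the martingale
    property makes the expected gain of the next step 0. *)
Let int_gains n : P.-integrable setT (EFin \o gains n) /\ (\int[P]_x (gains n x)%:E = 0)%E.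
Proof.
elim: n => [|n [ih1 ih2]].
  by split; [exact: integrable0|rewrite integral0].
have ri k : P.-integrable setT (EFin \o (fun x => M k x * \1_(holding n) x)).
  have := integrableMl measurableT (Mi k) (measurable_indic (mh n)).
  apply; exists 1; split => // t t1 x _ /=; rewrite ger0_norm// indicE.
  by case: (_ \in _) => /=; lra.
have ri' k : P.-integrable setT (fun x => (M k x * \1_(holding n) x)%:E).
  exact: ri.
have di : P.-integrable setT (EFin \o (fun x => \1_(holding n) x * (M n.+1 x - M n x))).
  rewrite (_ : EFin \o _ = ((EFin \o (fun x => (M n.+1 x * \1_(holding n) x)%R)) \-
    (EFin \o (fun x => (M n x * \1_(holding n) x)%R)))%E); last first.
    by apply/funext => x /=; rewrite -EFinB mulrC mulrBl.
  exact: integrableB.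
split; first exact: (integrableD measurableT ih1 di).
under eq_integral do rewrite /= EFinD.
rewrite integralD//= ih2 add0e.
under eq_integral do rewrite mulrC mulrBl EFinB.
rewrite (integralB measurableT (ri' n.+1) (ri' n))/=.
have hE k : (\int[P]_x (M k x * \1_(holding n) x)%:E = \int[P]_(x in holding n) (M k x)%:E)%E.
  rewrite [RHS]integral_mkcond; apply: eq_integral => x _.
  by rewrite patchE indicE; case: (_ \in _); rewrite ?mulr1 ?mulr0.
by rewrite !hE (Mmart (G_holding n)) subee// -hE (integrable_fin_num _ (ri n)).
Qed.

Lemma measurable_sales n : mfunT (sales n).
Proof.
elim: n => [|n ih] /=; first exact: measurable_cst.
apply: measurable_funD => //; apply: measurable_indic; apply: measurableI => //.
exact: Gm (GM' _ _).
Qed.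

Lemma sales_nd x : nondecreasing_seq (sales ^~ x).
Proof. by apply/nondecreasing_seqP => n; rewrite /= lerDl. Qed.

Lemma sales_ge0 n x : 0 <= sales n x.
Proof. by apply: le_trans (sales_nd x (leq0n n)). Qed.

(** By [gains_sales] the expected number of sales is at most a / (b - a) times the total mass,
    uniformly in n. Monotone convergence makes the supremum integrable, hence finite almost
    everywhere. *)
Lemma sales_bounded : {ae P, forall x, exists N, forall n, sales n x <= N}.
Proof.
have E n : (\int[P]_x (sales n x)%:E <= (a / (b - a))%:E * P setT)%E.
  have [gi g0] := int_gains n.
  have ba : 0 < b - a by rewrite subr_gt0.
  have ci : P.-integrable setT (EFin \o cst (a / (b - a))).
    apply: (@integrable_bounded _ _ _ _ _ (a / (b - a))) => // x.
    by rewrite ger0_norm// divr_ge0// ltW.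
  have zi : P.-integrable setT (fun x => ((b - a)^-1)%:E * (gains n x)%:E)%E.
    exact: (integrableZl measurableT (b - a)^-1 gi).
  rewrite -(integral_cst P measurableT (a / (b - a))%:E) -[leRHS]add0e -(mule0 ((b - a)^-1)%:E) -g0.
  rewrite -integralZl// -integralD//.
  apply: ge0_le_integral => //.
  - by move=> x _; rewrite lee_fin sales_ge0.
  - apply/measurable_EFinP; exact: measurable_sales.
  - apply: emeasurable_funD => //; exact: (measurable_int _ zi).
  - move=> x _; rewrite -EFinM -EFinD lee_fin.
    have a0' := a0; have := gains_sales n x; set s := sales n x; set g := gains n x.
    by move=> H; rewrite mulrC -mulrDl ler_pdivlMr//; move: H; nra.
pose S x := limn (fun n => (sales n x)%:E : \bar R).
have ndE x : nondecreasing_seq (fun n => (sales n x)%:E : \bar R).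
  by move=> m n mn; rewrite lee_fin; exact: sales_nd.
have mS : mfunT S.
  apply: (emeasurable_fun_cvg (fun n x => (sales n x)%:E)) => //.
    by move=> n; exact/measurable_EFinP/measurable_sales.
  by move=> x _; exact: ereal_nondecreasing_is_cvgn.
have S0 x : (0 <= S x)%E.
  apply: lime_ge; first exact: ereal_nondecreasing_is_cvgn.
  by apply: nearW => n; rewrite lee_fin sales_ge0.
have iS : (\int[P]_x S x <= (a / (b - a))%:E * P setT)%E.
  rewrite monotone_convergence//.
  - apply: lime_le; last exact: nearW.
    apply: ereal_nondecreasing_is_cvgn => m n mn; apply: ge0_le_integral => //.
    + by move=> x _; rewrite lee_fin sales_ge0.
    + exact/measurable_EFinP/measurable_sales.
    + exact/measurable_EFinP/measurable_sales.
    + by move=> x _; exact: ndE.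
  - by move=> n; exact/measurable_EFinP/measurable_sales.
  - by move=> n x _; rewrite lee_fin sales_ge0.
have Si : P.-integrable setT S.
  apply/integrableP; split => //; under eq_integral do rewrite gee0_abs//.
  by rewrite (le_lt_trans iS)// lte_mul_pinfty ?lee_fin// divr_ge0// subr_ge0 ltW.
apply: filterS (integrable_ae measurableT Si) => x /(_ Logic.I) Sx.
exists (fine (S x)) => n; rewrite -lee_fin (fineK Sx).
rewrite /S (cvg_lim _ (ereal_nondecreasing_cvgn (ndE x)))//.
by apply: ereal_sup_ubound; exists n.
Qed.

(** After a visit below a share is held, and the next visit above b sells it. *)
Lemma sales_unbounded x : (forall n, exists2 m, (n <= m)%N & M m x < a) ->
  (forall n, exists2 m, (n <= m)%N & b < M m x) -> forall N : nat, exists n, N%:R <= sales n x.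
Proof.
move=> ioa iob.
have H1 n : exists2 m, (n <= m)%N & holding m x.
  have [m nm Ma] := ioa n.
  case: m nm Ma => [|m] nm Ma; first by exists 0%N.
  have [h|h] := pselect (holding m x); exists m.+1 => //; apply/holdingS.
    by left; split => //; rewrite ltW// (lt_trans Ma).
  by right.
have H2 n k : holding n x -> b < M (n + k)%N x ->
    exists2 m, (n <= m)%N & sales n x + 1 <= sales m x.
  elim: k n => [|k ih] n hn bM.
    exfalso; move: bM; rewrite addn0 => bM.
    case: n hn bM => [/= Ma bM|n /holdingS h bM].
      by move: (lt_trans Ma ab); rewrite ltNge (ltW bM).
    by case: h bM => -[_] h bM; move: ab; lra.
  have [b1|b1] := ltP b (M n.+1 x).
    by exists n.+1 => //=; rewrite indicE mem_set.
  have hn1 : holding n.+1 x by apply/holdingS; left.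
  have [|m nm sm] := ih n.+1 hn1; first by rewrite addSnnS.
  exists m; first exact: ltnW.
  by apply: le_trans sm; rewrite lerD2r; exact: sales_nd.
elim=> [|N [n sn]]; first by exists 0%N.
have [m nm hm] := H1 n; have [p mp bp] := iob m.
have [q mq sq] : exists2 q, (m <= q)%N & sales m x + 1 <= sales q x.
  by apply: (H2 m (p - m)%N) => //; rewrite subnKC.
exists q; rewrite -natr1 (le_trans _ sq)// lerD2r (le_trans sn)//.
exact: sales_nd.
Qed.

End one_band.

(** Almost surely no pair of rational levels is crossed infinitely often, and the lower limit [L] is
    finite by Fatou; hence [L] is the limit. *)
Lemma nonneg_martingale_cvg : {ae P, forall x, cvgn (M ^~ x)}.
Proof.
(* An enumeration of nonnegative rationals, since [sales_bounded] asks for a nonnegative lower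
   level. *)
pose q k : R := `|ratr (odflt 0 (@unpickle rat k))|.
have osc : {ae P, forall x, forall k l, q k < q l -> exists N, forall n,
    sales (q k) (q l) n x <= N}.
  apply: ae_foralln => k; apply: ae_foralln => l.
  have [kl|kl] := ltP (q k) (q l).
    by apply: filterS (sales_bounded kl (normr_ge0 _)) => x H _.
  by apply: aeW.
pose L x := limn_einf (fun n => (M n x)%:E).
have Lsup x : L x = ereal_sup (range (einfs (fun n => (M n x)%:E))).
  rewrite /L limn_einf_lim; apply/cvg_lim => //.
  exact: ereal_nondecreasing_cvgn (nondecreasing_einfs _).
have mL : mfunT L.
  rewrite /L /limn_einf; apply: measurableT_comp => //.
  apply: measurable_fun_limn_esup => n; apply: measurableT_comp => //.
  exact/measurable_EFinP.
have L0 x : (0 <= L x)%E.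
  rewrite Lsup; apply: (@le_trans _ _ (einfs (fun n => (M n x)%:E) 0)).
    by apply: le_ereal_inf_tmp => _ [m _ <-]; rewrite lee_fin.
  by apply: ereal_sup_ubound; exists 0%N.
have Li : P.-integrable setT L.
  apply/integrableP; split => //; under eq_integral do rewrite gee0_abs//.
  apply: (@le_lt_trans _ _ (\int[P]_x (M 0%N x)%:E)%E); last first.
    by rewrite integrable_lty// (Mi 0).
  have := fatou P measurableT (fun n => measurable_funEFin (mM n))
    (fun n x _ => M0 n x : (0 <= (M n x)%:E)%E).
  move=> /le_trans; apply.
  have Mc n : (\int[P]_x (M n x)%:E = \int[P]_x (M 0%N x)%:E)%E.
    elim: n => // n <-; apply: Mmart.
    rewrite (_ : setT = ~` ([set x | M n x < 0] `&` ~` [set x | M n x < 0])).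
      by apply: GC; apply: GI; [exact: GM|apply: GC; exact: GM].
    by rewrite setICr setC0.
  rewrite (_ : (fun n => _) = cst (\int[P]_x (M 0%N x)%:E)%E); last first.
    by apply/funext => n; exact: Mc.
  by rewrite (cvg_limn_einf_sup (cvg_cst _)).1.
apply: filterS2 osc (integrable_ae measurableT Li) => x oscx /(_ Logic.I) Lx.
apply/cvg_ex; exists (fine (L x)).
set u := fun n => (M n x)%:E.
have l0 : 0 <= fine (L x) by rewrite fine_ge0.
have lfreq a n : fine (L x) < a -> exists2 m, (n <= m)%N & M m x < a.
  move=> La; have : (einfs u n < a%:E)%E.
    apply: (@le_lt_trans _ _ (L x)); last by rewrite -(fineK Lx) lte_fin.
    by rewrite Lsup; apply: ereal_sup_ubound; exists n.
  move=> /ereal_inf_lt[_ [m /= nm <-]]; rewrite lte_fin => ?.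
  by exists m.
have lev a : a < fine (L x) -> exists N, forall m, (N <= m)%N -> a < M m x.
  move=> aL; have : (a%:E < ereal_sup (range (einfs u)))%E.
    by rewrite -Lsup -(fineK Lx) lte_fin.
  move=> /ereal_sup_gt[_ [N _ <-]] aN; exists N => m Nm.
  rewrite -lte_fin (lt_le_trans aN)//; apply: ereal_inf_lbound.
  by exists m.
apply/cvgrPdist_le => e e0.
have Le : fine (L x) - e < fine (L x) by rewrite gtrBl.
have [N1 HN1] := lev (fine (L x) - e) Le.
have [N2 HN2] : exists N, forall m, (N <= m)%N -> M m x <= fine (L x) + e.
  apply: contrapT => nN.
  have [p1] : exists p : rat, ratr p \in `](fine (L x)), (fine (L x) + e / 2)[.
    by apply: rat_in_itvoo; rewrite ltrDl divr_gt0.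
  have [p2] : exists p : rat, ratr p \in `](fine (L x) + e / 2), (fine (L x) + e)[.
    by apply: rat_in_itvoo; rewrite ltrD2l; lra.
  rewrite !in_itv/= => /andP[p2l p2r] /andP[p1l p1r].
  have qE (p : rat) : 0 <= (ratr p : R) -> q (pickle p) = ratr p.
    by move=> p0; rewrite /q pickleK /= ger0_norm.
  have p10 : 0 <= (ratr p1 : R) by rewrite (le_trans l0)// ltW.
  have p20 : 0 <= (ratr p2 : R) by lra.
  have := oscx (pickle p1) (pickle p2); rewrite !qE// => /(_ _)[|K HK].
    by lra.
  have p12 : ratr p1 < ratr p2 :> R by lra.
  have iob n : exists2 m, (n <= m)%N & ratr p2 < M m x.
    apply: contrapT => nm; apply: nN; exists n => m nm1; rewrite leNgt.
    by apply/negP => Mm; apply: nm; exists m => //; lra.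
  have ioa n := lfreq (ratr p1) n p1l.
  have [n nK] := sales_unbounded p12 ioa iob (Num.bound `|K|).+1.
  have := HK n; have := archi_boundP (normr_ge0 K); have := ler_norm K.
  by move: nK; rewrite -natr1; lra.
near=> n.
have n1 : (N1 <= n)%N by near: n; exact: nbhs_infty_ge.
have n2 : (N2 <= n)%N by near: n; exact: nbhs_infty_ge.
have := HN1 n n1; have := HN2 n n2.
by rewrite ler_norml => *; apply/andP; split; lra.
Unshelve. all: by end_near.
Qed.

End upcrossing.

(** * Integration against kernels and on product spaces *)

Section ge0_induction.
Context d (T : measurableType d) (R : realType).
Import HBNNSimple.
Local Open Scope ereal_scope.

Lemma ge0_measurable_ind (Q : (T -> \bar R) -> Prop) :
  (forall A, measurable A -> Q (fun x => (\1_A x)%:E)) -> (forall f g, mfunT f -> mfunT g ->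
    (forall x, 0 <= f x) -> (forall x, 0 <= g x) -> Q f -> Q g -> Q (fun x => f x + g x)) ->
  (forall (c : R) f, (0 <= c)%R -> mfunT f ->
    (forall x, 0 <= f x) -> Q f -> Q (fun x => c%:E * f x)) ->
  (forall f_ : (T -> \bar R)^nat, (forall n, mfunT (f_ n)) ->
    (forall n x, 0 <= f_ n x) -> (forall x m n, (m <= n)%N -> f_ m x <= f_ n x) ->
    (forall n, Q (f_ n)) -> Q (fun x => limn (f_ ^~ x))) ->
  forall f, mfunT f -> (forall x, 0 <= f x) -> Q f.
Proof.
move=> Q1 QD QZ Qlim f mf f0.
pose f_ := nnsfun_approx measurableT mf.
have -> : f = (fun x => limn ((fun n x => (f_ n x)%:E) ^~ x)).
  by apply/funext => x; apply/esym/cvg_lim => //; apply: cvg_nnsfun_approx.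
apply: Qlim => [n|n x|x m n mn|n]; first exact/measurable_EFinP.
- by rewrite lee_fin.
- by rewrite lee_fin; exact/lefP/nd_nnsfun_approx.
(* Only the nonnegative values enter the sum, because scaling is available for nonnegative
   constants. *)
have -> : (fun x => (f_ n x)%:E) = (fun x =>
    \sum_(r <- [seq r <- finmap.enum_fset (fset_set (range (f_ n))) | (0 <= r)%R])
      (r%:E * (\1_(f_ n @^-1` [set r]) x)%:E)).
  apply/funext => x; rewrite fimfunE -fsumEFin// fsbig_finite//= big_filter.
  rewrite [RHS]big_mkcond/=; apply: eq_bigr => r _; case: ifPn => // r0.
  by rewrite preimage_nnfun0 ?indic0 ?mulr0// ltNge.
set s := seq.filter _ _; have : all (fun r => (0 <= r)%R) s by exact: filter_all.
elim: s => [_|r s ih /= /andP[r0 s0]].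
  rewrite (_ : (fun x => _) = (fun x => (\1_set0 x)%:E)); first exact: Q1.
  by apply/funext => x; rewrite big_nil indic0.
rewrite (_ : (fun x => _) = (fun x => r%:E * (\1_(f_ n @^-1` [set r]) x)%:E +
  \sum_(r <- s) (r%:E * (\1_(f_ n @^-1` [set r]) x)%:E))).
  have mi q : mfunT (fun x => (\1_(f_ n @^-1` [set q]) x)%:E : \bar R).
    exact: measurable_EFin_indic.
  apply: QD.
  - exact: measurable_funeM.
  - by apply: emeasurable_sum => q _; exact: measurable_funeM.
  - by move=> x; rewrite mule_ge0// lee_fin.
  - move=> x; rewrite big_seq; apply: sume_ge0 => q qs.
    by rewrite mule_ge0 ?lee_fin//; exact: (allP s0).
  - by apply: QZ => //; apply: Q1.
  - exact: ih.
by apply/funext => x; rewrite big_cons.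
Qed.

End ge0_induction.

Section mixture.
Import HBNNSimple.
Context d d' (Y : measurableType d) (Z : measurableType d') (R : realType).
Variables (m : {measure set Y -> \bar R}) (K : Y -> {measure set Z -> \bar R}).
Local Open Scope ereal_scope.

Section measurability.
Hypothesis mK : forall U, measurable U -> mfunT (K ^~ U).
Hypothesis Koo : forall y, K y setT < +oo.

Lemma measurable_xsection_kernel A : measurable A -> mfunT (fun y => K y (xsection A y)).
Proof.
move=> mA; rewrite (_ : (fun y => _) =
    (fun y => mrestr (K y) measurableT (xsection A y))); last first.
  by apply/funext => y /=; rewrite /mrestr setIT.
pose K' : R.-ker Y ~> Z := Kernel.Pack (Kernel.Class (isKernel.Build _ _ _ _ _ K mK)).
have := @measurable_prod_subset_xsection_kernel _ _ _ _ R K' _ measurableT.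
have KM y : exists M, forall X, measurable X -> mrestr (K y) measurableT X < M%:E.
  exists (fine (K y setT) + 1)%R => B mB; rewrite /mrestr setIT.
rewrite EFinD fineK ?ge0_fin_numE// (@le_lt_trans _ _ (K y setT))//.
  by rewrite le_measure ?inE.
  by rewrite lteDl ?lte01// ge0_fin_numE.
by move/(_ KM A mA) => [].
Qed.

Lemma measurable_integral_kernel (f : Y * Z -> \bar R) : (forall p, 0 <= f p) -> mfunT f ->
  mfunT (fun y => \int[K y]_z f (y, z)).
Proof.
move=> f0 mf; pose f_ := nnsfun_approx measurableT mf.
apply: (@measurable_fun_xsection_integral _ _ _ _ _ f K f_).
- by move=> p q pq; exact/nd_nnsfun_approx.
- by move=> z; exact/cvg_nnsfun_approx.
- move=> n r; have mA : measurable (f_ n @^-1` [set r]) by exact: measurable_funPTI.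
exact: measurable_xsection_kernel mA.
Qed.

End measurability.

(** The semidirect product of m and K. The two proofs are parameters so that the term by itself
    determines the measure structure declared below. *)
Definition mprod (mK : forall U, measurable U -> mfunT (K ^~ U))
  (Koo : forall y, K y setT < +oo) (A : set (Y * Z)) : \bar R := \int[m]_y K y (xsection A y).

Section mprod_measure.
Hypothesis mK : forall U, measurable U -> mfunT (K ^~ U).
Hypothesis Koo : forall y, K y setT < +oo.

Let mprod0 : mprod mK Koo set0 = 0.
Proof. by rewrite /mprod integral0_eq// => y _; rewrite xsection0 measure0. Qed.

Let mprod_ge0 A : 0 <= mprod mK Koo A.
Proof. exact: integral_ge0. Qed.

Let mprod_sigma_additive : semi_sigma_additive (mprod mK Koo).
Proof.
move=> F mF tF mUF; rewrite [X in _ --> X](_ : _ = \sum_(0 <= n <oo) mprod mK Koo (F n)).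
  apply/cvg_closeP; split; last by rewrite closeE.
  by apply: is_cvg_nneseries => n _ _; exact: mprod_ge0.
rewrite -integral_nneseries//; last by move=> n; exact: measurable_xsection_kernel.
apply: eq_integral => y _; apply/esym/cvg_lim => //=; rewrite xsection_bigcup.
apply: measure_semi_sigma_additive.
- by move=> n; exact: measurable_xsection.
- exact: trivIset_xsection.
- by apply: bigcup_measurable => n _; exact: measurable_xsection.
Qed.

HB.instance Definition _ := isMeasure.Build _ _ R (mprod mK Koo)
  mprod0 mprod_ge0 mprod_sigma_additive.

Lemma mprodX A B : measurable A -> measurable B -> mprod mK Koo (A `*` B) = \int[m]_(y in A) K y B.
Proof.
move=> mA mB; rewrite /mprod [RHS]integral_mkcond; apply: eq_integral => y _.
rewrite patchE; case: ifPn => yA; first by rewrite in_xsectionX.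
by rewrite notin_xsectionX// measure0.
Qed.

Lemma integral_mprod (f : Y * Z -> \bar R) : (forall p, 0 <= f p) -> mfunT f ->
  \int[mprod mK Koo]_p f p = \int[m]_y \int[K y]_z f (y, z).
Proof.
move=> + mf; move: f mf; apply: ge0_measurable_ind.
- move=> A mA; rewrite integral_indic// setIT; apply: eq_integral => y _.
  rewrite -[in LHS](setIT (xsection A y)) -integral_indic//; last exact: measurable_xsection.
  by apply: eq_integral => z _; rewrite !indicE mem_xsection.
- move=> f g mf mg f0 g0 If Ig; rewrite (ge0_integralD _ measurableT (fun x _ => f0 x) mf (fun x _ => g0 x) mg).
  rewrite If Ig -(ge0_integralD _ measurableT).
  + apply: eq_integral => y _; symmetry.
    apply: ge0_integralD => //; exact: measurable_fun_pair2.
  + by move=> y _; exact: integral_ge0.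
  + exact: measurable_integral_kernel.
  + by move=> y _; exact: integral_ge0.
  + exact: measurable_integral_kernel.
- move=> c f c0 mf f0 If; rewrite (ge0_integralZl_EFin _ measurableT (fun x _ => f0 x) mf c0) If.
  rewrite -(ge0_integralZl_EFin _ measurableT _ _ c0).
  + apply: eq_integral => y _; rewrite ge0_integralZl_EFin//; exact: measurable_fun_pair2.
  + by move=> y _; exact: integral_ge0.
  + exact: measurable_integral_kernel.
- move=> f_ mf f0 ndf If; rewrite monotone_convergence//; last by move=> ? ? ? ? ?; exact: ndf.
  under eq_fun do rewrite If.
  rewrite -monotone_convergence//.
  + apply: eq_integral => y _; rewrite monotone_convergence//.
    * by move=> n; exact: measurable_fun_pair2.
    * by move=> ? ? ? ? ?; exact: ndf.
  + by move=> n; exact: measurable_integral_kernel.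
  + by move=> n y _; exact: integral_ge0.
  + move=> y _ p q pq; apply: ge0_le_integral => //.
    * exact: measurable_fun_pair2.
    * exact: measurable_fun_pair2.
    * by move=> z _; exact: ndf.
Qed.

Lemma ae_mprod (Q : Y * Z -> Prop) : {ae mprod mK Koo, forall p, Q p} ->
  {ae m, forall y, {ae K y, forall z, Q (y, z)}}.
Proof.
move=> [N [mN N0 QN]].
have : {ae m, forall y, setT y -> K y (xsection N y) = 0}.
  apply/(ae_eq_integral_abs m measurableT).
    exact: measurable_xsection_kernel.
  by rewrite -[RHS]N0; apply: eq_integral => y _; rewrite gee0_abs.
apply: filterS => y /(_ I) Ky; exists (xsection N y); split => //.
  exact: measurable_xsection.
by move=> z nQ; rewrite /xsection/= inE; exact: QN.
Qed.

(** The converse of [ae_mprod]; with A measurable, the mass of its complement can be computed from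
    the sections. *)
Lemma ae_mprodT (A : set (Y * Z)) : measurable A ->
  {ae m, forall y, {ae K y, forall z, A (y, z)}} -> {ae mprod mK Koo, forall p, A p}.
Proof.
move=> mA mKA; exists (~` A); split => //; first exact: measurableC.
rewrite /mprod -[RHS](integral0 m setT); apply: ae_eq_integral => //.
  by apply: measurable_xsection_kernel => //; exact: measurableC.
apply: filterS mKA => y [N [mN N0 AN]] _.
apply/eqP; rewrite -measure_le0 -N0 le_measure ?inE//.
  by apply: measurable_xsection; exact: measurableC.
by move=> z; rewrite /xsection/= inE => nA; exact: AN.
Qed.

End mprod_measure.
End mixture.

Section measurable_case.
Context d (T : measurableType d) d' (U : measurableType d').

Lemma measurable_fun_case (I : countType) (g : T -> I) (f : I -> T -> U) :
  (forall i, measurable (g @^-1` [set i])) -> (forall i, mfunT (f i)) -> mfunT (fun t => f (g t) t).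
Proof.
move=> mg mf _ B mB; rewrite setTI.
pose E k : set T := if @unpickle I k is Some i then g @^-1` [set i] `&` f i @^-1` B else set0.
rewrite (_ : _ @^-1` B = \bigcup_k E k).
  apply: bigcup_measurable => k _; rewrite /E; case: unpickle => // i.
  by apply: measurableI => //; exact: (measurable_preimage (mf _)).
apply/seteqP; split => t.
  by move=> Bt; exists (pickle (g t)) => //; rewrite /E pickleK.
by move=> [k _]; rewrite /E; case: unpickle => // i [/= <-].
Qed.

End measurable_case.

Section measure_constructors.
Context d d' (T : measurableType d) (U : measurableType d') (R : realType).

Lemma fin_num_of_lty (m : {measure set T -> \bar R}) : (m setT < +oo)%E -> fin_num_fun m.
Proof.
move=> moo A mA; rewrite ge0_fin_numE// (le_lt_trans _ moo)//.
by rewrite le_measure ?inE.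
Qed.

Definition image_measure (m : {measure set T -> \bar R}) (f : T -> U)
    (mf : mfunT f) : {measure set U -> \bar R} :=
  measure_function_pushforward__canonical__measure_function_Measure m mf.

End measure_constructors.

(** An alias of m that carries the proof of finiteness, so that the structure of a finite measure
    can be attached to it. *)
Definition finite_measure_of d (T : measurableType d) (R : realType)
  (m : {measure set T -> \bar R}) (moo : (m setT < +oo)%E) : set T -> \bar R := m.

Section finite_measure_of.
Context d (T : measurableType d) (R : realType).
Variables (m : {measure set T -> \bar R}) (moo : (m setT < +oo)%E).

HB.instance Definition _ := Measure.copy (finite_measure_of moo) m.
HB.instance Definition _ := Measure_isFinite.Build d T R (finite_measure_of moo)
  (fin_num_of_lty moo).

End finite_measure_of.

Section Rintegral_sum.
Context d (T : measurableType d) (R : realType) (mu : {measure set T -> \bar R}).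

Lemma integrable_EFin_sum (I : Type) (s : seq I) (f : I -> T -> R) :
  (forall i, mu.-integrable setT (EFin \o f i)) ->
  mu.-integrable setT (EFin \o (fun x => \sum_(i <- s) f i x)).
Proof.
move=> H; elim: s => [|i s ih].
  under eq_fun do rewrite big_nil; exact: integrable0.
under eq_fun do rewrite big_cons; exact: (integrableD _ (H i) ih).
Qed.

Lemma Rintegral_sum (I : Type) (s : seq I) (f : I -> T -> R) :
  (forall i, mu.-integrable setT (EFin \o f i)) ->
  \int[mu]_x (\sum_(i <- s) f i x) = \sum_(i <- s) \int[mu]_x f i x.
Proof.
move=> H; elim: s => [|i s ih].
  under eq_Rintegral do rewrite big_nil; rewrite big_nil.
  by rewrite /Rintegral integral0.
under eq_Rintegral do rewrite big_cons; rewrite big_cons -ih.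
by rewrite RintegralD//; exact: integrable_EFin_sum.
Qed.

End Rintegral_sum.

Lemma cvg_sum_seq (R : realType) (I : Type) (s : seq I) (u : I -> R^nat) (l : I -> R) :
  (forall i, u i k @[k --> \oo] --> l i) ->
  (\sum_(i <- s) u i k) @[k --> \oo] --> \sum_(i <- s) l i.
Proof.
move=> H; elim: s => [|i s ih].
  rewrite big_nil (_ : (fun k => _) = cst 0); first exact: cvg_cst.
  by apply/funext => k; rewrite big_nil.
rewrite big_cons (_ : (fun k => _) = (fun k => u i k + \sum_(j <- s) u j k)).
  by apply: cvgD.
by apply/funext => k; rewrite big_cons.
Qed.

Section image.
Context d d' (T : measurableType d) (U : measurableType d') (R : realType).

Lemma ge0_integral_image (mu : {measure set T -> \bar R})
    (m : {measure set U -> \bar R}) (g : T -> U) (f : U -> \bar R) : mfunT g ->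
  (forall A, measurable A -> mu (g @^-1` A) = m A) -> (forall x, 0 <= f x)%E -> mfunT f ->
  (\int[mu]_x f (g x) = \int[m]_y f y)%E.
Proof.
move=> mg gm f0 mf.
rewrite -[LHS](@ge0_integral_pushforward _ _ _ _ _ _ mg _ setT f measurableT mf (fun w _ => f0 w)).
by apply: eq_measure_integral => A mA _; exact: gm.
Qed.

End image.

Section product_space.
Context (R : realType) (I : choiceType) d (Omega : measurableType d).
Variable P : probability Omega R.
Local Notation W := (product_space I Omega).
Variable Pa : probability W R.
Hypothesis hPa : is_product_measure P Pa.
Local Open Scope ereal_scope.

Lemma measurable_eval (u : I) : mfunT (fun w : W => w u).
Proof.
move=> _ B mB; rewrite setTI; apply: sub_sigma_algebra.
by exists u => //; exists B.
Qed.

Lemma measurable_fun_product d' (T : measurableType d') (f : T -> W) :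
  (forall u, mfunT (fun t => f t u)) -> mfunT f.
Proof.
move=> mf; apply: (@measurability _ _ _ _ setT f (@coordinate_sets I d Omega)) => //.
move=> _ [_ [u _ [B mB <-]] <-]; exact: mf.
Qed.

Definition finite_cylinder (s : seq I) (B : I -> set Omega) : set W :=
  [set w | forall i, i \in s -> B i (w i)].

Definition finite_cylinders : set (set W) :=
  [set A | exists s B, [/\ uniq s, (forall i, measurable (B i)) & A = finite_cylinder s B]].

Lemma measurable_finite_cylinder s B : (forall i, measurable (B i)) ->
  measurable (finite_cylinder s B).
Proof.
move=> mB; rewrite /finite_cylinder; elim: s => [|u s ih].
  by rewrite (_ : [set _ | _] = setT)//; apply/seteqP; split.
rewrite (_ : [set _ | _] = [set w : W | B u (w u)] `&`
    [set w : W | forall i, i \in s -> B i (w i)]).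
  apply: measurableI => //; rewrite -[X in measurable X]setTI.
  exact: measurable_eval.
apply/seteqP; split => w /=.
  by move=> H; split => [|i si]; apply: H; rewrite inE ?eqxx// si orbT.
by move=> [Hu Hs] i; rewrite inE => /orP[/eqP ->|/Hs].
Qed.

Lemma finite_cylinders_setI : setI_closed finite_cylinders.
Proof.
move=> _ _ [s [B [us mB ->]]] [s' [B' [us' mB' ->]]].
exists (undup (s ++ s')), (fun i => (if i \in s then B i else setT) `&`
  (if i \in s' then B' i else setT)); split; first exact: undup_uniq.
  by move=> i; apply: measurableI; case: ifPn.
apply/seteqP; split => w /=.
  by move=> [H H'] i; rewrite mem_undup => _; split; case: ifPn => // ? ; [exact: H|exact: H'].
move=> H; split => i si.
  have /H[+ _] : i \in undup (s ++ s') by rewrite mem_undup mem_cat si.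
  by rewrite si.
have /H[_ +] : i \in undup (s ++ s') by rewrite mem_undup mem_cat si orbT.
by rewrite si.
Qed.

Lemma product_measurableE : (@measurable _ W) = <<s finite_cylinders >>.
Proof.
apply/seteqP; split.
  apply: smallest_sub; first exact: smallest_sigma_algebra.
  move=> _ [u _ [B mB <-]]; apply: sub_sigma_algebra.
  exists [:: u], (fun=> B); split => //; apply/seteqP; split => w /=.
    by move=> Bw i; rewrite inE => /eqP ->.
  by apply; rewrite inE.
apply: smallest_sub; first exact: sigma_algebra_measurable.
by move=> _ [s [B [_ mB ->]]]; exact: measurable_finite_cylinder.
Qed.

Lemma eq_measure_finite_cylinder (m1 m2 : {measure set W -> \bar R}) :
  m1 setT < +oo -> (forall s B, uniq s -> (forall i, measurable (B i)) ->
    m1 (finite_cylinder s B) = m2 (finite_cylinder s B)) -> forall A, measurable A -> m1 A = m2 A.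
Proof.
move=> m1oo m12 A mA.
apply: (measure_unique finite_cylinders (fun=> setT)) => //.
- exact: product_measurableE.
- exact: finite_cylinders_setI.
- move=> n; exists [::], (fun=> setT); split => //.
  by apply/seteqP; split.
- by rewrite bigcup_const.
- by move=> _ [s [B [us mB ->]]]; exact: m12.
Qed.

Lemma product_finite_cylinder s B : uniq s -> (forall i, measurable (B i)) ->
  Pa (finite_cylinder s B) = \prod_(i <- s) P (B i).
Proof. by move=> us mB; exact: hPa. Qed.

Section merge.
Variables (C : pred I) (rho : I -> I).
Hypothesis rho_inj : forall u v, ~~ C u -> ~~ C v -> rho u = rho v -> u = v.

(** Resamples a part of a configuration: with rho the identity it redraws chosen labels, with rho =
    [behead] it grafts an independent tree. *)
Definition merge (p : W * W) : W := fun u => if C u then p.1 u else p.2 (rho u).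

Lemma measurable_merge : mfunT merge.
Proof.
apply: measurable_fun_product => u; rewrite /merge; case: (C u).
  exact: (measurableT_comp (measurable_eval u) measurable_fst).
exact: (measurableT_comp (measurable_eval (rho u)) measurable_snd).
Qed.

Let mcst U : measurable U -> mfunT (fun _ : W => Pa U).
Proof. by []. Qed.

Let Paoo (w : W) : Pa setT < +oo.
Proof. by rewrite probability_setT ltry. Qed.

(** Off C distinct coordinates are read from distinct places, since rho is injective there, so the
    merged configuration is again a sample of the product measure. It is enough to compare finite
    cylinders. *)
Lemma integral_merge (f : W -> \bar R) : (forall w, 0 <= f w) -> mfunT f ->
  \int[Pa]_w'' \int[Pa]_w' f (merge (w'', w')) = \int[Pa]_w f w.
Proof.
move=> f0 mf.
have mfm := measurableT_comp mf measurable_merge.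
rewrite -(@integral_mprod _ _ _ _ _ Pa (fun=> Pa) mcst Paoo (f \o merge) (fun p => f0 _) mfm).
apply: (ge0_integral_image (g := merge)) => // [|A mA]; first exact: measurable_merge.
pose m1 := image_measure (mprod Pa mcst Paoo) measurable_merge.
rewrite -[LHS]/(m1 A); apply: eq_measure_finite_cylinder => // [|s B us mB].
  rewrite /m1 /= /pushforward preimage_setT -setXTT mprodX//.
  have PaT : (Pa : {measure set W -> \bar R}) setT = 1 by exact: probability_setT.
  by under eq_integral do rewrite PaT; rewrite integral_cst// mul1e PaT ltry.
rewrite /m1 /= /pushforward.
pose s1 := [seq i <- s | C i]; pose s2 := [seq i <- s | ~~ C i].
(* The constraint on the coordinate j of the second configuration comes from the one index of [s2]
   that rho sends to j, if there is any. *)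
pose B2 j := if [seq i <- s2 | rho i == j] is i :: _ then B i else setT.
have B2E i : i \in s2 -> B2 (rho i) = B i.
  move=> si; rewrite /B2.
  case E: [seq _ <- _ | _] => [|k l].
    have : i \in [seq k <- s2 | rho k == rho i] by rewrite mem_filter eqxx.
    by rewrite E.
  have : k \in [seq k <- s2 | rho k == rho i] by rewrite E mem_head.
  rewrite mem_filter => /andP[/eqP ki].
  rewrite mem_filter => /andP[Ck _]; move: si; rewrite mem_filter => /andP[Ci _].
  by rewrite (rho_inj Ck Ci ki).
have mB2 j : measurable (B2 j) by rewrite /B2; case: [seq _ <- _ | _].
have us2 : uniq (map rho s2).
  rewrite map_inj_in_uniq ?filter_uniq// => i j; rewrite !mem_filter.
  by move=> /andP[? _] /andP[? _]; exact: rho_inj.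
rewrite (_ : _ @^-1` _ = finite_cylinder s1 B `*` finite_cylinder (map rho s2) B2).
  rewrite mprodX; try exact: measurable_finite_cylinder.
  rewrite integral_cst; last exact: measurable_finite_cylinder.
  have mPa s' B' us' mB' : (Pa : {measure set W -> \bar R}) _ = _ :=
    @product_finite_cylinder s' B' us' mB'.
  rewrite !mPa ?filter_uniq// big_map [in RHS](bigID C)/= !big_filter muleC; congr (_ * _).
  rewrite big_seq_cond [RHS]big_seq_cond; apply: eq_bigr => i /andP[si Ci].
  by rewrite B2E// mem_filter Ci.
apply/seteqP; split => -[w1 w2] /=.
  move=> H; split => [i|j].
    by rewrite mem_filter => /andP[Ci /H]; rewrite /merge Ci.
  move=> /mapP[i si ->]; rewrite B2E//; move: si; rewrite mem_filter => /andP[Ci /H].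
  by rewrite /merge (negbTE Ci).
move=> [H1 H2] i si; rewrite /merge; case: ifPn => Ci.
  by apply: H1; rewrite mem_filter Ci.
have si2 : i \in s2 by rewrite mem_filter Ci.
by rewrite /= -(B2E i)//; apply: H2; exact: map_f.
Qed.

End merge.

Lemma integral_eval (u : I) (f : Omega -> \bar R) : (forall x, 0 <= f x) -> mfunT f ->
  \int[Pa]_w f (w u) = \int[P]_x f x.
Proof.
move=> f0 mf.
apply: (@ge0_integral_image _ _ _ _ _ _ _ (fun w : W => w u)) => // [|A mA].
  exact: measurable_eval.
transitivity (Pa (finite_cylinder [:: u] (fun=> A))).
  congr (Pa _); apply/seteqP; split => w /=.
    by move=> Aw i; rewrite inE => /eqP ->.
  by apply; rewrite inE.
by rewrite product_finite_cylinder// big_seq1.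
Qed.

End product_space.

(** * Comparison of integrals, sets of convergence, densities *)

Section probability_measure.
Context d (T : measurableType d) (R : realType) (m : {measure set T -> \bar R}).
Hypothesis m1 : m setT = 1%E.

Lemma pmeasure_le1 A : measurable A -> (m A <= 1)%E.
Proof. by move=> mA; rewrite -m1 le_measure ?inE. Qed.

Lemma pmeasure_fin A : measurable A -> m A \is a fin_num.
Proof.
by move=> mA; rewrite ge0_fin_numE// (le_lt_trans (pmeasure_le1 mA))// ltry.
Qed.

End probability_measure.

Section integral_comparison.
Context d (T : measurableType d) (R : realType) (mu : {measure set T -> \bar R}).
Local Open Scope ereal_scope.

Lemma fatou_ae (f : nat -> T -> \bar R) (g : T -> \bar R) (c : \bar R) :
  (forall n, mfunT (f n)) -> (forall n x, 0 <= f n x) -> mfunT g -> (forall x, 0 <= g x) ->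
  {ae mu, forall x, f n x @[n --> \oo] --> g x} ->
  (forall n, \int[mu]_x f n x <= c) -> \int[mu]_x g x <= c.
Proof.
move=> mf f0 mg g0 fg fc.
have [N [mN N0 Nfg]] := fg.
have mC : measurable (~` N) by exact: measurableC.
have -> : \int[mu]_x g x = \int[mu]_(x in ~` N) g x.
  rewrite -(setUv N) ge0_integral_setU//.
  - by rewrite null_set_integral ?add0e//; exact: measurable_funTS.
  - by rewrite setUv.
  - by rewrite /disj_set setICr eqxx.
rewrite (eq_integral (fun x => limn_einf (f ^~ x))) => [|x]; last first.
  rewrite inE => Nx; symmetry.
  have /cvg_limn_einf_sup[]// : f n x @[n --> \oo] --> g x.
  by apply: contrapT => nfg; apply: Nx; exact: Nfg.
apply: (le_trans (fatou mu mC (fun n => measurable_funTS (mf n)) (fun n x _ => f0 n x))).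
rewrite limn_einf_lim; apply: lime_le; first exact: is_cvg_einfs.
apply: nearW => n; apply: (@le_trans _ _ (\int[mu]_(x in ~` N) f n x)).
  by apply: ereal_inf_lbound; exists n => /=.
by apply: le_trans (fc n); apply: ge0_subset_integral.
Qed.

Lemma ge0_integral_mrestr D (mD : measurable D) (f : T -> \bar R) :
  mfunT f -> (forall x, 0 <= f x) -> \int[mrestr mu mD]_x f x = \int[mu]_(x in D) f x.
Proof.
move: f; apply: ge0_measurable_ind.
- by move=> A mA; rewrite !integral_indic// setIT.
- move=> f g mf mg f0 g0 If Ig.
  rewrite (ge0_integralD _ measurableT (fun x _ => f0 x) mf (fun x _ => g0 x) mg) If Ig.
  by rewrite (ge0_integralD _ mD (fun x _ => f0 x) (measurable_funTS mf)
    (fun x _ => g0 x) (measurable_funTS mg)).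
- move=> c f c0 mf f0 If.
  rewrite (ge0_integralZl_EFin _ measurableT (fun x _ => f0 x) mf c0) If.
  by rewrite (ge0_integralZl_EFin _ mD (fun x _ => f0 x) (measurable_funTS mf) c0).
- move=> f mf f0 ndf If.
  rewrite (monotone_convergence _ measurableT mf (fun n x _ => f0 n x)); last first.
    by move=> x _ m n mn; exact: ndf.
  rewrite (monotone_convergence _ mD (fun n => measurable_funTS (mf n))
    (fun n x _ => f0 n x)); last by move=> x _ m n mn; exact: ndf.
  by under eq_fun do rewrite If.
Qed.

(** The difference g - f is nonnegative almost everywhere and its integral is at most 0. *)
Lemma ae_eq_of_le (f g : T -> \bar R) : mfunT f -> mfunT g ->
  (forall x, 0 <= f x) -> {ae mu, forall x, f x <= g x} -> \int[mu]_x g x <= \int[mu]_x f x ->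
  \int[mu]_x f x < +oo -> (forall x, 0 <= g x) -> {ae mu, forall x, f x = g x}.
Proof.
move=> mf mg f0 fg gf foo g0.
have fi : mu.-integrable setT f.
  by apply/integrableP; split => //; under eq_integral do rewrite gee0_abs//.
have gi : mu.-integrable setT g.
  by apply/integrableP; split => //; under eq_integral do rewrite gee0_abs//; exact: le_lt_trans foo.
have ffin := integrable_ae measurableT fi; have gfin := integrable_ae measurableT gi.
have int0 : \int[mu]_x (g x - f x) <= 0.
  by rewrite integralB// leeBlDr ?add0e//; exact: integrable_fin_num.
have mh : mfunT (fun x => g x - f x) by exact: emeasurable_funB.
have : {ae mu, forall x, setT x -> g x - f x = 0}.
  apply/(ae_eq_integral_abs mu measurableT mh); apply/eqP; rewrite eq_le integral_ge0// andbT.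
  apply: le_trans int0; rewrite le_eqVlt; apply/orP; left; apply/eqP.
  apply: ae_eq_integral => //; first exact: measurableT_comp.
  apply: filterS2 ffin fg => x /(_ I) xfin xfg _; by rewrite gee0_abs// sube_ge0// xfin.
apply: filterS3 ffin gfin => x /(_ I) f1 /(_ I) g1 /(_ I).
by rewrite -(fineK f1) -(fineK g1) -EFinB => -[/eqP]; rewrite subr_eq0 => /eqP ->.
Qed.

End integral_comparison.

Section cvg_set.
Context d (T : measurableType d) (R : realType).

(** The Cauchy criterion with integer quantifiers only, which makes the set of convergence
    measurable. *)
Lemma cvgn_natSinvP (u : R^nat) : cvgn u <->
  forall m : nat, exists N, forall n, (N <= n)%N -> `|u n - u N| <= m.+1%:R^-1.
Proof.
split=> [cu m|H].
  have e0 : 0 < m.+1%:R^-1 / 2 :> R by rewrite divr_gt0.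
  have [l ul] := (cvg_ex _).1 cu.
  move/cvgrPdist_le : ul => /(_ _ e0)[N _ HN]; exists N => n Nn.
  have := HN n Nn; have := HN N (leqnn N) => /=.
  rewrite (distrC l (u n)) => h1 h2; rewrite -(subrKA l) (le_trans (ler_normD _ _))//.
  by rewrite [leRHS](splitr _) lerD.
apply/cauchy_cvgP/cauchy_exP => e e0.
have [m me] : exists m : nat, m.+1%:R^-1 < e.
  have [m _ Hm] := near_infty_natSinv_lt (PosNum e0); exists m; exact: (Hm m (leqnn m)).
have [N HN] := H m; exists (u N); exists N => // n Nn.
by rewrite /ball /= distrC (le_lt_trans (HN n Nn)).
Qed.

Lemma measurable_cvgn_set (f : nat -> T -> R) :
  (forall n, mfunT (f n)) -> measurable [set x | cvgn (f ^~ x)].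
Proof.
move=> mf; rewrite (_ : [set _ | _] = \bigcap_m \bigcup_N \bigcap_n
    [set x | (N <= n)%N -> `|f n x - f N x| <= m.+1%:R^-1]).
  apply: bigcap_measurable => // m _; apply: bigcup_measurable => N _.
  apply: bigcap_measurable => // n _; have [Nn|nN] := leqP N n; last first.
    by rewrite (_ : [set _ | _] = setT)//; apply/seteqP; split.
  rewrite (_ : [set _ | _] = [set x | `|f n x - f N x| <= cst m.+1%:R^-1 x]).
    apply: measurable_ler_set => //; apply: measurableT_comp => //.
    exact: measurable_funB.
  by apply/seteqP; split => x /=; [exact|].
apply/seteqP; split => x /=.
  by move/cvgn_natSinvP => H m _; have [N HN] := H m; exists N => // n _; exact: HN.
move=> H; apply/cvgn_natSinvP => m; have [N _ HN] := H m I.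
by exists N => n; exact: HN.
Qed.

End cvg_set.

Section density_measure.
Context d (T : measurableType d) (R : realType) (mu : {measure set T -> \bar R}).
Local Open Scope ereal_scope.

Definition density_measure (f : T -> R) (mf : mfunT f)
  (f0 : forall x, (0 <= f x)%R) (A : set T) : \bar R := \int[mu]_(x in A) (f x)%:E.

Variables (f : T -> R) (mf : mfunT f) (f0 : forall x, (0 <= f x)%R).
Local Notation m := (density_measure mf f0).

Let m0 : m set0 = 0. Proof. exact: integral_set0. Qed.
Let m_ge0 A : 0 <= m A. Proof. by apply: integral_ge0 => x _; rewrite lee_fin. Qed.
Let mEf : mfunT (EFin \o f). Proof. exact/measurable_EFinP. Qed.
Let m_sigma_additive : semi_sigma_additive m.
Proof.
move=> F mF tF mUF; rewrite [X in _ --> X](_ : _ = \sum_(0 <= n <oo) m (F n)).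
  apply/cvg_closeP; split; last by rewrite closeE.
  by apply: is_cvg_nneseries => n _ _; exact: m_ge0.
by rewrite /density_measure ge0_integral_bigcup//; [exact: measurable_funTS|
  move=> x _; rewrite lee_fin].
Qed.

HB.instance Definition _ := isMeasure.Build _ _ R m m0 m_ge0 m_sigma_additive.

Lemma ge0_integral_density_measure (g : T -> \bar R) : mfunT g ->
  (forall x, 0 <= g x) -> \int[m]_x g x = \int[mu]_x ((f x)%:E * g x).
Proof.
move: g; apply: ge0_measurable_ind.
- move=> A mA; rewrite integral_indic// setIT [LHS]integral_mkcond.
  apply: eq_integral => x _; rewrite patchE indicE.
  by case: ifPn; rewrite ?mule1// ?mule0.
- move=> g h mg mh g0 h0 Ig Ih.
  rewrite (ge0_integralD _ measurableT (fun x _ => g0 x) mg (fun x _ => h0 x) mh) Ig Ih.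
  rewrite -(ge0_integralD _ measurableT).
  + by apply: eq_integral => x _; rewrite ge0_muleDr.
  + by move=> x _; rewrite mule_ge0// lee_fin.
  + exact: emeasurable_funM.
  + by move=> x _; rewrite mule_ge0// lee_fin.
  + exact: emeasurable_funM.
- move=> c g c0 mg g0 Ig.
  rewrite (ge0_integralZl_EFin _ measurableT (fun x _ => g0 x) mg c0) Ig.
  rewrite -(ge0_integralZl_EFin _ measurableT _ _ c0).
  + by apply: eq_integral => x _; rewrite muleCA.
  + by move=> x _; rewrite mule_ge0// lee_fin.
  + exact: emeasurable_funM.
- move=> g mg g0 ndg Ig.
  rewrite (monotone_convergence _ measurableT mg (fun n x _ => g0 n x)); last first.
    by move=> x _ k n kn; exact: ndg.
  under eq_fun do rewrite Ig.
  rewrite -(monotone_convergence _ measurableT (g' := fun n x => (f x)%:E * g n x)).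
  + apply: eq_integral => x _; apply/cvg_lim => //; apply: cvgeZl => //.
    by apply: ereal_nondecreasing_is_cvgn => k n kn; exact: ndg.
  + by move=> n; exact: emeasurable_funM.
  + by move=> n x _; rewrite mule_ge0// lee_fin.
  + by move=> x _ k n kn; apply: lee_wpmul2l; [rewrite lee_fin|exact: ndg].
Qed.

End density_measure.

(** * Convexity inequalities for z ln z *)

Section xlnx.
Context (R : realType).

(** Since z ln z >= -1, the shift by 1 keeps the integrands of the entropy argument nonnegative, and
    no difference of infinite integrals can occur. *)
Definition psi (z : R) : R := z * ln z + 1.

Lemma ln_le_sub1 (x : R) : 0 < x -> ln x <= x - 1.
Proof.
by move=> x0; have := expR_ge1Dx (ln x); rewrite lnK// => h; rewrite lerBrDl.
Qed.

Lemma psi_ge0 (z : R) : 0 <= z -> 0 <= psi z.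
Proof.
rewrite le_eqVlt => /predU1P[<-|z0]; first by rewrite /psi mul0r add0r.
have zi : 0 < z^-1 by rewrite invr_gt0.
have := ln_le_sub1 zi; rewrite lnV// => h.
have : z * (- ln z) <= z * (z^-1 - 1) by rewrite ler_wpM2l// ltW.
by rewrite mulrBr mulfV ?gt_eqF// /psi; lra.
Qed.

(* From ln u <= 2 (sqrt u - 1) with u = s / x. *)
Lemma xlnx_ratio (s x : R) : 0 <= x -> 0 < s ->
  x * ln s <= x * ln x + 2 * (Num.sqrt s * Num.sqrt x - x).
Proof.
rewrite le_eqVlt => /predU1P[<-|x0] s0; first by rewrite !mul0r sqrtr0 mulr0 subr0 mulr0 addr0.
have q0 : 0 < Num.sqrt s / Num.sqrt x by rewrite divr_gt0// sqrtr_gt0.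
have := ln_le_sub1 q0; rewrite ln_div ?posrE ?sqrtr_gt0//.
have aux (y : R) : 0 < y -> ln y = 2 * ln (Num.sqrt y).
  move=> y0; rewrite -[in LHS](sqr_sqrtr (ltW y0)) lnXn ?sqrtr_gt0//.
  by rewrite mulr_natl.
have sE := aux _ s0; have xE := aux _ x0.
move=> h.
have h2 : x * (ln (Num.sqrt s) - ln (Num.sqrt x)) <=
    x * (Num.sqrt s / Num.sqrt x - 1) by rewrite ler_wpM2l// ltW.
have h3 : x * (Num.sqrt s / Num.sqrt x) = Num.sqrt s * Num.sqrt x.
  have b0 : Num.sqrt x != 0 by rewrite gt_eqF// sqrtr_gt0.
  rewrite -[X in X * (_ / _)](sqr_sqrtr (ltW x0)).
  by move: (Num.sqrt x) (Num.sqrt s) b0 => b c b0; field.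
rewrite sE xE; move: h2; rewrite [leRHS]mulrBr h3 mulr1 mulrBr => h2; lra.
Qed.

(** The cross terms add up to Y^2 - s, where Y is the sum of the square roots. Summing [xlnx_ratio]
    at s leaves the error 2 sqrt(s) Y - 2 s, which is at most Y^2 - s because (Y - sqrt(s))^2 >=
    0. *)
Lemma sum_xlnx (I : finType) (x : I -> R) : (forall i, 0 <= x i) ->
  (\sum_i x i) * ln (\sum_i x i) <= \sum_i x i * ln (x i) +
    \sum_i \sum_(j | j != i) Num.sqrt (x i) * Num.sqrt (x j).
Proof.
move=> x0; set s := \sum_i x i.
have s0 : 0 <= s by exact: sumr_ge0.
have off : \sum_i \sum_(j | j != i) Num.sqrt (x i) * Num.sqrt (x j) =
    (\sum_i Num.sqrt (x i)) ^+ 2 - s.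
  rewrite expr2 mulr_suml -sumrB; apply: eq_bigr => i _.
  rewrite mulr_sumr [in RHS](bigD1 i)//= -expr2 sqr_sqrtr//; lra.
rewrite off; move: s0; rewrite le_eqVlt => /predU1P[s0|s0].
  have xi0 i : x i = 0.
    apply/eqP; move: (esym s0) => /eqP; rewrite psumr_eq0// => /allP /(_ i).
    by rewrite mem_index_enum => /(_ isT).
  by rewrite -s0 mul0r subr0 addr_ge0 ?sqr_ge0// big1// => i _; rewrite xi0 mul0r.
have : s * ln s <= \sum_i (x i * ln (x i) + 2 * (Num.sqrt s * Num.sqrt (x i) - x i)).
  by rewrite mulr_suml; apply: ler_sum => i _; exact: xlnx_ratio.
rewrite big_split/= -mulr_sumr sumrB -mulr_sumr -/s.
move: (\sum_i x i * ln (x i)) (\sum_i Num.sqrt (x i)) => u y h.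
have := sqr_ge0 (y - Num.sqrt s).
rewrite sqrrB sqr_sqrtr ?(ltW s0)// => h'.
move: h h'; rewrite -mulr_natl; move: (Num.sqrt s) => q; nra.
Qed.

Lemma measurable_psi : mfunT psi.
Proof. by apply: measurable_funD => //; apply: measurable_funM => //; exact: measurable_ln. Qed.

Lemma measurable_ln_comp d (T : measurableType d) (f : T -> R) :
  mfunT f -> mfunT (fun x => ln (f x)).
Proof. by move=> mf; exact: measurableT_comp (@measurable_ln R) mf. Qed.

Lemma measurable_psi_comp d (T : measurableType d) (f : T -> R) :
  mfunT f -> mfunT (fun x => psi (f x)).
Proof. by move=> mf; exact: measurableT_comp measurable_psi mf. Qed.

Lemma measurable_sqrt_comp d (T : measurableType d) (f : T -> R) :
  mfunT f -> mfunT (fun x => Num.sqrt (f x)).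
Proof. by move=> mf; exact: measurableT_comp (continuous_measurable_fun (@sqrt_continuous R)) mf. Qed.

(* The entropy inequality behind non-degeneracy, with all terms nonnegative. *)
Lemma psi_recursion (I : finType) (v : R) (p z : I -> R) : 0 <= v ->
  (forall i, 0 <= p i) -> (forall i, 0 <= z i) -> \sum_i p i = 1 ->
  psi (v * \sum_i p i * z i) + v * (\sum_i - (p i * ln (p i)) * z i) + \sum_i p i * z i + v <=
  1 + psi v * (\sum_i p i * z i) + v * (\sum_i p i * psi (z i)) +
    v * \sum_i \sum_(j | j != i) (Num.sqrt (p i) * Num.sqrt (z i)) *
       (Num.sqrt (p j) * Num.sqrt (z j)).
Proof.
move=> v0 p0 z0 p1; have := @sum_xlnx _ (fun i => v * (p i * z i)).
case/(_ _)/Wrap => [i|]; first by rewrite !mulr_ge0.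
rewrite -mulr_sumr.
have lnE i : v * (p i * z i) * ln (v * (p i * z i)) = v * ln v * (p i * z i) +
    v * ((p i * ln (p i)) * z i) + v * (p i * (psi (z i) - 1)).
  have [->|vn0] := eqVneq v 0; first by rewrite !mul0r !addr0.
  have [->|pn0] := eqVneq (p i) 0; first by rewrite !(mul0r, mulr0) !addr0.
  have [->|zn0] := eqVneq (z i) 0.
    by rewrite /psi; ring.
  have vp : 0 < v by rewrite lt0r vn0.
  have pp : 0 < p i by rewrite lt0r pn0 p0.
  have zp : 0 < z i by rewrite lt0r zn0 z0.
  rewrite lnM ?posrE ?mulr_gt0// lnM ?posrE// /psi.
  move: (ln v) (ln (p i)) (ln (z i)) => lv lp lz; ring.
have sqE i j : Num.sqrt (v * (p i * z i)) * Num.sqrt (v * (p j * z j)) =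
    v * ((Num.sqrt (p i) * Num.sqrt (z i)) * (Num.sqrt (p j) * Num.sqrt (z j))).
  rewrite !sqrtrM// -[X in X * _ = _]mulrC.
  rewrite -[in RHS](sqr_sqrtr v0) expr2; move: (Num.sqrt v) => q; ring.
rewrite (eq_bigr _ (fun i _ => lnE i)).
rewrite (eq_bigr _ (fun i _ => eq_bigr _ (fun j _ => sqE i j))).
rewrite (eq_bigr _ (fun i _ => esym (mulr_sumr _ _ _ _))) -[X in _ <= _ + X]mulr_sumr.
rewrite !big_split/= -!mulr_sumr.
have -> : \sum_i p i * (psi (z i) - 1) = \sum_i p i * psi (z i) - 1.
  by rewrite -[in RHS]p1 -sumrB; apply: eq_bigr => i _; ring.
have -> : \sum_i - (p i * ln (p i)) * z i = - (\sum_i (p i * ln (p i)) * z i).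
  by rewrite -sumrN; apply: eq_bigr => i _; rewrite mulNr.
rewrite [psi (v * _)]/psi.
move: (\sum_i p i * z i) (\sum_i p i * ln (p i) * z i) (\sum_i p i * psi (z i)) => A B C.
move: (\sum_i _) => D h; rewrite -subr_ge0; move: h; rewrite -subr_ge0.
by rewrite /psi; move: (ln v) (ln (v * A)) => l1 l2; congr (0 <= _); ring.
Qed.

End xlnx.

Section sum_scale.
Context d (T : measurableType d) (R : realType) (mu : {measure set T -> \bar R}).
Local Open Scope ereal_scope.
Variables (I : Type) (s : seq I) (Q : pred I) (c : I -> R) (F : I -> T -> \bar R).
Hypothesis c0 : forall i, (0 <= c i)%R.
Hypothesis mF : forall i, mfunT (F i).
Hypothesis F0 : forall i x, 0 <= F i x.

Lemma measurable_sum_scale : mfunT (fun x => \sum_(i <- s | Q i) (c i)%:E * F i x).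
Proof.
have -> : (fun x => \sum_(i <- s | Q i) (c i)%:E * F i x) =
    (fun x => \sum_(i <- [seq i <- s | Q i]) (c i)%:E * F i x).
  by apply/funext => x; rewrite big_filter.
by apply: emeasurable_sum => i; exact: measurable_funeM.
Qed.

Lemma ge0_integral_sum_scale : \int[mu]_x (\sum_(i <- s | Q i) (c i)%:E * F i x) =
  \sum_(i <- s | Q i) (c i)%:E * \int[mu]_x F i x.
Proof.
under eq_integral do rewrite -big_filter.
rewrite ge0_integral_sum//.
- rewrite big_filter; apply: eq_bigr => i _.
  by rewrite ge0_integralZl// lee_fin.
- by move=> i; exact: measurable_funeM.
- by move=> i x _; rewrite mule_ge0// lee_fin.
Qed.

End sum_scale.

Lemma descent_rearrange (R : realType) (x y z h p : R) :
  x + h + 2 <= 1 + (p + (y + z)) -> x <= y - (1 + h - p) + z.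
Proof. by lra. Qed.

Lemma eq_measure_rectangle (R : realType) d1 d2 (X1 : measurableType d1) (X2 : measurableType d2)
    (m1 m2 : {measure set (X1 * X2) -> \bar R}) : (m1 setT < +oo)%E ->
  (forall B C, measurable B -> measurable C -> m1 (B `*` C) = m2 (B `*` C)) ->
  forall E, measurable E -> m1 E = m2 E.
Proof.
move=> m1oo H E mE.
pose G := [set A `*` B | A in @measurable _ X1 & B in @measurable _ X2].
apply: (measure_unique G (fun=> setT)) => //.
- by rewrite measurable_prod_measurableType.
- move=> _ _ [A1 mA1 [A2 mA2 <-]] [B1 mB1 [B2 mB2 <-]].
  exists (A1 `&` B1); first exact: measurableI.
  by exists (A2 `&` B2); [exact: measurableI|rewrite setXI].
- by move=> _; exists setT => //; exists setT => //; rewrite setXTT.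
- by rewrite bigcup_const.
- by move=> _ [B mB [D mD <-]]; exact: H.
Qed.

Section eq_measure_box.
Context (R : realType) d1 d2 d3 (X1 : measurableType d1) (X2 : measurableType d2)
  (X3 : measurableType d3).
Local Open Scope ereal_scope.

(** The middle factor is tested only on a class Pi that determines finite measures; for the tree
    this is the class of finite cylinders. Fixing the other factors turns the comparison into one of
    image measures. *)
Lemma eq_measure_box (Pi : set (set X2)) (m1 m2 : {measure set ((X1 * X2) * X3) -> \bar R}) :
  (forall E, Pi E -> measurable E) -> (forall n1 n2 : {measure set X2 -> \bar R}, n1 setT < +oo ->
    (forall E, Pi E -> n1 E = n2 E) -> forall E, measurable E -> n1 E = n2 E) -> m1 setT < +oo ->
  (forall D E C, measurable D -> Pi E -> measurable C ->
    m1 ((D `*` E) `*` C) = m2 ((D `*` E) `*` C)) -> forall A, measurable A -> m1 A = m2 A.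
Proof.
move=> mPi ePi m1oo H; apply: eq_measure_rectangle => // B C mB mC.
have mf1 : mfunT (fst : (X1 * X2) * X3 -> X1 * X2) by exact: measurable_fst.
have mf2 : mfunT (fun p : (X1 * X2) * X3 => p.1.2).
  exact: measurableT_comp measurable_snd measurable_fst.
have mTC (Y : set X3) : measurable Y -> measurable ((setT : set (X1 * X2)) `*` Y).
  by move=> mY; exact: measurableX.
have fstE (m : {measure set ((X1 * X2) * X3) -> \bar R}) (D : set (X1 * X2)) :
    image_measure (mrestr m (mTC _ mC)) mf1 D = m (D `*` C).
  rewrite /= /pushforward /= /mrestr; congr (m _).
  by apply/seteqP; split => -[p z] /=; [move=> [? [_ ?]]|move=> [? ?]].
rewrite -!fstE; apply: eq_measure_rectangle => // [|D E mD mE].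
  rewrite fstE (le_lt_trans _ m1oo)// le_measure ?inE//; exact: measurableX.
rewrite !fstE.
have mDT : measurable ((D `*` (setT : set X2)) `*` C).
  by apply: measurableX => //; exact: measurableX.
have sndE (m : {measure set ((X1 * X2) * X3) -> \bar R}) (F : set X2) :
    image_measure (mrestr m mDT) mf2 F = m ((D `*` F) `*` C).
  rewrite /= /pushforward /= /mrestr; congr (m _).
  by apply/seteqP; split => -[[x y] z] /=; [move=> [? [[? ?] ?]]|move=> [[? ?] ?]].
rewrite -!sndE; apply: ePi => // [|F PF].
  rewrite sndE (le_lt_trans _ m1oo)// le_measure ?inE//.
rewrite !sndE; exact: H.
Qed.

End eq_measure_box.

Section xlnx.
Context (R : realType).

Lemma xlnx_le1 (x : R) : 0 <= x <= 1 -> - (x * ln x) <= 1.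
Proof.
move=> /andP[x0 x1]; have [->|xn0] := eqVneq x 0; first by rewrite mul0r oppr0.
have xp : 0 < x by rewrite lt_def xn0.
have := ln_sublinear xp.
have : ln x^-1 < x^-1 by apply: ln_sublinear; rewrite invr_gt0.
rewrite lnV ?posrE// => h _; rewrite -mulrN.
by rewrite (le_trans (ler_wpM2l x0 (ltW h)))// mulfV.
Qed.

Lemma xlnx_ge0 (x : R) : 0 <= x <= 1 -> 0 <= - (x * ln x).
Proof. by move=> /andP[x0 x1]; rewrite -mulrN mulr_ge0// oppr_ge0 ln_le0. Qed.

(** This is - y ln y <= 1 at y = sqrt x, because x ln x = 2 sqrt x (sqrt x ln (sqrt x)). It yields
    the continuity of x ln x at 0. *)
Lemma xlnx_le_sqrt (x : R) : 0 <= x <= 1 -> - (x * ln x) <= 2 * Num.sqrt x.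
Proof.
move=> /andP[x0 x1]; have s0 := sqrtr_ge0 x.
have s1 : Num.sqrt x <= 1 by rewrite -[leRHS]sqrtr1 ler_wsqrtr.
have := xlnx_le1 (x := Num.sqrt x); rewrite s0 s1 => /(_ isT).
have [x0'|xp] := eqVneq x 0; first by rewrite x0' sqrtr0 mul0r oppr0 mulr0.
have sp : 0 < Num.sqrt x by rewrite sqrtr_gt0 lt_def xp.
have -> : ln x = 2 * ln (Num.sqrt x) by rewrite -[in LHS](sqr_sqrtr x0) lnXn// mulr_natl.
rewrite -[in X in _ -> - (X * _) <= _](sqr_sqrtr x0).
move: (Num.sqrt x) (ln (Num.sqrt x)) s0 => s l s0 h; rewrite expr2; nra.
Qed.

Lemma xlnx_cvg (u : nat -> R) (l : R) : (forall n, 0 <= u n <= 1) ->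
  u n @[n --> \oo] --> l -> - (u n * ln (u n)) @[n --> \oo] --> - (l * ln l).
Proof.
move=> u01 ul; have l0 : 0 <= l.
  rewrite -(cvg_lim _ ul)//; apply: limr_ge; first by apply/cvg_ex; exists l.
  by apply: nearW => n; have /andP[] := u01 n.
have [lz|ln0] := eqVneq l 0; last first.
  apply: cvgN; apply: cvgM => //; apply: continuous_cvg => //.
  by apply: continuous_ln; rewrite lt_def ln0.
rewrite lz mul0r oppr0.
apply: (@squeeze_cvgr _ _ _ _ (cst 0) (fun n => 2 * Num.sqrt (u n))).
- by apply: nearW => n; rewrite xlnx_ge0//= xlnx_le_sqrt.
- exact: cvg_cst.
- rewrite -(mulr0 2) -(@sqrtr0 R) -lz; apply: cvgM; first exact: cvg_cst.
  by apply: continuous_cvg => //; exact: sqrt_continuous.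
Qed.

End xlnx.

Lemma sum_tupleS (V : nmodType) (L : finType) n (F : seq L -> V) :
  \sum_(u : n.+1.-tuple L) F u = \sum_(i : L) \sum_(u : n.-tuple L) F (i :: u).
Proof.
rewrite pair_bigA/= (reindex (fun p : L * n.-tuple L => [tuple of p.1 :: p.2]))//=.
exists (fun t => (thead t, [tuple of behead t])) => [[i u] _|t _].
  by congr pair; apply: val_inj.
by rewrite -tuple_eta.
Qed.

Section clamp.
Context (R : realType).

Definition clamp (z : R) : R := Num.min (Num.max z 0) 1.

Lemma clamp01 z : 0 <= clamp z <= 1.
Proof. by rewrite /clamp le_min ge_min le_max !lexx ler01 !orbT. Qed.

Lemma clamp_id z : 0 <= z <= 1 -> clamp z = z.
Proof. by move=> /andP[z0 z1]; rewrite /clamp max_l// min_l. Qed.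

Lemma measurable_clamp d (T : measurableType d) (f : T -> R) :
  mfunT f -> mfunT (fun x => clamp (f x)).
Proof. by move=> mf; apply: measurable_minr => //; exact: measurable_maxr. Qed.

(** The inverse is expressed through exp and ln, while the indicator supplies the default value 0 of
    the inverse of 0. *)
Lemma measurable_inv_ge0 d (T : measurableType d) (f : T -> R) : (forall x, 0 <= f x) ->
  mfunT f -> mfunT (fun x => (f x)^-1).
Proof.
move=> f0 mf; have -> : (fun x => (f x)^-1) =
    (fun x => \1_(~` [set 0 : R]) (f x) * expR (- ln (f x))).
  apply/funext => x; rewrite indicE; have [->|fx] := eqVneq (f x) 0.
    by rewrite memNset ?mul0r ?invr0//; apply.
  rewrite mem_set; last exact/eqP.
  by rewrite mul1r expRN lnK// posrE lt_def fx f0.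
apply: measurable_funM.
  apply: measurableT_comp mf; apply: measurable_indic; apply: measurableC; exact: measurable_set1.
by apply: measurableT_comp => //; apply: measurableT_comp => //; exact: measurable_ln_comp.
Qed.

End clamp.

Section bounded_density.
Context d (T : measurableType d) (R : realType) (nu nu1 : {measure set T -> \bar R}).
Hypothesis nuoo : (nu setT < +oo)%E.
Hypothesis nu1le : forall A, measurable A -> (nu1 A <= nu A)%E.
Local Open Scope ereal_scope.

(** The Radon-Nikodym density exceeds 1 only on a null set: over {f > 1} the integral of f - 1 is
    the difference of nu1 and nu, which is at most 0. Clamping makes the bounds hold everywhere. *)
Lemma bounded_density : exists f : T -> R, [/\ mfunT f, forall x, (0 <= f x <= 1)%R &
  forall A, measurable A -> nu1 A = \int[nu]_(x in A) (f x)%:E].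
Proof.
have nu1oo : nu1 setT < +oo by rewrite (le_lt_trans (nu1le measurableT)).
have dom : finite_measure_of nu1oo `<< finite_measure_of nuoo.
  apply/null_content_dominatesP => A mA A0; apply/eqP; rewrite -measure_le0/=.
  by rewrite (le_trans (nu1le mA))// -[X in _ <= X]A0.
have [f [f0 ffin fi fE]] := radon_nikodym_sigma_finite dom.
have mf := measurable_int _ fi.
pose A := [set x | 1 < f x].
have mA : measurable A by exact: measurable_lte_set.
have mf1 : measurable_fun A (fun x => f x - 1).
  by apply: emeasurable_funD => //; exact: measurable_funTS.
have f10 x : A x -> 0 <= f x - 1 by rewrite /A /= => /ltW; rewrite -(fineK (ffin x)) -EFinB !lee_fin subr_ge0.
have int0 : \int[nu]_(x in A) (f x - 1) = 0.
  have E : nu1 A = \int[nu]_(x in A) (f x - 1) + nu A.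
    rewrite -[LHS]/(finite_measure_of nu1oo A) fE//.
    rewrite -[nu A in RHS]mul1e -integral_cst// -ge0_integralD//.
    by apply: eq_integral => x _; rewrite subeK.
  have Afin : nu A \is a fin_num by exact: fin_num_of_lty.
  have := nu1le mA; rewrite E => h; apply/eqP; rewrite eq_le integral_ge0// andbT.
  by move: h; rewrite -[leRHS]add0e leeD2rE.
have f1 : {ae nu, forall x, f x <= 1}.
  have : {ae nu, forall x, A x -> f x - 1 = 0}.
    apply/(ae_eq_integral_abs nu mA mf1); rewrite -[RHS]int0.
    by apply: eq_integral => x; rewrite inE => Ax; rewrite gee0_abs// f10.
  apply: filterS => x h; rewrite leNgt; apply/negP => fx.
  by have /eqP := h fx; rewrite sube_eq ?ffin// add0e => /eqP fx1; rewrite fx1 ltxx in fx.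
pose g x := clamp (fine (f x)).
have mg : mfunT g by apply: measurable_clamp; exact: measurableT_comp.
exists g; split => //.
- by move=> x; exact: clamp01.
- move=> B mB; rewrite -[LHS]/(finite_measure_of nu1oo B) fE//.
  apply: ae_eq_integral => //; first exact: measurable_funTS.
    by apply/measurable_EFinP; exact: measurable_funTS.
  apply: filterS f1 => x fx _; rewrite /g clamp_id ?fineK// fine_ge0//=.
  by rewrite -lee_fin fineK.
Qed.

End bounded_density.

Lemma nneseries_exp_lty (R : realType) (c e : R) : 0 <= c -> 0 < e ->
  (\sum_(0 <= n <oo) (c * expR (- (e * n%:R)))%:E < +oo)%E.
Proof.
move=> c0 e0; pose x := expR (- e).
have x0 : 0 < x by exact: expR_gt0.
have x1 : x < 1 by rewrite expR_lt1 oppr_lt0.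
have xE n : expR (- (e * n%:R)) = x ^+ n by rewrite -mulNr mulrC expRM_natl.
apply: (@le_lt_trans _ _ (c / (1 - x))%:E); last exact: ltry.
apply: lime_le; first by apply: is_cvg_nneseries => n _ _; rewrite lee_fin mulr_ge0// expR_ge0.
apply: nearW => n; rewrite sumEFin lee_fin ler_pdivlMr ?subr_gt0//.
under eq_bigr do rewrite xE.
rewrite -mulr_sumr -mulrA ler_piMr//.
have -> : (\sum_(0 <= i < n) x ^+ i) * (1 - x) = 1 - x ^+ n.
  elim: n => [|n ih]; first by rewrite big_nil mul0r expr0 subrr.
  by rewrite big_nat_recr//= mulrDl ih exprSr; ring.
by rewrite gerBl exprn_ge0// ltW.
Qed.

(** * Averages along coboundaries and ratios of logarithms *)

Section coboundary.
Context d (T : measurableType d) (R : realType).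
Variables (mu : {measure set T -> \bar R}) (th : T -> T).
Hypothesis mu1 : mu setT = 1%E.
Hypothesis mth : mfunT th.
Hypothesis inv : forall A, measurable A -> mu (th @^-1` A) = mu A.
Hypothesis erg : forall A, measurable A -> th @^-1` A = A -> mu A = 0%E \/ mu A = 1%E.

(* Birkhoff gives a constant limit, and the iterates of g are identically
   distributed, so that g (th^n x) / n tends to 0 in measure. *)
Lemma coboundary_average (f g : T -> R) : mfunT g ->
  mu.-integrable setT (EFin \o f) -> {ae mu, forall x, g (th x) - g x = f x} ->
  {ae mu, forall x, n%:R^-1 * g (iter n th x) @[n --> \oo] --> 0}.
Proof.
move=> mg fi gf; pose L := fine (\int[mu]_x (f x)%:E).
have n0 (c : R) : n%:R^-1 * c @[n --> \oo] --> 0.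
  rewrite -[X in _ --> X](mul0r c); apply: cvgM; last exact: cvg_cst.
  rewrite -(cvg_shiftS (fun n : nat => n%:R^-1 : R)); exact: cvg_harmonic.
have gL : {ae mu, forall x, n%:R^-1 * g (iter n th x) @[n --> \oo] --> L}.
  have gf' := ae_inv_iter mth inv gf.
  apply: filterS2 (birkhoff mu1 mth inv erg fi) gf' => x bx gx.
  have E n : n%:R^-1 * g (iter n th x) = n%:R^-1 * birkhoff_sum th f n x + n%:R^-1 * g x.
    rewrite -mulrDr; congr (_ * _); elim: n => [|n ih]; first by rewrite /birkhoff_sum big_ord0 add0r.
    rewrite /birkhoff_sum big_ord_recr/= -gx -[\sum_(_ < _) _]/(birkhoff_sum th f n x).
    by rewrite addrAC -ih; ring.
  rewrite (funext E) -[X in _ --> X]addr0; exact: cvgD.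
(* Integrability of g is not assumed, so a bounded continuous function that vanishes only at 0 is
   integrated in its place. *)
pose h (z : R) := Num.min `|z| 1.
have mh (u : T -> R) : mfunT u -> mfunT (fun x => h (u x)).
  by move=> mu'; apply: measurable_minr => //; exact: measurableT_comp.
have h01 z : 0 <= h z <= 1 by rewrite /h le_min ge_min normr_ge0 ler01 lexx orbT.
have hc (u : nat -> R) (l : R) : u n @[n --> \oo] --> l -> h (u n) @[n --> \oo] --> h l.
  move=> ul; have hE z : h z = (`|z| + 1 - `| `|z| - 1 |) / 2 by rewrite /h minr_absE.
  under eq_fun do rewrite hE; rewrite hE; apply: cvgM; last exact: cvg_cst.
  have nl : `|u n| @[n --> \oo] --> `|l| by exact: cvg_norm.
  apply: cvgB; first by apply: cvgD => //; exact: cvg_cst.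
  by apply: cvg_norm; apply: cvgB => //; exact: cvg_cst.
have bnd (u : T -> R) : mfunT u -> (forall x, 0 <= u x <= 1) -> mu.-integrable setT (EFin \o u).
  move=> mu' u01; apply: (@integrable_bounded _ _ _ _ _ 1) => //; first by rewrite mu1 ltry.
  by move=> x; have /andP[? ?] := u01 x; rewrite ger0_norm.
have mn (n : nat) (u : T -> R) : mfunT u -> mfunT (fun x => n%:R^-1 * u x).
  by move=> mu'; exact: measurable_funM.
have key (u : nat -> T -> R) (l : R) : (forall n, mfunT (u n)) ->
    {ae mu, forall x, u n x @[n --> \oo] --> l} ->
    (\int[mu]_x (h (u n x))%:E @[n --> \oo] --> (h l)%:E)%E.
  move=> mu' ul; have -> : (h l)%:E = (\int[mu]_x (cst (h l) x)%:E)%E.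
    by rewrite [RHS](integral_cst mu measurableT (h l)%:E) mu1 mule1.
  apply: (@dominated_cvg_real _ _ _ mu (fun n x => h (u n x)) _ (cst 1)) => //.
  - by move=> n; exact: mh.
  - by apply: filterS ul => x; exact: hc.
  - by apply: bnd => // x; rewrite ler01 lexx.
  - by apply: nearW => x n; have /andP[? ?] := h01 (u n x); rewrite ger0_norm.
have mgi n : mfunT (fun x => g (iter n th x)).
  exact: measurableT_comp mg (measurable_iter mth n).
have kL := key _ _ (fun n => mn n _ (mgi n)) gL.
have k0 : (\int[mu]_x (h (n%:R^-1 * g x))%:E @[n --> \oo] --> (h 0)%:E)%E.
  apply: (key (fun n x => n%:R^-1 * g x)) => [n|]; first exact: mn.
  by apply: nearW => x; exact: n0.
have E n : (\int[mu]_x (h (n%:R^-1 * g (iter n th x)))%:E = \int[mu]_x (h (n%:R^-1 * g x))%:E)%E.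
  have := @ge0_integral_inv _ _ _ mu (iter n th) (measurable_iter mth n) (iter_inv mth inv n)
    (fun x => (h (n%:R^-1 * g x))%:E); apply.
    by apply/measurable_EFinP; apply: mh; exact: mn.
  by move=> x; rewrite lee_fin; have /andP[] := h01 (n%:R^-1 * g x).
have hL0 : h L = 0.
  have [] : (h L)%:E = (h 0)%:E.
    by rewrite (funext E) in kL; exact: (cvg_unique _ kL k0).
  by move=> ->; rewrite /h normr0 min_l.
have -> : (0 : R) = L.
  apply/esym/eqP; rewrite -normr_eq0; move: hL0; rewrite /h minElt; case: ifP => [_ ->//|_ /eqP].
  by rewrite oner_eq0.
exact: gL.
Qed.

End coboundary.

Lemma add_rearrange (R : nmodType) (a b s c z : R) : a + b + (s + c + z) = a + s + (b + c) + z.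
Proof. by rewrite -!addrA; congr (_ + _); rewrite addrCA. Qed.

Lemma measurable_cvg_to d (T : measurableType d) (R : realType) (f : nat -> T -> R) (g : T -> R) :
  (forall n, mfunT (f n)) -> mfunT g -> measurable [set x | f n x @[n --> \oo] --> g x].
Proof.
move=> mf mg.
have -> : [set x | f n x @[n --> \oo] --> g x] = \bigcap_m \bigcup_N \bigcap_n
    [set x | `|g x - f (N + n)%N x| <= m.+1%:R^-1].
  apply/seteqP; split => x /=.
    move=> /cvgrPdist_le fg m _; have m0 : 0 < m.+1%:R^-1 :> R by [].
    have [N _ HN] := fg _ m0; exists N => // n _; apply: HN; exact: leq_addr.
  move=> H; apply/cvgrPdist_le => e e0; have [N _ HN] := H (Num.truncn e^-1) I.
  exists N => // n /= Nn; have := HN (n - N)%N I; rewrite /= subnKC// => /le_trans; apply.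
  have /andP[_ h] := truncn_itv (ltW (eqbRL (invr_gt0 e) e0)).
  by rewrite -[leRHS](invrK e) lef_pV2 ?posrE ?invr_gt0// ltW.
apply: bigcapT_measurable => m; apply: bigcupT_measurable => N; apply: bigcapT_measurable => n.
by apply: measurable_ler_set => //; apply: measurableT_comp => //; exact: measurable_funB.
Qed.

Lemma three_quarters_bound (R : realType) (N e I x y : R) : 0 <= N -> I <= e / 4 ->
  x <= I + e / 4 -> y <= 0 + e / 4 -> N * x + N * y <= e * N + - (e / 4 * N).
Proof.
move=> N0 Ie xI ye.
have : N * (x + y) <= N * (e - e / 4) by apply: ler_wpM2l => //; lra.
lra.
Qed.

Section log_ratio.
Context (R : realType).

Lemma near_right_log : \forall rho \near (0 : R)^'+, [/\ 0 < rho, rho < 1 & ln rho < 0].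
Proof.
near=> rho; have r0 : 0 < rho by near: rho; exact: nbhs_right_gt.
have r1 : rho < 1 by near: rho; exact: nbhs_right_lt.
by split => //; apply: ln_lt0; rewrite r0.
Unshelve. all: by end_near. Qed.

Lemma cvg_inv_ln (c : R) : c / ln rho @[rho --> 0^'+] --> (0 : R).
Proof.
rewrite -[X in _ --> X](mulr0 c); apply: cvgM; first exact: cvg_cst.
apply: (iffLR (cvgrVNy (f := fun rho : R => (ln rho)^-1) _)).
  by apply: filterS near_right_log => x [_ _ h] /=; rewrite invr_lt0.
rewrite (_ : unstable.inv_fun _ = @ln R); first exact: lnNy.
by apply/funext => x /=; rewrite invrK.
Qed.

Let cvg_average_succ (U : nat -> R) (l : R) : n%:R^-1 * U n @[n --> \oo] --> l ->
  n%:R^-1 * U n.+1 @[n --> \oo] --> l.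
Proof.
move=> Ul0; have Ul : n.+1%:R^-1 * U n.+1 @[n --> \oo] --> l.
  by rewrite (cvg_shiftS (fun n => n%:R^-1 * U n)).
have q1 : 1 + n%:R^-1 @[n --> \oo] --> (1 : R).
  rewrite -[X in _ --> X]addr0; apply: cvgD; first exact: cvg_cst.
  have h : n.+1%:R^-1 @[n --> \oo] --> (0 : R) by exact: cvg_harmonic.
  by rewrite (cvg_shiftS (fun n => n%:R^-1 : R)) in h.
have h : (1 + n%:R^-1) * (n.+1%:R^-1 * U n.+1) @[n --> \oo] --> 1 * l by exact: cvgM q1 Ul.
rewrite mul1r in h; apply: cvg_trans h; apply: near_eq_cvg.
near=> n; have n0 : (n%:R : R) != 0 by rewrite pnatr_eq0 -lt0n; near: n; exists 1%N.
have n1 : n%:R + 1 != 0 :> R by rewrite natr1 pnatr_eq0.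
by rewrite -natr1; field; rewrite n0 n1.
Unshelve. all: by end_near. Qed.

(** For s (n + 1) <= rho < s n monotonicity places ln (G rho) between its values at two consecutive
    scales, and dividing by n or by n + 1 gives the same limit. *)
Lemma log_ratio_interpolation (G : R -> R) (s : nat -> R) (chi E : R) : 0 < chi ->
  (forall x, 0 < x -> 0 < G x) -> (forall x y, 0 < x -> x <= y -> G x <= G y) ->
  (forall n, 0 < s n) -> (forall n, s n.+1 <= s n) -> s n @[n --> \oo] --> 0 ->
  n%:R^-1 * ln (s n) @[n --> \oo] --> - chi -> n%:R^-1 * ln (G (s n)) @[n --> \oo] --> - E ->
  ln (G rho) / ln rho @[rho --> 0^'+] --> E / chi.
Proof.
move=> chi0 G0 Gm s0 sS sto0 schi GE.
have sm m n : (m <= n)%N -> s n <= s m.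
  by move=> mn; apply: (@homo_leq _ s (fun x y => y <= x)) mn => // x y z xy yz; exact: le_trans yz xy.
(* The index of the last scale above rho; when rho is out of range, any index will do. *)
have Hex rho : exists n, 0 < rho < s 0%N -> s n.+1 <= rho < s n.
  have [/andP[rho0 rhos]|nr] := boolP (0 < rho < s 0%N); last by exists 0%N.
  have ex : exists n, s n <= rho.
    by have [n _ /(_ n (leqnn n)) /ltW] := cvgr_lt 0 sto0 _ rho0; exists n.
  have [[sn _|n sn nmin]] := ex_minnP ex; first by rewrite leNgt rhos in sn.
  exists n => _; rewrite sn ltNge; apply/negP => /nmin; by rewrite ltnn.
have [N HN] := choice Hex.
have nearN : \forall rho \near (0 : R)^'+, s (N rho).+1 <= rho < s (N rho).
  near=> rho; apply: HN; apply/andP; split; near: rho; [exact: nbhs_right_gt|exact: nbhs_right_lt].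
have Noo : N rho @[rho --> (0 : R)^'+] --> \oo.
  apply/cvgnyPge => M; near=> rho.
  have /andP[h _] : s (N rho).+1 <= rho < s (N rho) by near: rho.
  rewrite leqNgt; apply/negP => NM.
  have : s M <= rho := le_trans (sm _ _ NM) h.
  by apply/negP; rewrite -ltNge; near: rho; exact: nbhs_right_lt.
have N0 : \forall rho \near (0 : R)^'+, (0 < N rho)%N by move/cvgnyPge : Noo => /(_ 1%N).
have along (f : R -> R) (l : R) : (forall x y, 0 < x -> x <= y -> f x <= f y) ->
    n%:R^-1 * f (s n) @[n --> \oo] --> l -> (N rho)%:R^-1 * f rho @[rho --> (0 : R)^'+] --> l.
  move=> fm fl; have h1 := cvg_comp _ _ Noo fl; have h2 := cvg_comp _ _ Noo (cvg_average_succ fl).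
  apply: (squeeze_cvgr _ h2 h1); near=> rho => /=.
  have /andP[sn1 sn] : s (N rho).+1 <= rho < s (N rho) by near: rho.
  by rewrite !ler_wpM2l ?invr_ge0// fm// ?(ltW sn)// (lt_le_trans (s0 _) sn1).
have lnm (x y : R) : 0 < x -> x <= y -> ln x <= ln y.
  by move=> x0 xy; rewrite ler_ln ?posrE// (lt_le_trans x0).
have hs := along (@ln R) _ lnm schi.
have hG : (N rho)%:R^-1 * ln (G rho) @[rho --> (0 : R)^'+] --> - E.
  apply: (along (fun x => ln (G x)) _ _ GE) => x y x0 xy.
  by apply: lnm; [exact: G0|exact: Gm].
have chiN : - chi != 0 by rewrite oppr_eq0 gt_eqF.
have hV : ((N rho)%:R^-1 * ln rho)^-1 @[rho --> (0 : R)^'+] --> (- chi)^-1 by exact: cvgV chiN hs.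
have h : ((N rho)%:R^-1 * ln (G rho)) * ((N rho)%:R^-1 * ln rho)^-1 @[rho --> (0 : R)^'+] --> E / chi.
  by rewrite -mulrNN -invrN; exact: cvgM hG hV.
apply: cvg_trans h; apply: near_eq_cvg.
near=> rho; have n0 : ((N rho)%:R : R) != 0 by rewrite pnatr_eq0 -lt0n; near: rho.
have l0 : ln rho != 0.
  have [_ _ h] : [/\ 0 < rho, rho < 1 & ln rho < 0] by near: rho; exact: near_right_log.
  by rewrite lt_eqF.
by rewrite /=; field; rewrite l0 n0.
Unshelve. all: by end_near. Qed.

(** Since ln rho < 0, the bound of G by F gives the lower estimate of the ratio, and the bound of F
    by G, used at rho / 2, the upper one. The factor x^(-e) shifts the exponent by e; constants
    vanish after division by ln rho. *)
Lemma log_ratio_comparison (F G : R -> R) (D : R) :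
  (forall x, 0 < x -> 0 < F x) -> (forall x, 0 < x -> 0 < G x) ->
  (exists2 c, 0 < c & forall x, 0 < x -> G x <= c * F x) -> (forall e, 0 < e -> exists2 c, 0 < c &
     forall x, 0 < x < 1 -> F x <= c * expR (- (e * ln x)) * G (2 * x)) ->
  ln (F rho) / ln rho @[rho --> 0^'+] --> D -> ln (G rho) / ln rho @[rho --> 0^'+] --> D.
Proof.
move=> F0 G0 [c c0 Gc] H FD.
apply/cvgrPdist_le => e e0.
have lower : \forall rho \near (0 : R)^'+, D - e <= ln (G rho) / ln rho.
  have h : ln c / ln rho + ln (F rho) / ln rho @[rho --> (0 : R)^'+] --> 0 + D.
    exact: cvgD (cvg_inv_ln _) FD.
  rewrite add0r in h; have De : D - e < D by rewrite gtrBl.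
  apply: filterS2 (cvgr_ge D h _ De) near_right_log => rho hr [rho0 _ l0].
  apply: le_trans hr _; rewrite -mulrDl ler_nM2r ?invr_lt0// -lnM ?posrE ?F0//.
  by rewrite ler_ln ?posrE ?G0 ?mulr_gt0 ?F0// Gc.
have upper : \forall rho \near (0 : R)^'+, ln (G rho) / ln rho <= D + e.
  have e2 : 0 < e / 2 by rewrite divr_gt0.
  have [k k0 Hk] := H _ e2.
  have half0 : rho / 2 @[rho --> (0 : R)^'+] --> (0 : R)^'+.
    move=> A; rewrite /at_right /within/= => -[d /= d0 Hd]; exists d => //= rho rhod rho0.
    apply: Hd => /=; last by rewrite divr_gt0.
    by move: rhod; rewrite /= !sub0r !normrN !gtr0_norm ?divr_gt0//; lra.
  have h1 : (ln (F sig) / ln sig + e / 2 - ln k / ln sig) @[sig --> (0 : R)^'+] --> D + e / 2 - 0.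
    by apply: cvgB (cvg_inv_ln _); apply: cvgD FD _; exact: cvg_cst.
  have h2 := cvg_comp _ _ half0 h1.
  have h3 : 1 - ln 2 / ln rho @[rho --> (0 : R)^'+] --> (1 - 0 : R).
    by apply: cvgB (cvg_inv_ln _); exact: cvg_cst.
  have h : (ln (F (rho / 2)) / ln (rho / 2) + e / 2 - ln k / ln (rho / 2)) * (1 - ln 2 / ln rho)
      @[rho --> (0 : R)^'+] --> (D + e / 2 - 0) * (1 - 0) by exact: cvgM h2 h3.
  rewrite !subr0 mulr1 in h.
  have De : D + e / 2 < D + e by rewrite ltrD2l ltr_pdivrMr// ltr_pMr// ltr1n.
  apply: filterS2 (cvgr_le _ h _ De) near_right_log => rho hr [rho0 rho1 l0].
  apply: le_trans _ hr => /=.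
  have s0 : 0 < rho / 2 by rewrite divr_gt0.
  have s1 : rho / 2 < 1 by rewrite ltr_pdivrMr// mul1r (lt_trans rho1)// ltr1n.
  have ls : ln (rho / 2) = ln rho - ln 2 by rewrite ln_div ?posrE.
  have ls0 : ln (rho / 2) < 0 by apply: ln_lt0; rewrite s0.
  have -> : 1 - ln 2 / ln rho = ln (rho / 2) / ln rho by rewrite ls mulrBl divff ?lt_eqF.
  rewrite mulrA ler_nM2r ?invr_lt0//.
  have := Hk _ (introT andP (conj s0 s1)); rewrite [2 * _]mulrC divfK//.
  have l0' : ln (rho / 2) != 0 by rewrite lt_eqF.
  move: (rho / 2) s0 l0' {s1 ls ls0} => sig sig0 l0'.
  rewrite -ler_ln ?posrE ?F0 ?mulr_gt0 ?expR_gt0 ?G0// !lnM ?posrE ?mulr_gt0 ?expR_gt0 ?G0// expRK.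
  rewrite !(mulrDl, mulNr) !divfK//.
  by move: (ln (F _)) (ln k) (e / 2 * _) (ln (G _)) => x y z t'; lra.
apply: filterS2 lower upper => rho h1 h2; rewrite ler_norml.
by move: (ln _ / _) h1 h2 => x h1 h2; apply/andP; split; lra.
Unshelve. all: by end_near. Qed.

End log_ratio.

Section ball_comparison.
Context d (T : measurableType d) (R : realType) (Phi : T -> R).
Hypothesis mPhi : mfunT Phi.
Local Open Scope ereal_scope.
Local Notation I z s := (`](z - s)%R, (z + s)%R[%classic : set R).

(** The maximal inequality with s = 1 / (j + 1): a point at which the ratios of ball masses are
    unbounded lies in every [E j], and the al-masses of these sets tend to 0. *)
Lemma ae_ball_comparison (al be : {measure set T -> \bar R}) : be setT < +oo ->
  {ae al, forall x : T, exists2 c : R, (0 < c)%R &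
    forall s, (0 < s)%R -> be (Phi @^-1` I (Phi x) s) <= c%:E * al (Phi @^-1` I (Phi x) s)}.
Proof.
move=> beoo; pose al' := image_measure al mPhi; pose be' := image_measure be mPhi.
have /choice[E HE] (j : nat) : exists E : set R, [/\ measurable E,
    sparse_points al' be' j.+1%:R^-1 `<=` E & al' E <= (2 * j.+1%:R^-1)%:E * be' setT].
  by apply: maximal_inequality; rewrite invr_ge0.
have mE j : measurable (E j) by have [] := HE j.
pose N := \bigcap_j E j.
have mN : measurable N by exact: bigcapT_measurable.
have befin : be' setT \is a fin_num by rewrite ge0_fin_numE.
have Nle j : al' N <= (2 * j.+1%:R^-1 * fine (be' setT))%:E.
  have [_ _ h] := HE j; rewrite EFinM fineK// (le_trans _ h)// le_measure ?inE//.
  by move=> x; exact.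
have N0 : al' N = 0.
  have Nfin : al' N \is a fin_num by rewrite ge0_fin_numE// (le_lt_trans (Nle 0%N)) ?ltry.
  apply/eqP; rewrite eq_le measure_ge0 andbT leNgt; apply/negP => Npos.
  move: Nle Npos; rewrite -(fineK Nfin) lte_fin; move: (fine _) (fine _) => b m h m0.
  have b0 : (0 <= b)%R.
    by have := h 0%N; rewrite lee_fin invr1 mulr1 => /(le_trans (ltW m0)); rewrite pmulr_rge0.
  have /andP[_ bm] := truncn_itv (divr_ge0 (mulr_ge0 (ler0n R 2) b0) (ltW m0)).
  have := h (Num.truncn (2 * b / m)); rewrite lee_fin leNgt => /negP; apply.
  by rewrite mulrAC ltr_pdivrMr ?ltr0n// [ltRHS]mulrC -ltr_pdivrMr.
exists (Phi @^-1` N); split; first exact: (measurable_preimage mPhi).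
  exact: N0.
move=> x /= nex j _; apply: contrapT => nE; apply: nex; have [_ sE _] := HE j.
have sp := contra_not (@sE (Phi x)) nE; exists j.+1%:R => // s s0.
rewrite leNgt; apply/negP => h; apply: sp; exists (Phi x - s)%R, (Phi x + s)%R; split.
  by rewrite in_itv /= ltrDl s0 andbT ltrBlDr ltrDl.
have e1 : (j.+1%:R^-1 * j.+1%:R)%R%:E = 1 :> \bar R by rewrite mulVf.
by rewrite -[X in X < _]mul1e -[X in X * _ < _]e1 EFinM -muleA lte_pmul2l.
Qed.

End ball_comparison.

Lemma image_measureE d d' (T : measurableType d) (U : measurableType d') (R : realType)
  (m : {measure set T -> \bar R}) (f : T -> U) (mf : mfunT f) A :
  image_measure m mf A = m (f @^-1` A).
Proof. by []. Qed.

Lemma integrable_lower_bound d (T : measurableType d) (R : realType)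
    (P : probability T R) (f : T -> R) (c : R) : mfunT f ->
  (forall x, - c <= f x) -> (\int[P]_x (f x)%:E < +oo)%E -> P.-integrable setT (EFin \o f).
Proof.
move=> mf fc foo.
have PT : (P : {measure set T -> \bar R}) setT = 1%E by exact: probability_setT.
have mEf : mfunT (EFin \o f) by exact/measurable_EFinP.
have negoo : (\int[P]_x (EFin \o f)^\- x < +oo)%E.
  apply: (@le_lt_trans _ _ (\int[P]_x (cst (Num.max c 0)%:E) x)%E).
    apply: ge0_le_integral => //; first exact: measurable_funeneg.
    move=> x _; rewrite funenegE /= -[X in maxe X]/((- f x)%:E) -EFin_max lee_fin ge_max !le_max lexx orbT andbT.
    by rewrite lerNl fc.
  by rewrite integral_cst// [X in (_ * X)%E](_ : _ = 1%E)// mule1 ltry.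
have posoo : (\int[P]_x (EFin \o f)^\+ x < +oo)%E.
  rewrite ltey; apply/negP => /eqP pinf; move: foo.
  by rewrite integralE pinf addye ?ltxx// ; apply/eqP => /eqP; rewrite eqe_oppLR /= => /eqP h; rewrite h in negoo.
apply/integrableP; split => //.
rewrite (eq_integral (fun x => (EFin \o f)^\+ x + (EFin \o f)^\- x)%E); last first.
  by move=> x _; rewrite -[LHS]/((abse \o (EFin \o f)) x) fune_abse.
rewrite ge0_integralD//; [|exact: measurable_funepos|exact: measurable_funeneg].
by rewrite lte_add_pinfty.
Qed.

(** Fubini applied to [integral_merge]. It allows a part of the labels to be redrawn without leaving
    a set of full measure. *)
Lemma ae_merge (R : realType) (I : choiceType) d (Omega : measurableType d)
    (P : probability Omega R) (Pa : probability (product_space I Omega) R)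
    (C : pred I) (rho : I -> I) (A : product_space I Omega -> Prop) : is_product_measure P Pa ->
  (forall u v, ~~ C u -> ~~ C v -> rho u = rho v -> u = v) -> {ae Pa, forall w, A w} ->
  {ae Pa, forall w, {ae Pa, forall w', A (merge C rho (w, w'))}}.
Proof.
move=> hPa rho_inj [N [mN N0 AN]].
have mcst U : measurable U -> mfunT (fun _ : product_space I Omega => Pa U).
  by move=> _; exact: measurable_cst.
have Paoo (w : product_space I Omega) : (Pa setT < +oo)%E by rewrite probability_setT ltry.
have mM : measurable (merge C rho @^-1` N : set (product_space I Omega * product_space I Omega)).
  exact: (measurable_preimage (measurable_merge _ _)).
have H : {ae mprod Pa mcst Paoo, forall p, ~ (merge C rho @^-1` N) p}.
  exists (merge C rho @^-1` N); split => // [|p /=]; last exact: contrapT.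
  have mi : mfunT (fun w => (\1_N w)%:E : \bar R).
    exact: measurable_EFin_indic.
  rewrite -N0 -[X in Pa X](setIT N) -integral_indic// -(integral_merge hPa rho_inj)//.
  apply: eq_integral => w _.
  transitivity (\int[Pa]_w' (\1_(xsection (merge C rho @^-1` N) w) w')%:E)%E.
    by rewrite integral_indic ?setIT//; exact: measurable_xsection.
  apply: eq_integral => w' _; congr EFin; rewrite !indicE; congr (_%:R); congr nat_of_bool.
  by rewrite mem_xsection; apply/idP/idP; rewrite !inE.
have := ae_mprod H; apply: filterS => w; apply: filterS => w' /= nN.
by apply: contrapT => nA; apply: nN; exact: AN.
Qed.

Section scaling.
Context d (T : measurableType d) (R : realType).
Variables (Phi : T -> R) (mPhi : mfunT Phi).

(* Where a ball has mass 0 both logarithms are the junk value 0. *)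
Lemma exact_dimensional_scale (m : {measure set T -> \bar R})
    (m' : {finite_measure set T -> \bar R}) (c D : R) : 0 < c ->
  (forall A, measurable A -> m A = (c%:E * m' A)%E) ->
  {ae image_measure m mPhi, forall z : R, ln (fine (m (Phi @^-1` `](z - rho), (z + rho)[%classic)))
    / ln rho @[rho --> (0 : R)^'+] --> D} -> exact_dimensional (pushforward m' Phi) D.
Proof.
move=> c0 mE [N [mN N0 DN]]; exists N; split => //.
  move: N0; rewrite image_measureE mE; last exact: (measurable_preimage mPhi).
  by move/eqP; rewrite mule_eq0 eqe gt_eqF//= => /eqP.
apply: subset_trans DN => z /=; apply: contra_not => zD.
pose g rho := fine (m' (Phi @^-1` ball z rho)).
pose dl rho : R := if g rho == 0 then 0 else ln c / ln rho.
have dl0 : dl rho @[rho --> (0 : R)^'+] --> (0 : R).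
  have h0 : `|ln c / ln rho| @[rho --> (0 : R)^'+] --> (0 : R).
    by rewrite -[X in _ --> X](normr0 R); apply: cvg_norm; exact: cvg_inv_ln.
  have h0N : - `|ln c / ln rho| @[rho --> (0 : R)^'+] --> (0 : R).
    by rewrite -[X in _ --> X]oppr0; exact: cvgN.
  apply: (squeeze_cvgr _ h0N h0); apply: nearW => rho; rewrite /dl; case: ifP => _.
    by rewrite oppr_le0 normr_ge0.
  by rewrite -ler_norml.
have : ln (fine (m (Phi @^-1` `](z - rho), (z + rho)[%classic))) / ln rho - dl rho
    @[rho --> (0 : R)^'+] --> D - 0 by exact: cvgB zD dl0.
rewrite subr0; apply: cvg_trans; apply: near_eq_cvg; apply: nearW => rho /=.
have mB : measurable (Phi @^-1` ball z rho).
  by rewrite ball_itv -[X in measurable X]setTI; exact: mPhi.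
rewrite -ball_itv mE// /pushforward -/(g rho).
have -> : fine (c%:E * m' (Phi @^-1` ball z rho))%E = c * g rho by rewrite fineM// fin_num_measure.
rewrite /dl; case: eqP => [->|/eqP g0]; first by rewrite mulr0 subr0.
rewrite lnM ?posrE// ?lt_def ?g0 ?fine_ge0// -mulrBl; congr (_ / _).
by rewrite addrAC subrr add0r.
Qed.

End scaling.

(** * Topology and measures of the symbolic space *)

Section symbolic.
Context (R : realType) (a : nat) (ha : (2 <= a)%N).
Local Notation measure_on T := {measure set T -> \bar R}.
Local Notation letter := (letter ha).
Local Notation S := (symbolic nat ha).
Local Notation sshift := (@Defs.shift a ha).

Section symbolic_topology.

Lemma symbolic_cvgP (I : choiceType) (F : set_system (symbolic I ha))
    (x : symbolic I ha) : Filter F -> F --> x <-> forall i, \forall y \near F, y i = x i.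
Proof.
move=> FF.
have := @pointwise_cvgP (discrete_topology I) (discrete_topology letter) F x FF.
rewrite -[{ptws, _ --> _}]/(F --> x) => ->.
split=> H i; have := H i.
  by move/discrete_cvg.
by move=> Fi; apply/discrete_cvg.
Qed.

Lemma open_coordinate (I : choiceType) (i : I) (l : letter) :
  open [set x : symbolic I ha | x i = l].
Proof.
rewrite openE => x /= xil; rewrite /interior.
have /symbolic_cvgP/(_ i) : nbhs x --> x by exact: cvg_id.
by apply: filterS => y /= ->.
Qed.

Lemma prefix_wordP n (x y : S) :
  prefix_word x n = prefix_word y n <-> forall i, (i < n)%N -> x i = y i.
Proof.
split=> [xy i ni|xy].
  have := congr1 (fun s => nth (x i) s i) xy.
  by rewrite !nth_mkseq.
by apply/eq_in_map => i; rewrite mem_iota add0n => /andP[_]; exact: xy.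
Qed.

Lemma size_prefix_word n (x : S) : size (prefix_word x n) = n.
Proof. exact: size_mkseq. Qed.

Lemma prefix_wordS n (x : S) : prefix_word x n.+1 = x 0%N :: prefix_word (sshift x) n.
Proof.
rewrite /prefix_word /mkseq /= -[1%N]addn1 addnC iotaDl -map_comp.
by congr cons; apply: eq_map.
Qed.

Lemma prefix_word_rcons n (x : S) : prefix_word x n.+1 = rcons (prefix_word x n) (x n).
Proof. by rewrite /prefix_word mkseqS. Qed.

Lemma take_prefix_word m n (x : S) : (m <= n)%N -> take m (prefix_word x n) = prefix_word x m.
Proof. by move=> mn; rewrite /prefix_word -map_take take_iota (minn_idPl mn). Qed.

Lemma cylinderP (u : seq letter) (x : S) : cylinder u x <-> prefix_word x (size u) = u.
Proof. by []. Qed.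

Lemma cylinder_prefix (x : S) n : cylinder (prefix_word x n) x.
Proof. by rewrite /cylinder/= size_prefix_word. Qed.

Lemma cylinder_nil : cylinder [::] = [set: S].
Proof. by apply/seteqP; split. Qed.

Lemma cylinder_cons (i : letter) (u : seq letter) :
  cylinder (i :: u) = [set x : S | x 0%N = i] `&` sshift @^-1` cylinder u.
Proof.
apply/seteqP; split => x; rewrite /cylinder /= prefix_wordS.
  by move=> [-> ->].
by move=> [-> ->].
Qed.

Lemma cylinder_rcons (u : seq letter) (i : letter) :
  cylinder (rcons u i) = cylinder u `&` [set x : S | x (size u) = i].
Proof.
apply/seteqP; split => x; rewrite /cylinder /= size_rcons prefix_word_rcons.
  by move/rcons_inj => [-> ->].
by move=> [-> ->].
Qed.

Lemma cylinderI (u v : seq letter) (x : S) : cylinder u x -> cylinder v x ->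
  (size u <= size v)%N -> cylinder u `&` cylinder v = (cylinder v : set S).
Proof.
move=> xu xv uv; apply/seteqP; split => [y [_]//|y yv]; split => //.
rewrite /cylinder /= in xu xv yv *.
by rewrite -(take_prefix_word y uv) yv -xv take_prefix_word.
Qed.

Lemma open_cylinder (u : seq letter) : open (cylinder u : set S).
Proof.
elim/last_ind: u => [|u i ih]; first by rewrite cylinder_nil; exact: openT.
by rewrite cylinder_rcons; apply: openI => //; exact: open_coordinate.
Qed.

Lemma open_cylinder_subset (U : set S) (x : S) : open U -> U x ->
  exists n, cylinder (prefix_word x n) `<=` U.
Proof.
move=> oU Ux.
(* The filter generated by the cylinders around x converges to x in each coordinate, so every
   neighbourhood of x contains a cylinder. *)
pose F := filter_from [set: nat] (fun n => cylinder (prefix_word x n)).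
have FF : Filter F.
  apply: filter_from_filter; first by exists 0%N.
  move=> m n _ _; exists (maxn m n) => // y; rewrite /cylinder /= !size_prefix_word.
  move/prefix_wordP => H; split; apply/prefix_wordP => i im; apply: H.
    by rewrite (leq_trans im)// leq_maxl.
  by rewrite (leq_trans im)// leq_maxr.
have Fx : F --> x.
  apply/symbolic_cvgP => i; exists i.+1 => // y.
  by move=> /cylinderP; rewrite size_prefix_word => /prefix_wordP; exact.
by have [n _ nU] := Fx U (open_nbhs_nbhs (conj oU Ux)); exists n.
Qed.

Definition cylinders : set (set S) := [set A | A = set0 \/ exists u : seq letter, A = cylinder u].

Lemma cylinders_setI : setI_closed cylinders.
Proof.
move=> A B [->|[u ->]]; first by left; rewrite set0I.
move=> [->|[v ->]]; first by left; rewrite setI0.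
have [->|/set0P[x [xu xv]]] := eqVneq (cylinder u `&` cylinder v) set0.
  by left.
right; case/orP: (leq_total (size u) (size v)) => uv.
  by exists v; exact: cylinderI xu xv uv.
by exists u; rewrite setIC; exact: cylinderI xv xu uv.
Qed.

Lemma measurable_cylinder (u : seq letter) : measurable (cylinder u : set S).
Proof. by apply: sub_sigma_algebra; exact: open_cylinder. Qed.

Lemma measurable_coordinate (I : choiceType) (i : I) (l : letter) :
  measurable [set x : symbolic I ha | x i = l].
Proof. by apply: sub_sigma_algebra; exact: open_coordinate. Qed.

(** An open set is the union of the countably many cylinders that it contains. *)
Lemma symbolic_measurableE : (@measurable _ S) = <<s cylinders >>.
Proof.
apply/seteqP; split.
  apply: smallest_sub; first exact: smallest_sigma_algebra.
  move=> U oU.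
  pose E k : set S := if @unpickle (seq letter) k is Some u then
    (if `[< cylinder u `<=` U >] then cylinder u else set0) else set0.
  rewrite (_ : U = \bigcup_k E k).
    apply: sigma_algebra_bigcup => k; apply: sub_sigma_algebra.
    rewrite /E; case: unpickle => [u|]; last by left.
    by case: ifPn => _; [right; exists u|left].
  apply/seteqP; split => x.
    move=> Ux; have [n nU] := open_cylinder_subset oU Ux.
    exists (pickle (prefix_word x n)) => //; rewrite /E pickleK.
    by case: asboolP => // _; exact: cylinder_prefix.
  by move=> [k _]; rewrite /E; case: unpickle => // u; case: asboolP => // uU /uU.
apply: smallest_sub; first exact: sigma_algebra_measurable.
move=> A [->|[u ->]]; first exact: measurable0.
exact: measurable_cylinder.
Qed.

Lemma measurable_fun_symbolic d (T : measurableType d) (f : T -> S) :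
  (forall i l, measurable [set t | f t i = l]) -> mfunT f.
Proof.
move=> mf; apply: (measurability (cylinders)) => [|_ [A [->|[u ->]] <-]].
- exact: symbolic_measurableE.
- by rewrite preimage_set0 setI0.
- rewrite setTI; elim/last_ind: u => [|u i ih].
    by rewrite cylinder_nil preimage_setT.
  by rewrite cylinder_rcons preimage_setI; apply: measurableI => //; exact: mf.
Qed.

Lemma measurable_prefix_fun n d (T : measurableType d) (F : seq letter -> T) :
  mfunT (fun x : S => F (prefix_word x n)).
Proof.
apply: (measurable_fun_case (g := fun x : S => prefix_word x n) (f := fun u _ => F u)) => // u.
have [un|un] := eqVneq (size u) n; first by rewrite -un; exact: measurable_cylinder.
rewrite (_ : _ @^-1` _ = set0)//; apply/seteqP; split => // x /= xu.
by move: un; rewrite -xu size_prefix_word eqxx.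
Qed.

Lemma measurable_shift : mfunT sshift.
Proof.
by apply: measurable_fun_symbolic => i l; exact: measurable_coordinate.
Qed.

Definition scons (i : letter) (x : S) : S := fun n => if n is k.+1 then x k else i.

Lemma measurable_scons i : mfunT (scons i).
Proof.
apply: measurable_fun_symbolic => -[|n] l; last exact: measurable_coordinate.
have [->|il] := eqVneq i l; first by rewrite (_ : [set _ | _] = setT)//; apply/seteqP; split.
rewrite (_ : [set _ | _] = set0)//; apply/seteqP; split => // x /= il'.
by rewrite il' eqxx in il.
Qed.

Lemma scons_shift x : scons (x 0%N) (sshift x) = x.
Proof. by apply/funext => -[|n]. Qed.

Lemma eq_measure_cylinder (m1 m2 : measure_on S) :
  (m1 setT < +oo)%E -> (forall u, m1 (cylinder u) = m2 (cylinder u)) ->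
  forall A, measurable A -> m1 A = m2 A.
Proof.
move=> m1oo m12 A mA.
apply: (measure_unique cylinders (fun=> setT)) => //.
- exact: symbolic_measurableE.
- exact: cylinders_setI.
- by move=> n; right; exists [::]; rewrite cylinder_nil.
- by rewrite bigcup_const.
- by move=> B [->|[u ->]]; rewrite ?measure0.
Qed.

End symbolic_topology.

Section cylinder_measure.
Variable c : seq letter -> R.
Hypothesis c0 : forall u, 0 <= c u.
Hypothesis cS : forall u, c u = \sum_(i : letter) c (rcons u i).

(* The words of length [n] are laid out in lexicographic order as consecutive
   intervals [word_itv u] of length [c u]; the address of a point [s] is the
   sequence of words whose intervals contain [s]. *)
Fixpoint lo_from (p v : seq letter) : R := if v is i :: v' then
  \sum_(j : letter | (j < i)%N) c (rcons p j) + lo_from (rcons p i) v' else 0.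

Definition lo := lo_from [::].

Lemma lo_rcons u i : lo (rcons u i) = lo u + \sum_(j : letter | (j < i)%N) c (rcons u j).
Proof.
rewrite /lo -[X in _ = _ + \sum_(j | _) c (rcons X j)]/([::] ++ u).
elim: u [::] => [|j u ih] p /=; first by rewrite add0r addr0 cats0.
by rewrite ih addrA cat_rcons.
Qed.

Definition word_itv u : set R := `[lo u, (lo u + c u)[%classic.

Lemma word_itv_rcons u i : word_itv (rcons u i) `<=` word_itv u.
Proof.
move=> s; rewrite /word_itv /= !in_itv/= lo_rcons => /andP[s1 s2].
apply/andP; split; first by rewrite (le_trans _ s1)// lerDl sumr_ge0.
rewrite (lt_le_trans s2)// -addrA lerD2l [leRHS]cS.
rewrite [leRHS](bigID (fun j : letter => (j < i)%N))/= lerD2l.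
by rewrite (bigD1 i) ?ltnn//= lerDl sumr_ge0.
Qed.

Lemma word_itv_inj u i j s : word_itv (rcons u i) s -> word_itv (rcons u j) s -> i = j.
Proof.
wlog ij : i j / (i <= j)%N.
  move=> H si sj; case/orP: (leq_total i j) => ij; first exact: H.
  by apply/esym; exact: H.
rewrite /word_itv /= !in_itv/= !lo_rcons => /andP[_ s2] /andP[s1 _].
apply/eqP; rewrite -(inj_eq val_inj) eqn_leq [X in X && _]ij/= leqNgt.
apply/negP => ltij; have := le_lt_trans s1 s2; apply/negP.
rewrite -leNgt -addrA lerD2l [leRHS](bigID (fun k : letter => (k < i)%N))/=; apply: lerD.
  rewrite le_eqVlt; apply/orP; left; apply/eqP; apply: eq_bigl => k.
  by case: (ltnP k i) => ki; rewrite ?andbF// andbT (ltn_trans ki).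
by rewrite (bigD1 i) ?ltnn ?andbT//= lerDl sumr_ge0.
Qed.

Lemma word_itv_ex u s : word_itv u s -> exists i, word_itv (rcons u i) s.
Proof.
rewrite /word_itv /= in_itv/= => /andP[s1 s2].
pose f m := \sum_(j : letter | (j < m)%N) c (rcons u j).
have fa : f a = c u.
  by rewrite cS; apply: eq_bigl => j; exact: (ltn_ord (j : 'I_a)).
(* The letter sought is the largest m for which the first m subintervals end at or before s. *)
pose Q m := (m <= a)%N && (lo u + f m <= s).
have Q0 : exists m, Q m.
  by exists 0%N; rewrite /Q /f big_pred0// addr0 s1.
have Qa m : Q m -> (m <= a)%N by case/andP.
case: (ex_maxnP Q0 Qa) => m /andP[ma ms] mmax.
have {}ma : (m < a)%N.
  rewrite ltn_neqAle ma andbT; apply/eqP => mE; move: ms.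
  by rewrite mE fa leNgt s2.
exists (Ordinal ma : letter); rewrite lo_rcons in_itv/= ms/=.
rewrite ltNge; apply/negP => H; have : Q m.+1.
  rewrite /Q ma/= (le_trans _ H)// -addrA lerD2l /f.
  rewrite (bigD1 (Ordinal ma : letter))/=; last exact: ltnSn.
  rewrite addrC lerD2r le_eqVlt; apply/orP; left; apply/eqP; apply: eq_bigl => j.
  by rewrite ltnS (ltn_neqAle j m) -(inj_eq val_inj) andbC.
by move/mmax; rewrite ltnn.
Qed.

(** By [word_itv_ex] the default letter can occur only for s outside [word_itv u]. *)
Definition digit (u : seq letter) s : letter :=
  odflt point [pick i : letter | `[< word_itv (rcons u i) s >]].

Fixpoint address_word s n : seq letter := if n is k.+1 then
  rcons (address_word s k) (digit (address_word s k) s) else [::].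

Definition address s : S := if `[< word_itv [::] s >]
  then (fun n => digit (address_word s n) s) else point.

Lemma address_wordE s n : word_itv [::] s -> prefix_word (address s) n = address_word s n.
Proof.
move=> s0; rewrite /address asboolT//.
elim: n => [|n ih] //; by rewrite prefix_word_rcons ih.
Qed.

Lemma word_itv_address_word s n : word_itv [::] s -> word_itv (address_word s n) s.
Proof.
move=> s0; elim: n => [|n ih] //=; rewrite /digit.
case: pickP => [i /asboolP//|nH].
by have [i /asboolP] := word_itv_ex ih; rewrite nH.
Qed.

Lemma word_itv_cylinder u s : word_itv u s <-> word_itv [::] s /\ cylinder u (address s).
Proof.
split.
  elim/last_ind: u => [//|u i ih] sui.
  have [s0 cu] := ih (word_itv_rcons sui); split => //.
  rewrite cylinder_rcons; split => //=.
  move/cylinderP: cu; rewrite address_wordE// => cu.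
  have := word_itv_address_word (size u).+1 s0; rewrite /= cu => H.
  rewrite /address asboolT// cu; exact: word_itv_inj H sui.
move=> [s0 /cylinderP]; rewrite address_wordE// => <-.
exact: word_itv_address_word.
Qed.

Lemma measurable_address : mfunT address.
Proof.
apply: (measurability (@cylinders)) => [|_ [A [->|[u ->]] <-]].
- exact: symbolic_measurableE.
- by rewrite preimage_set0 setI0.
rewrite setTI (_ : _ @^-1` _ = word_itv u `|` (~` word_itv [::] `&`
    (if `[< cylinder u (point : S) >] then setT else set0))).
  apply: measurableU; first exact: measurable_itv.
  apply: measurableI; first by apply: measurableC; exact: measurable_itv.
  by case: ifP.
apply/seteqP; split => s.
  move=> /= cu; have [s0|s0] := pselect (word_itv [::] s).
    by left; apply/word_itv_cylinder.
  right; split => //; move: cu; rewrite /address asboolF//.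
  by move=> cu; rewrite asboolT.
move=> [/word_itv_cylinder[]//|[s0]].
case: asboolP => // cp _; by rewrite /= /address asboolF.
Qed.

(** Kolmogorov extension realised as the image under [address] of Lebesgue measure on [word_itv
    [::]]: the preimage of a cylinder is the interval of its word. *)
Lemma cylinder_measure_exists : exists m : {finite_measure set S -> \bar R},
  forall u, m (cylinder u) = (c u)%:E.
Proof.
have mI : measurable (word_itv [::]) by exact: measurable_itv.
pose m0 := pushforward (mrestr (@lebesgue_measure R) mI) address.
have m0E u : m0 (cylinder u) = (c u)%:E.
  rewrite /m0 /pushforward /mrestr (_ : _ `&` _ = word_itv u); last first.
    apply/seteqP; split => s.
      by move=> [cu s0]; apply/word_itv_cylinder.
    by move/word_itv_cylinder => [].
  rewrite /word_itv lebesgue_measure_itv/= lte_fin ltrDl.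
  by have [cu|cu] := ltP 0 (c u); [rewrite -EFinB addrAC subrr add0r|
    congr EFin; apply/eqP; rewrite eq_le c0 cu].
pose m1 := image_measure (mrestr (@lebesgue_measure R) mI) measurable_address.
have m1oo : (m1 setT < +oo)%E by rewrite -cylinder_nil [X in (X < _)%E]m0E ltry.
by exists (finite_measure_of m1oo) => u; exact: m0E.
Qed.

End cylinder_measure.

(** * Weak convergence tested on cylinders *)

Section weak_convergence.

Definition extend_word (u : seq letter) : S := fun i => nth point u i.

Lemma extend_wordK (u : seq letter) : prefix_word (extend_word u) (size u) = u.
Proof. by rewrite /prefix_word mkseq_nth. Qed.

Lemma prefix_extend_word n (x : S) :
  prefix_word (extend_word (prefix_word x n)) n = prefix_word x n.
Proof. by have := extend_wordK (prefix_word x n); rewrite size_prefix_word. Qed.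

Lemma prefix_fun_sum (F : seq letter -> R) n (x : S) :
  F (prefix_word x n) = \sum_(u : n.-tuple letter) F u * \1_(cylinder u) x.
Proof.
have sz : size (prefix_word x n) == n by rewrite size_prefix_word.
rewrite (bigD1 (Tuple sz))//= indicE mem_set; last exact: cylinder_prefix.
rewrite mulr1 big1 ?addr0// => u /eqP ux; rewrite indicE memNset ?mulr0//.
move=> /cylinderP; rewrite size_tuple => xu; apply: ux; exact/val_inj.
Qed.

Lemma continuous_prefix_fun (F : seq letter -> R) n : continuous (fun x : S => F (prefix_word x n)).
Proof.
apply/continuousP => A _; rewrite openE => x Ax; rewrite /interior.
have : \forall y \near x, cylinder (prefix_word x n) y.
  apply: open_nbhs_nbhs; split; [exact: open_cylinder|exact: cylinder_prefix].
by apply: filterS => y /cylinderP; rewrite size_prefix_word /preimage/= => ->.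
Qed.

Lemma indic_cylinderE (u : seq letter) (x : S) :
  \1_(cylinder u) x = (prefix_word x (size u) == u)%:R :> R.
Proof.
rewrite indicE; congr (_%:R); congr nat_of_bool; apply/idP/eqP; rewrite inE//.
Qed.

Lemma continuous_indic_cylinder (u : seq letter) : continuous (\1_(cylinder u) : S -> R).
Proof.
have := @continuous_prefix_fun (fun v => (v == u)%:R) (size u).
by rewrite (_ : (fun x => _) = \1_(cylinder u))//; apply/funext => x; rewrite indic_cylinderE.
Qed.

Lemma measurable_prefix_real (F : seq letter -> R) n : mfunT (fun x : S => F (prefix_word x n)).
Proof. exact: measurable_prefix_fun. Qed.

Lemma prefix_fun_bounded (F : seq letter -> R) n :
  exists C, forall x : S, `|F (prefix_word x n)| <= C.
Proof.
exists (\sum_(u : n.-tuple letter) `|F u|) => x.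
rewrite prefix_fun_sum (le_trans (ler_norm_sum _ _ _))//.
apply: ler_sum => u _; rewrite normrM ler_piMr// indicE.
by case: (_ \in _); rewrite ?normr1 ?normr0.
Qed.

(** Compactness in the form of a tree argument: if no n works on a cylinder, none works on one of
    its subcylinders, and the infinite word selected in this way contradicts continuity there. *)
Lemma continuous_unif_prefix (f : S -> R) (e : R) : continuous f -> 0 < e ->
  exists n, forall x y, prefix_word x n = prefix_word y n -> `|f x - f y| <= e.
Proof.
move=> cf e0; pose Bad (u : seq letter) := forall n, exists x y : S,
  [/\ cylinder u x, cylinder u y, prefix_word x n = prefix_word y n & e < `|f x - f y|].
apply: contrapT => nf.
have B0 : Bad [::].
  move=> n; apply: contrapT => nB; apply: nf; exists n => x y xy.
  rewrite leNgt; apply/negP => ef; apply: nB; exists x, y.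
  by split => //; rewrite cylinder_nil.
have BS u : exists i, Bad u -> Bad (rcons u i).
  have [Bu|] := pselect (Bad u); last by exists point.
  apply: contrapT => nB.
  have /choice[N HN] : forall i : letter, exists n, forall x y : S,
      cylinder (rcons u i) x -> cylinder (rcons u i) y ->
      prefix_word x n = prefix_word y n -> `|f x - f y| <= e.
    move=> i; apply: contrapT => ni; apply: nB; exists i => _ n.
    apply: contrapT => nn; apply: ni; exists n => x y xu yu xy.
    by rewrite leNgt; apply/negP => ef; apply: nn; exists x, y.
  (* At this length x and y share the letter that follows u, and they agree far enough for the
     modulus of that subcylinder. *)
  have [x [y [xu yu xy ef]]] := Bu (\sum_i N i + (size u).+1)%N.
  have le_xy m : (m <= \sum_i N i + (size u).+1)%N -> prefix_word x m = prefix_word y m.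
    by move=> mle; rewrite -(take_prefix_word x mle) xy take_prefix_word.
  move: ef; apply/negP; rewrite -leNgt; apply: (HN (x (size u))).
  - by rewrite cylinder_rcons; split.
  - rewrite cylinder_rcons; split => //=; have /prefix_wordP : prefix_word x (size u).+1 =
      prefix_word y (size u).+1 by apply: le_xy; rewrite leq_addl.
    by move=> ->.
  - apply: le_xy; rewrite (leq_trans _ (leq_addr _ _))//.
    by rewrite (bigD1 (x (size u)))//= leq_addr.
have /choice[g Hg] := BS.
pose W := fix W n : seq letter := if n is k.+1 then rcons (W k) (g (W k)) else [::].
have BW n : Bad (W n) by elim: n => //= n; exact: Hg.
pose z : S := fun n => g (W n).
have zW n : prefix_word z n = W n.
  by elim: n => // n ih; rewrite prefix_word_rcons ih.
have e2 : 0 < e / 2 by rewrite divr_gt0.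
have oU : open (f @^-1` ball (f z) (e / 2)).
  by apply: open_comp => [x _|]; [exact: cf|exact: ball_open].
have [n nU] := open_cylinder_subset oU (ballxx (f z) e2).
have [x [y [xu yu _ ef]]] := BW n n.
rewrite -zW in xu yu.
have /= := nU _ xu; have /= := nU _ yu; rewrite /ball/= => h1 h2.
move: ef; apply/negP; rewrite -leNgt -(subrKA (f z)) (le_trans (ler_normD _ _))//.
by rewrite (distrC (f x)); lra.
Qed.

Section density.
Variables (lam : measure_on S) (m : measure_on S).
Variables (F : nat -> seq letter -> R).
Hypothesis lamoo : (lam setT < +oo)%E.
Hypothesis moo : (m setT < +oo)%E.
Hypothesis F0 : forall k u, 0 <= F k u.

Let D k (x : S) := F k (prefix_word x k).

Lemma measurable_continuous_symbolic (f : S -> R) : continuous f -> mfunT f.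
Proof.
move=> cf.
have /choice[N HN] : forall k : nat, exists n, forall x y,
    prefix_word x n = prefix_word y n -> `|f x - f y| <= k.+1%:R^-1.
  by move=> k; apply: continuous_unif_prefix.
have mh k : mfunT (fun x => f (extend_word (prefix_word x (N k)))).
  exact: (measurable_prefix_real (fun u => f (extend_word u))).
apply: (measurable_fun_cvg mh) => x _; apply/cvgrPdist_le => e e0; near=> k.
apply: (@le_trans _ _ k.+1%:R^-1); first by apply: HN; rewrite prefix_extend_word.
by apply: ltW; near: k; exact: (near_infty_natSinv_lt (PosNum e0)).
Unshelve. all: by end_near. Qed.

Let integrable_fD (f : S -> R) k : continuous f ->
  lam.-integrable setT (EFin \o (fun x => f x * D k x)).
Proof.
move=> cf; have mf := measurable_continuous_symbolic cf; have [n Hn] := continuous_unif_prefix cf (@ltr01 R).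
have [C HC] := prefix_fun_bounded (F k) k.
have [C' HC'] := prefix_fun_bounded (f \o extend_word) n.
apply: (@integrable_bounded _ _ _ _ _ ((C' + 1) * C)) => //.
  by apply: measurable_funM => //; exact: measurable_prefix_real.
move=> x; rewrite normrM ler_pM//.
have /Hn : prefix_word x n = prefix_word (extend_word (prefix_word x n)) n.
  by rewrite prefix_extend_word.
have := HC' x => /= h1 h2; rewrite -[f x](subrK (f (extend_word (prefix_word x n)))).
by rewrite (le_trans (ler_normD _ _))// addrC lerD.
exact: HC.
Qed.

(** A continuous function is uniformly close to a function of a prefix, which is a finite
    combination of indicators of cylinders. *)
Lemma weak_cvg_cylinder : (forall f : S -> R, continuous f ->
    (\int[lam]_x (f x * D k x)%:E)%E @[k --> \oo] --> (\int[m]_x (f x)%:E)%E) <->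
  (forall u, (\int[lam]_(x in cylinder u) (D k x)%:E)%E @[k --> \oo] --> m (cylinder u)).
Proof.
have indE (m' : measure_on S) g u :
    (\int[m']_x (\1_(cylinder u) x * g x)%:E = \int[m']_(x in cylinder u) (g x)%:E)%E.
  rewrite [RHS]integral_mkcond; apply: eq_integral => x _.
  by rewrite patchE indicE; case: (_ \in _); rewrite ?mul1r ?mul0r.
split=> [H u|H f cf].
  have := H _ (@continuous_indic_cylinder u); under eq_fun do rewrite indE.
  by rewrite integral_indic ?setIT//; exact: measurable_cylinder.
have mf := measurable_continuous_symbolic cf.
have HT : (\int[lam]_x (D k x)%:E)%E @[k --> \oo] --> m setT.
  by rewrite -cylinder_nil; exact: H.
pose I k (g : S -> R) := \int[lam]_x (g x * D k x).
pose J (g : S -> R) := \int[m]_x g x.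
have im (g : S -> R) : continuous g -> m.-integrable setT (EFin \o g).
  move=> cg; have [n Hn] := continuous_unif_prefix cg (@ltr01 R).
  have [C HC] := prefix_fun_bounded (g \o extend_word) n.
  apply: (@integrable_bounded _ _ _ _ _ (C + 1)) => //.
    exact: measurable_continuous_symbolic.
  move=> x; rewrite -[g x](subrK (g (extend_word (prefix_word x n)))).
  rewrite (le_trans (ler_normD _ _))// addrC lerD//; first exact: HC.
  by apply: Hn; rewrite prefix_extend_word.
have IE k (g : S -> R) : continuous g -> (\int[lam]_x (g x * D k x)%:E)%E = (I k g)%:E.
  by move=> cg; rewrite /I /Rintegral fineK//; exact: integrable_fin_num (integrable_fD _ cg).
have JE (g : S -> R) : continuous g -> (\int[m]_x (g x)%:E)%E = (J g)%:E.
  by move=> cg; rewrite /J /Rintegral fineK//; exact: integrable_fin_num (im _ cg).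
suff IJ : I k f @[k --> \oo] --> J f.
  rewrite JE//; under eq_fun do rewrite IE//.
  by apply: cvg_EFin; [near=> k|exact: IJ].
have IJ1 u : I k \1_(cylinder u) @[k --> \oo] --> J \1_(cylinder u).
  have c1 := @continuous_indic_cylinder u.
  have := H u.
  have -> : m (cylinder u) = (\int[m]_x (\1_(cylinder u) x)%:E)%E.
    by rewrite integral_indic ?setIT//; exact: measurable_cylinder.
  rewrite JE//; under eq_fun do rewrite -indE IE//.
  by move/fine_cvg.
have c1 : continuous (cst 1 : S -> R).
  exact: (@continuous_prefix_fun (fun=> 1) 0).
have I1 : I k (cst 1) @[k --> \oo] --> J (cst 1).
  have := IJ1 [::]; rewrite (_ : \1_(cylinder [::]) = cst 1)//.
  by apply/funext => x; rewrite cylinder_nil indicT.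
have I10 k : 0 <= I k (cst 1).
  by apply: Rintegral_ge0 => x _; rewrite mul1r; exact: F0.
have J10 : 0 <= J (cst 1) by exact: Rintegral_ge0.
apply/cvgrPdist_le => e e0.
(* As [I k (cst 1)] is eventually at most [J (cst 1) + 1], each replacement of f by g costs at most
   e / 3. *)
pose e' := e / (3 * (J (cst 1) + 1)).
have e'0 : 0 < e' by rewrite divr_gt0// mulr_gt0// ltr_wpDl.
have [n Hn] := continuous_unif_prefix cf e'0.
pose g (x : S) := f (extend_word (prefix_word x n)).
have cg : continuous g by exact: (@continuous_prefix_fun (f \o extend_word)).
have fg x : `|f x - g x| <= e' by apply: Hn; rewrite prefix_extend_word.
have gE x : g x = \sum_(u : n.-tuple letter) f (extend_word u) * \1_(cylinder u) x.
  exact: (@prefix_fun_sum (f \o extend_word)).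
have Ifg k : `|I k f - I k g| <= e' * I k (cst 1).
  rewrite /I -RintegralB//; try exact: integrable_fD.
  rewrite -RintegralZl//; last exact: (integrable_fD k c1).
  apply: (le_trans (le_normr_Rintegral _ _)) => //.
    apply: (integrableB _ (integrable_fD k cf) (integrable_fD k cg)) => //.
  apply: le_Rintegral => //.
  - exact: (integrable_norm (integrableB measurableT (integrable_fD k cf) (integrable_fD k cg))).
  - exact: (integrableZl _ e' (integrable_fD k c1)).
  - move=> x _; rewrite -mulrBl normrM mul1r ler_pM//.
    by rewrite ger0_norm//; exact: F0.
have Jfg : `|J f - J g| <= e' * J (cst 1).
  rewrite /J -RintegralB//; try exact: im.
  rewrite -RintegralZl//; last exact: (im _ c1).
  apply: (le_trans (le_normr_Rintegral _ _)) => //.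
    apply: (integrableB _ (im _ cf) (im _ cg)) => //.
  apply: le_Rintegral => //.
  - exact: (integrable_norm (integrableB measurableT (im _ cf) (im _ cg))).
  - exact: (integrableZl _ e' (im _ c1)).
  - by move=> x _; rewrite mulr1; exact: fg.
have Igg k : I k g = \sum_(u : n.-tuple letter) f (extend_word u) * I k \1_(cylinder u).
  have i1 (u : n.-tuple letter) := integrable_fD k (@continuous_indic_cylinder u).
  rewrite /I; under eq_Rintegral do rewrite gE mulr_suml.
  rewrite Rintegral_sum.
    apply: eq_bigr => u _; rewrite -RintegralZl//.
    by apply: eq_Rintegral => x _; rewrite mulrA.
  move=> u; have := integrableZl measurableT (f (extend_word u)) (i1 u).
  by apply: eq_integrable => // x _; rewrite /= -EFinM mulrA.
have Jgg : J g = \sum_(u : n.-tuple letter) f (extend_word u) * J \1_(cylinder u).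
  have i1 (u : n.-tuple letter) := im _ (@continuous_indic_cylinder u).
  rewrite /J; under eq_Rintegral do rewrite gE.
  rewrite Rintegral_sum.
    by apply: eq_bigr => u _; rewrite -RintegralZl.
  by move=> u; exact: (integrableZl measurableT (f (extend_word u)) (i1 u)).
have Ig : I k g @[k --> \oo] --> J g.
  rewrite Jgg; under eq_fun do rewrite Igg.
  by apply: cvg_sum_seq => u; apply: cvgMr; exact: IJ1.
have e3 : 0 < e / 3 by rewrite divr_gt0.
move/cvgrPdist_le: Ig => /(_ _ e3); move/cvgrPdist_le: I1 => /(_ _ ltr01).
apply: filterS2 => k h1 h2.
have h3 : I k (cst 1) <= J (cst 1) + 1.
  by move: h1; rewrite ler_norml => /andP[h1 _]; lra.
have h4 : e' * (J (cst 1) + 1) = e / 3.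
  by rewrite /e' invfM mulrA -mulrA mulVf ?mulr1// gt_eqF// ltr_wpDl.
have h5 : e' * I k (cst 1) <= e / 3 by rewrite -h4 ler_wpM2l// ltW.
have h6 : e' * J (cst 1) <= e / 3 by rewrite -h4 ler_wpM2l ?(ltW e'0)// lerDl.
have := Ifg k; move: h2 Jfg; rewrite !ler_norml.
move: (I k f) (I k g) (J f) (J g) (e' * I k (cst 1)) (e' * J (cst 1)) h5 h6 => x1 x2 x3 x4 x5 x6.
move=> h5 h6 /andP[? ?] /andP[? ?] /andP[? ?]; apply/andP; split; lra.
Unshelve. all: by end_near. Qed.

End density.
End weak_convergence.

Section symbolic_product.
Context d (Y : measurableType d).
Local Open Scope ereal_scope.

Lemma eq_measure_cylinderX (m1 m2 : measure_on (S * Y)) : m1 setT < +oo ->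
  (forall v C, measurable C -> m1 (cylinder v `*` C) = m2 (cylinder v `*` C)) ->
  forall E, measurable E -> m1 E = m2 E.
Proof.
move=> m1oo H; apply: eq_measure_rectangle => // B C mB mC.
have mSC : measurable ([set: S] `*` C) by exact: measurableX.
have mf : mfunT (fst : S * Y -> S) by exact: measurable_fst.
pose n (m : measure_on (S * Y)) := image_measure (mrestr m mSC) mf.
have nE (m : measure_on (S * Y)) D : m (D `*` C) = n m D.
  rewrite /n /= /pushforward /mrestr; congr (m _); apply/seteqP; split => -[x y] /=.
    by move=> [].
  by move=> [? []].
rewrite !nE; apply: eq_measure_cylinder => // [|v]; last by rewrite -!nE H.
by rewrite -nE (le_lt_trans _ m1oo)// le_measure ?inE//; exact: measurableX.
Qed.

Lemma integral_letter (m : measure_on S) (f : letter -> \bar R) :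
  (forall i, 0 <= f i) -> \int[m]_x f (x 0%N) = \sum_i f i * m (cylinder [:: i]).
Proof.
move=> f0.
have mi i : mfunT (fun x => (\1_(cylinder [:: i] : set S) x)%:E : \bar R).
  by apply: measurable_EFin_indic; exact: measurable_cylinder.
rewrite (eq_integral (fun x : S => \sum_i f i * (\1_(cylinder [:: i]) x)%:E)).
  rewrite ge0_integral_sum//; last by move=> i x _; rewrite mule_ge0// lee_fin.
    apply: eq_bigr => i _; rewrite ge0_integralZl// integral_indic ?setIT//.
    exact: measurable_cylinder.
  by move=> i; exact: measurable_funeM.
move=> x _; rewrite (bigD1 (x 0%N))//= indicE mem_set//= mule1 big1 ?adde0// => i /eqP ix.
rewrite indicE memNset ?mule0// => /cylinderP /= [xi].
by apply: ix; rewrite -xi.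
Qed.

Lemma measure_cylinder1 (m : measure_on S) A : measurable A ->
  m A = \sum_(i : letter) m (cylinder [:: i] `&` A).
Proof.
move=> mA; have := @integral_letter (mrestr m mA) (fun=> 1) (fun=> lee01).
rewrite integral_cst// mul1e [LHS]/(mrestr _ _ _) setTI => ->.
by apply: eq_bigr => i _; rewrite mul1e.
Qed.

End symbolic_product.

(** * Masses of cascades on cylinders *)

Section cascade_mass.
Context d (Omega : measurableType d).
Local Notation W := (product_space (seq letter) Omega).
Variable V : Omega -> R.
Hypothesis V0 : forall w, 0 <= V w.

(** The cascade density at level k read off a word; the word may be longer than k, which allows
    masses of different levels to be written as sums over the same words. *)
Definition weight (w : W) k (v : seq letter) : R := \prod_(j < k) V (w (take j.+1 v)).

Lemma weight_ge0 w k v : 0 <= weight w k v.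
Proof. by apply: prodr_ge0 => j _. Qed.

Lemma cascade_densityE k (w : W) (x : S) : cascade_density V k w x = weight w k (prefix_word x k).
Proof.
by apply: eq_bigr => j _; rewrite take_prefix_word.
Qed.

Lemma measurable_cascade_density k w : mfunT (fun x : S => cascade_density V k w x).
Proof.
under eq_fun do rewrite cascade_densityE; exact: measurable_prefix_real.
Qed.

Lemma cascade_density_ge0 k (w : W) (x : S) : 0 <= cascade_density V k w x.
Proof. by rewrite cascade_densityE weight_ge0. Qed.

Local Open Scope ereal_scope.

Definition mass (lam : measure_on S) k (w : W) (u : seq letter) : \bar R :=
  \int[lam]_(x in cylinder u) (cascade_density V k w x)%:E.

Lemma mass_ge0 lam k w u : 0 <= mass lam k w u.
Proof.
by apply: integral_ge0 => x _; rewrite lee_fin cascade_density_ge0.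
Qed.

Lemma massE_ge lam k n w u : (k <= n)%N -> mass lam k w u =
  \sum_(v : n.-tuple letter) (weight w k v)%:E * lam (cylinder u `&` cylinder v).
Proof.
move=> kn; have mu := @measurable_cylinder u.
rewrite /mass (eq_integral (fun x : S => \sum_(v : n.-tuple letter)
    (weight w k v)%:E * (\1_(cylinder v) x)%:E)); last first.
  move=> x _; rewrite cascade_densityE.
  have -> : weight w k (prefix_word x k) = weight w k (prefix_word x n).
    apply: eq_bigr => j _; rewrite !take_prefix_word//.
    by rewrite (leq_trans _ kn).
  rewrite (prefix_fun_sum (weight w k)) -sumEFin.
  by apply: eq_bigr => v _; rewrite EFinM.
have mi v : measurable_fun (cylinder u) (fun x => (\1_(cylinder v : set S) x)%:E : \bar R).
  apply/measurable_EFinP; apply: measurable_funTS; apply: measurable_indic.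
  exact: measurable_cylinder.
rewrite ge0_integral_sum//.
- apply: eq_bigr => v _; rewrite ge0_integralZl//; last by rewrite lee_fin weight_ge0.
  by rewrite integral_indic// 1?setIC//; exact: measurable_cylinder.
- by move=> v; exact: measurable_funeM.
- by move=> v x _; rewrite mule_ge0// lee_fin// weight_ge0.
Qed.

Lemma massE lam k w u : mass lam k w u =
  \sum_(v : k.-tuple letter) (weight w k v)%:E * lam (cylinder u `&` cylinder v).
Proof. exact: massE_ge. Qed.

Lemma mass0 lam w u : mass lam 0 w u = lam (cylinder u).
Proof.
rewrite /mass (eq_integral (cst 1)); last by move=> x _; rewrite /cascade_density big_ord0.
by rewrite integral_cst ?mul1e//; exact: measurable_cylinder.
Qed.

Section finite.
Variable lam : measure_on S.
Hypothesis lamoo : lam setT < +oo.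

Lemma mass_fin k w u : mass lam k w u \is a fin_num.
Proof.
rewrite massE; apply/sum_fin_numP => v _ _; rewrite fin_numM//.
apply: fin_num_of_lty => //; apply: measurableI; exact: measurable_cylinder.
Qed.

Lemma cylinder_split (m : measure_on S) (u : seq letter) A : measurable A ->
  m (cylinder u `&` A) = \sum_i m (cylinder (rcons u i) `&` A).
Proof.
move=> mA; have mi v : measurable_fun A (fun x => (\1_(cylinder v : set S) x)%:E : \bar R).
  apply/measurable_EFinP; apply: measurable_funTS; apply: measurable_indic.
  exact: measurable_cylinder.
have mE v : m (cylinder v `&` A) = \int[m]_(x in A) (\1_(cylinder v) x)%:E.
  by rewrite integral_indic//; exact: measurable_cylinder.
rewrite mE (eq_integral (fun x : S => \sum_i (\1_(cylinder (rcons u i)) x)%:E)).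
  by rewrite ge0_integral_sum//; apply: eq_bigr => i _; rewrite mE.
move=> x _; rewrite (bigD1 (x (size u)))//= [X in _ + X]big1 => [|i /eqP ix].
  rewrite adde0 !indicE; congr (_%:R%:E); congr nat_of_bool; apply/idP/idP.
    by rewrite !inE cylinder_rcons => ?.
  by rewrite !inE cylinder_rcons => -[].
rewrite indicE memNset// cylinder_rcons => -[_ /= xi]; by apply: ix.
Qed.

Lemma mass_rcons k w u : mass lam k w u = \sum_i mass lam k w (rcons u i).
Proof.
under eq_bigr do rewrite massE; rewrite massE exchange_big/=; apply: eq_bigr => v _.
rewrite -ge0_sume_distrr//; congr (_ * _).
by apply: cylinder_split; exact: measurable_cylinder.
Qed.

Lemma is_cascadeP w m : is_cascade V lam w m <->
  forall u, mass lam k w u @[k --> \oo] --> m (cylinder u).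
Proof.
have := @weak_cvg_cylinder lam m (weight w) lamoo (fin_num_fun_lty (fin_num_measure m)) (weight_ge0 w).
have E1 (f : S -> R) : (fun k => \int[lam]_x (f x * cascade_density V k w x)%:E) =
    (fun k => \int[lam]_x (f x * weight w k (prefix_word x k))%:E).
  by apply/funext => k; apply: eq_integral => x _; rewrite cascade_densityE.
have E2 u : (fun k => mass lam k w u) =
    (fun k => \int[lam]_(x in cylinder u) (weight w k (prefix_word x k))%:E).
  by apply/funext => k; apply: eq_integral => x _; rewrite cascade_densityE.
move=> [h1 h2]; split.
  by move=> H u; rewrite E2; apply: h1 => f cf; rewrite -E1; exact: H.
by move=> H f cf; rewrite E1; apply: h2 => // u; rewrite -E2; exact: H.
Qed.

Definition mass_cvg w := forall u, cvgn (fun k => fine (mass lam k w u)).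

(** The limits on cylinders are nonnegative and additive, so they are the values of a measure. *)
Lemma mass_cvgP w : mass_cvg w <-> exists m, is_cascade V lam w m.
Proof.
split=> [cw|[m /is_cascadeP H] u]; last first.
  have := H u; rewrite -(@fineK _ (m _)); last exact: fin_num_measure (measurable_cylinder u).
  by move/fine_cvg => h; apply/cvg_ex; exists (fine (m (cylinder u))).
pose c u := limn (fun k => fine (mass lam k w u)).
have cc u : (fun k => fine (mass lam k w u)) @ \oo --> c u by exact: cw.
have [m Hm] : exists m : {finite_measure set S -> \bar R}, forall u, m (cylinder u) = (c u)%:E.
  apply: cylinder_measure_exists => u.
    apply: limr_ge; first exact: cw.
    by apply: nearW => k; rewrite fine_ge0// mass_ge0.
  apply: cvg_lim => //.
  rewrite (_ : (fun k => _) = (fun k => (\sum_i fine (mass lam k w (rcons u i)))%R)).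
    by apply: cvg_sum_seq => i; exact: cc.
  apply/funext => k; rewrite mass_rcons -sum_fine//= => i _; exact: mass_fin.
exists m; apply/is_cascadeP => u; rewrite Hm.
apply: cvg_EFin; last exact: cc.
by apply: nearW => k; exact: mass_fin.
Qed.

Lemma cascade_cylinder w u : mass_cvg w ->
  mass lam k w u @[k --> \oo] --> cascade V lam w (cylinder u).
Proof.
move=> /mass_cvgP h; rewrite /cascade; case: pselect => // h'.
by have /is_cascadeP := projT2 (cid h'); exact.
Qed.

(** The cascade is obtained by choice; this explicit formula is what gives its measurability in the
    tree. *)
Lemma cascade_cylinderE w u : cascade V lam w (cylinder u) =
  if `[< mass_cvg w >] then (limn (fun k => fine (mass lam k w u)))%:E else 0.
Proof.
case: asboolP => cw.
  have := @cascade_cylinder w u cw.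
  rewrite -(@fineK _ (cascade V lam w _)); last exact: fin_num_measure (measurable_cylinder u).
  by move/fine_cvg => h; congr EFin; symmetry; exact/cvg_lim.
by rewrite /cascade; case: pselect => // h; case: cw; exact/mass_cvgP.
Qed.

End finite.
End cascade_mass.

(** * Almost sure convergence and measurability of cascades *)

Section measurable_kernel_cylinder.
Context d (T : measurableType d).
Variable K : T -> measure_on S.
Local Open Scope ereal_scope.

Lemma measurable_kernel_cylinder : (forall t, K t setT < +oo) ->
  (forall u, mfunT (fun t => K t (cylinder u))) -> forall A, measurable A -> mfunT (K ^~ A).
Proof.
move=> Koo mK A; rewrite symbolic_measurableE => GA.
pose H : set (set S) := [set A | measurable A /\ mfunT (K ^~ A)].
suff [] : H A by [].
have H0 : H setT by split => //; rewrite -cylinder_nil; exact: mK.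
apply: (lambda_system_subset (@cylinders_setI) (D := setT)) GA => //.
- split => //.
  + move=> B C CB [mB fB] [mC fC]; split; first exact: measurableD.
    rewrite (_ : (fun t => _) = (fun t => K t B - K t C)).
      exact: emeasurable_funB.
    apply/funext => t; rewrite measureD//.
      by rewrite setIidr.
    by rewrite (le_lt_trans _ (Koo t))// le_measure ?inE.
  + move=> F ndF HF; split.
      by apply: bigcup_measurable => n _; case: (HF n).
    have cK t : (fun n => K t (F n)) @ \oo --> K t (\bigcup_n F n).
      apply: nondecreasing_cvg_mu => //; first by move=> n; case: (HF n).
      by apply: bigcup_measurable => n _; case: (HF n).
    have mF n : mfunT (fun t => K t (F n)) by case: (HF n).
    exact: (emeasurable_fun_cvg _ _ mF (fun t _ => cK t)).
- move=> B [->|[u ->]].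
    split => //; rewrite (_ : (fun t => _) = cst 0)//.
    by apply/funext => t; rewrite measure0.
  by split => //; exact: measurable_cylinder.
Qed.

End measurable_kernel_cylinder.

Section cascade_kernel.
Context d (Omega : measurableType d).
Local Notation W := (product_space (seq letter) Omega).
Variables (P : probability Omega R) (Pa : probability W R).
Hypothesis hPa : is_product_measure P Pa.
Variable V : Omega -> R.
Hypothesis mV : mfunT V.
Hypothesis V0 : forall w, 0 <= V w.
Local Open Scope ereal_scope.
Hypothesis V1 : \int[P]_x (V x)%:E = 1.

Let PaT : (Pa : measure_on W) setT = 1.
Proof. exact: probability_setT. Qed.

Lemma integral_prob_cst (c : \bar R) : \int[Pa]_w c = c.
Proof. by rewrite integral_cst// PaT mule1. Qed.

(** The label at v is redrawn by [merge]: g does not see the change, and h sees only the new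
    label. *)
Lemma integral_indep_coordinate (v : seq letter) (g : W -> \bar R) (h : Omega -> \bar R) :
  (forall w, 0 <= g w) -> mfunT g -> (forall x, 0 <= h x) -> mfunT h ->
  (forall w w' : W, (forall u, u != v -> w u = w' u) -> g w = g w') ->
  \int[Pa]_w (g w * h (w v)) = \int[Pa]_w g w * \int[P]_x h x.
Proof.
move=> g0 mg h0 mh gv.
have mhv : mfunT (fun w : W => h (w v)).
  exact: (measurableT_comp mh (@measurable_eval _ _ _ v)).
rewrite -(integral_merge hPa (C := fun u => u != v) (rho := id))//.
- rewrite -ge0_integralZr//; last by apply: integral_ge0.
  apply: eq_integral => w'' _.
  transitivity (\int[Pa]_w' (g w'' * h (w' v))).
    apply: eq_integral => w' _; rewrite /merge eqxx/=; congr (_ * _).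
    by apply: gv => u /= ->.
  by rewrite ge0_integralZl// (integral_eval hPa).
- by move=> w; rewrite mule_ge0.
- exact: emeasurable_funM.
Qed.

Lemma measurable_V_eval (u : seq letter) : mfunT (fun w : W => V (w u)).
Proof. exact: (measurableT_comp mV (@measurable_eval _ _ _ u)). Qed.

Lemma measurable_weight k v : mfunT (fun w : W => weight V w k v).
Proof.
rewrite /weight; apply: measurable_prod => j _; exact: measurable_V_eval.
Qed.

Section fixed.
Variable lam : measure_on S.
Hypothesis lamoo : lam setT < +oo.

Lemma measurable_mass k u : mfunT (fun w : W => mass V lam k w u).
Proof.
have -> : (fun w : W => mass V lam k w u) = (fun w : W => \sum_(v : k.-tuple letter)
    (weight V w k v)%:E * lam (cylinder u `&` cylinder v)).
  by apply/funext => w; exact: massE.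
apply: emeasurable_sum => v; apply: emeasurable_funM => //.
apply/measurable_EFinP; exact: measurable_weight.
Qed.

(** The natural filtration of the masses, described by invariance under changes of the labels of
    words longer than k. *)
Definition level_sets (k : nat) : set (set W) := [set A | measurable A /\
  forall w w' : W, (forall u, (size u <= k)%N -> w u = w' u) -> A w -> A w'].

(** The martingale property: the new factors, the labels of the words of length k + 1, have mean 1
    and are independent of the shorter words. *)
Lemma integral_mass_succ k u A : level_sets k A ->
  \int[Pa]_(w in A) mass V lam k.+1 w u = \int[Pa]_(w in A) mass V lam k w u.
Proof.
move=> [mA levA].
have mw n v : measurable_fun A (fun w : W => (weight V w n v)%:E : \bar R).
  by apply/measurable_EFinP; apply: measurable_funTS; exact: measurable_weight.
under [in LHS]eq_integral do rewrite massE//.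
under [in RHS]eq_integral do rewrite (@massE_ge _ _ V V0 lam k k.+1)//.
have mwl n v : measurable_fun A
    (fun w : W => (weight V w n v)%:E * lam (cylinder u `&` cylinder v)).
  by apply: emeasurable_funM.
have wl0 n v (w : W) : A w -> 0 <= (weight V w n v)%:E * lam (cylinder u `&` cylinder v).
  by move=> _; rewrite mule_ge0// lee_fin weight_ge0.
rewrite (ge0_integral_sum _ mA (fun v : k.+1.-tuple letter => mwl k.+1 v) (fun v => wl0 k.+1 v)).
rewrite (ge0_integral_sum _ mA (fun v : k.+1.-tuple letter => mwl k v) (fun v => wl0 k v)).
apply: eq_bigr => v _.
rewrite ge0_integralZr//; try by move=> w _; rewrite lee_fin weight_ge0.
rewrite [RHS]ge0_integralZr//; try by move=> w _; rewrite lee_fin weight_ge0.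
congr (_ * _); rewrite integral_mkcond [RHS]integral_mkcond.
pose g (w : W) : \bar R := (\1_A w * weight V w k v)%:E.
transitivity (\int[Pa]_w (g w * (V (w v))%:E)).
  apply: eq_integral => w _; rewrite patchE /g indicE.
  case: (w \in A); last by rewrite mul0r mul0e.
  rewrite mul1r -EFinM /weight big_ord_recr/=; congr (_ * V (w _))%:E%R.
  by rewrite take_oversize// size_tuple.
transitivity (\int[Pa]_w g w); last first.
  apply: eq_integral => w _; rewrite patchE /g indicE.
  by case: (w \in A); rewrite ?mul0r ?mul1r.
rewrite (integral_indep_coordinate (h := fun x => (V x)%:E)) ?V1 ?mule1//.
- by move=> w; rewrite lee_fin mulr_ge0// weight_ge0.
- apply/measurable_EFinP; apply: measurable_funM; last exact: measurable_weight.
  exact: measurable_indic.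
- exact/measurable_EFinP.
- move=> w w' ww'; have eqk s : (size s <= k)%N -> w s = w' s.
    move=> sk; apply: ww'; apply/eqP => sv; move: sk.
    by rewrite sv size_tuple ltnn.
  congr (_ * _)%:E%R.
    rewrite !indicE; congr (_%:R); congr nat_of_bool; apply/idP/idP; rewrite !inE.
      exact: levA.
    by apply: levA => s sk; rewrite eqk.
  apply: eq_bigr => j _; rewrite eqk// size_take size_tuple ltnS ltn_ord.
  exact: ltn_ord.
Qed.

Lemma integral_mass k u : \int[Pa]_w mass V lam k w u = lam (cylinder u).
Proof.
elim: k => [|k ih].
  by under eq_integral do rewrite mass0//; exact: integral_prob_cst.
by rewrite integral_mass_succ//; split.
Qed.

Lemma level_sets_lt k (f : W -> R) (r : R) : mfunT f ->
  (forall w w' : W, (forall u, (size u <= k)%N -> w u = w' u) -> f w = f w') ->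
  level_sets k [set w | (f w < r)%R] /\ level_sets k [set w | (r < f w)%R].
Proof.
move=> mf levf; split; split.
- by apply: measurable_ltr_set.
- by move=> w w' /levf /= ->.
- by apply: measurable_ltr_set.
- by move=> w w' /levf /= ->.
Qed.

Lemma ae_cvg_mass u : {ae Pa, forall w, cvgn (fun k => fine (mass V lam k w u))}.
Proof.
have mM k : mfunT (fun w : W => fine (mass V lam k w u)).
  by apply: measurableT_comp => //; exact: measurable_mass.
have levM k (w w' : W) : (forall s, (size s <= k)%N -> w s = w' s) ->
    fine (mass V lam k w u) = fine (mass V lam k w' u).
  move=> ww'; rewrite !massE//; congr fine; apply: eq_bigr => v _; congr (_%:E * _).
  apply: eq_bigr => j _; rewrite ww'// size_take size_tuple.
  by case: ltnP => // _; exact: ltn_ord.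
have ME k w : (fine (mass V lam k w u))%:E = mass V lam k w u.
  by rewrite fineK//; exact: mass_fin.
apply: (@nonneg_martingale_cvg _ _ _ Pa (fun k w => fine (mass V lam k w u)) level_sets).
- by rewrite PaT ltry.
- by move=> k w; rewrite fine_ge0// mass_ge0.
- move=> k; apply/integrableP; split; first exact/measurable_EFinP.
  rewrite (_ : \int[Pa]_w _ = \int[Pa]_w mass V lam k w u).
    by rewrite integral_mass -ge0_fin_numE// fin_num_of_lty//; exact: measurable_cylinder.
  by apply: eq_integral => w _; rewrite gee0_abs ?ME ?mass_ge0//= ME mass_ge0.
- by move=> k A [].
- move=> k A [mA lA]; split => // w w' ww'; apply: lA => s sk.
  by apply: ww'; exact: leqW.
- move=> k A [mA lA]; split; first exact: measurableC.
  move=> w w' ww' nA Aw'; apply: nA; apply: lA Aw' => s sk.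
  by rewrite ww'.
- move=> k A B [mA lA] [mB lB]; split; first exact: measurableI.
  by move=> w w' ww' [Aw Bw]; split; [exact: lA Aw|exact: lB Bw].
- by move=> k r; exact: (level_sets_lt r (mM k) (@levM k)).1.
- by move=> k r; exact: (level_sets_lt r (mM k) (@levM k)).2.
- move=> k A lA.
  rewrite (eq_integral (fun w : W => mass V lam k.+1 w u)) => [|w _]; last by rewrite ME.
  rewrite integral_mass_succ//; apply: eq_integral => w _; by rewrite ME.
Qed.

Lemma ae_mass_cvg : {ae Pa, forall w, mass_cvg V lam w}.
Proof.
have : {ae Pa, forall w, forall n : nat, forall u,
    @unpickle (seq letter) n = Some u -> cvgn (fun k => fine (mass V lam k w u))}.
  apply: ae_foralln => n; case: unpickle => [u|]; last exact: nearW.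
  by apply: filterS (ae_cvg_mass u) => w H v [<-].
by apply: filterS => w H u; apply: (H (pickle u)); rewrite pickleK.
Qed.

End fixed.

Section kernel.
Context d' (Y : measurableType d').
Variable lam : Y -> measure_on S.
Hypothesis mlam : forall U, measurable U -> mfunT (lam ^~ U).
Hypothesis lamoo : forall y, lam y setT < +oo.

Lemma measurable_mass_kernel k u : mfunT (fun p : Y * W => mass V (lam p.1) k p.2 u).
Proof.
have -> : (fun p : Y * W => mass V (lam p.1) k p.2 u) = (fun p => \sum_(v : k.-tuple letter)
    (weight V p.2 k v)%:E * lam p.1 (cylinder u `&` cylinder v)).
  by apply/funext => w; exact: massE.
apply: emeasurable_sum => v; apply: emeasurable_funM => //.
  apply/measurable_EFinP.
  exact: (measurableT_comp (measurable_weight k v) measurable_snd).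
have muv : measurable (cylinder u `&` cylinder v : set S).
  by apply: measurableI; exact: measurable_cylinder.
exact: (measurableT_comp (mlam muv) measurable_fst).
Qed.

Lemma measurable_mass_cvg : measurable [set p : Y * W | mass_cvg V (lam p.1) p.2].
Proof.
rewrite (_ : [set _ | _] = \bigcap_n [set p : Y * W | forall u, @unpickle (seq letter) n = Some u ->
    cvgn (fun k => fine (mass V (lam p.1) k p.2 u))]).
  apply: bigcap_measurable => // n _; case: unpickle => [u|]; last first.
    by rewrite (_ : [set _ | _] = setT)//; apply/seteqP; split.
  rewrite (_ : [set _ | _] = [set p : Y * W | cvgn (fun k => fine (mass V (lam p.1) k p.2 u))]).
    apply: measurable_cvgn_set => k.
    by apply: measurableT_comp => //; exact: measurable_mass_kernel.
  apply/seteqP; split => p /= H; first exact: H.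
  by move=> v [<-].
apply/seteqP; split => p /=.
  by move=> H n _ u _; exact: H.
by move=> H u; apply: (H (pickle u)) => //; rewrite pickleK.
Qed.

Lemma measurable_cascade_cylinder u : mfunT (fun p : Y * W => cascade V (lam p.1) p.2 (cylinder u)).
Proof.
have -> : (fun p : Y * W => cascade V (lam p.1) p.2 (cylinder u)) = (fun p => EFin
    (if `[< mass_cvg V (lam p.1) p.2 >] then
       limn (fun k => fine (mass V (lam p.1) k p.2 u)) else 0%R)).
  by apply/funext => p; rewrite cascade_cylinderE//; case: asboolP.
apply/measurable_EFinP.
(* Multiplication by the indicator of the convergence set makes the sequence converge everywhere. *)
pose f k (p : Y * W) := (\1_[set p : Y * W | mass_cvg V (lam p.1) p.2] p *
  fine (mass V (lam p.1) k p.2 u))%R.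
have mf k : mfunT (f k).
  apply: measurable_funM; first by apply: measurable_indic; exact: measurable_mass_cvg.
  by apply: measurableT_comp => //; exact: measurable_mass_kernel.
apply: (measurable_fun_cvg mf) => p _; rewrite /f.
case: asboolP => cp.
  rewrite indicE mem_set//; under eq_fun do rewrite mul1r; exact: cp.
by rewrite indicE memNset//; under eq_fun do rewrite mul0r; exact: cvg_cst.
Qed.

Lemma measurable_cascade A : measurable A -> mfunT (fun p : Y * W => cascade V (lam p.1) p.2 A).
Proof.
apply: measurable_kernel_cylinder => [p|u]; last exact: measurable_cascade_cylinder.
exact: (fin_num_fun_lty (fin_num_measure _)).
Qed.

End kernel.

Lemma ae_cascade_mass (lam : measure_on S) : lam setT < +oo ->
  {ae Pa, forall w, forall u, mass V lam k w u @[k --> \oo] --> cascade V lam w (cylinder u)}.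
Proof.
move=> lamoo; apply: filterS (ae_mass_cvg lamoo) => w cw u.
exact: cascade_cylinder.
Qed.

Lemma measurable_cascade_fixed (lam : measure_on S) A :
  lam setT < +oo -> measurable A -> mfunT (fun w : W => cascade V lam w A).
Proof.
move=> lamoo mA.
have := @measurable_cascade _ S (fun=> lam) (fun _ _ => measurable_cst _) (fun=> lamoo) A mA.
by move/(measurable_fun_pair2 point).
Qed.

Lemma integral_cascade_cylinder_le (lam : measure_on S) u :
  lam setT < +oo -> \int[Pa]_w cascade V lam w (cylinder u) <= lam (cylinder u).
Proof.
move=> lamoo; apply: (@fatou_ae _ _ _ Pa (fun k w => mass V lam k w u)) => //.
- by move=> k; exact: measurable_mass.
- by move=> k w; exact: mass_ge0.
- by apply: measurable_cascade_fixed => //; exact: measurable_cylinder.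
- by apply: filterS (ae_cascade_mass lamoo) => w; exact.
- by move=> k; rewrite integral_mass.
Qed.

End cascade_kernel.

(** * Inequalities on cylinders and differentiation along prefixes *)

Section le_measure_cylinder.
Local Open Scope ereal_scope.

(** The sets that satisfy an inequality need not form a lambda-system. Instead, the difference of
    the two measures on cylinders extends to a measure [m3], and the equality m1 + m3 = m2 passes
    from cylinders to all measurable sets. *)
Lemma le_measure_cylinder (m1 m2 : measure_on S) : m2 setT < +oo ->
  (forall u, m1 (cylinder u) <= m2 (cylinder u)) -> forall B, measurable B -> m1 B <= m2 B.
Proof.
move=> m2oo m12 B mB.
have mc (u : seq letter) := @measurable_cylinder u.
have f2 u : m2 (cylinder u) \is a fin_num by exact: fin_num_of_lty.
have f1 u : m1 (cylinder u) \is a fin_num.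
  by rewrite ge0_fin_numE// (le_lt_trans (m12 u))// -ge0_fin_numE.
pose c u := (fine (m2 (cylinder u)) - fine (m1 (cylinder u)))%R.
have split_cyl (m : measure_on S) u : m (cylinder u) = \sum_i m (cylinder (rcons u i)).
  have := cylinder_split m u measurableT; rewrite setIT => ->.
  by apply: eq_bigr => i _; rewrite setIT.
have [m3 Hm3] : exists m : {finite_measure set S -> \bar R}, forall u, m (cylinder u) = (c u)%:E.
  apply: cylinder_measure_exists => u; first by rewrite subr_ge0 fine_le.
  by rewrite /c (split_cyl m2 u) (split_cyl m1 u) -!sum_fine// -sumrB.
pose m13 : measure_on S := measure_add m1 m3.
have m13E D : m13 D = m1 D + m3 D by exact: measure_addE.
have H : m13 B = m2 B.
  have m13u u : m13 (cylinder u) = m2 (cylinder u).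
    rewrite m13E Hm3 /c -(fineK (f1 u)) -(fineK (f2 u)) -EFinD.
    by congr EFin; rewrite !fineK// addrC subrK.
  apply: eq_measure_cylinder => //.
  by have := m13u [::]; rewrite cylinder_nil => ->.
by rewrite -H m13E leeDl.
Qed.

End le_measure_cylinder.

Section cylinder_differentiation.
Local Open Scope ereal_scope.
Variable m : measure_on S.
Hypothesis moo : m setT < +oo.

Let mcyl (u : seq letter) : measurable (cylinder u : set S).
Proof. exact: measurable_cylinder. Qed.

Lemma ge0_integral_prefix_fun n (F : seq letter -> R) : (forall u, (0 <= F u)%R) ->
  \int[m]_x (F (prefix_word x n))%:E = \sum_(u : n.-tuple letter) (F u)%:E * m (cylinder u).
Proof.
move=> F0; under eq_integral do rewrite prefix_fun_sum -sumEFin.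
have mi (u : seq letter) : mfunT (fun x => (\1_(cylinder u : set S) x)%:E : \bar R).
  exact: measurable_EFin_indic.
rewrite ge0_integral_sum//.
- apply: eq_bigr => u _; under eq_integral do rewrite EFinM.
  rewrite ge0_integralZl//; first by rewrite integral_indic// setIT.
  by rewrite lee_fin.
- by move=> u; apply/measurable_EFinP; apply: measurable_funM => //; exact: measurable_indic.
- by move=> u x _; rewrite lee_fin mulr_ge0.
Qed.

Variable f : S -> R.
Hypothesis mf : mfunT f.
Hypothesis f01 : forall x, (0 <= f x <= 1)%R.

Let f0 x : (0 <= f x)%R. Proof. by have /andP[] := f01 x. Qed.

Local Notation nu := (density_measure m mf f0).

Let nu_le A : measurable A -> nu A <= m A.
Proof.
move=> mA; rewrite -[leRHS]mul1e -integral_cst//; apply: ge0_le_integral => //.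
- by move=> x _; rewrite lee_fin.
- by apply/measurable_EFinP; exact: measurable_funTS.
- by move=> x _; rewrite lee_fin; have /andP[] := f01 x.
Qed.

Let m_fin A : measurable A -> m A \is a fin_num.
Proof. exact: fin_num_of_lty. Qed.

Let nu_fin A : measurable A -> nu A \is a fin_num.
Proof.
move=> mA; rewrite ge0_fin_numE// (le_lt_trans (nu_le mA))//.
by rewrite -ge0_fin_numE// m_fin.
Qed.

(** The conditional expectation of f given a prefix, as a function of this prefix; it is 0 on null
    cylinders. *)
Definition cylinder_ratio (u : seq letter) : R :=
  (fine (\int[m]_(x in cylinder u) (f x)%:E) / fine (m (cylinder u)))%R.

Lemma cylinder_ratio_ge0 u : (0 <= cylinder_ratio u)%R.
Proof. by rewrite divr_ge0 ?fine_ge0//; apply: integral_ge0 => x _; rewrite lee_fin. Qed.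

Lemma cylinder_ratio_le1 u : (cylinder_ratio u <= 1)%R.
Proof.
have [m0|m0] := eqVneq (fine (m (cylinder u))) 0%R.
  by rewrite /cylinder_ratio m0 invr0 mulr0.
have mp : (0 < fine (m (cylinder u)))%R by rewrite lt_def m0 fine_ge0.
rewrite ler_pdivrMr// mul1r fine_le ?m_fin//; last exact: nu_le.
exact: (nu_fin (mcyl u)).
Qed.

Lemma cylinder_ratioM u :
  (cylinder_ratio u)%:E * m (cylinder u) = \int[m]_(x in cylinder u) (f x)%:E.
Proof.
have mfin := m_fin (mcyl u); have nfin := nu_fin (mcyl u).
rewrite -[in LHS](fineK mfin) -EFinM /cylinder_ratio -mulrA.
have [m0|m0] := eqVneq (fine (m (cylinder u))) 0%R.
  rewrite m0 mulr0 mulr0; apply/esym/eqP; rewrite eq_le.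
  apply/andP; split; first by rewrite (le_trans (nu_le (mcyl u)))// -(fineK mfin) m0.
  by apply: integral_ge0 => x _; rewrite lee_fin.
by rewrite mulVf// mulr1 fineK.
Qed.

Let b n (x : S) := cylinder_ratio (prefix_word x n).

Let mb n : mfunT (b n). Proof. exact: measurable_prefix_real. Qed.

Let b01 n x : (0 <= b n x <= 1)%R.
Proof. by rewrite cylinder_ratio_ge0 cylinder_ratio_le1. Qed.

Let prefix_set n (A : set S) := exists p : seq letter -> bool, A = [set x | p (prefix_word x n)].

Let prefix_setS n A : prefix_set n A -> prefix_set n.+1 A.
Proof.
move=> [p ->]; exists (fun u => p (take n u)); apply/seteqP; split => x /=;
  by rewrite take_prefix_word.
Qed.

Let integral_prefix_set n A : prefix_set n A -> \int[m]_(x in A) (b n x)%:E = nu A.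
Proof.
move=> [p ->]; pose F u := ((p u)%:R * cylinder_ratio u)%R.
have F0 u : (0 <= F u)%R by rewrite mulr_ge0// cylinder_ratio_ge0.
have E (g : S -> R) : \int[m]_(x in [set x | p (prefix_word x n)]) (g x)%:E =
    \int[m]_x ((p (prefix_word x n))%:R * g x)%:E.
  rewrite integral_mkcond; apply: eq_integral => x _; rewrite patchE.
  have [px|px] := boolP (p (prefix_word x n)).
    by rewrite mem_set// mul1r.
  by rewrite memNset ?mul0r//; exact/negP.
rewrite /density_measure !E (ge0_integral_prefix_fun n F0).
under [RHS]eq_integral => x _ do rewrite (prefix_fun_sum (fun u => (p u)%:R)%R) mulr_suml -sumEFin.
have mi (u : seq letter) : mfunT (fun x => (\1_(cylinder u : set S) x)%:E : \bar R).
  exact: measurable_EFin_indic.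
rewrite ge0_integral_sum//.
- apply: eq_bigr => u _; under eq_integral do rewrite -mulrA EFinM.
  rewrite ge0_integralZl//; first 1 last.
  + apply/measurable_EFinP; apply: measurable_funM => //; exact: measurable_indic.
  + by move=> x _; rewrite lee_fin mulr_ge0.
  rewrite /F EFinM -muleA cylinder_ratioM; congr (_ * _).
  rewrite [LHS]integral_mkcond; apply: eq_integral => x _; rewrite patchE indicE.
  by case: (x \in _); rewrite ?mul1r ?mul0r.
- move=> u; apply/measurable_EFinP; apply: measurable_funM => //.
  by apply: measurable_funM => //; exact: measurable_indic.
- by move=> u x _; rewrite lee_fin !mulr_ge0.
Qed.

Let bcvg : {ae m, forall x, cvgn (b ^~ x)}.
Proof.
apply: (@nonneg_martingale_cvg _ _ _ m b prefix_set) => //.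
- by move=> n x; have /andP[] := b01 n x.
- move=> n; apply: (@integrable_bounded _ _ _ _ _ 1) => // x.
  by have /andP[? ?] := b01 n x; rewrite ger0_norm.
- move=> n A [p ->]; exact: (measurable_pred (measurable_prefix_fun n p)).
- by move=> n A [p ->]; exists (fun u => ~~ p u); apply/seteqP; split => x /= /negP.
- move=> n A B [p ->] [q ->]; exists (fun u => p u && q u).
  by apply/seteqP; split => x /=; [move=> [-> ->]|move=> /andP[]].
- by move=> n c; exists (fun u => cylinder_ratio u < c)%R.
- by move=> n c; exists (fun u => c < cylinder_ratio u)%R.
- by move=> n A GA; rewrite !integral_prefix_set//; exact: prefix_setS.
Qed.

(** The ratios form a bounded martingale. Its limit has the same integrals over cylinders as f,
    hence equals f almost everywhere. *)
Lemma cylinder_differentiation :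
  {ae m, forall x, cylinder_ratio (prefix_word x n) @[n --> \oo] --> f x}.
Proof.
(* The limit is represented by the upper limit, clamped to [0, 1] below, so as to be a bounded
   measurable function defined everywhere. *)
pose g x := limn_sup (b ^~ x).
have mg : mfunT g.
  apply: measurable_fun_limn_sup => // x _.
    by exists 1%R => _ [n _ <-]; have /andP[] := b01 n x.
  by exists 0%R => _ [n _ <-]; have /andP[] := b01 n x.
have bg : {ae m, forall x, b n x @[n --> \oo] --> g x}.
  by apply: filterS bcvg => x cx; rewrite /g cvg_limn_supE.
pose g' x := Num.min (Num.max (g x : R) (0 : R)%R) (1 : R)%R.
have mg' : mfunT g' by apply: measurable_minr => //; exact: measurable_maxr.
have g'0 x : (0 <= g' x)%R by rewrite le_min le_max lexx orbT ler01.
have g'1 x : (g' x <= 1)%R by rewrite ge_min lexx orbT.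
have {}bg : {ae m, forall x, b n x @[n --> \oo] --> g' x}.
  apply: filterS bg => x bx; suff -> : g' x = g x by [].
  have cb : cvgn (b ^~ x) by apply/cvg_ex; exists (g x).
  have g0 : (0 <= g x)%R.
    rewrite -(cvg_lim _ bx)//; apply: limr_ge => //.
    by apply: nearW => n; have /andP[] := b01 n x.
  have g1 : (g x <= 1)%R.
    rewrite -(cvg_lim _ bx)//; apply: limr_le => //.
    by apply: nearW => n; have /andP[] := b01 n x.
  by rewrite /g' max_l// min_l.
have bounded (h : S -> R) : mfunT h -> (forall x, (0 <= h x <= 1)%R) ->
    m.-integrable setT (EFin \o h).
  move=> mh h01; apply: (@integrable_bounded _ _ _ _ _ 1) => // x.
  by have /andP[? ?] := h01 x; rewrite ger0_norm.
have E u : nu (cylinder u) = density_measure m mg' g'0 (cylinder u).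
  pose b' n x := (\1_(cylinder u) x * b n x)%R.
  have mE (h : S -> R) : \int[m]_(x in cylinder u) (h x)%:E = \int[m]_x (\1_(cylinder u) x * h x)%:E.
    rewrite integral_mkcond; apply: eq_integral => x _; rewrite patchE indicE.
    by case: (x \in _); rewrite ?mul1r ?mul0r.
  have L : \int[m]_x (b' n x)%:E @[n --> \oo] --> \int[m]_x (\1_(cylinder u) x * g' x)%:E.
    apply: (@dominated_cvg_real _ _ _ m b' _ (cst 1%R)) => //.
    - by move=> n; apply: measurable_funM => //; exact: measurable_indic.
    - by apply: measurable_funM => //; exact: measurable_indic.
    - by apply: filterS bg => x; exact: cvgMr.
    - by apply: bounded => // x; rewrite ler01 lexx.
    - apply: nearW => x n; have /andP[? ?] := b01 n x.
      have [i0 i1] : (0 <= \1_(cylinder u) x :> R)%R /\ (\1_(cylinder u) x <= 1 :> R)%R.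
        by rewrite indicE; case: (_ \in _).
      by rewrite /b' ger0_norm; [exact: mulr_ile1|exact: mulr_ge0].
  rewrite {2}/density_measure mE; apply: (cvg_unique _ _ L) => //.
  apply: cvg_near_cst; exists (size u) => // n /= un.
  rewrite -mE; apply: integral_prefix_set.
  exists (fun v => take (size u) v == u); apply/seteqP; split => x /=.
    by move=> /cylinderP; rewrite take_prefix_word// => ->.
  by rewrite take_prefix_word// => /eqP ux; apply/cylinderP.
have numT : nu setT < +oo by rewrite (le_lt_trans (nu_le _)).
have {}E := eq_measure_cylinder numT E.
have fg : {ae m, forall x, setT x -> (f x)%:E = (g' x)%:E}.
  apply: integral_ae_eq => //; first exact: bounded.
    exact/measurable_EFinP.
  by move=> A _ mA; exact: E.
by apply: filterS2 bg fg => x bx /(_ I) [->].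
Qed.

End cylinder_differentiation.

(** * The coding map and its balls *)

Section coding.
Variables r t : letter -> R.
Hypothesis hr : forall i, 0 < r i < 1.

Let r0 i : 0 < r i. Proof. by have /andP[] := hr i. Qed.

Definition contraction : R := \big[Num.max/0]_i r i.
Local Notation rho := contraction.

Lemma le_contraction i : r i <= rho. Proof. exact: le_bigmax. Qed.

Lemma contraction_lt1 : rho < 1.
Proof. by apply: bigmax_lt => // i _; have /andP[] := hr i. Qed.

Lemma contraction_gt0 : 0 < rho.
Proof. exact: lt_le_trans (r0 point) (le_contraction point). Qed.

Definition scale n (x : S) : R := \prod_(j < n) r (x j).

Lemma scaleS n x : scale n.+1 x = r (x 0%N) * scale n (sshift x).
Proof. exact: big_ord_recl. Qed.

Lemma scale_gt0 n x : 0 < scale n x.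
Proof. by apply: prodr_gt0 => j _. Qed.

Lemma scale_le n x : scale n x <= rho ^+ n.
Proof.
rewrite /scale -[X in _ ^+ X]card_ord -prodr_const; apply: ler_prod => j _.
by rewrite ltW//= le_contraction.
Qed.

Let partial (x : S) n := foldr (fun i y => r i * y + t i) 0 (prefix_word x n).

Let foldr_affine u y : foldr (fun i y => r i * y + t i) y u =
  (\prod_(i <- u) r i) * y + foldr (fun i y => r i * y + t i) 0 u.
Proof.
elim: u => [|i u ih] /=; first by rewrite big_nil mul1r addr0.
by rewrite big_cons ih mulrDr mulrA addrA.
Qed.

Definition translation_bound : R := \big[Num.max/0]_i `|t i|.

Let tb0 : 0 <= translation_bound. Proof. exact: bigmax_ge_id. Qed.

Let partialE x : partial x = series (fun k => scale k x * t (x k)).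
Proof.
apply/funext => n; rewrite /series /=; elim: n => [|n ih]; first by rewrite big_nil.
rewrite big_nat_recr//= -ih /partial prefix_word_rcons foldr_rcons mulr0 add0r foldr_affine.
rewrite [LHS]addrC; congr (_ + _ * _); rewrite /prefix_word /mkseq big_map /scale.
by rewrite -[X in iota 0 X]subn0 -/(index_iota 0 n) big_mkord.
Qed.

Lemma cvg_coding x : partial x n @[n --> \oo] --> coding r t x.
Proof.
suff : cvgn (partial x) by [].
rewrite partialE; apply: normed_cvg.
apply: (@series_le_cvg _ _ (fun k => translation_bound * rho ^+ k)) => [k|k|k|].
- exact: normr_ge0.
- by rewrite mulr_ge0// exprn_ge0// ltW// contraction_gt0.
- rewrite /= normrM gtr0_norm ?scale_gt0// mulrC ler_pM//; first exact: ltW (scale_gt0 _ _).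
    exact: le_bigmax.
  exact: scale_le.
- apply: is_cvg_geometric_series; rewrite gtr0_norm ?contraction_gt0//.
  exact: contraction_lt1.
Qed.

Lemma coding_shift x : coding r t x = r (x 0%N) * coding r t (sshift x) + t (x 0%N).
Proof.
have h1 : partial x n.+1 @[n --> \oo] --> coding r t x.
  by rewrite (cvg_shiftS (partial x)); exact: cvg_coding.
apply: (cvg_unique _ h1) => //.
have -> : (fun n => partial x n.+1) = (fun n => r (x 0%N) * partial (sshift x) n + t (x 0%N)).
  by apply/funext => n; rewrite /partial prefix_wordS.
by apply: cvgD; [apply: cvgM; [exact: cvg_cst|exact: cvg_coding]|exact: cvg_cst].
Qed.

Lemma measurable_coding : mfunT (coding r t).
Proof.
apply: (@measurable_fun_cvg _ _ _ _ (fun n x => partial x n)) => [n|x _].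
  exact: (measurable_prefix_real (foldr (fun i y => r i * y + t i) 0)).
exact: cvg_coding.
Qed.

Definition coding_bound : R := translation_bound / (1 - rho).

Lemma coding_le x : `|coding r t x| <= coding_bound.
Proof.
have r1 : 0 < 1 - rho by rewrite subr_gt0 contraction_lt1.
have b0 : 0 <= coding_bound by rewrite divr_ge0// ltW.
have H n y : `|partial y n| <= coding_bound.
  elim: n y => [|n ih] y; first by rewrite normr0.
  rewrite /partial prefix_wordS /= -/(partial (sshift y) n).
  have -> : coding_bound = rho * coding_bound + translation_bound.
    by rewrite /coding_bound; field; rewrite gt_eqF.
  rewrite (le_trans (ler_normD _ _))// lerD//; last exact: le_bigmax.
  by rewrite normrM gtr0_norm// ler_pM// ?le_contraction// ltW.
have h : `|partial x n| @[n --> \oo] --> `|coding r t x|.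
  by apply: cvg_norm; exact: cvg_coding.
rewrite -(cvg_lim _ h)//.
apply: limr_le; first by apply/cvg_ex; eexists; exact: h.
exact: nearW.
Qed.

Lemma coding_dist n x y : prefix_word x n = prefix_word y n ->
  `|coding r t x - coding r t y| <= 2 * coding_bound * rho ^+ n.
Proof.
elim: n x y => [|n ih] x y xy.
  by rewrite expr0 mulr1 (le_trans (ler_normB _ _))// mulr_natl mulr2n lerD// coding_le.
move: xy; rewrite !prefix_wordS => -[x0 /ih h].
rewrite !(coding_shift x, coding_shift y) x0 opprD addrACA subrr addr0 -mulrBr normrM.
rewrite gtr0_norm// exprS mulrCA ler_pM// ?le_contraction// ltW//.
Qed.

Local Open Scope ereal_scope.
Local Notation I z s := (`](z - s)%R, (z + s)%R[%classic : set R).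

(* The factor makes the ball of radius [window 0] contain the whole range. *)
Definition window n x : R := ((2 * coding_bound + 1) * scale n x)%R.

Lemma window_factor_gt0 : (0 < 2 * coding_bound + 1)%R.
Proof.
have r1 : (0 < 1 - rho)%R by rewrite subr_gt0 contraction_lt1.
by rewrite ltr_wpDl// mulr_ge0// divr_ge0// ltW.
Qed.

Lemma window_gt0 n x : (0 < window n x)%R.
Proof. by rewrite mulr_gt0 ?scale_gt0// window_factor_gt0. Qed.

Lemma windowS n x : window n.+1 x = (r (x 0%N) * window n (sshift x))%R.
Proof. by rewrite /window scaleS mulrCA. Qed.

Definition coding_ball (x : S) s : set S := coding r t @^-1` I (coding r t x) s.

Lemma measurable_coding_ball x s : measurable (coding_ball x s).
Proof. exact: (measurable_preimage measurable_coding). Qed.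

Lemma coding_ballP x s y : coding_ball x s y <-> (`|coding r t y - coding r t x| < s)%R.
Proof.
rewrite /coding_ball /= in_itv /= ltrBlDr ltr_distl.
by split => /andP[h1 h2]; apply/andP; split; rewrite // -?ltrBlDr// ltrBlDr.
Qed.

Lemma coding_ball0 x : coding_ball x (window 0 x) = setT.
Proof.
apply/seteqP; split => // y _; apply/coding_ballP; rewrite /window /scale big_ord0 mulr1.
rewrite (le_lt_trans (ler_normB _ _))// (@le_lt_trans _ _ (2 * coding_bound)%R) ?ltrDl//.
by rewrite mulr_natl mulr2n lerD// coding_le.
Qed.

(** Self-similarity: on the cylinder of x_0 the coding map contracts distances by r (x_0), which is
    also the ratio of the two radii. *)
Lemma coding_ballS n x : cylinder [:: x 0%N] `&` coding_ball x (window n.+1 x) =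
  cylinder [:: x 0%N] `&` sshift @^-1` coding_ball (sshift x) (window n (sshift x)).
Proof.
rewrite cylinder_cons cylinder_nil preimage_setT setIT.
apply/seteqP; split => y /= [y0 By]; split => //; move: By => /coding_ballP By;
  apply/coding_ballP; move: By; rewrite windowS (coding_shift y) (coding_shift x) y0
  opprD addrACA subrr addr0 -mulrBr normrM gtr0_norm// ltr_pM2l//.
Qed.

End coding.

(** * The share of the first letter in a ball *)

Section letter_gain.
Local Open Scope ereal_scope.
Variables r t : letter -> R.
Hypothesis hr : forall i, (0 < r i < 1)%R.

Local Notation Phi := (coding r t).
Local Notation ball n x := (coding_ball r t x (window r t n x)).

Let mcyl (u : seq letter) : measurable (cylinder u : set S).
Proof. exact: measurable_cylinder. Qed.

Let mball n x : measurable (ball n x).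
Proof. exact: measurable_coding_ball. Qed.

Lemma measurable_scale n : mfunT (fun x : S => scale r n x).
Proof.
have -> : (fun x : S => scale r n x) = (fun x : S => \prod_(i <- prefix_word x n) r i)%R.
  apply/funext => x; rewrite /prefix_word /mkseq big_map /scale.
  by rewrite -[X in iota 0 X]subn0 -/(index_iota 0 n) big_mkord.
exact: (measurable_prefix_real (fun u => \prod_(i <- u) r i)%R).
Qed.

Lemma window_cvg x : window r t n x @[n --> \oo] --> (0 : R)^'+.
Proof.
have w0 : window r t n x @[n --> \oo] --> (0 : R)%R.
  have c0 := window_factor_gt0 t hr; have rho0 := contraction_gt0 hr.
  apply: (@squeeze_cvgr _ _ _ _ (cst 0%R)
      (fun n => (2 * coding_bound r t + 1) * contraction r ^+ n)%R).
  - apply: nearW => n; rewrite /= ltW ?window_gt0//=.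
    by apply: ler_wpM2l; [exact: ltW|exact: scale_le].
  - exact: cvg_cst.
  - rewrite -[X in _ --> X](mulr0 (2 * coding_bound r t + 1)%R).
    apply: cvgM; first exact: cvg_cst.
    by apply: cvg_expr; rewrite gtr0_norm//; exact: contraction_lt1.
move=> A; rewrite /at_right /within/= => -[e /= e0 He].
move/cvgrPdist_lt : w0 => /(_ _ e0); apply: filterS => n /= h.
by apply: He => //; exact: window_gt0.
Qed.

(** The proportion of the ball that is carried by the first letter of its centre: at small scales,
    the conditional probability of this letter given the coding. *)
Definition ratio (lam : set S -> \bar R) n x : R :=
  (fine (lam (cylinder [:: x 0%N] `&` ball n x)) / fine (lam (ball n x)))%R.

Definition gain lam n x : R := (- ln (ratio lam n x))%R.

(** The upper limit and the clamp make this a total function that is measurable in x and in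
    parameters; by [gain_cvg] it is almost everywhere the limit of [gain]. *)
Definition gain_lim lam x : R := (- ln (clamp (limn_sup (ratio lam ^~ x))))%R.

Lemma ratio_scale (lam lam' : set S -> \bar R) (c : R) n x : (0 < c)%R ->
  (forall A, measurable A -> lam A = c%:E * lam' A) ->
  (forall A, measurable A -> lam' A \is a fin_num) -> ratio lam n x = ratio lam' n x.
Proof.
move=> c0 H fin; rewrite /ratio !H//; last exact: measurableI.
rewrite !fineM//; [|exact: fin|exact/fin/measurableI].
by rewrite -mulf_div divff ?mul1r// gt_eqF.
Qed.

Section measurability.
Context d (Y : measurableType d).
Variables (k : Y -> measure_on S) (xi : Y -> S).
Hypothesis mk : forall U, measurable U -> mfunT (k ^~ U).
Hypothesis koo : forall y, k y setT < +oo.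
Hypothesis mxi : mfunT xi.

Lemma measurable_ball_section n (D : set S) : measurable D ->
  mfunT (fun y => fine (k y (D `&` ball n (xi y)))).
Proof.
move=> mD; apply: measurableT_comp => //.
pose A := [set p : Y * S | D p.2] `&`
  [set p : Y * S | `|Phi p.2 - Phi (xi p.1)| < window r t n (xi p.1)]%R.
have mxi1 : mfunT (fun p : Y * S => xi p.1).
  exact: measurableT_comp mxi measurable_fst.
have mP := measurable_coding t hr.
have mA : measurable A.
  apply: measurableI.
    exact: (measurable_preimage measurable_snd).
  apply: measurable_ltr_set.
    apply: measurableT_comp => //; apply: measurable_funB.
      exact: measurableT_comp mP measurable_snd.
    exact: measurableT_comp mP mxi1.
  by apply: measurable_funM => //; exact: measurableT_comp (measurable_scale n) mxi1.
apply: eq_measurable_fun (measurable_xsection_kernel mk koo mA) => y _.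
congr (k y _); apply/seteqP; split => z; rewrite /xsection /= inE /A /=.
  by move=> [Dz h]; split => //; apply/coding_ballP.
by move=> [Dz /coding_ballP].
Qed.

Lemma measurable_ratio n : mfunT (fun y => ratio (k y) n (xi y)).
Proof.
apply: measurable_funM; last first.
  apply: measurable_inv_ge0 => [y|]; first exact: fine_ge0.
  apply: eq_measurable_fun (measurable_ball_section n measurableT) => y _.
  by rewrite setTI.
apply: (@measurable_fun_case _ _ _ _ letter (fun y => xi y 0%N)
  (fun i y => fine (k y (cylinder [:: i] `&` ball n (xi y))))) => i.
  have := mxi measurableT (measurable_coordinate 0%N i); rewrite setTI.
  by congr measurable; apply/seteqP; split => y.
exact: measurable_ball_section.
Qed.

Lemma measurable_gain n : mfunT (fun y => gain (k y) n (xi y)).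
Proof.
by apply: measurableT_comp => //; apply: measurable_ln_comp; exact: measurable_ratio.
Qed.

End measurability.

Section one_measure.
Variable lam : measure_on S.
Hypothesis lamoo : lam setT < +oo.

Let lamfin A : measurable A -> lam A \is a fin_num. Proof. exact: fin_num_of_lty. Qed.

Lemma ratio01 n x : (0 <= ratio lam n x <= 1)%R.
Proof.
rewrite divr_ge0 ?fine_ge0//=.
have [z|nz] := eqVneq (fine (lam (ball n x))) 0%R; first by rewrite /ratio z invr0 mulr0.
rewrite ler_pdivrMr ?lt_def ?nz ?fine_ge0// mul1r; apply: fine_le.
- exact/lamfin/measurableI.
- exact: lamfin.
- by apply: le_measure; rewrite ?inE//; exact: measurableI.
Qed.

Lemma gain_ge0 n x : (0 <= gain lam n x)%R.
Proof. by rewrite oppr_ge0 ln_le0//; have /andP[] := ratio01 n x. Qed.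

Let nu := image_measure lam (measurable_coding t hr).
Let nui i := image_measure (mrestr lam (mcyl [:: i])) (measurable_coding t hr).

Let nuiE i A : nui i A = lam (cylinder [:: i] `&` Phi @^-1` A).
Proof. by rewrite /nui /= /pushforward /= /mrestr setIC. Qed.

Lemma measurable_gain_tail (k : R) : measurable [set x : S | exists n, (k < gain lam n x)%R].
Proof.
have -> : [set x : S | exists n, (k < gain lam n x)%R] = \bigcup_n [set x : S | (k < gain lam n x)%R].
  by apply/seteqP; split => x [n]; exists n.
apply: bigcupT_measurable => n; apply: measurable_ltr_set => //.
exact: (@measurable_gain _ S (fun=> lam) id).
Qed.

(** A gain above k means that the letter i = x_0 carries less than the fraction e^(-k) of some ball
    around x. The maximal inequality is applied to each letter and the results are added. *)
Lemma gain_tail (k : R) : (0 <= k)%R -> lam [set x : S | exists n, (k < gain lam n x)%R] <=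
  (#|{: letter}|%:R * (2 * expR (- k)))%:E * lam setT.
Proof.
move=> k0; rewrite (measure_cylinder1 _ (measurable_gain_tail k)).
have -> : (#|{: letter}|%:R * (2 * expR (- k)))%:E * lam setT =
    \sum_(i : letter) (2 * expR (- k))%:E * lam setT.
  have [z ->] : exists z, lam setT = z%:E.
    by exists (fine (lam setT)); rewrite fineK// lamfin.
  transitivity ((2 * expR (- k) * z) *+ #|{: letter}|)%:E%R.
    by rewrite -EFinM -mulr_natl; congr EFin; ring.
  by rewrite -sumr_const -sumEFin; apply: eq_bigr => i _; rewrite EFinM.
apply: lee_sum => i _.
have [E [mE spE ltE]] := maximal_inequality (nui i) nu (expR_ge0 (- k)).
apply: (@le_trans _ _ (nui i E)); last exact: ltE.
rewrite nuiE; apply: le_measure; rewrite ?inE.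
- by apply: measurableI => //; exact: measurable_gain_tail.
- apply: measurableI => //; exact: (measurable_preimage (measurable_coding t hr)).
move=> x [xi [n kn]]; split => //; apply: spE.
exists (Phi x - window r t n x)%R, (Phi x + window r t n x)%R; split.
  by rewrite in_itv/= ltrBlDr !ltrDl window_gt0.
have x0 : x 0%N = i by move: xi => /cylinderP [].
(* Where the ratio is 0 the gain takes the default value 0, which does not exceed k >= 0. *)
have rn0 : ratio lam n x != 0%R.
  by apply/negP => /eqP r0; move: kn; rewrite /gain r0 ln0// oppr0 ltNge k0.
have rp : (0 < ratio lam n x)%R by rewrite lt_def rn0; have /andP[] := ratio01 n x.
have rk : (ratio lam n x < expR (- k))%R.
  by rewrite -(lnK (x := ratio lam n x)) ?posrE// ltr_expR ltrNr.
have dp : (0 < fine (lam (ball n x)))%R.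
  rewrite lt_def fine_ge0// andbT; apply: contra rn0 => /eqP z.
  by rewrite /ratio z invr0 mulr0.
move: rk; rewrite /ratio ltr_pdivrMr// -lte_fin EFinM !fineK//; last 2 first.
- exact: lamfin.
- exact/lamfin/measurableI.
by rewrite x0 nuiE.
Qed.

(** The density [f i] is the conditional probability of the letter i given the coding, obtained by
    differentiating the image of lam on [i] with respect to the image of lam. At the actual first
    letter it is positive almost everywhere, because the part of [i] where [f i] vanishes is
    null. *)
Lemma coding_density : exists f : letter -> R -> R, [/\ forall i, mfunT (f i),
  forall i z, (0 <= f i z <= 1)%R,
  forall i B, measurable B -> lam (cylinder [:: i] `&` Phi @^-1` B) =
    \int[lam]_(x in Phi @^-1` B) (f i (Phi x))%:E &
  {ae lam, forall x : S, (0 < f (x 0%N) (Phi x))%R /\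
    ratio lam n x @[n --> \oo] --> f (x 0%N) (Phi x)}].
Proof.
have nuoo : nu setT < +oo by [].
have mP := measurable_coding t hr.
have mPB B : measurable B -> measurable (Phi @^-1` B).
  by move=> mB; exact: (measurable_preimage mP).
have nuile i A : measurable A -> nui i A <= nu A.
  move=> mA; rewrite nuiE; apply: le_measure; rewrite ?inE; last by move=> ? [].
    by apply: measurableI => //; exact: mPB.
  exact: mPB.
have [f fP] := choice (fun i => bounded_density nuoo (nuile i)).
have mf i : mfunT (f i) by have [] := fP i.
have f01 i z : (0 <= f i z <= 1)%R by have [_ /(_ z)] := fP i.
have fE i A : measurable A -> nui i A = \int[nu]_(z in A) (f i z)%:E by have [_ _] := fP i; exact.
have f0 i z : (0 <= f i z)%R by have /andP[] := f01 i z.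
have intE i B : measurable B -> \int[nu]_(z in B) (f i z)%:E =
    \int[lam]_(x in Phi @^-1` B) (f i (Phi x))%:E.
  move=> mB; rewrite [LHS]integral_mkcond [RHS]integral_mkcond.
  rewrite -(ge0_integral_image (mu := lam) (g := Phi))//.
  - by move=> z; rewrite /patch; case: ifPn; rewrite // lee_fin.
  - by apply/(measurable_restrictT _ mB); apply/measurable_EFinP; exact: measurable_funTS.
exists f; split => // [i B mB|]; first by rewrite -intE// -fE.
have ae_pre (Q : R -> Prop) : {ae nu, forall z, Q z} -> {ae lam, forall x : S, Q (Phi x)}.
  move=> [N [mN N0 QN]]; exists (Phi @^-1` N); split => //; first exact: mPB.
  by move=> x /=; exact: QN.
have H i : {ae lam, forall x : S, x 0%N = i -> (0 < f i (Phi x))%R /\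
    ratio lam n x @[n --> \oo] --> f i (Phi x)}.
  have h1 : {ae lam, forall x : S, x 0%N = i -> (0 < f i (Phi x))%R}.
    pose N := [set z | f i z <= 0]%R.
    have mN : measurable N by exact: measurable_ler_set.
    exists (cylinder [:: i] `&` Phi @^-1` N); split.
    - by apply: measurableI => //; exact: mPB.
    - rewrite -nuiE fE// (eq_integral (cst 0)) ?integral0// => z; rewrite inE /N /= => fz.
      by congr EFin; apply/eqP; rewrite eq_le fz f0.
    - move=> x /= /not_implyP[xi fx]; split; first by apply/cylinderP; rewrite /= -xi.
      by rewrite /N /= leNgt; exact/negP.
  have h2 := ae_pre _ (differentiation nuoo (mf i) (f01 i) (fE i)).
  apply: filterS2 h1 h2 => x h1x h2x xi; split; first exact: h1x.
  rewrite /ratio xi.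
  have -> : (fun n => fine (lam (cylinder [:: i] `&` ball n x)) / fine (lam (ball n x)))%R =
      (fun n => (fun s => fine (nui i `](Phi x - s)%R, (Phi x + s)%R[%classic) /
        fine (nu `](Phi x - s)%R, (Phi x + s)%R[%classic)) (window r t n x))%R.
    by apply/funext => n; rewrite nuiE.
  exact: cvg_comp (window_cvg x) h2x.
suff G : forall s : seq letter, {ae lam, forall x : S, x 0%N \in s ->
    (0 < f (x 0%N) (Phi x))%R /\ ratio lam n x @[n --> \oo] --> f (x 0%N) (Phi x)}.
  by apply: filterS (G (enum (predT : pred letter))) => x; apply; rewrite mem_enum.
elim => [|j s ih]; first exact: aeW.
by apply: filterS2 ih (H j) => x h1 h2; rewrite inE => /predU1P[xj|]; [rewrite xj; exact: h2|exact: h1].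
Qed.

Lemma gain_cvg : {ae lam, forall x : S, gain lam n x @[n --> \oo] --> gain_lim lam x}.
Proof.
have [f [mf f01 fE fcvg]] := coding_density.
move: fcvg; apply: filterS => x [fx cx].
have cc : cvgn (ratio lam ^~ x) by apply/cvg_ex; eexists; exact: cx.
rewrite /gain_lim (cvg_limn_supE cc) (cvg_lim _ cx)// clamp_id//.
by apply: cvgN; apply: continuous_cvg => //; exact: continuous_ln.
Qed.

End one_measure.

Lemma is_condexp_le (lam : measure_on S) (F g h : S -> R) :
  is_condexp lam (coding_algebra r t) F g -> is_condexp lam (coding_algebra r t) F h ->
  {ae lam, forall x, (g x <= h x)%R}.
Proof.
move=> [ag ig eg] [ah ih eh].
pose A := [set x | (h x < g x)%R].
(* The set {h < g} is the countable union over the rationals q of {h < q < g}, whose members come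
   from Borel sets of the line. *)
have algA : coding_algebra r t A.
  pose B k : set S := if @unpickle rat k is Some q then
    [set x | (h x < ratr q)%R] `&` [set x | (ratr q < g x)%R] else set0.
  have /choice[C CP] : forall k, exists C, measurable C /\ Phi @^-1` C = B k.
    move=> k; rewrite /B; case: unpickle => [q|]; last by exists set0; rewrite preimage_set0.
    have [D mD] := ah `]-oo, (ratr q : R)[%classic (measurable_itv _).
    have [E mE] := ag `](ratr q : R), +oo[%classic (measurable_itv _).
    rewrite !setTI => Ee De; exists (D `&` E); split; first exact: measurableI.
    rewrite preimage_setI De Ee; apply/seteqP.
    by split => x /=; rewrite !in_itv/= andbT.
  exists (\bigcup_k C k); first by apply: bigcupT_measurable => k; have [] := CP k.
  rewrite setTI preimage_bigcup; apply/seteqP; split => x /=.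
    move=> [k _]; rewrite -[(_ @^-1` _) x]/((Phi @^-1` C k) x); have [_ ->] := CP k.
    by rewrite /B; case: unpickle => // q [/= h1 h2]; exact: lt_trans h1 h2.
  move=> /rat_in_itvoo[q]; rewrite in_itv/= => /andP[h1 h2].
  exists (pickle q) => //; rewrite -[_ x]/((Phi @^-1` C (pickle q)) x).
  by have [_ ->] := CP (pickle q); rewrite /B pickleK.
have mA : measurable A.
  by case: algA => C mC <-; exact: measurable_coding.
have igA := integrableS measurableT mA (@subsetT _ A) ig.
have ihA := integrableS measurableT mA (@subsetT _ A) ih.
have int0 : \int[lam]_(x in A) ((g x)%:E - (h x)%:E) = 0.
  rewrite integralB_EFin//.
  have -> : \int[lam]_(x in A) (g x)%:E = \int[lam]_(x in A) (h x)%:E by rewrite eg// eh.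
  by rewrite subee//; exact: integrable_fin_num ihA.
have mgh : measurable_fun A (fun x => (g x)%:E - (h x)%:E).
  by apply: emeasurable_funB; [exact: measurable_int igA|exact: measurable_int ihA].
have : {ae lam, forall x, A x -> (g x)%:E - (h x)%:E = 0}.
  apply/(ae_eq_integral_abs lam mA mgh); rewrite -[RHS]int0; apply: eq_integral => x.
  by move=> /set_mem hg; rewrite gee0_abs// -EFinB lee_fin subr_ge0 ltW.
apply: filterS => x H; rewrite leNgt; apply/negP => hg.
by have [/eqP] := H hg; rewrite subr_eq0 => /eqP gh; rewrite gh ltxx in hg.
Qed.

(** The version chosen by [condexp] agrees almost everywhere with the densities of [coding_density],
    to which [ratio] converges. *)
Lemma conditional_entropy_gain (lam : probability S R) :
  conditional_entropy r t lam = \int[lam]_x (gain_lim lam x)%:E.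
Proof.
have lamoo : (lam : measure_on S) setT < +oo.
  by rewrite [X in X < _](_ : _ = 1) ?ltry//; exact: probability_setT.
have [f [mf f01 fE fcvg]] := coding_density lamoo.
have mP := measurable_coding t hr.
have mfP i : mfunT (fun x => f i (Phi x)) by exact: measurableT_comp.
have bounded (h : S -> R) : mfunT h -> (forall x, (0 <= h x <= 1)%R) ->
    lam.-integrable setT (EFin \o h).
  move=> mh h01; apply: (@integrable_bounded _ _ _ _ _ 1) => // x.
  by have /andP[? ?] := h01 x; rewrite ger0_norm.
have fcond i : is_condexp lam (coding_algebra r t) \1_(cylinder [:: i]) (fun x => f i (Phi x)).
  split=> [B mB||A [B mB <-]].
  - exists (f i @^-1` B); last by rewrite setTI.
    exact: (measurable_preimage (mf _)).
  - exact: bounded.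
  - rewrite setTI -fE// integral_indic//.
    exact: (measurable_preimage mP).
pose g i := condexp lam (coding_algebra r t) \1_(cylinder [:: i]).
have gcond i : is_condexp lam (coding_algebra r t) \1_(cylinder [:: i]) (g i).
  by rewrite /g /condexp; case: xgetP => [h -> //|/(_ _ (fcond i))].
have mg i : mfunT (g i).
  move=> _ B mB; rewrite setTI; have [H _ _] := gcond i.
  have [C mC <-] := H _ mB; exact: mP.
have geq i : {ae lam, forall x, g i x = f i (Phi x)}.
  have := is_condexp_le (gcond i) (fcond i); have := is_condexp_le (fcond i) (gcond i).
  by apply: filterS2 => x h1 h2; apply/eqP; rewrite eq_le h1 h2.
have {}geq : {ae lam, forall x, forall i, g i x = f i (Phi x)}.
  suff G : forall s : seq letter, {ae lam, forall x i, i \in s -> g i x = f i (Phi x)}.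
    by apply: filterS (G (enum (predT : pred letter))) => x h i; apply: h; rewrite mem_enum.
  elim => [|j s ih]; first exact: aeW.
  by apply: filterS2 ih (geq j) => x h1 h2 i; rewrite inE => /predU1P[->//|]; exact: h1.
rewrite /conditional_entropy; apply: ae_eq_integral => //.
- apply/measurable_EFinP; apply: measurable_sum => i; apply: measurableT_comp => //.
  apply: measurable_funM; first exact: measurable_indic.
  by apply: measurable_ln_comp; exact: mg.
- apply/measurable_EFinP; apply: measurableT_comp => //; apply: measurable_ln_comp.
  apply: measurable_clamp; apply: measurable_fun_limn_sup => [x _|x _|n].
  + by exists 1%R => _ [n _ <-]; have /andP[] := ratio01 lamoo n x.
  + by exists 0%R => _ [n _ <-]; have /andP[] := ratio01 lamoo n x.
  + exact: (@measurable_ratio _ S (fun=> lam) id).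
- apply: filterS2 geq fcvg => x gx [fx cx] _; congr EFin.
  rewrite (bigD1 (x 0%N))//= big1 => [|i ix]; last first.
    by rewrite indicE memNset ?mul0r ?oppr0// => /cylinderP [] /esym/eqP; apply/negP.
  rewrite addr0 indicE mem_set ?mul1r; last exact/cylinderP.
  rewrite -[condexp _ _ _ x]/(g (x 0%N) x) gx.
  have cc : cvgn (ratio lam ^~ x) by apply/cvg_ex; eexists; exact: cx.
  by rewrite /gain_lim (cvg_limn_supE cc) (cvg_lim _ cx)// clamp_id.
Qed.

End letter_gain.

Section measurable_gain_lim.
Context d (Y : measurableType d).
Variables r t : letter -> R.
Hypothesis hr : forall i, 0 < r i < 1.

Lemma measurable_gain_lim (k : Y -> measure_on S) (xi : Y -> S) :
  (forall U, measurable U -> mfunT (k ^~ U)) -> (forall y, k y setT < +oo)%E -> mfunT xi ->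
  mfunT (fun y => gain_lim r t (k y) (xi y)).
Proof.
move=> mk koo mxi; apply: measurableT_comp => //; apply: measurable_ln_comp.
apply: measurable_clamp; apply: measurable_fun_limn_sup => [y _|y _|n].
- by exists 1 => _ [n _ <-]; have /andP[] := ratio01 t hr (koo y) n (xi y).
- by exists 0 => _ [n _ <-]; have /andP[] := ratio01 t hr (koo y) n (xi y).
- exact: measurable_ratio.
Qed.

Lemma gain_lim_ge0 (lam : set S -> \bar R) x : 0 <= gain_lim r t lam x.
Proof.
by rewrite oppr_ge0 ln_le0//; have /andP[] := clamp01 (limn_sup (ratio r t lam ^~ x)).
Qed.

End measurable_gain_lim.

(** * From cylinders to balls *)

Section coding_comparison.
Variables r t : letter -> R.
Hypothesis hr : forall i, 0 < r i < 1.
Variables nu m : measure_on S.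
Hypotheses (nuoo : (nu setT < +oo)%E) (moo : (m setT < +oo)%E).
Local Notation ball := (coding_ball r t).
Local Notation theta := (contraction r).
Local Notation cyl x n := (cylinder (prefix_word x n)).

Let nufin A : measurable A -> nu A \is a fin_num.
Proof. by move=> mA; rewrite ge0_fin_numE// (le_lt_trans _ nuoo)// le_measure ?inE. Qed.

Let mfin A : measurable A -> m A \is a fin_num.
Proof. by move=> mA; rewrite ge0_fin_numE// (le_lt_trans _ moo)// le_measure ?inE. Qed.

Let mball x s : measurable (ball x s). Proof. exact: measurable_coding_ball. Qed.

Let mcyl (u : seq letter) : measurable (cylinder u : set S).
Proof. exact: measurable_cylinder. Qed.

(* Cylinders of length k have diameter at most rho, so those meeting
   [G `&` ball x rho] lie in the ball of twice the radius. *)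
Lemma ball_mass_le (G : set S) k x rho c : measurable G -> 0 <= c ->
  (forall y, G y -> fine (nu (cyl y k)) <= c * fine (m (cyl y k))) ->
  2 * coding_bound r t * theta ^+ k <= rho ->
  fine (nu (G `&` ball x rho)) <= c * fine (m (ball x (2 * rho))).
Proof.
move=> mG c0 Gle kr.
pose b (u : seq letter) : R := `[< exists y, [/\ G y, ball x rho y & prefix_word y k = u] >]%:R.
have b0 u : 0 <= b u by [].
have mb : mfunT (fun y : S => (b (prefix_word y k))%:E : \bar R).
  by apply/measurable_EFinP; exact: (measurable_prefix_real b).
rewrite -lee_fin EFinM !fineK ?mfin ?nufin//; last exact: measurableI.
apply: (@le_trans _ _ (\int[nu]_y (b (prefix_word y k))%:E)%E).
  rewrite -[X in nu X]setIT -integral_indic//; last exact: measurableI.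
  apply: ge0_le_integral => //.
  - by apply: measurable_EFin_indic; exact: measurableI.
  - move=> y _; rewrite lee_fin indicE /b; case: (boolP (y \in _)) => // yG.
    by rewrite asboolT//; move: yG; rewrite inE => -[Gy By]; exists y.
apply: (@le_trans _ _ (c%:E * \int[m]_y (b (prefix_word y k))%:E)%E); last first.
  apply: lee_wpmul2l; first by rewrite lee_fin.
  rewrite -[X in m X]setIT -integral_indic//; apply: ge0_le_integral => //.
  - by move=> z _; rewrite lee_fin.
  - exact: measurable_EFin_indic.
  - move=> z _; rewrite lee_fin indicE /b; case: asboolP => [[y [Gy By yz]]|_]; last exact: ler0n.
    rewrite mem_set//; apply/coding_ballP.
    have zy : `|coding r t z - coding r t y| <= rho.
      by rewrite distrC (le_trans (coding_dist t hr yz)).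
    move: By => /coding_ballP By; rewrite -[coding r t z](subrK (coding r t y)) -addrA.
    by rewrite (le_lt_trans (ler_normD _ _))// mulr_natl mulr2n ler_ltD.
rewrite !ge0_integral_prefix_fun// ge0_sume_distrr => [|u _]; last first.
  by apply: mule_ge0 => //; rewrite lee_fin.
apply: lee_sum => u _; rewrite muleCA; have [bu|bu] := asboolP (exists y, [/\ G y, ball x rho y & prefix_word y k = u :> seq letter]).
  have [y [Gy _ <-]] := bu; apply: lee_wpmul2l; first by rewrite lee_fin.
  by rewrite -(fineK (nufin (mcyl _))) -(fineK (mfin (mcyl _))) -EFinM lee_fin Gle.
by rewrite /b asboolF// !mul0e.
Qed.

(** Cylinders reach diameter x at a length which is ln x / ln theta up to a constant; [C] absorbs
    this constant and N. *)
Let word_length (N : nat) : exists2 C : R, 0 <= C & forall x, 0 < x < 1 ->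
  exists k, [/\ (N <= k)%N, 2 * coding_bound r t * theta ^+ k <= x & k%:R <= C + ln x / ln theta].
Proof.
have theta0 := contraction_gt0 hr; have theta1 := contraction_lt1 hr.
have lth : ln theta < 0 by apply: ln_lt0; rewrite theta0.
have c1 : 0 < 2 * coding_bound r t + 1 by exact: window_factor_gt0.
have cb0 : 0 <= coding_bound r t by exact: le_trans (coding_le t hr (point : S)).
set c := 2 * coding_bound r t + 1 in c1 *.
have lc : 0 <= ln c by apply: ln_ge0; rewrite lerDr mulr_ge0.
exists (N%:R + 1 - ln c / ln theta) => [|x /andP[x0 x1]].
  by rewrite addr_ge0// ?addr_ge0// -mulrN -invrN divr_ge0// oppr_ge0 ltW.
have lx : ln x < 0 by apply: ln_lt0; rewrite x0.
set q := (ln x - ln c) / ln theta.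
have q0 : 0 <= q by rewrite /q -mulrNN -invrN divr_ge0// oppr_ge0 ?(ltW lth)// subr_le0 (le_trans (ltW lx)).
have /andP[q1 q2] := truncn_itv q0.
exists (N + (Num.truncn q).+1)%N; split; first exact: leq_addr.
  apply: (@le_trans _ _ (c * theta ^+ (N + (Num.truncn q).+1))).
    by rewrite ler_wpM2r ?exprn_ge0 ?(ltW theta0)// lerDl.
  rewrite -ler_ln ?posrE ?mulr_gt0 ?exprn_gt0// lnM ?posrE ?exprn_gt0// lnXn// -lerBrDl.
  by rewrite -[leLHS]mulr_natl -ler_ndivrMr// -/q natrD ler_wpDl// ltW.
rewrite natrD -natr1; have -> : N%:R + 1 - ln c / ln theta + ln x / ln theta = N%:R + (1 + q).
  by rewrite /q mulrBl !addrA addrAC.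
by rewrite lerD2l addrC lerD2l.
Qed.

(** The first bound is the maximal inequality. The second is obtained on the sets [G i N] where the
    cylinders are comparable from length N on: around almost every point of such a set the nu-mass
    of a ball is at most a constant times its nu-mass inside the set, again by the maximal
    inequality. *)
Lemma ae_coding_comparison : {ae nu, forall x : S, forall e, 0 < e -> \forall n \near \oo,
    fine (nu (cyl x n)) <= expR (e * n%:R) * fine (m (cyl x n))} -> {ae nu, forall x : S,
    (exists2 c, 0 < c & forall s, 0 < s -> fine (m (ball x s)) <= c * fine (nu (ball x s))) /\
    (forall e, 0 < e -> exists2 c, 0 < c & forall s, 0 < s < 1 ->
      fine (nu (ball x s)) <= c * expR (- (e * ln s)) * fine (m (ball x (2 * s))))}.
Proof.
move=> H; have mP := measurable_coding t hr.
have L := ae_ball_comparison mP nu moo.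
pose G (i N : nat) := \bigcap_(n in [set n | (N <= n)%N]) [set y : S |
  fine (nu (cyl y n)) <= expR (i.+1%:R^-1 * n%:R) * fine (m (cyl y n))].
have mG i N : measurable (G i N).
  apply: bigcap_measurable => [|n _]; first by exists N => /=.
  exact: (measurable_pred (measurable_prefix_fun n
    (fun u => fine (nu (cylinder u)) <= expR (i.+1%:R^-1 * n%:R) * fine (m (cylinder u))))).
have U : {ae nu, forall x : S, forall i N : nat, G i N x -> exists2 c : R, (0 < c)%R &
    forall s, (0 < s)%R -> (nu (ball x s) <= c%:E * nu (G i N `&` ball x s))%E}.
  apply: ae_foralln => i; apply: ae_foralln => N.
  have [E [mE E0 HE]] := ae_ball_comparison mP (mrestr nu (mG i N)) nuoo.
  exists (E `&` G i N); split; [exact: measurableI|exact: E0|].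
  move=> x /=; apply: contra_notP => nE Gx; apply: contrapT => nex; apply: nE; split => //.
  apply: HE => -[c c0 hc]; apply: nex; exists c => // s s0.
  by rewrite setIC; exact: hc.
apply: filterS3 H L U => x Hx [c c0 Lx] Ux; split.
  exists c => // s s0; rewrite -lee_fin EFinM !fineK ?nufin ?mfin//; exact: Lx.
move=> e e0; have theta0 := contraction_gt0 hr; have theta1 := contraction_lt1 hr.
have lth : ln theta < 0 by apply: ln_lt0; rewrite theta0.
have el : 0 < (e * - ln theta)^-1 by rewrite invr_gt0 mulr_gt0// oppr_gt0.
(* For k close to ln s / ln theta this choice makes exp (k / (i + 1)) at most a constant times
   s^(-e). *)
pose i := Num.truncn (e * - ln theta)^-1.
have ie : i.+1%:R^-1 <= e * - ln theta.
  have /andP[_ h] := truncn_itv (ltW el).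
  by rewrite -[leRHS]invrK lef_pV2 ?posrE// ltW.
have i0 : 0 < i.+1%:R^-1 :> R by rewrite invr_gt0.
have [N _ HN] := Hx _ i0.
have GN : G i N x by move=> n /= /HN.
have [c' c'0 Hc] := Ux _ _ GN.
have [C C0 HC] := word_length N.
exists (c' * expR (e * - ln theta * C)) => [|s s01]; first by rewrite mulr_gt0 ?expR_gt0.
have [k [Nk ks kC]] := HC s s01; have /andP[s0 s1] := s01.
have h1 : fine (nu (ball x s)) <= c' * fine (nu (G i N `&` ball x s)).
  by rewrite -lee_fin EFinM !fineK ?nufin//; [exact: Hc|exact: measurableI].
apply: le_trans h1 _; rewrite -!mulrA ler_pM2l//.
have h2 := ball_mass_le x (mG i N) (expR_ge0 (i.+1%:R^-1 * k%:R)) (fun y Gy => Gy k Nk) ks.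
apply: le_trans h2 _; rewrite mulrA -expRD ler_wpM2r ?fine_ge0// ler_expR.
apply: (@le_trans _ _ (e * - ln theta * k%:R)); first by rewrite ler_wpM2r.
apply: (@le_trans _ _ (e * - ln theta * (C + ln s / ln theta))).
  by apply: ler_wpM2l kC; rewrite mulr_ge0 ?(ltW e0)// oppr_ge0 ltW.
by rewrite le_eqVlt; apply/orP; left; apply/eqP; field; rewrite lt_eqF.
Qed.

End coding_comparison.

End symbolic.

(** As V has mean 1, it cannot vanish at the root almost surely. *)
Lemma exists_root_gt0 (R : realType) (a : nat) (ha : (2 <= a)%N) d (Omega : measurableType d)
    (P : probability Omega R) (Pa : probability (product_space (seq (letter ha)) Omega) R)
    (V : Omega -> R) (A : product_space (seq (letter ha)) Omega -> Prop) :
  is_product_measure P Pa -> mfunT V -> (forall z, 0 <= V z) ->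
  (\int[P]_z (V z)%:E = 1)%E -> {ae Pa, forall w, A w} -> exists2 w, A w & 0 < V (w [::]).
Proof.
move=> hPa mV V0 V1 H; apply: contrapT => nex.
have z : {ae Pa, forall w : product_space (seq (letter ha)) Omega, setT w -> (V (w [::]))%:E = 0%E}.
  apply: filterS H => w Aw _; congr EFin; apply/eqP; rewrite eq_le V0 andbT leNgt.
  by apply/negP => Vw; apply: nex; exists w.
have mVr : mfunT (fun w : product_space (seq (letter ha)) Omega => (V (w [::]))%:E).
  by apply/measurable_EFinP; exact: measurableT_comp mV (@measurable_eval _ _ _ [::]).
have : (\int[Pa]_w (cst 1 w * (V (w [::]))%:E) = \int[Pa]_w cst 1 w * \int[P]_z (V z)%:E)%E.
  by apply: (integral_indep_coordinate hPa (v := [::])) => //; exact/measurable_EFinP.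
rewrite V1 mule1 (eq_integral (fun w : product_space (seq (letter ha)) Omega => (V (w [::]))%:E)) => [|w _]; last by rewrite mul1e.
rewrite (ae_eq_integral (cst 0%E))// integral0 integral_cst// mul1e.
rewrite [X in _ = X](_ : _ = 1%E); last exact: probability_setT.
by move/eqP; rewrite eq_sym onee_eq0.
Qed.


(** * The natural extension in terms of past and future *)

Section cascade.
Context (R : realType) (a : nat) (ha : (2 <= a)%N).
Local Notation measure_on T := {measure set T -> \bar R}.
Local Notation letter := (letter ha).
Local Notation S := (symbolic nat ha).
Local Notation Sigma := (symbolic int ha).
Local Notation sshift := (@Defs.shift a ha).
Context d (Omega : measurableType d).
Local Notation W := (product_space (seq letter) Omega).
Local Notation X := ((S * W) * S)%type.
Local Open Scope ereal_scope.
Variables (mup : probability S R) (mu : probability Sigma R).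
Variable kappa : R.-pker S ~> S.
Hypothesis hmup : shift_ergodic mup.
Hypothesis hmu : natural_extension mup mu.
Hypothesis hkappa : is_disintegration mu kappa.
Variables (P : probability Omega R) (Pa : probability W R).
Hypothesis hPa : is_product_measure P Pa.
Variable V : Omega -> R.
Hypothesis mV : mfunT V.
Hypothesis V0 : forall w, (0 <= V w)%R.
Hypothesis V1 : \int[P]_x (V x)%:E = 1.

Lemma measurable_past : mfunT (@past a ha).
Proof. by apply: measurable_fun_symbolic => i l; exact: measurable_coordinate. Qed.

Lemma measurable_future : mfunT (@future a ha).
Proof. by apply: measurable_fun_symbolic => i l; exact: measurable_coordinate. Qed.

Definition pastm : measure_on S := image_measure mu measurable_past.

Lemma pastmT : pastm setT = 1.
Proof. by rewrite /pastm /= /pushforward preimage_setT; exact: probability_setT. Qed.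

Lemma kappaT im : kappa im setT = 1. Proof. exact: prob_kernel. Qed.

Let mkappa U : measurable U -> mfunT (kappa ^~ U).
Proof. exact: measurable_kernel. Qed.

Let kappaoo im : kappa im setT < +oo. Proof. by rewrite kappaT ltry. Qed.

(* The law of (past, future) under mu. *)
Definition extm : measure_on (S * S) := mprod pastm mkappa kappaoo.

Lemma integral_extm (f : S * S -> \bar R) : (forall p, 0 <= f p) -> mfunT f ->
  \int[extm]_p f p = \int[pastm]_im \int[kappa im]_x f (im, x).
Proof. exact: integral_mprod. Qed.

Lemma extmX A B : measurable A -> measurable B -> extm (A `*` B) = \int[pastm]_(im in A) kappa im B.
Proof. exact: mprodX. Qed.

Lemma extmE A : measurable A -> extm A = mu [set i | A (past i, future i)].
Proof.
have mpf : mfunT (fun i : Sigma => (past i, future i)).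
  by apply/measurable_fun_pairP; split; [exact: measurable_past|exact: measurable_future].
move=> mA; rewrite -[RHS]/(image_measure mu mpf A).
apply: eq_measure_rectangle => // [|B D mB mD]; last first.
  by rewrite [LHS]mprodX//; exact/esym/hkappa.
rewrite -setXTT [X in X < _]mprodX//; under eq_integral do rewrite kappaT.
by rewrite integral_cst// mul1e pastmT ltry.
Qed.

Lemma extmT : extm setT = 1.
Proof. by rewrite extmE//; exact: probability_setT. Qed.

Lemma extm_future C : measurable C -> extm (setT `*` C) = (mup : measure_on S) C.
Proof.
move=> mC; rewrite extmE; last exact: measurableX.
rewrite -[RHS]hmu.2// /pushforward; congr (mu _); apply/seteqP; split => i /=; first by case.
by split.
Qed.

(** The shift of the natural extension in the coordinates (past, future). *)
Definition ext_shift (p : S * S) : S * S := (scons (p.2 0%N) p.1, sshift p.2).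

Lemma measurable_ext_shift : mfunT ext_shift.
Proof.
apply/measurable_fun_pairP; split; last first.
  exact: (measurableT_comp (@measurable_shift a ha) measurable_snd).
apply: measurable_fun_symbolic => -[|i] l /=.
  rewrite (_ : [set _ | _] = snd @^-1` [set x : S | x 0%N = l])//.
  rewrite -[X in measurable X]setTI; apply: measurable_snd => //.
  exact: measurable_coordinate.
rewrite (_ : [set _ | _] = fst @^-1` [set x : S | x i = l])//.
rewrite -[X in measurable X]setTI; apply: measurable_fst => //.
exact: measurable_coordinate.
Qed.

Lemma past_shiftZ (i : Sigma) : past (shiftZ i) = scons (future i 0%N) (past i).
Proof.
apply/funext => -[|n] /=; rewrite /past /shiftZ /future /=; congr (i _); lia.
Qed.

Lemma future_shiftZ (i : Sigma) : future (shiftZ i) = sshift (future i).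
Proof.
by apply/funext => n; rewrite /future /shiftZ /Defs.shift; congr (i _); lia.
Qed.

Lemma ext_shift_inv A : measurable A -> extm (ext_shift @^-1` A) = extm A.
Proof.
move=> mA; have mSA : measurable (ext_shift @^-1` A).
  exact: (measurable_preimage measurable_ext_shift).
rewrite !extmE// -[RHS]hmu.1; last first.
  have mpf : mfunT (fun i : Sigma => (past i, future i)).
    by apply/measurable_fun_pairP; split; [exact: measurable_past|exact: measurable_future].
  by have := mpf measurableT _ mA; rewrite setTI.
by congr (mu _); apply/funext => i /=; rewrite past_shiftZ future_shiftZ.
Qed.

Lemma ext_shift_cylinder i v C : ext_shift @^-1` (cylinder (i :: v) `*` C) =
  cylinder v `*` (cylinder [:: i] `&` sshift @^-1` C).
Proof.
apply/seteqP; split => -[im x]; rewrite /ext_shift !cylinder_cons cylinder_nil /=.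
  by move=> [[/= <- ?] ?].
by move=> [? [[<- _] ?]].
Qed.

Lemma pi_extm (A : set (S * S)) (c : R) : measurable A -> (0 <= c)%R ->
  (forall v C, measurable C -> extm (A `&` (cylinder v `*` C)) = c%:E * extm (cylinder v `*` C)) ->
  forall E, measurable E -> extm (A `&` E) = c%:E * extm E.
Proof.
move=> mA c0 H E mE.
pose cn := NngNum c0.
rewrite setIC -[LHS]/(mrestr extm mA E) -[RHS]/(mscale cn extm E).
apply: eq_measure_cylinderX => // [|v C mC].
  by rewrite /= /mrestr setTI -ge0_fin_numE// pmeasure_fin// extmT.
by rewrite /= /mrestr setIC H.
Qed.

(** The trace of an invariant A on the future is shift-invariant and dominated by mup, hence a
    multiple of it: A is independent of the future. Shifting makes A independent of each finite
    piece of the past as well, and therefore of itself. *)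
Lemma ext_ergodic A : measurable A -> ext_shift @^-1` A = A -> extm A = 0 \/ extm A = 1.
Proof.
move=> mA invA.
have msnd : mfunT (snd : S * S -> S) by exact: measurable_snd.
pose rho := image_measure (mrestr extm mA) msnd.
have rhoE C : rho C = extm (A `&` (setT `*` C)).
  rewrite /rho /= /pushforward /mrestr setIC; congr (extm (A `&` _)).
  by apply/seteqP; split => -[im x] //= -[].
have fA : extm A \is a fin_num.
  by rewrite pmeasure_fin// extmT.
have H1 C : measurable C -> rho C = extm A * mup C.
  move=> mC.
  have -> : extm A = rho setT by rewrite rhoE setXTT setIT.
  apply: (@ergodic_invariant_measure _ _ _ mup sshift) => //.
  - exact: probability_setT.
  - exact: measurable_shift.
  - exact: hmup.1.
  - exact: hmup.2.
  - move=> B mB; rewrite rhoE -extm_future// le_measure ?inE//; last exact: measurableX.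
    by apply: measurableI => //; exact: measurableX.
  - move=> B mB; rewrite !rhoE.
    have <- : ext_shift @^-1` (A `&` (setT `*` B)) = A `&` (setT `*` (sshift @^-1` B)).
      rewrite preimage_setI invA; congr (_ `&` _); by apply/seteqP; split.
    by rewrite ext_shift_inv//; apply: measurableI => //; exact: measurableX.
have H2 v : forall C, measurable C -> extm (A `&` (cylinder v `*` C)) =
     (fine (extm A))%:E * extm (cylinder v `*` C).
  elim: v => [|i v ih] C mC.
    by rewrite fineK// cylinder_nil -rhoE H1// extm_future.
  have mvC : measurable (cylinder (i :: v) `*` C).
    by apply: measurableX => //; exact: measurable_cylinder.
  rewrite -(ext_shift_inv mvC) -(ext_shift_inv (measurableI _ _ mA mvC)).
  rewrite preimage_setI invA ext_shift_cylinder ih//.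
  apply: measurableI; first exact: measurable_cylinder.
  exact: (measurable_preimage (@measurable_shift _ _)).
have := pi_extm mA (fine_ge0 (measure_ge0 _ A)) H2 mA.
rewrite setIid -(fineK fA) -EFinM => -[]; move: (fine _) => x /eqP.
have [->|x0] := eqVneq x 0%R; first by left.
rewrite -subr_eq0 -{1}[x]mulr1 -mulrBr mulf_eq0 (negbTE x0)/= subr_eq0 => /eqP <-.
by right.
Qed.

(** The conditional probability of the next letter given the past. *)
Definition letter_prob (i : letter) (im : S) : \bar R := kappa im (cylinder [:: i]).
Local Notation p := letter_prob.

Lemma measurable_letter_prob i : mfunT (p i).
Proof. by apply: mkappa; exact: measurable_cylinder. Qed.

Lemma letter_prob_le1 i im : p i im <= 1.
Proof. by rewrite -(kappaT im) le_measure ?inE//; exact: measurable_cylinder. Qed.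

Lemma letter_prob_fin i im : p i im \is a fin_num.
Proof. by rewrite ge0_fin_numE// (le_lt_trans (letter_prob_le1 i im))// ltry. Qed.

Lemma sum_letter_prob im : \sum_i p i im = 1.
Proof.
rewrite -(kappaT im) (measure_cylinder1 (kappa im))//.
by apply: eq_bigr => i _; rewrite setIT.
Qed.

(** Stationarity: [pastm] is invariant for the chain that prepends the letter i to the past with
    probability [letter_prob i]. *)
Lemma integral_pastm_scons (F : S -> \bar R) : (forall x, 0 <= F x) -> mfunT F ->
  \int[pastm]_im F im = \int[pastm]_im \sum_i F (scons i im) * p i im.
Proof.
move=> F0 mF.
have mF1 : mfunT (F \o (fst : S * S -> S)).
  exact: measurableT_comp mF measurable_fst.
transitivity (\int[extm]_p F p.1).
  rewrite integral_extm//; apply: eq_integral => im _.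
  rewrite (eq_integral (cst (F im)))// integral_cst//.
  by rewrite -[X in _ = _ * X]/(kappa im setT) kappaT mule1.
rewrite -(ge0_integral_image measurable_ext_shift ext_shift_inv)//.
rewrite integral_extm//; last exact: measurableT_comp mF1 measurable_ext_shift.
by apply: eq_integral => im _; rewrite (integral_letter _ (f := fun i => F (scons i im))).
Qed.

Lemma ae_scons (Q : S -> Prop) : {ae pastm, forall im, Q im} ->
  {ae pastm, forall im, forall i, p i im = 0 \/ Q (scons i im)}.
Proof.
move=> [N [mN N0 QN]].
have mi : mfunT (fun x => (\1_N x)%:E : \bar R).
  exact: measurable_EFin_indic.
have i0 x : 0 <= (\1_N x)%:E :> \bar R by rewrite lee_fin.
have mG : mfunT (fun im => \sum_i (\1_N (scons i im))%:E * p i im).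
  apply: emeasurable_sum => i; apply: emeasurable_funM; last exact: measurable_letter_prob.
  exact: (measurableT_comp mi (measurable_scons i)).
have G0 im : 0 <= \sum_i (\1_N (scons i im))%:E * p i im.
  by apply: sume_ge0 => i _; rewrite mule_ge0// lee_fin.
have := integral_pastm_scons i0 mi; rewrite integral_indic// setIT N0 => /esym I0.
have : {ae pastm, forall im, setT im -> \sum_i (\1_N (scons i im))%:E * p i im = 0}.
  apply/(ae_eq_integral_abs pastm measurableT mG).
  by rewrite -[RHS]I0; apply: eq_integral => x _; rewrite gee0_abs.
apply: filterS => im /(_ I) /eqP H i; apply: contrapT => /not_orP[pi0 nQ].
move: H; rewrite seq_psume_eq0; last by move=> j _; rewrite mule_ge0// lee_fin.
move=> /allP /(_ i (mem_index_enum _)) /= /eqP.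
by rewrite indicE mem_set ?mul1e//; exact: QN.
Qed.

(** Both sides have the same integral over every set of pasts, by the invariance of [extm]. Testing
    on the countably many cylinders gives one null set for all B. *)
Lemma disintegration_scons : {ae pastm, forall im, forall i B, measurable B ->
  kappa im (cylinder [:: i] `&` sshift @^-1` B) = p i im * kappa (scons i im) B}.
Proof.
have H1 i B : measurable B -> {ae pastm, forall im,
    kappa im (cylinder [:: i] `&` sshift @^-1` B) = p i im * kappa (scons i im) B}.
  move=> mB.
  have miB : measurable (cylinder [:: i] `&` sshift @^-1` B).
    apply: measurableI; first exact: measurable_cylinder.
    exact: (measurable_preimage (@measurable_shift _ _)).
  have mk : mfunT (fun im => kappa (scons i im) B).
    exact: measurableT_comp (mkappa mB) (measurable_scons i).
  have mr : mfunT (fun im => p i im * kappa (scons i im) B).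
    by apply: emeasurable_funM => //; exact: measurable_letter_prob.
  have mk2 : mfunT (fun im => kappa im (cylinder [:: i] `&` sshift @^-1` B)).
    exact: mkappa.
  have ik : pastm.-integrable setT (fun im => kappa im (cylinder [:: i] `&` sshift @^-1` B)).
    apply/integrableP; split => //; rewrite (@le_lt_trans _ _ (\int[pastm]_x 1))//.
      apply: ge0_le_integral => //; first exact: measurableT_comp.
      by move=> x _; rewrite gee0_abs// pmeasure_le1// kappaT.
    by rewrite integral_cst// mul1e pastmT ltry.
  have := integral_ae_eq measurableT ik mr; case/(_ _)/Wrap => [A _ mA|].
    rewrite -extmX//.
    (* The set of pasts that begin with i and continue in A: the product of A with the futures that
       begin with i and continue in B is the preimage of D x B. *)
    pose D := cylinder [:: i] `&` sshift @^-1` A.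
    have mD : measurable D.
      apply: measurableI; first exact: measurable_cylinder.
      exact: (measurable_preimage (@measurable_shift _ _)).
    have -> : A `*` (cylinder [:: i] `&` sshift @^-1` B) = ext_shift @^-1` (D `*` B).
      apply/seteqP; split => -[im x]; rewrite /D /ext_shift !cylinder_cons !cylinder_nil /=.
        by move=> [? [[? _] ?]].
      by move=> [[[? _] ?] ?].
    rewrite ext_shift_inv; last exact: measurableX.
    rewrite extmX// [LHS]integral_mkcond integral_pastm_scons.
    - rewrite [RHS]integral_mkcond; apply: eq_integral => im _; rewrite patchE.
      have E j : (scons j im \in D) = (j == i) && (im \in A).
        apply/idP/andP; rewrite !inE /D cylinder_cons cylinder_nil /=.
          by move=> [[-> _] ?]; rewrite eqxx.
        by move=> [/eqP -> ?].
      rewrite (bigD1 i)//= big1 ?adde0 => [|j /negbTE ji]; rewrite patchE E ?ji ?mul0e//.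
      by rewrite eqxx/=; case: ifPn => _; [rewrite muleC|exact: mul0e].
    - by move=> im; rewrite patchE; case: ifP.
    - apply/(measurable_restrictT _ mD); apply: measurable_funTS; exact: mkappa.
  by apply: filterS => im; exact.
pose Q im i u := kappa im (cylinder [:: i] `&` sshift @^-1` cylinder u) =
   p i im * kappa (scons i im) (cylinder u).
have : {ae pastm, forall im, forall n : nat, forall i u,
    @unpickle (letter * seq letter)%type n = Some (i, u) -> Q im i u}.
  apply/ae_foralln => n; case: unpickle => [[i u]|].
    by apply: filterS (H1 i _ (measurable_cylinder u)) => im H j v [<- <-].
  exact: nearW.
apply: filterS => im H i B mB.
have {}H u : Q im i u by apply: (H (pickle (i, u))); rewrite pickleK.
have mi : measurable (cylinder [:: i] : set S) by exact: measurable_cylinder.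
pose c := NngNum (fine_ge0 (measure_ge0 (kappa im) (cylinder [:: i]))).
have cE : c%:num%:E = p i im by rewrite /= fineK// letter_prob_fin.
pose m1 := image_measure (mrestr (kappa im) mi) (@measurable_shift a ha).
have m1E D : m1 D = kappa im (cylinder [:: i] `&` sshift @^-1` D).
  by rewrite /m1 /= /pushforward /mrestr setIC.
rewrite -m1E -cE -[RHS]/(mscale c (kappa (scons i im)) B).
apply: eq_measure_cylinder => // [|u].
  by rewrite m1E preimage_setT setIT -ge0_fin_numE// pmeasure_fin// kappaT.
by rewrite m1E -[RHS]/(c%:num%:E * kappa (scons i im) (cylinder u)) cE; exact: H.
Qed.

Local Notation pm := pastm.
Let pmoo : pm setT < +oo. Proof. by rewrite pastmT ltry. Qed.

(** * The skew shift and its transfer operator *)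

Section transfer.

Definition subtree (i : letter) (w : W) : W := fun u => w (i :: u).

Lemma measurable_subtree i : mfunT (subtree i).
Proof. by apply: measurable_fun_product => u; exact: measurable_eval. Qed.

Definition off_branch (i : letter) (u : seq letter) : bool := if u is j :: _ then j != i else true.

(* The tree w'' with its subtree above the letter i replaced by w'. *)
Definition graft (i : letter) (w'' w' : W) : W := merge (off_branch i) behead (w'', w').

Lemma subtree_graft i w'' w' : subtree i (graft i w'' w') = w'.
Proof. by apply/funext => u; rewrite /subtree /graft /merge /= eqxx. Qed.

Lemma graft_root i w'' w' : graft i w'' w' [::] = w'' [::].
Proof. by []. Qed.

Section one_step.

Let Pam : measure_on W := Pa.
Let PaT : Pam setT = 1. Proof. exact: probability_setT. Qed.
Let mPa (A : set W) : measurable A -> mfunT (fun _ : S => Pam A).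
Proof. by []. Qed.
Let Paoo (y : S) : Pam setT < +oo. Proof. by rewrite PaT ltry. Qed.

Definition basem : measure_on (S * W) := mprod pastm (K := fun=> Pam) mPa Paoo.

Lemma integral_basem (f : S * W -> \bar R) : (forall p, 0 <= f p) -> mfunT f ->
  \int[basem]_p f p = \int[pastm]_im \int[Pa]_w f (im, w).
Proof. exact: integral_mprod. Qed.

Lemma basemT : basem setT = 1.
Proof.
rewrite -setXTT [LHS]mprodX// (eq_integral (cst 1)); last by move=> *; exact: PaT.
by rewrite integral_cst// mul1e; exact: pastmT.
Qed.

Lemma integral_graft i (f : W -> \bar R) : (forall w, 0 <= f w) -> mfunT f ->
  \int[Pa]_w'' \int[Pa]_w' f (graft i w'' w') = \int[Pa]_w f w.
Proof.
apply: (integral_merge hPa); rewrite /off_branch => -[|j u] [|k v] //=.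
by rewrite !negbK => /eqP -> /eqP -> ->.
Qed.

Lemma integral_subtree i (f : W -> \bar R) : (forall w, 0 <= f w) ->
  mfunT f -> \int[Pa]_w f (subtree i w) = \int[Pa]_w f w.
Proof.
move=> f0 mf; rewrite -(@integral_graft i)//; last first.
  exact: measurableT_comp mf (measurable_subtree i).
under eq_integral do (under eq_integral do rewrite subtree_graft).
by rewrite integral_cst//= PaT mule1.
Qed.

Lemma ae_subtree i (Q : W -> Prop) : {ae Pa, forall w, Q w} -> {ae Pa, forall w, Q (subtree i w)}.
Proof.
move=> [N [mN N0 QN]].
have mNi : measurable (subtree i @^-1` N).
  exact: (measurable_preimage (measurable_subtree _)).
exists (subtree i @^-1` N); split => //; last by move=> w nQ; exact: QN.
have i0 (w : W) : 0 <= (\1_N w)%:E :> \bar R by rewrite lee_fin.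
have mi : mfunT (fun w => (\1_N w)%:E : \bar R).
  exact: measurable_EFin_indic.
have := integral_subtree i i0 mi; rewrite [RHS]integral_indic// setIT => IN.
by rewrite -[RHS]N0 -[RHS]IN -(setIT (subtree i @^-1` N)) -integral_indic.
Qed.

Lemma integral_V_root : \int[Pa]_w (V (w [::]))%:E = 1.
Proof.
rewrite (integral_eval hPa [::] (f := fun x => (V x)%:E))//.
exact/measurable_EFinP.
Qed.

Lemma measurable_graft d' (T : measurableType d') (g : T -> S) (f1 f2 : T -> W) :
  mfunT g -> mfunT f1 -> mfunT f2 -> mfunT (fun t => graft (g t 0%N) (f1 t) (f2 t)).
Proof.
move=> mg mf1 mf2.
apply: (measurable_fun_case (g := fun t => g t 0%N) (f := fun i t => graft i (f1 t) (f2 t))) => i.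
  rewrite (_ : _ @^-1` _ = g @^-1` [set x : S | x 0%N = i])//.
  by rewrite -[X in measurable X]setTI; apply: mg => //; exact: measurable_coordinate.
apply: measurable_fun_product => u; rewrite /graft /merge.
case: (off_branch i u) => /=.
  exact: (measurableT_comp (@measurable_eval _ _ _ u) mf1).
exact: (measurableT_comp (@measurable_eval _ _ _ (behead u)) mf2).
Qed.

Lemma measurable_scons_fun d' (T : measurableType d') (g h : T -> S) : mfunT g -> mfunT h ->
  mfunT (fun t => scons (g t 0%N) (h t)).
Proof.
move=> mg mh.
apply: (measurable_fun_case (g := fun t => g t 0%N) (f := fun i t => scons i (h t))) => i.
  rewrite (_ : _ @^-1` _ = g @^-1` [set x : S | x 0%N = i])//.
  by rewrite -[X in measurable X]setTI; apply: mg => //; exact: measurable_coordinate.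
exact: measurableT_comp (measurable_scons i) mh.
Qed.

Definition skew (p : X) : X := ((scons (p.2 0%N) p.1.1, subtree (p.2 0%N) p.1.2), sshift p.2).

Lemma measurable_skew : mfunT skew.
Proof.
apply: measurable_fun_pair; last exact: measurableT_comp (@measurable_shift a ha) measurable_snd.
apply: measurable_fun_pair.
  apply: measurable_scons_fun; first exact: measurable_snd.
  exact: measurableT_comp measurable_fst measurable_fst.
apply: (measurable_fun_case (g := fun p : X => p.2 0%N)
  (f := fun i (p : X) => subtree i p.1.2)) => i.
  rewrite (_ : _ @^-1` _ = snd @^-1` [set x : S | x 0%N = i])//.
  by rewrite -[X in measurable X]setTI; apply: measurable_snd => //; exact: measurable_coordinate.
apply: measurableT_comp (measurable_subtree i) _.
exact: measurableT_comp measurable_snd measurable_fst.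
Qed.

(* The dual of composition with [skew]: the average of f over the preimages. *)
Definition transfer (f : X -> \bar R) (q : X) : \bar R := \int[Pa]_w'' ((V (w'' [::]))%:E *
    f ((sshift q.1.1, graft (q.1.1 0%N) w'' q.1.2), scons (q.1.1 0%N) q.2)).

Lemma transfer_ge0 f q : (forall p, 0 <= f p) -> 0 <= transfer f q.
Proof. by move=> f0; apply: integral_ge0 => w _; rewrite mule_ge0// lee_fin. Qed.

Lemma measurable_transfer_integrand f : mfunT f -> mfunT (fun z : X * W => ((V (z.2 [::]))%:E *
    f ((sshift z.1.1.1, graft (z.1.1.1 0%N) z.2 z.1.1.2), scons (z.1.1.1 0%N) z.1.2))).
Proof.
move=> mf.
have m1 : mfunT (fun z : X * W => z.1.1.1).
  exact: measurableT_comp measurable_fst (measurableT_comp measurable_fst measurable_fst).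
have m2 : mfunT (fun z : X * W => z.1.1.2).
  exact: measurableT_comp measurable_snd (measurableT_comp measurable_fst measurable_fst).
have m3 : mfunT (fun z : X * W => z.1.2).
  exact: measurableT_comp measurable_snd measurable_fst.
have m4 : mfunT (fun z : X * W => z.2) by exact: measurable_snd.
apply: emeasurable_funM.
  apply/measurable_EFinP.
  exact: measurableT_comp mV (measurableT_comp (@measurable_eval _ _ _ [::]) m4).
apply: measurableT_comp mf _; apply: measurable_fun_pair; last exact: (measurable_scons_fun m1 m3).
apply: measurable_fun_pair; first exact: measurableT_comp (@measurable_shift a ha) m1.
exact: (measurable_graft m1 m4 m2).
Qed.

Lemma measurable_transfer f : (forall p, 0 <= f p) -> mfunT f -> mfunT (transfer f).
Proof.
move=> f0 mf.
apply: (@measurable_integral_kernel _ _ X W R (fun=> Pam) (fun _ _ => measurable_cst _)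
  (fun=> (Paoo point)) (fun z : X * W => ((V (z.2 [::]))%:E *
    f ((sshift z.1.1.1, graft (z.1.1.1 0%N) z.2 z.1.1.2), scons (z.1.1.1 0%N) z.1.2)))).
- by move=> z; rewrite mule_ge0// lee_fin.
- exact: measurable_transfer_integrand.
Qed.

Section kernels.
Variables K1 K2 : S * W -> {finite_measure set S -> \bar R}.
Hypothesis mK1 : forall U, measurable U -> mfunT (K1 ^~ U).
Hypothesis mK2 : forall U, measurable U -> mfunT (K2 ^~ U).

Lemma finite_kernel_lty (K : S * W -> {finite_measure set S -> \bar R}) p : K p setT < +oo.
Proof. exact: (fin_num_fun_lty (fin_num_measure _)). Qed.

Definition skewm (K : S * W -> {finite_measure set S -> \bar R})
    (mK : forall U, measurable U -> mfunT (K ^~ U)) : {measure set X -> \bar R} :=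
  mprod basem (K := K) mK (finite_kernel_lty K).

(** Two kernels are needed because the approximation at level k + 1 recurses to the one at level k;
    the cascade itself recurses to itself. *)
Definition step_recursion p := forall i B, measurable B ->
  K1 p (cylinder [:: i] `&` sshift @^-1` B) =
  ((V (p.2 [::]))%:E * letter_prob i p.1) * K2 (scons i p.1, subtree i p.2) B.

Lemma integral_step_recursion p (g : S -> \bar R) : step_recursion p ->
  (forall x, 0 <= g x) -> mfunT g ->
  \int[K1 p]_x g x = \sum_i ((V (p.2 [::]))%:E * letter_prob i p.1) *
    \int[K2 (scons i p.1, subtree i p.2)]_y g (scons i y).
Proof.
move=> rp g0 mg.
have mi i : measurable (cylinder [:: i] : set S) by exact: measurable_cylinder.
have mii i : mfunT (fun x => (\1_(cylinder [:: i] : set S) x)%:E : \bar R).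
  exact: measurable_EFin_indic.
rewrite (eq_integral (fun x => \sum_i g x * (\1_(cylinder [:: i]) x)%:E)); last first.
  move=> x _; rewrite (bigD1 (x 0%N))//= indicE mem_set//= mule1 big1 ?adde0// => i /eqP ix.
  rewrite indicE memNset ?mule0// => /cylinderP /= [xi].
  by apply: ix; rewrite -xi.
rewrite ge0_integral_sum//; last 2 first.
- by move=> i; exact: emeasurable_funM.
- by move=> i x _; rewrite mule_ge0// lee_fin.
apply: eq_bigr => i _.
have c0 : (0 <= V (p.2 [::]) * fine (letter_prob i p.1))%R.
  by rewrite mulr_ge0// fine_ge0.
pose c := NngNum c0.
have cE : c%:num%:E = (V (p.2 [::]))%:E * letter_prob i p.1.
  by rewrite /= EFinM fineK// letter_prob_fin.
have mgi := measurableT_comp mg (measurable_scons i).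
have gi0 x : 0 <= (g \o scons i) x by exact: g0.
transitivity (\int[mrestr (K1 p) (mi i)]_x g (scons i (sshift x))).
  rewrite ge0_integral_mrestr//; last exact: measurableT_comp mgi (@measurable_shift a ha).
  rewrite [RHS]integral_mkcond; apply: eq_integral => x _; rewrite patchE indicE.
  case: ifPn; rewrite ?inE => xi; last by rewrite mule0.
  rewrite mule1; congr g; rewrite -[LHS]scons_shift; congr scons.
  by move: xi => /cylinderP /= [].
rewrite (@ge0_integral_image _ _ _ _ _ _ (mscale c (K2 (scons i p.1, subtree i p.2))) sshift
  (g \o scons i))//.
- by rewrite ge0_integral_mscale// -cE.
- exact: measurable_shift.
- move=> A mA; rewrite -[RHS]/(c%:num%:E * K2 _ A) cE -rp//.
  by rewrite [LHS]/= /mrestr setIC.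
Qed.

Lemma integral_skewm (K : S * W -> {finite_measure set S -> \bar R}) mK (f : X -> \bar R) :
  (forall p, 0 <= f p) -> mfunT f -> \int[@skewm K mK]_p f p = \int[basem]_p \int[K p]_x f (p, x).
Proof. exact: integral_mprod. Qed.

Hypothesis rec : {ae basem, forall p, step_recursion p}.

(** The recursion splits the integral by the first letter, [integral_pastm_scons] changes the past,
    and [integral_graft] separates the subtree from the rest of the tree, over which [transfer]
    averages. *)
Lemma integral_skew_transfer (F f : X -> \bar R) : (forall p, 0 <= F p) -> mfunT F ->
  (forall p, 0 <= f p) -> mfunT f ->
  \int[skewm mK1]_p (F (skew p) * f p) = \int[skewm mK2]_q (F q * transfer f q).
Proof.
move=> F0 mF f0 mf.
have mFs := measurableT_comp mF measurable_skew.
have mFf : mfunT (fun p => F (skew p) * f p) by exact: emeasurable_funM.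
have mtf := measurable_transfer f0 mf.
have mFt : mfunT (fun q => F q * transfer f q) by exact: emeasurable_funM.
have Ft0 q : 0 <= F q * transfer f q by rewrite mule_ge0// transfer_ge0.
have Ff0 p : 0 <= F (skew p) * f p by rewrite mule_ge0.
rewrite !integral_skewm//.
pose H i (p : S * W) := \int[K2 (scons i p.1, subtree i p.2)]_y
  (F ((scons i p.1, subtree i p.2), y) * f (p, scons i y)).
have mst i : mfunT (fun p : S * W => (scons i p.1, subtree i p.2)).
  apply: measurable_fun_pair.
    exact: measurableT_comp (measurable_scons i) measurable_fst.
  exact: measurableT_comp (measurable_subtree i) measurable_snd.
have mHi i : mfunT (fun z : X => F ((scons i z.1.1, subtree i z.1.2), z.2) * f (z.1, scons i z.2)).
  apply: emeasurable_funM; apply: measurableT_comp => //; apply: measurable_fun_pair => //.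
  - exact: measurableT_comp (mst i) measurable_fst.
  - exact: measurableT_comp (measurable_scons i) measurable_snd.
have mH i : mfunT (H i).
  apply: (@measurable_integral_kernel _ _ _ _ _
    (fun p : S * W => K2 (scons i p.1, subtree i p.2)) _ _
    (fun z : X => F ((scons i z.1.1, subtree i z.1.2), z.2) * f (z.1, scons i z.2))).
  - by move=> U mU; exact: measurableT_comp (mK2 mU) (mst i).
  - by move=> p; exact: finite_kernel_lty.
  - by move=> z; rewrite mule_ge0.
  - exact: mHi.
have H0 i p : 0 <= H i p by apply: integral_ge0 => y _; rewrite mule_ge0.
have mVr : mfunT (fun p : S * W => (V (p.2 [::]))%:E : \bar R).
  apply/measurable_EFinP.
  exact: measurableT_comp mV (measurableT_comp (@measurable_eval _ _ _ [::]) measurable_snd).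
have mp i : mfunT (fun p : S * W => letter_prob i p.1).
  exact: measurableT_comp (measurable_letter_prob i) measurable_fst.
have mVpH i : mfunT (fun p : S * W => ((V (p.2 [::]))%:E * letter_prob i p.1) * H i p).
  by apply: emeasurable_funM => //; exact: emeasurable_funM.
have VpH0 i p : 0 <= ((V (p.2 [::]))%:E * letter_prob i p.1) * H i p.
  by rewrite !mule_ge0// lee_fin.
transitivity (\int[basem]_p \sum_i ((V (p.2 [::]))%:E * letter_prob i p.1) * H i p).
  apply: ge0_ae_eq_integral => //.
  - apply: (@measurable_integral_kernel _ _ _ _ _ K1 _ _ (fun z : X => F (skew z) * f z)) => //.
    by move=> p; exact: finite_kernel_lty.
  - exact: emeasurable_sum.
  - by move=> p _; apply: integral_ge0.
  - by move=> p _; apply: sume_ge0.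
  - apply: filterS rec => p rp _.
    by rewrite (@integral_step_recursion p (fun x => F (skew (p, x)) * f (p, x)))//;
      exact: (measurable_fun_pair2 p mFf).
pose G im' := \int[Pa]_w' \int[K2 (im', w')]_y (F ((im', w'), y) * transfer f ((im', w'), y)).
have mG1 : mfunT (fun p : S * W => \int[K2 p]_y (F (p, y) * transfer f (p, y))).
  apply: (@measurable_integral_kernel _ _ _ _ _ K2 _ _ (fun z : X => F z * transfer f z)) => //.
  by move=> p; exact: finite_kernel_lty.
have G10 (p : S * W) : 0 <= \int[K2 p]_y (F (p, y) * transfer f (p, y)).
  by apply: integral_ge0.
rewrite [RHS]integral_basem// -[RHS]/(\int[pastm]_im G im) integral_pastm_scons; last 2 first.
- by move=> im; apply: integral_ge0.
- apply: (@measurable_integral_kernel _ _ S W R (fun=> Pam) (fun _ _ => measurable_cst _)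
    Paoo (fun p : S * W => \int[K2 p]_y (F (p, y) * transfer f (p, y)))) => //.
rewrite integral_basem//; last 2 first.
- by move=> p; apply: sume_ge0.
- exact: emeasurable_sum.
apply: eq_integral => im _.
rewrite (ge0_integral_sum _ measurableT (fun i => measurable_fun_pair2 im (mVpH i)))//.
apply: eq_bigr => i _.
transitivity (letter_prob i im * \int[Pa]_w ((V (w [::]))%:E * H i (im, w))).
  rewrite -ge0_integralZl//.
  - by apply: eq_integral => w _; rewrite /= muleAC muleC.
  - apply: emeasurable_funM; first exact: (measurable_fun_pair2 im mVr).
    exact: (measurable_fun_pair2 im (mH i)).
  - by move=> w _; rewrite mule_ge0// lee_fin.
rewrite muleC; congr (_ * _).
rewrite -(@integral_graft i)//; last 2 first.
- by move=> w; rewrite mule_ge0// lee_fin.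
- apply: emeasurable_funM; first exact: (measurable_fun_pair2 im mVr).
  exact: (measurable_fun_pair2 im (mH i)).
pose im' := scons i im.
pose J (z : (W * W) * S) := F ((im', z.1.2), z.2) *
  ((V (z.1.1 [::]))%:E * f ((im, graft i z.1.1 z.1.2), scons i z.2)).
have mz12 : mfunT (fun z : (W * W) * S => z.1.2).
  exact: measurableT_comp measurable_snd measurable_fst.
have mz11 : mfunT (fun z : (W * W) * S => z.1.1).
  exact: measurableT_comp measurable_fst measurable_fst.
have mz2 : mfunT (fun z : (W * W) * S => z.2) by exact: measurable_snd.
have mJ : mfunT J.
  apply: emeasurable_funM; last apply: emeasurable_funM.
  - apply: measurableT_comp mF _; apply: measurable_fun_pair => //.
    exact: measurable_fun_pair.
  - apply/measurable_EFinP.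
    exact: measurableT_comp mV (measurableT_comp (@measurable_eval _ _ _ [::]) mz11).
  - apply: measurableT_comp mf _; apply: measurable_fun_pair; last first.
      exact: measurableT_comp (measurable_scons i) mz2.
    apply: measurable_fun_pair => //.
    by have := measurable_graft (measurable_cst (scons i im)) mz11 mz12.
have J0 z : 0 <= J z by rewrite !mule_ge0// lee_fin.
have mJK : mfunT (fun z : W * W => \int[K2 (im', z.2)]_y J (z, y)).
  apply: (@measurable_integral_kernel _ _ _ _ _ (fun z : W * W => K2 (im', z.2))) => //.
  - move=> U mU; apply: measurableT_comp (mK2 mU) _.
    by apply: measurable_fun_pair => //; exact: measurable_snd.
  - by move=> p; exact: finite_kernel_lty.
transitivity (\int[Pa]_w'' \int[Pa]_w' \int[K2 (im', w')]_y J ((w'', w'), y)).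
  apply: eq_integral => w'' _; apply: eq_integral => w' _.
  rewrite /= graft_root -ge0_integralZl//; last 3 first.
  - exact: (measurable_fun_pair2 (im, graft i w'' w') (mHi i)).
  - by move=> y _; rewrite mule_ge0.
  - by rewrite lee_fin.
  rewrite /H /= subtree_graft; apply: eq_integral => y _.
  by rewrite /J /= muleCA.
have JK0 z : 0 <= \int[K2 (im', z.2)]_y J (z, y) by exact: integral_ge0.
(* The rest w'' of the tree is now to be integrated first, which produces the transfer. *)
etransitivity; first exact: (fubini_tonelli (m1 := Pa) (m2 := Pa) _ mJK JK0).
apply: eq_integral => w' _.
have mJw : mfunT (fun z : W * S => J ((z.1, w'), z.2)).
  apply: measurableT_comp mJ _; apply: measurable_fun_pair; last exact: measurable_snd.
  by apply: measurable_fun_pair => //; exact: measurable_fst.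
have Jw0 (z : W * S) : 0 <= J ((z.1, w'), z.2) by [].
etransitivity; first exact: (fubini_tonelli (m1 := Pa) (m2 := K2 (im', w')) _ mJw Jw0).
apply: eq_integral => y _; rewrite /transfer -ge0_integralZl//.
- exact: (measurable_fun_pair2 ((im', w'), y) (measurable_transfer_integrand mf)).
- by move=> w _; rewrite mule_ge0// lee_fin.
Qed.

End kernels.
End one_step.
End transfer.

Local Notation T := skew.
Local Notation base := basem.

(** * The cascades of the fibre measures *)

Section cascade_recursion.

Definition good_past (im : S) := forall i B, measurable B ->
  kappa im (cylinder [:: i] `&` sshift @^-1` B) = letter_prob i im * kappa (scons i im) B.

Lemma integral_good_past im i B (g : S -> \bar R) : good_past im -> measurable B ->
  mfunT g -> (forall x, 0 <= g x) ->
  \int[kappa im]_(x in cylinder [:: i] `&` sshift @^-1` B) g (sshift x) =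
  letter_prob i im * \int[kappa (scons i im)]_(y in B) g y.
Proof.
move=> gim mB mg g0.
have mi : measurable (cylinder [:: i] : set S) by exact: measurable_cylinder.
have msB : measurable (sshift @^-1` B).
  exact: (measurable_preimage (@measurable_shift _ _)).
have miB := measurableI _ _ mi msB.
pose c := NngNum (fine_ge0 (measure_ge0 (kappa im) (cylinder [:: i]))).
have cE : c%:num%:E = letter_prob i im by rewrite /= fineK// letter_prob_fin.
have mgs := measurableT_comp mg (@measurable_shift a ha).
have gs0 x : 0 <= (g \o sshift) x by exact: g0.
rewrite -(ge0_integral_mrestr _ miB mgs)//.
rewrite (@ge0_integral_image _ _ _ _ _ _ (mscale c (mrestr (kappa (scons i im)) mB)) sshift)//.
- by rewrite -cE ge0_integral_mscale// ge0_integral_mrestr.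
- exact: measurable_shift.
- move=> A mA; rewrite -[RHS]/(c%:num%:E * mrestr (kappa (scons i im)) mB A) cE.
  rewrite /mrestr /= -gim//; last exact: measurableI.
  by rewrite [LHS]/= /mrestr preimage_setI [in LHS]setIC -setIA (setIC (sshift @^-1` B)).
Qed.

Lemma ae_basem_fst (Q : S -> Prop) : {ae pastm, forall im, Q im} -> {ae basem, forall p, Q p.1}.
Proof.
move=> [N [mN N0 QN]]; exists (N `*` setT); split; first exact: measurableX.
  by rewrite [LHS]mprodX// null_set_integral.
by move=> [im w] /= nQ; split => //; exact: QN.
Qed.

(** In contrast to [cascade_density], the product begins at the root and stops one level earlier: it
    involves the labels of words shorter than k. *)
Definition root_density (k : nat) (w : W) (x : S) : R := (\prod_(j < k) V (w (prefix_word x j)))%R.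

Lemma root_density_ge0 k w x : (0 <= root_density k w x)%R.
Proof. by apply: prodr_ge0. Qed.

Lemma root_densityS k w x : root_density k.+1 w x =
  (V (w [::]) * root_density k (subtree (x 0%N) w) (sshift x))%R.
Proof.
rewrite /root_density big_ord_recl; congr (_ * _)%R; apply: eq_bigr => j _.
by rewrite lift0 prefix_wordS.
Qed.

Lemma root_density_cascade k w x : root_density k.+1 w x = (V (w [::]) * cascade_density V k w x)%R.
Proof. by rewrite /root_density big_ord_recl. Qed.

Lemma measurable_root_density k : mfunT (fun p : (S * W) * S => root_density k p.1.2 p.2).
Proof.
apply: measurable_prod => j _.
apply: (measurable_fun_case (g := fun p : (S * W) * S => prefix_word p.2 j)
  (f := fun u (p : (S * W) * S) => V (p.1.2 u))) => u.
  have [uj|uj] := eqVneq (size u) j.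
    rewrite (_ : _ @^-1` _ = snd @^-1` (cylinder u : set S)); last by rewrite -uj.
    by rewrite -[X in measurable X]setTI; apply: measurable_snd => //; exact: measurable_cylinder.
  rewrite (_ : _ @^-1` _ = set0)//; apply/seteqP; split => // p /= pu.
  by move: uj; rewrite -pu size_prefix_word eqxx.
exact: measurableT_comp mV (measurableT_comp (@measurable_eval _ _ _ u)
  (measurableT_comp measurable_snd measurable_fst)).
Qed.

Lemma measurable_root_density_fiber k w : mfunT (root_density k w).
Proof.
have := @measurable_root_density k; move/(measurable_fun_pair2 ((point, w) : S * W)).
exact.
Qed.

Lemma measurable_root_density_EFin k w : mfunT (fun x => (root_density k w x)%:E).
Proof. by apply/measurable_EFinP; exact: measurable_root_density_fiber. Qed.

Definition density_kernel_measure (k : nat) (p : S * W) : measure_on S :=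
  density_measure (kappa p.1) (measurable_root_density_fiber k p.2) (@root_density_ge0 k p.2).

Lemma root_density_bounded k w : exists C, forall x, (`|root_density k w x| <= C)%R.
Proof.
have [C HC] := prefix_fun_bounded (fun u => \prod_(j < k) V (w (take j u)))%R k.
exists C => x; rewrite (_ : root_density k w x = \prod_(j < k)
  V (w (take j (prefix_word x k))))%R//.
by apply: eq_bigr => j _; rewrite take_prefix_word// ltnW.
Qed.

Lemma density_kernel_lty k p : density_kernel_measure k p setT < +oo.
Proof.
have [C HC] := root_density_bounded k p.2.
have kT : kappa p.1 setT < +oo by rewrite kappaT ltry.
have := integrable_bounded kT (measurable_root_density_fiber k p.2) HC.
move=> /integrableP[_]; apply: le_lt_trans.
rewrite /density_kernel_measure /= /density_measure; apply: ge0_le_integral => //.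
- by move=> x _; rewrite lee_fin root_density_ge0.
- exact: measurable_root_density_EFin.
- apply/measurable_EFinP; apply: measurableT_comp => //.
  exact: measurable_root_density_fiber.
- by move=> x _; rewrite lee_fin ler_norm.
Qed.

Definition density_kernel k p : {finite_measure set S -> \bar R} :=
  finite_measure_of (density_kernel_lty k p).

Lemma measurable_density_kernel k U : measurable U -> mfunT (fun p => density_kernel k p U).
Proof.
move=> mU; rewrite /density_kernel /= /finite_measure_of /density_kernel_measure /=.
rewrite (_ : (fun p => _) = (fun p : S * W => \int[kappa p.1]_x
    ((root_density k p.2 x)%:E * (\1_U x)%:E))).
  apply: (@measurable_integral_kernel _ _ _ _ _ (fun p : S * W => kappa p.1) _ _
    (fun z : (S * W) * S => (root_density k z.1.2 z.2)%:E * (\1_U z.2)%:E)).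
  - by move=> A mA; exact: measurableT_comp (measurable_kernel kappa A mA) measurable_fst.
  - by move=> p; rewrite kappaT ltry.
  - by move=> z; rewrite mule_ge0// lee_fin// root_density_ge0.
  - apply: emeasurable_funM; apply/measurable_EFinP; first exact: measurable_root_density.
    exact: measurableT_comp (measurable_indic mU) measurable_snd.
apply/funext => p; rewrite /density_measure integral_mkcond.
by apply: eq_integral => x _; rewrite patchE indicE; case: ifPn; rewrite ?mule1 ?mule0.
Qed.

Lemma integral_density_kernel k p (g : S -> \bar R) : mfunT g -> (forall x, 0 <= g x) ->
  \int[density_kernel k p]_x g x = \int[kappa p.1]_x ((root_density k p.2 x)%:E * g x).
Proof. exact: ge0_integral_density_measure. Qed.

Lemma density_kernel_recursion k p : good_past p.1 ->
  step_recursion (density_kernel k.+1) (density_kernel k) p.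
Proof.
case: p => im w /= gim i B mB.
rewrite /density_kernel /= /finite_measure_of /density_kernel_measure /= /density_measure.
have mi : measurable (cylinder [:: i] : set S) by exact: measurable_cylinder.
have msB : measurable (sshift @^-1` B).
  exact: (measurable_preimage (@measurable_shift _ _)).
have miB := measurableI _ _ mi msB.
rewrite (eq_integral (fun x => (V (w [::]))%:E *
    (root_density k (subtree i w) (sshift x))%:E)); last first.
  move=> x; rewrite inE => -[/cylinderP /= [xi] _].
  by rewrite root_densityS -EFinM xi.
rewrite ge0_integralZl//.
- rewrite (@integral_good_past _ _ _ (fun x => (root_density k (subtree i w) x)%:E))//.
  + by rewrite muleA.
  + exact: measurable_root_density_EFin.
  + by move=> x; rewrite lee_fin root_density_ge0.
- apply: measurable_funTS; apply/measurable_EFinP.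
  exact: measurableT_comp (measurable_root_density_fiber k _) (@measurable_shift a ha).
- by move=> x _; rewrite lee_fin root_density_ge0.
- by rewrite lee_fin.
Qed.

Definition cascade_kernel_measure (p : S * W) : measure_on S :=
  mscale (NngNum (V0 (p.2 [::]))) (cascade V (kappa p.1) p.2).

Lemma cascade_kernel_lty p : cascade_kernel_measure p setT < +oo.
Proof.
rewrite /cascade_kernel_measure /= /mscale /= -ge0_fin_numE; last by rewrite mule_ge0// lee_fin.
by rewrite fin_numM// fin_num_measure.
Qed.

Definition cascade_kernel p : {finite_measure set S -> \bar R} :=
  finite_measure_of (cascade_kernel_lty p).

Lemma cascade_kernelE p A : cascade_kernel p A = (V (p.2 [::]))%:E * cascade V (kappa p.1) p.2 A.
Proof. by []. Qed.

Lemma measurable_cascade_kernel U : measurable U -> mfunT (fun p => cascade_kernel p U).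
Proof.
move=> mU; have -> : (fun p => cascade_kernel p U) = (fun p : S * W =>
    (V (p.2 [::]))%:E * cascade V (kappa p.1) p.2 U) by apply/funext.
apply: emeasurable_funM.
  apply/measurable_EFinP.
  exact: measurableT_comp mV (measurableT_comp (@measurable_eval _ _ _ [::]) measurable_snd).
exact: (measurable_cascade mV V0 (lam := fun im => kappa im)).
Qed.

(** Convergence is also required in the subtrees, because the recursion passes to the limit on both
    sides. *)
Definition good_point (p : S * W) := [/\ good_past p.1, mass_cvg V (kappa p.1) p.2 &
  forall i, mass_cvg V (kappa (scons i p.1)) (subtree i p.2)].

Lemma ae_good_point : {ae basem, forall p, good_point p}.
Proof.
have h1 := ae_basem_fst disintegration_scons.
have mm := measurable_mass_cvg mV V0 (lam := fun im => kappa im) mkappa.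
have h2 : {ae basem, forall p, mass_cvg V (kappa p.1) p.2}.
  apply: (@ae_mprodT _ _ _ _ _ _ _ _ _ [set p : S * W | mass_cvg V (kappa p.1) p.2]) => //.
  by apply: nearW => im; exact: (ae_mass_cvg hPa mV V0 V1 (kappaoo _)).
have h3 i : {ae basem, forall p : S * W, mass_cvg V (kappa (scons i p.1)) (subtree i p.2)}.
  apply: (@ae_mprodT _ _ _ _ _ _ _ _ _ [set p : S * W |
      mass_cvg V (kappa (scons i p.1)) (subtree i p.2)]).
    have mst : mfunT (fun p : S * W => (scons i p.1, subtree i p.2)).
      apply: measurable_fun_pair.
        exact: measurableT_comp (measurable_scons i) measurable_fst.
      exact: measurableT_comp (measurable_subtree i) measurable_snd.
    by have := mst measurableT _ mm; rewrite setTI.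
  apply: nearW => im; exact: (ae_subtree i (ae_mass_cvg hPa mV V0 V1 (kappaoo (scons i im)))).
have {}h3 : {ae basem, forall p : S * W, forall n : nat, forall i : letter,
    @unpickle letter n = Some i -> mass_cvg V (kappa (scons i p.1)) (subtree i p.2)}.
  apply: ae_foralln => n; case: unpickle => [i|]; last exact: nearW.
  by apply: filterS (h3 i) => p H j [<-].
apply: filterS3 h1 h2 h3 => p g1 g2 g3; split; [exact: g1|exact: g2|move=> i].
by apply: (g3 (pickle i)); rewrite pickleK.
Qed.

Lemma mass_cons im k i u w : good_past im ->
  mass V (kappa im) k.+1 w (i :: u) = ((V (w [:: i]))%:E * letter_prob i im) *
    mass V (kappa (scons i im)) k (subtree i w) u.
Proof.
move=> gim; rewrite /mass cylinder_cons -[[set x : S | x 0%N = i]](_ : cylinder [:: i] = _); last first.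
  by rewrite cylinder_cons cylinder_nil preimage_setT setIT.
have mu' : measurable (cylinder u : set S) by exact: measurable_cylinder.
have mi : measurable (cylinder [:: i] : set S) by exact: measurable_cylinder.
have msB : measurable (sshift @^-1` (cylinder u)).
  exact: (measurable_preimage (@measurable_shift _ _)).
have miB := measurableI _ _ mi msB.
have md := measurable_cascade_density V k (subtree i w).
rewrite (eq_integral (fun x => (V (w [:: i]))%:E *
    (cascade_density V k (subtree i w) (sshift x))%:E)); last first.
  move=> x; rewrite inE => -[/cylinderP /= [xi] _].
  rewrite -EFinM /cascade_density big_ord_recl prefix_wordS xi; congr (_ * _)%:E%R.
  by apply: eq_bigr => j _; rewrite lift0 prefix_wordS xi.
rewrite ge0_integralZl//.
- rewrite (@integral_good_past _ _ _ (fun x => (cascade_density V k (subtree i w) x)%:E))//.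
  + by rewrite muleA.
  + exact/measurable_EFinP.
  + by move=> x; rewrite lee_fin cascade_density_ge0.
- apply: measurable_funTS; apply/measurable_EFinP.
  exact: measurableT_comp md (@measurable_shift a ha).
- by move=> x _; rewrite lee_fin cascade_density_ge0.
- by rewrite lee_fin.
Qed.

(** The limit of [mass_cons] on cylinders. The label of the word [:: i] is the root label of the
    subtree above i, so its weight is absorbed by the kernel there. *)
Lemma cascade_kernel_recursion p : good_point p -> step_recursion cascade_kernel cascade_kernel p.
Proof.
case: p => im w [/= gim cw ciw] i B mB.
have mi : measurable (cylinder [:: i] : set S) by exact: measurable_cylinder.
pose c := NngNum (mulr_ge0 (V0 (w [::])) (fine_ge0 (measure_ge0 (kappa im) (cylinder [:: i])))).
have cE : c%:num%:E = (V (w [::]))%:E * letter_prob i im.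
  by rewrite /= EFinM fineK// letter_prob_fin.
rewrite -cE.
pose m1 := image_measure (mrestr (cascade_kernel (im, w)) mi) (@measurable_shift a ha).
have m1E D : m1 D = cascade_kernel (im, w) (cylinder [:: i] `&` sshift @^-1` D).
  by rewrite /m1 /= /pushforward /mrestr setIC.
rewrite -m1E -[RHS]/(mscale c (cascade_kernel (scons i im, subtree i w)) B).
apply: eq_measure_cylinder => // [|u].
  rewrite m1E preimage_setT setIT -ge0_fin_numE// fin_num_measure//.
rewrite m1E -[RHS]/(c%:num%:E * cascade_kernel (scons i im, subtree i w) (cylinder u)) cE.
have -> : cylinder [:: i] `&` sshift @^-1` cylinder u = cylinder (i :: u).
  by rewrite [RHS]cylinder_cons cylinder_cons cylinder_nil preimage_setT setIT.
rewrite !cascade_kernelE /= -muleA; congr (_ * _).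
have h1 := @cascade_cylinder _ _ _ _ _ _ V0 _ (kappaoo im) _ (i :: u) cw.
have h2 := @cascade_cylinder _ _ _ _ _ _ V0 _ (kappaoo (scons i im)) _ u (ciw i).
have {}h1 : mass V (kappa im) k.+1 w (i :: u) @[k --> \oo] -->
    cascade V (kappa im) w (cylinder (i :: u)).
  by rewrite (cvg_shiftS (fun k => mass V (kappa im) k w (i :: u)) _).
have h3 : mass V (kappa im) k.+1 w (i :: u) @[k --> \oo] -->
    ((V (w [:: i]))%:E * letter_prob i im) *
    cascade V (kappa (scons i im)) (subtree i w) (cylinder u).
  rewrite (_ : (fun k => _) = (fun k => ((V (w [:: i]))%:E * letter_prob i im) *
    mass V (kappa (scons i im)) k (subtree i w) u)).
    by apply: cvgeZl => //; rewrite fin_numM// letter_prob_fin.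
  by apply/funext => k; rewrite mass_cons.
have -> := cvg_unique _ h1 h3 => //.
by rewrite [RHS]muleA (muleC (letter_prob _ _)).
Qed.

End cascade_recursion.

Local Notation K := cascade_kernel.
Local Notation Kn := density_kernel.

Definition ends (p : X) : S * S := (p.1.1, p.2).

Let measurable_ends : mfunT ends.
Proof.
apply: measurable_fun_pair; last exact: measurable_snd.
exact: measurableT_comp measurable_fst measurable_fst.
Qed.

Lemma measurable_at_point (f : X -> \bar R) : mfunT f ->
  mfunT (fun p : S * S => f ((p.1, point), p.2)).
Proof.
move=> mf; apply: measurableT_comp mf _; apply: measurable_fun_pair => //.
by apply: measurable_fun_pair => //; exact: measurable_fst.
Qed.

(** * The invariant measure of the skew shift *)

Section skew_product.

Let PaT : (Pa : measure_on W) setT = 1.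
Proof. exact: probability_setT. Qed.

Let Paoo (y : S) : (Pa : measure_on W) setT < +oo.
Proof. by rewrite PaT ltry. Qed.

Definition cascm : {measure set X -> \bar R} := skewm measurable_cascade_kernel.

Definition densm k : {measure set X -> \bar R} := skewm (measurable_density_kernel k).

Lemma integral_cascm (f : X -> \bar R) : (forall p, 0 <= f p) -> mfunT f ->
  \int[cascm]_p f p = \int[pastm]_im \int[Pa]_w \int[K (im, w)]_x f ((im, w), x).
Proof.
move=> f0 mf; rewrite [LHS]integral_skewm// integral_basem//.
- by move=> p; exact: integral_ge0.
- apply: (@measurable_integral_kernel _ _ _ _ _ K _ _ f) => //.
    exact: measurable_cascade_kernel.
  by move=> p; exact: finite_kernel_lty.
Qed.

Lemma integral_densm k (f : X -> \bar R) : (forall p, 0 <= f p) -> mfunT f ->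
  \int[densm k]_p f p = \int[pastm]_im \int[Pa]_w \int[Kn k (im, w)]_x f ((im, w), x).
Proof.
move=> f0 mf; rewrite [LHS]integral_skewm// integral_basem//.
- by move=> p; exact: integral_ge0.
- apply: (@measurable_integral_kernel _ _ _ _ _ (Kn k) _ _ f) => //.
    exact: measurable_density_kernel.
  by move=> p; exact: finite_kernel_lty.
Qed.

(** This is the mean 1 of V, and it is what makes [cascm] invariant. *)
Lemma transfer1 q : transfer (cst 1) q = 1.
Proof.
by rewrite /transfer; under eq_integral do rewrite mule1; exact: integral_V_root.
Qed.

Lemma integral_cascm_transfer (F f : X -> \bar R) : (forall p, 0 <= F p) -> mfunT F ->
  (forall p, 0 <= f p) -> mfunT f ->
  \int[cascm]_p (F (T p) * f p) = \int[cascm]_q (F q * transfer f q).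
Proof.
apply: integral_skew_transfer => //.
apply: filterS ae_good_point => p.
exact: cascade_kernel_recursion.
Qed.

Lemma integral_densm_transfer k (f : X -> \bar R) : (forall p, 0 <= f p) -> mfunT f ->
  \int[densm k.+1]_p f p = \int[densm k]_q transfer f q.
Proof.
move=> f0 mf.
have rec : {ae basem, forall p, step_recursion (Kn k.+1) (Kn k) p}.
  apply: filterS (ae_basem_fst disintegration_scons) => p.
  exact: density_kernel_recursion.
have H := integral_skew_transfer (measurable_density_kernel k.+1) (measurable_density_kernel k)
  rec (F := cst 1) (fun=> lee01) (measurable_cst _) f0 mf.
transitivity (\int[densm k.+1]_p (cst 1 (T p) * f p)).
  by apply: eq_integral => p _; rewrite mul1e.
etransitivity; first exact: H.
by apply: eq_integral => p _; rewrite mul1e.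
Qed.

Lemma integral_cascm_skew (F : X -> \bar R) : (forall p, 0 <= F p) ->
  mfunT F -> \int[cascm]_p F (T p) = \int[cascm]_p F p.
Proof.
move=> F0 mF; transitivity (\int[cascm]_p (F (T p) * cst 1 p)).
  by apply: eq_integral => p _; rewrite mule1.
rewrite integral_cascm_transfer//.
by apply: eq_integral => p _; rewrite transfer1 mule1.
Qed.

Lemma cascm_skew A : measurable A -> cascm (T @^-1` A) = cascm A.
Proof.
move=> mA; have mi : mfunT (fun p => (\1_A p)%:E : \bar R).
  exact: measurable_EFin_indic.
have i0 p : 0 <= (\1_A p)%:E :> \bar R by rewrite lee_fin.
have msA : measurable (T @^-1` A).
  exact: (measurable_preimage measurable_skew).
have := integral_cascm_skew i0 mi; rewrite [RHS]integral_indic// setIT => <-.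
by rewrite -[in LHS](setIT (T @^-1` A)) -integral_indic.
Qed.

Lemma integral_root_mass im k u :
  \int[Pa]_w ((V (w [::]))%:E * mass V (kappa im) k w u) = kappa im (cylinder u).
Proof.
under eq_integral do rewrite muleC.
rewrite (integral_indep_coordinate hPa (v := [::]) (g := fun w => mass V (kappa im) k w u)
  (h := fun x => (V x)%:E)).
- by rewrite V1 mule1 (integral_mass hPa).
- by move=> w; exact: mass_ge0.
- exact: measurable_mass.
- by move=> x; rewrite lee_fin.
- exact/measurable_EFinP.
- move=> w w' ww'; rewrite !massE//; apply: eq_bigr => v _; congr (_%:E * _).
  apply: eq_bigr => j _; congr V; apply: ww'.
  rewrite -size_eq0 size_take size_tuple; case: ifP => // _.
  by rewrite -lt0n (leq_ltn_trans _ (ltn_ord j)).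
Qed.

Let mKim im U : measurable U -> mfunT (fun w => K (im, w) U).
Proof.
by move=> mU; have := measurable_fun_pair2 im (measurable_cascade_kernel mU).
Qed.

(** Only an inequality at this stage: Fatou allows mass to be lost in the limit. *)
Lemma integral_cascade_kernel_le im B : measurable B -> \int[Pa]_w K (im, w) B <= kappa im B.
Proof.
move=> mB.
have Koo (w : W) : K (im, w) setT < +oo by exact: finite_kernel_lty.
pose m0 := mprod (Pa : measure_on W) (@mKim im) Koo.
have ms : mfunT (snd : W * S -> S) by exact: measurable_snd.
pose m1 := image_measure m0 ms.
have m1E C : measurable C -> m1 C = \int[Pa]_w K (im, w) C.
  move=> mC; rewrite /m1 /= /pushforward.
  rewrite (_ : _ @^-1` _ = setT `*` C); first exact: mprodX.
  by apply/seteqP; split => -[w x] //= -[].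
rewrite -m1E//; apply: le_measure_cylinder => // u.
rewrite m1E; last exact: measurable_cylinder.
apply: (@fatou_ae _ _ _ Pa (fun k w => (V (w [::]))%:E * mass V (kappa im) k w u)).
- move=> k; apply: emeasurable_funM; last exact: measurable_mass.
  by apply/measurable_EFinP; exact: measurable_V_eval.
- by move=> k w; rewrite mule_ge0 ?mass_ge0// lee_fin.
- by apply: mKim; exact: measurable_cylinder.
- by move=> w; exact: measure_ge0.
- apply: filterS (ae_cascade_mass hPa mV V0 V1 (kappaoo im)) => w H.
  by rewrite cascade_kernelE; apply: cvgeZl => //; exact: H.
- by move=> k; rewrite integral_root_mass.
Qed.

Definition ctot : R := fine (cascm setT).

Lemma cascm_le1 : cascm setT <= 1.
Proof.
have -> : cascm setT = \int[cascm]_p (cst 1 p) by rewrite integral_cst// mul1e.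
rewrite integral_cascm//; apply: (@le_trans _ _ (\int[pastm]_im 1)); last first.
  by rewrite integral_cst// mul1e pastmT.
have E im w : \int[K (im, w)]_x (cst 1 ((im, w), x)) = K (im, w) setT.
  by rewrite (eq_integral (cst 1))// integral_cst// mul1e.
have mS : mfunT (fun p : S * W => K p setT).
  exact: measurable_cascade_kernel.
apply: ge0_le_integral => //.
- by move=> im _; apply: integral_ge0 => w _; exact: integral_ge0.
- apply: (eq_measurable_fun (fun im => \int[Pa]_w K (im, w) setT)).
    by move=> im _; apply: eq_integral => w _; rewrite E.
  apply: (@measurable_integral_kernel _ _ S W R (fun=> Pa) (fun _ _ => measurable_cst _)
    Paoo (fun p : S * W => K p setT)) => //.
- move=> im _; rewrite (eq_integral (fun w => K (im, w) setT)) => [|w _]; last exact: E.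
  by rewrite -(kappaT im); exact: integral_cascade_kernel_le.
Qed.

Lemma ctotE : ctot%:E = cascm setT.
Proof.
by rewrite /ctot fineK// ge0_fin_numE// (le_lt_trans cascm_le1)// ltry.
Qed.

(** The transfer lowers the level by one ([level_transfer]), so that identities for functions of
    finite level reduce to functions of the two ends. *)
Definition level k (f : X -> \bar R) := forall im (w w' : W) x,
  (forall u, (size u < k)%N -> w u = w' u) -> f ((im, w), x) = f ((im, w'), x).

Lemma level_transfer k f : level k.+1 f -> level k (transfer f).
Proof.
move=> lf im w w' x ww'; apply: eq_integral => w'' _; congr (_ * _); apply: lf => u.
rewrite /graft /merge /=; case: ifPn => //.
by case: u => [|i u]//= _; rewrite ltnS; exact: ww'.
Qed.

(** The image of [cascm] under [ends] is shift-invariant and dominated by [extm], which is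
    ergodic. *)
Lemma cascm_ends A : measurable A -> cascm (ends @^-1` A) = ctot%:E * extm A.
Proof.
move=> mA; pose rho := image_measure cascm measurable_ends.
rewrite ctotE -[LHS]/(rho A) -[X in _ = X * _]/(rho setT).
apply: (@ergodic_invariant_measure _ _ _ extm ext_shift) => //.
- exact: extmT.
- exact: measurable_ext_shift.
- by move=> B mB; exact: ext_shift_inv.
- by move=> B mB; exact: ext_ergodic.
- move=> B mB; have mi : mfunT (fun p => (\1_B (ends p))%:E : \bar R).
    apply/measurable_EFinP; exact: measurableT_comp (measurable_indic mB) measurable_ends.
  have -> : rho B = \int[cascm]_p (\1_B (ends p))%:E.
    have meB : measurable (ends @^-1` B).
      exact: (measurable_preimage measurable_ends).
    by rewrite -[LHS]/(cascm (ends @^-1` B)) -[in LHS](setIT (ends @^-1` B)) -integral_indic.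
  rewrite integral_cascm// -[leRHS]/(\int[pastm]_im kappa im (xsection B im)).
  have E im w : \int[K (im, w)]_x (\1_B (ends ((im, w), x)))%:E = K (im, w) (xsection B im).
    rewrite -[in RHS](setIT (xsection B im)) -integral_indic//; last exact: measurable_xsection.
    by apply: eq_integral => x _; rewrite !indicE mem_xsection.
  have mS : mfunT (fun p : S * W => K p (xsection B p.1)).
    have -> : (fun p : S * W => K p (xsection B p.1)) =
        (fun p => \int[K p]_x (\1_B (ends (p, x)))%:E).
      by apply/funext => -[im w]; rewrite E.
    apply: (@measurable_integral_kernel _ _ _ _ _ K _ _ (fun z : X => (\1_B (ends z))%:E)) => //.
    + exact: measurable_cascade_kernel.
    + by move=> p; exact: finite_kernel_lty.
  apply: ge0_le_integral => //.
  + by move=> im _; apply: integral_ge0 => w _; apply: integral_ge0 => x _; rewrite lee_fin.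
  + apply: (eq_measurable_fun (fun im => \int[Pa]_w K (im, w) (xsection B im))).
      by move=> im _; apply: eq_integral => w _; rewrite E.
    apply: (@measurable_integral_kernel _ _ S W R (fun=> Pa) (fun _ _ => measurable_cst _)
      Paoo (fun p : S * W => K p (xsection B p.1))) => //.
  + apply: (@measurable_xsection_kernel _ _ _ _ _ (fun im => kappa im)) => //.
  + move=> im _; rewrite (eq_integral (fun w => K (im, w) (xsection B im))) => [|w _]; last exact: E.
    by apply: integral_cascade_kernel_le; exact: measurable_xsection.
- move=> B mB; rewrite -[LHS]/(cascm (T @^-1` (ends @^-1` B))) cascm_skew//.
  exact: (measurable_preimage measurable_ends).
Qed.

Lemma integral_cascm_level0 f : (forall p, 0 <= f p) -> mfunT f -> level 0 f -> \int[cascm]_p f p =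
    ctot%:E * \int[extm]_p f ((p.1, point), p.2).
Proof.
move=> f0 mf lf; have mfp := measurable_at_point mf.
have c0 : (0 <= ctot)%R by rewrite fine_ge0.
rewrite -(ge0_integral_mscale _ measurableT (NngNum c0))//.
rewrite -(@ge0_integral_image _ _ _ _ _ cascm _ ends)//; last first.
  by move=> A mA; exact: cascm_ends.
by apply: eq_integral => -[[im w] x] _; exact: lf.
Qed.

Lemma integral_densm_level0 f : (forall p, 0 <= f p) -> mfunT f ->
  level 0 f -> \int[densm 0]_p f p = \int[extm]_p f ((p.1, point), p.2).
Proof.
move=> f0 mf lf; have mfp := measurable_at_point mf.
rewrite integral_densm// integral_extm//.
apply: eq_integral => im _.
rewrite (eq_integral (fun w : W => \int[kappa im]_x f ((im, point), x))).
  exact: integral_prob_cst.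
move=> w _; rewrite integral_density_kernel//; last exact: (measurable_fun_pair2 (im, w) mf).
apply: eq_integral => x _; rewrite /root_density big_ord0 mul1e.
exact: lf.
Qed.

(** After k transfers on both sides the function depends on the ends only, where the two measures
    differ by the factor [ctot]. *)
Lemma integral_cascm_level k f : (forall p, 0 <= f p) -> mfunT f ->
  level k f -> \int[cascm]_p f p = ctot%:E * \int[densm k]_p f p.
Proof.
elim: k f => [|k ih] f f0 mf lf.
  by rewrite integral_cascm_level0// integral_densm_level0.
rewrite integral_densm_transfer//.
have tf0 q : 0 <= transfer f q by exact: transfer_ge0.
have mtf : mfunT (transfer f) by exact: measurable_transfer.
rewrite -(ih _ tf0 mtf (level_transfer lf)).
transitivity (\int[cascm]_p (cst 1 (T p) * f p)).
  by apply: eq_integral => p _; rewrite mul1e.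
rewrite integral_cascm_transfer//.
by apply: eq_integral => p _; rewrite mul1e.
Qed.

End skew_product.

Local Notation Q := cascm.

Let PaT : (Pa : measure_on W) setT = 1.
Proof. exact: probability_setT. Qed.
Let Paoo : (Pa : measure_on W) setT < +oo.
Proof. by rewrite PaT ltry. Qed.

(** * Non-degeneracy: the entropy recursion *)

Section nondegeneracy.

(** The martingale of total masses, root weight included; [casc_mass] is its almost sure limit. *)
Definition dens_mass k (p : S * W) : R := fine (Kn k p setT).
Definition casc_mass (p : S * W) : R := fine (K p setT).
Local Notation Zk := dens_mass.
Local Notation Z := casc_mass.

Lemma dens_mass_ge0 k p : (0 <= Zk k p)%R. Proof. exact: fine_ge0. Qed.
Lemma casc_mass_ge0 p : (0 <= Z p)%R. Proof. exact: fine_ge0. Qed.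
Lemma dens_massE k p : (Zk k p)%:E = Kn k p setT.
Proof. by rewrite /Zk fineK// fin_num_measure. Qed.
Lemma casc_massE p : (Z p)%:E = K p setT.
Proof. by rewrite /Z fineK// fin_num_measure. Qed.

Lemma measurable_dens_mass k : mfunT (Zk k).
Proof. by apply: measurableT_comp => //; exact: measurable_density_kernel. Qed.
Lemma measurable_casc_mass : mfunT Z.
Proof. by apply: measurableT_comp => //; exact: measurable_cascade_kernel. Qed.

Let measurable_dens_mass_fiber k im : mfunT (fun w => Zk k (im, w)).
Proof. exact: (measurable_fun_pair2 im (measurable_dens_mass k)). Qed.

Lemma density_kernel_mass k p u :
  Kn k.+1 p (cylinder u) = (V (p.2 [::]))%:E * mass V (kappa p.1) k p.2 u.
Proof.
have mu' : measurable (cylinder u : set S) by exact: measurable_cylinder.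
rewrite /density_kernel /= /finite_measure_of /density_kernel_measure /= /density_measure.
rewrite /mass -ge0_integralZl//.
- by apply: eq_integral => x _; rewrite root_density_cascade EFinM.
- by apply: measurable_funTS; apply/measurable_EFinP; exact: measurable_cascade_density.
- by move=> x _; rewrite lee_fin cascade_density_ge0.
- by rewrite lee_fin.
Qed.

Lemma dens_mass0 p : Zk 0 p = 1%R.
Proof.
rewrite /Zk /density_kernel /= /finite_measure_of /density_kernel_measure /= /density_measure.
rewrite (eq_integral (cst 1)); last by move=> x _; rewrite /root_density big_ord0.
by rewrite integral_cst// mul1e -[X in fine X]/(kappa p.1 setT) kappaT.
Qed.

Lemma integral_dens_mass k im : \int[Pa]_w (Zk k (im, w))%:E = 1.
Proof.
case: k => [|k].
  under eq_integral do rewrite dens_mass0; exact: integral_prob_cst.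
transitivity (\int[Pa]_w ((V (w [::]))%:E * mass V (kappa im) k w [::])).
  by apply: eq_integral => w _; rewrite dens_massE -cylinder_nil density_kernel_mass.
by rewrite integral_root_mass cylinder_nil kappaT.
Qed.

Local Notation q i im := (fine (letter_prob i im)).

Lemma sum_q im : (\sum_i q i im)%R = 1%R.
Proof.
by rewrite sum_fine ?(sum_letter_prob im)// => i _; exact: letter_prob_fin.
Qed.

Lemma q_le1 i im : (q i im <= 1)%R.
Proof.
by rewrite -lee_fin fineK ?letter_prob_fin// letter_prob_le1.
Qed.

Lemma q_ge0 i im : (0 <= q i im)%R. Proof. exact: fine_ge0. Qed.

Lemma measurable_q i : mfunT (fun im => q i im).
Proof. by apply: measurableT_comp => //; exact: measurable_letter_prob. Qed.

Lemma dens_mass_succ k im w : good_past im -> Zk k.+1 (im, w) =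
  (V (w [::]) * \sum_i q i im * Zk k (scons i im, subtree i w))%R.
Proof.
move=> gim; apply: EFin_inj; rewrite dens_massE (measure_cylinder1 (Kn k.+1 (im, w)))//.
rewrite EFinM -sumEFin ge0_sume_distrr; last first.
  by move=> i _; rewrite lee_fin mulr_ge0// ?q_ge0// dens_mass_ge0.
apply: eq_bigr => i _.
have := @density_kernel_recursion k (im, w) gim i setT measurableT.
move=> E; etransitivity; first exact: E.
by rewrite EFinM fineK ?letter_prob_fin// dens_massE muleA.
Qed.

Lemma dens_mass_cvgP p : mass_cvg V (kappa p.1) p.2 -> Zk k p @[k --> \oo] --> Z p.
Proof.
case: p => im w /= cw; have H := @cascade_cylinder _ _ _ _ _ _ V0 _ (kappaoo im) _ [::] cw.
have h : (V (w [::]))%:E * mass V (kappa im) k w [::] @[k --> \oo] --> (Z (im, w))%:E.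
  rewrite casc_massE cascade_kernelE -cylinder_nil; apply: cvgeZl => //; exact: H.
rewrite -(cvg_shiftS (fun k => Zk k (im, w)) _).
apply/fine_cvg; move: h; apply: cvg_trans; apply: near_eq_cvg; apply: nearW => k.
by have := density_kernel_mass k (im, w) [::]; rewrite cylinder_nil -dens_massE => /= <-.
Qed.

Lemma dens_mass_cvg im : {ae Pa, forall w, Zk k (im, w) @[k --> \oo] --> Z (im, w)}.
Proof.
apply: filterS (ae_mass_cvg hPa mV V0 V1 (kappaoo im)) => w.
exact: (@dens_mass_cvgP (im, w)).
Qed.

Lemma ae_dens_mass_cvg : {ae basem, forall p, Zk k p @[k --> \oo] --> Z p}.
Proof.
apply: filterS ae_good_point => p [_ cp _].
exact: dens_mass_cvgP.
Qed.

Let measurable_subtree_comp i (g : W -> R) : mfunT g -> mfunT (fun w => g (subtree i w)).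
Proof. by move=> mg; exact: measurableT_comp mg (measurable_subtree i). Qed.

Let measurable_root (f : Omega -> R) : mfunT f -> mfunT (fun w : W => f (w [::])).
Proof. by move=> mf; exact: measurableT_comp mf (@measurable_eval _ _ _ [::]). Qed.

Lemma integral_root_subtree i (f : Omega -> R) (g : W -> R) : mfunT f -> (forall x, (0 <= f x)%R) ->
  mfunT g -> (forall w, (0 <= g w)%R) -> \int[Pa]_w (f (w [::]) * g (subtree i w))%:E =
  \int[P]_x (f x)%:E * \int[Pa]_w (g w)%:E.
Proof.
move=> mf f0 mg g0.
have mF : mfunT (fun w : W => (f (w [::]) * g (subtree i w))%:E).
  by apply/measurable_EFinP; apply: measurable_funM; [exact: measurable_root|
    exact: measurable_subtree_comp].
have F0 (w : W) : 0 <= (f (w [::]) * g (subtree i w))%:E by rewrite lee_fin mulr_ge0.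
rewrite -(integral_graft i F0 mF).
have mEg : mfunT (fun w => (g w)%:E) by exact/measurable_EFinP.
have mEf : mfunT (fun w : W => (f (w [::]))%:E).
  by apply/measurable_EFinP; exact: measurable_root.
transitivity (\int[Pa]_w'' ((f (w'' [::]))%:E * \int[Pa]_w (g w)%:E)).
  apply: eq_integral => w'' _; rewrite -ge0_integralZl//; last 2 first.
  - by move=> w _; rewrite lee_fin.
  - by rewrite lee_fin.
  by apply: eq_integral => w' _; rewrite subtree_graft EFinM.
rewrite ge0_integralZr//; last 2 first.
- by move=> w _; rewrite lee_fin.
- by apply: integral_ge0 => w _; rewrite lee_fin.
congr (_ * _); apply: (integral_eval hPa [::] (f := fun x => (f x)%:E)).
  by move=> x; rewrite lee_fin.
exact/measurable_EFinP.
Qed.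

Lemma integral_root_subtrees i j (f : Omega -> R) (g h : W -> R) : j != i ->
  mfunT f -> (forall x, (0 <= f x)%R) -> mfunT g -> (forall w, (0 <= g w)%R) ->
  mfunT h -> (forall w, (0 <= h w)%R) ->
  \int[Pa]_w (f (w [::]) * (g (subtree i w) * h (subtree j w)))%:E =
  \int[P]_x (f x)%:E * (\int[Pa]_w (g w)%:E * \int[Pa]_w (h w)%:E).
Proof.
move=> ji mf f0 mg g0 mh h0.
have mF : mfunT (fun w : W => (f (w [::]) * (g (subtree i w) * h (subtree j w)))%:E).
  apply/measurable_EFinP; apply: measurable_funM; first exact: measurable_root.
  by apply: measurable_funM; exact: measurable_subtree_comp.
have F0 (w : W) : 0 <= (f (w [::]) * (g (subtree i w) * h (subtree j w)))%:E.
  by rewrite lee_fin !mulr_ge0.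
rewrite -(integral_graft i F0 mF).
have mEg : mfunT (fun w => (g w)%:E) by exact/measurable_EFinP.
have mEfh : mfunT (fun w : W => (f (w [::]) * h (subtree j w))%:E).
  by apply/measurable_EFinP; apply: measurable_funM; [exact: measurable_root|
    exact: measurable_subtree_comp].
have fh0 (w : W) : (0 <= f (w [::]) * h (subtree j w))%R by rewrite mulr_ge0.
transitivity (\int[Pa]_w'' ((f (w'' [::]) * h (subtree j w''))%:E * \int[Pa]_w (g w)%:E)).
  apply: eq_integral => w'' _; rewrite -ge0_integralZl//; last 2 first.
  - by move=> w _; rewrite lee_fin.
  - by rewrite lee_fin.
  apply: eq_integral => w' _; rewrite subtree_graft -EFinM; congr EFin.
  have -> : subtree j (graft i w'' w') = subtree j w''.
    by apply/funext => u; rewrite /subtree /graft /merge /= ji.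
  by rewrite graft_root mulrCA mulrC.
rewrite ge0_integralZr//; last 2 first.
- by move=> w _; rewrite lee_fin.
- by apply: integral_ge0 => w _; rewrite lee_fin.
by rewrite integral_root_subtree// -muleA (muleC (\int[Pa]_w (h w)%:E)).
Qed.

Definition psi_int k im := \int[Pa]_w (psi (Zk k (im, w)))%:E.
Definition sqrt_int k im := \int[Pa]_w (Num.sqrt (Zk k (im, w)))%:E.
Definition letter_entropy im : \bar R := (\sum_i - (q i im * ln (q i im)))%:E%R.
(** The mean of the cross terms of [sum_xlnx]; it factorises because distinct subtrees are
    independent. *)
Definition cross k im := \sum_i \sum_(j | j != i) (Num.sqrt (q i im) * Num.sqrt (q j im))%:E *
  (sqrt_int k (scons i im) * sqrt_int k (scons j im)).

Let nqlnq_ge0 i im : (0 <= - (q i im * ln (q i im)))%R.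
Proof. by rewrite -mulrN mulr_ge0 ?q_ge0// oppr_ge0 ln_le0// q_le1. Qed.

(** The mean of [psi_recursion] over the tree, the root label and the subtrees being independent.
    Every term stands on the side where it is nonnegative, so that the inequality makes sense before
    any finiteness is known. *)
Lemma psi_int_step k im : good_past im -> psi_int k.+1 im + letter_entropy im + 2%:E <=
  1 + (\int[P]_x (psi (V x))%:E + (\sum_i (q i im)%:E * psi_int k (scons i im) + cross k im)).
Proof.
move=> gim.
pose z i (w : W) := Zk k (scons i im, subtree i w).
have mz i : mfunT (z i).
  exact: (measurable_subtree_comp i (measurable_dens_mass_fiber k (scons i im))).
have z0 i w : (0 <= z i w)%R by exact: dens_mass_ge0.
have mVr : mfunT (fun w : W => V (w [::])) by exact: measurable_root.
have IV : \int[Pa]_w (V (w [::]))%:E = 1 by exact: integral_V_root.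
have IVz i : \int[Pa]_w (V (w [::]) * z i w)%:E = 1.
  rewrite (integral_root_subtree i (g := fun w => Zk k (scons i im, w)))//.
    by rewrite V1 integral_dens_mass mule1.
  by move=> w; exact: dens_mass_ge0.
have Iz i : \int[Pa]_w (z i w)%:E = 1.
  rewrite -(integral_dens_mass k (scons i im)).
  apply: (integral_subtree i (f := fun w => (Zk k (scons i im, w))%:E)).
    by move=> w; rewrite lee_fin dens_mass_ge0.
  by apply/measurable_EFinP; exact: measurable_dens_mass_fiber.
have mEV : mfunT (fun w : W => (V (w [::]))%:E) by exact/measurable_EFinP.
have mEz i : mfunT (fun w : W => (z i w)%:E) by exact/measurable_EFinP.
have mEVz i : mfunT (fun w : W => (V (w [::]) * z i w)%:E).
  by apply/measurable_EFinP; exact: measurable_funM.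
have mEpz i : mfunT (fun w : W => (psi (V (w [::])) * z i w)%:E).
  apply/measurable_EFinP; apply: measurable_funM => //; exact: measurable_psi_comp.
have mEVp i : mfunT (fun w : W => (V (w [::]) * psi (z i w))%:E).
  apply/measurable_EFinP; apply: measurable_funM => //; exact: measurable_psi_comp.
have mEVs i j : mfunT (fun w : W => (V (w [::]) * (Num.sqrt (z i w) * Num.sqrt (z j w)))%:E).
  apply/measurable_EFinP; apply: measurable_funM => //.
  by apply: measurable_funM; exact: measurable_sqrt_comp.
have mEP : mfunT (fun w : W => (psi (Zk k.+1 (im, w)))%:E).
  by apply/measurable_EFinP; exact: measurable_psi_comp.
have eV0 (w : W) : 0 <= (V (w [::]))%:E by rewrite lee_fin.
have ez0 i (w : W) : 0 <= (z i w)%:E by rewrite lee_fin.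
have eVz0 i (w : W) : 0 <= (V (w [::]) * z i w)%:E by rewrite lee_fin mulr_ge0.
have epz0 i (w : W) : 0 <= (psi (V (w [::])) * z i w)%:E by rewrite lee_fin mulr_ge0// psi_ge0.
have eVp0 i (w : W) : 0 <= (V (w [::]) * psi (z i w))%:E by rewrite lee_fin mulr_ge0// psi_ge0.
have eVs0 i j (w : W) : 0 <= (V (w [::]) * (Num.sqrt (z i w) * Num.sqrt (z j w)))%:E.
  by rewrite lee_fin !mulr_ge0// sqrtr_ge0.
have eP0 (w : W) : 0 <= (psi (Zk k.+1 (im, w)))%:E.
  by rewrite lee_fin psi_ge0// dens_mass_ge0.
have q0 i := q_ge0 i im.
have n0 i := nqlnq_ge0 i im.
have s0 i j : (0 <= Num.sqrt (q i im) * Num.sqrt (q j im))%R.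
  by rewrite mulr_ge0// sqrtr_ge0.
pose L2 (w : W) := \sum_i (- (q i im * ln (q i im)))%:E * (V (w [::]) * z i w)%:E.
pose L3 (w : W) := \sum_i (q i im)%:E * (z i w)%:E.
pose U2 (w : W) := \sum_i (q i im)%:E * (psi (V (w [::])) * z i w)%:E.
pose U3 (w : W) := \sum_i (q i im)%:E * (V (w [::]) * psi (z i w))%:E.
pose U4i i (w : W) := \sum_(j | j != i) (Num.sqrt (q i im) * Num.sqrt (q j im))%:E *
      (V (w [::]) * (Num.sqrt (z i w) * Num.sqrt (z j w)))%:E.
pose U4 (w : W) := \sum_i U4i i w.
have mL2 : mfunT L2 by apply: measurable_sum_scale.
have mL3 : mfunT L3 by apply: measurable_sum_scale.
have mU2 : mfunT U2 by apply: measurable_sum_scale.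
have mU3 : mfunT U3 by apply: measurable_sum_scale.
have mU4i i : mfunT (U4i i) by apply: measurable_sum_scale.
have mU4 : mfunT U4 by exact: emeasurable_sum.
have L20 w : 0 <= L2 w by apply: sume_ge0 => ? _; rewrite mule_ge0// lee_fin.
have L30 w : 0 <= L3 w by apply: sume_ge0 => ? _; rewrite mule_ge0// lee_fin.
have U20 w : 0 <= U2 w by apply: sume_ge0 => ? _; rewrite mule_ge0// lee_fin.
have U30 w : 0 <= U3 w by apply: sume_ge0 => ? _; rewrite mule_ge0// lee_fin.
have U4i0 i w : 0 <= U4i i w by apply: sume_ge0 => ? _; rewrite mule_ge0// lee_fin.
have U40 w : 0 <= U4 w by apply: sume_ge0.
pose L (w : W) := (psi (Zk k.+1 (im, w)))%:E + (L2 w + (L3 w + (V (w [::]))%:E)).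
pose U (w : W) := 1 + (U2 w + (U3 w + U4 w)).
have LU w : L w <= U w.
  rewrite /L /U /L2 /L3 /U2 /U3 /U4 /U4i.
  under eq_bigr do rewrite -EFinM; under [X in _ + (_ + (X + _)) <= _]eq_bigr do rewrite -EFinM.
  under [X in _ <= _ + (X + _)]eq_bigr do rewrite -EFinM.
  under [X in _ <= _ + (_ + (X + _))]eq_bigr do rewrite -EFinM.
  under [X in _ <= _ + (_ + (_ + X))]eq_bigr do under eq_bigr do rewrite -EFinM.
  under [X in _ <= _ + (_ + (_ + X))]eq_bigr do rewrite sumEFin.
  rewrite !sumEFin -!EFinD lee_fin.
  have := @psi_recursion R (letter) (V (w [::])) (fun i => q i im) (fun i => z i w)
    (V0 _) q0 (fun i => z0 i w) (sum_q im).
  rewrite -(@dens_mass_succ k im w gim) => h.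
  have -> : (\sum_i - (q i im * ln (q i im)) * (V (w [::]) * z i w) =
      V (w [::]) * \sum_i - (q i im * ln (q i im)) * z i w)%R.
    by rewrite mulr_sumr; apply: eq_bigr => i _; rewrite mulrCA.
  have -> : (\sum_i q i im * (psi (V (w [::])) * z i w) =
      psi (V (w [::])) * \sum_i q i im * z i w)%R.
    by rewrite mulr_sumr; apply: eq_bigr => i _; rewrite mulrCA.
  have -> : (\sum_i q i im * (V (w [::]) * psi (z i w)) =
      V (w [::]) * \sum_i q i im * psi (z i w))%R.
    by rewrite mulr_sumr; apply: eq_bigr => i _; rewrite mulrCA.
  have -> : (\sum_i \sum_(j | j != i) Num.sqrt (q i im) * Num.sqrt (q j im) *
        (V (w [::]) * (Num.sqrt (z i w) * Num.sqrt (z j w))) =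
      V (w [::]) * \sum_i \sum_(j | j != i) (Num.sqrt (q i im) * Num.sqrt (z i w)) *
        (Num.sqrt (q j im) * Num.sqrt (z j w)))%R.
    rewrite mulr_sumr; apply: eq_bigr => i _; rewrite mulr_sumr; apply: eq_bigr => j _.
    rewrite mulrCA; congr (_ * _)%R; exact: mulrACA.
  by rewrite !addrA.
have IL : \int[Pa]_w L w = psi_int k.+1 im + letter_entropy im + 2%:E.
  rewrite (ge0_integralD _ measurableT (fun w _ => eP0 w) mEP
    (fun w _ => adde_ge0 (L20 w) (adde_ge0 (L30 w) (eV0 w)))
    (emeasurable_funD mL2 (emeasurable_funD mL3 mEV))).
  rewrite (ge0_integralD _ measurableT (fun w _ => L20 w) mL2
    (fun w _ => adde_ge0 (L30 w) (eV0 w)) (emeasurable_funD mL3 mEV)).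
  rewrite (ge0_integralD _ measurableT (fun w _ => L30 w) mL3 (fun w _ => eV0 w) mEV).
  rewrite IV ge0_integral_sum_scale// ge0_integral_sum_scale//.
  under eq_bigr do rewrite IVz mule1; under [X in _ + (_ + (X + _))]eq_bigr do rewrite Iz mule1.
  have -> : (2%:E : \bar R) = 1 + 1 by rewrite -EFinD.
  by rewrite !sumEFin sum_q -addeA.
have IU : \int[Pa]_w U w = 1 + (\int[P]_x (psi (V x))%:E +
   (\sum_i (q i im)%:E * psi_int k (scons i im) + cross k im)).
  rewrite (ge0_integralD _ measurableT (f1 := cst 1) (fun w _ => lee01) (measurable_cst _)
    (fun w _ => adde_ge0 (U20 w) (adde_ge0 (U30 w) (U40 w)))
    (emeasurable_funD mU2 (emeasurable_funD mU3 mU4))).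
  rewrite (ge0_integralD _ measurableT (fun w _ => U20 w) mU2
    (fun w _ => adde_ge0 (U30 w) (U40 w)) (emeasurable_funD mU3 mU4)).
  rewrite (ge0_integralD _ measurableT (fun w _ => U30 w) mU3 (fun w _ => U40 w) mU4).
  rewrite integral_prob_cst; congr (_ + _).
  rewrite ge0_integral_sum_scale// ge0_integral_sum_scale//; congr (_ + (_ + _)).
  - transitivity (\sum_i (q i im)%:E * \int[P]_x (psi (V x))%:E).
      apply: eq_bigr => i _; congr (_ * _).
      rewrite (integral_root_subtree i (f := fun x => psi (V x)) (g := fun w => Zk k (scons i im, w)))//.
      + by rewrite integral_dens_mass mule1.
      + exact: measurable_psi_comp.
      + by move=> x; exact: psi_ge0.
      + by move=> w; exact: dens_mass_ge0.
    rewrite -ge0_sume_distrl; last by move=> i _; rewrite lee_fin.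
    by rewrite sumEFin sum_q mul1e.
  - apply: eq_bigr => i _; congr (_ * _).
    rewrite (integral_root_subtree i (g := fun w => psi (Zk k (scons i im, w))))//.
    + by rewrite V1 mul1e.
    + exact: measurable_psi_comp.
    + by move=> w; apply: psi_ge0; exact: dens_mass_ge0.
  - rewrite ge0_integral_sum//; apply: eq_bigr => i _.
    rewrite ge0_integral_sum_scale//; apply: eq_bigr => j ji; congr (_ * _).
    rewrite (integral_root_subtrees ji (g := fun w => Num.sqrt (Zk k (scons i im, w)))
      (h := fun w => Num.sqrt (Zk k (scons j im, w))))//.
    + by rewrite V1 mul1e.
    + exact: measurable_sqrt_comp.
    + exact: measurable_sqrt_comp.
rewrite -IL -IU; apply: ge0_le_integral => //.
- by move=> w _; rewrite !adde_ge0.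
- by apply: emeasurable_funD => //; apply: emeasurable_funD => //; exact: emeasurable_funD.
- by apply: emeasurable_funD => //; apply: emeasurable_funD => //; exact: emeasurable_funD.
Qed.

Lemma sqrt_int_le1 k im : sqrt_int k im <= 1.
Proof.
apply: (@le_trans _ _ (\int[Pa]_w (2^-1%:E * ((Zk k (im, w))%:E + 1)))).
  apply: ge0_le_integral => //.
  - apply/measurable_EFinP; exact: measurable_sqrt_comp.
  - apply: measurable_funeM; apply: emeasurable_funD => //; exact/measurable_EFinP.
  - move=> w _; rewrite -EFinD -EFinM lee_fin.
    have z0 := dens_mass_ge0 k (im, w).
    have := sqr_ge0 (Num.sqrt (Zk k (im, w)) - 1); rewrite sqrrB sqr_sqrtr// mulr1 expr1n.
    move: (Num.sqrt (Zk k (im, w))) (Zk k (im, w)) => x y; rewrite -mulr_natl; lra.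
have m1 : mfunT (fun w : W => (Zk k (im, w))%:E + (cst 1) w).
  by apply: emeasurable_funD => //; exact/measurable_EFinP.
have p1 (w : W) : setT w -> 0 <= (Zk k (im, w))%:E + (cst 1) w.
  by move=> _; rewrite adde_ge0// lee_fin dens_mass_ge0.
have h0 : (0 <= 2^-1 :> R)%R by [].
have h1 : 0 <= (2^-1 : R)%:E by rewrite lee_fin.
rewrite (ge0_integralZl Pa measurableT m1 p1 h1) ge0_integralD//; last 2 first.
- by move=> w _; rewrite lee_fin dens_mass_ge0.
- exact/measurable_EFinP.
rewrite integral_dens_mass integral_prob_cst -EFinD -EFinM lee_fin; lra.
Qed.

Lemma sqrt_int_ge0 k im : 0 <= sqrt_int k im.
Proof. by apply: integral_ge0 => w _; rewrite lee_fin sqrtr_ge0. Qed.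

Definition sqrt_intr k im : R := fine (sqrt_int k im).

Lemma sqrt_intE k im : sqrt_int k im = (sqrt_intr k im)%:E.
Proof.
by rewrite fineK// ge0_fin_numE ?sqrt_int_ge0// (le_lt_trans (sqrt_int_le1 k im))// ltry.
Qed.

Lemma sqrt_intr_ge0 k im : (0 <= sqrt_intr k im)%R.
Proof. by rewrite fine_ge0// sqrt_int_ge0. Qed.

Lemma sqrt_intr_le1 k im : (sqrt_intr k im <= 1)%R.
Proof. by rewrite -lee_fin -sqrt_intE sqrt_int_le1. Qed.

(** Square roots of variables of mean 1 are uniformly integrable: sqrt z is at most the minimum of
    sqrt z and t, plus z / t. The truncated part tends to 0 by dominated convergence. *)
Lemma sqrt_intr_cvg0 im : {ae Pa, forall w, Z (im, w) = 0%R} ->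
  sqrt_intr k im @[k --> \oo] --> (0 : R)%R.
Proof.
move=> Z0; pose g t k (w : W) := Num.min (Num.sqrt (Zk k (im, w))) t.
have mg t k : mfunT (g t k).
  by apply: measurable_minr => //; exact: measurable_sqrt_comp.
have g0 t k w : (0 <= t)%R -> (0 <= g t k w)%R.
  by move=> t0; rewrite le_min sqrtr_ge0.
have I0 t : (0 <= t)%R -> \int[Pa]_w (g t k w)%:E @[k --> \oo] --> 0.
  move=> t0; rewrite -(integral0 Pa setT).
  apply: (@dominated_cvg_real _ _ _ Pa (g t) (cst 0%R) (cst t)) => //.
  - apply: filterS2 (dens_mass_cvg im) Z0 => w h z0.
    have sh : Num.sqrt (Zk k (im, w)) @[k --> \oo] --> (0 : R)%R.
      rewrite -(@sqrtr0 R) -z0; apply: continuous_cvg => //; exact: sqrt_continuous.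
    apply: (@squeeze_cvgr _ _ _ _ (cst 0%R) (fun k => Num.sqrt (Zk k (im, w)))) => //.
      by apply: nearW => k; rewrite g0//= /g ge_min lexx.
    exact: cvg_cst.
  - apply: (@integrable_bounded _ _ _ _ _ t) => //.
    by move=> w; rewrite ger0_norm.
  - apply: nearW => w k; rewrite ger0_norm ?g0//.
    by rewrite /g ge_min lexx orbT.
have le_g t k : (0 < t)%R -> sqrt_int k im <= \int[Pa]_w (g t k w)%:E + (t^-1)%:E.
  move=> t0; have -> : (t^-1)%:E = (t^-1)%:E * \int[Pa]_w (Zk k (im, w))%:E.
    by rewrite integral_dens_mass mule1.
  rewrite -ge0_integralZl//; last 3 first.
  - exact/measurable_EFinP.
  - by move=> w _; rewrite lee_fin dens_mass_ge0.
  - by rewrite lee_fin invr_ge0 ltW.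
  rewrite -ge0_integralD//; last 4 first.
  - by move=> w _; rewrite lee_fin g0// ltW.
  - exact/measurable_EFinP.
  - by move=> w _; rewrite mule_ge0// lee_fin ?dens_mass_ge0// invr_ge0 ltW.
  - by apply: measurable_funeM; exact/measurable_EFinP.
  apply: ge0_le_integral => //.
  - by apply/measurable_EFinP; exact: measurable_sqrt_comp.
  - apply: emeasurable_funD; first exact/measurable_EFinP.
    by apply: measurable_funeM; exact/measurable_EFinP.
  - move=> w _; rewrite -EFinM -EFinD lee_fin /g.
    have z0 := dens_mass_ge0 k (im, w).
    have [st|ts] := leP (Num.sqrt (Zk k (im, w))) t.
      by rewrite lerDl mulr_ge0// invr_ge0 ltW.
    apply: (@le_trans _ _ (t^-1 * Zk k (im, w))%R); last by rewrite lerDr ltW.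
    rewrite -[leLHS]mul1r -(mulVf (lt0r_neq0 t0)) -mulrA.
    apply: ler_wpM2l; first by rewrite invr_ge0 ltW.
    rewrite -[leRHS](sqr_sqrtr z0) expr2; apply: ler_wpM2r; first exact: sqrtr_ge0.
    exact: ltW.
apply/cvgrPdist_le => e e0.
pose t := (2 / e)%R; have t0 : (0 < t)%R by rewrite divr_gt0.
have e2 : (0 < e / 2)%R by rewrite divr_gt0.
have /fine_cvg := I0 t (ltW t0); move/cvgrPdist_le => /(_ _ e2).
apply: filterS => k; rewrite !sub0r !normrN.
rewrite ger0_norm ?fine_ge0//; last by apply: integral_ge0 => w _; rewrite lee_fin g0// ltW.
rewrite ger0_norm ?sqrt_intr_ge0// => h.
have gfin : \int[Pa]_w (g t k w)%:E \is a fin_num.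
  rewrite ge0_fin_numE; last by apply: integral_ge0 => w _; rewrite lee_fin g0// ltW.
  apply: (@le_lt_trans _ _ (\int[Pa]_w (cst t%:E w))); last by rewrite integral_prob_cst ltry.
  apply: ge0_le_integral => //.
  - by move=> w _; rewrite lee_fin g0// ltW.
  - exact/measurable_EFinP.
  - by move=> w _; rewrite lee_fin /g ge_min lexx orbT.
have := le_g t k t0; rewrite sqrt_intE -(fineK gfin) -EFinD lee_fin => h'.
by rewrite (le_trans h')// (splitr e) lerD// /t invf_div lexx.
Qed.

Definition crossr k im : R := (\sum_i \sum_(j | j != i) (Num.sqrt (q i im) * Num.sqrt (q j im)) *
  (sqrt_intr k (scons i im) * sqrt_intr k (scons j im)))%R.

Lemma crossE k im : cross k im = (crossr k im)%:E.
Proof.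
rewrite /cross /crossr -sumEFin; apply: eq_bigr => i _; rewrite -sumEFin.
by apply: eq_bigr => j _; rewrite !sqrt_intE -!EFinM.
Qed.

Let sqrtq_le1 i im : (Num.sqrt (q i im) <= 1)%R.
Proof. by rewrite -[leRHS]sqrtr1 ler_wsqrtr// q_le1. Qed.

Lemma crossr_ge0 k im : (0 <= crossr k im)%R.
Proof.
by apply: sumr_ge0 => i _; apply: sumr_ge0 => j _; rewrite !mulr_ge0// ?sqrtr_ge0// sqrt_intr_ge0.
Qed.

Definition cross_bound : R := (\sum_(i : letter) \sum_(j : letter | j != i) 1)%R.

Lemma crossr_le k im : (crossr k im <= cross_bound)%R.
Proof.
apply: ler_sum => i _; apply: ler_sum => j _.
rewrite mulr_ile1// ?mulr_ge0 ?sqrtr_ge0 ?sqrt_intr_ge0//.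
  by rewrite mulr_ile1// ?sqrtr_ge0 ?sqrtq_le1.
by rewrite mulr_ile1// ?sqrt_intr_ge0 ?sqrt_intr_le1.
Qed.

Let measurable_base_int (f : S * W -> R) : (forall p, (0 <= f p)%R) ->
  mfunT f -> mfunT (fun im => \int[Pa]_w (f (im, w))%:E).
Proof.
move=> f0 mf; apply: (@measurable_integral_kernel _ _ S W R (fun=> Pa)
  (fun _ _ => measurable_cst _) (fun=> Paoo) (fun p : S * W => (f p)%:E)) => //.
exact/measurable_EFinP.
Qed.

Lemma measurable_psi_int k : mfunT (psi_int k).
Proof.
apply: (measurable_base_int (f := fun p => psi (Zk k p))).
  by move=> p; apply: psi_ge0; exact: dens_mass_ge0.
by apply: measurable_psi_comp; exact: measurable_dens_mass.
Qed.

Lemma measurable_sqrt_intr k : mfunT (sqrt_intr k).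
Proof.
apply: measurableT_comp => //.
apply: (measurable_base_int (f := fun p => Num.sqrt (Zk k p))).
  by move=> p; exact: sqrtr_ge0.
by apply: measurable_sqrt_comp; exact: measurable_dens_mass.
Qed.

Lemma measurable_letter_entropy : mfunT letter_entropy.
Proof.
apply/measurable_EFinP; apply: measurable_sum => i.
apply: measurableT_comp => //; apply: measurable_funM; first exact: measurable_q.
by apply: measurable_ln_comp; exact: measurable_q.
Qed.

Lemma measurable_crossr k : mfunT (crossr k).
Proof.
have -> : crossr k = (fun im => \sum_i \sum_j (j != i)%:R *
  ((Num.sqrt (q i im) * Num.sqrt (q j im)) *
  (sqrt_intr k (scons i im) * sqrt_intr k (scons j im))))%R.
  apply/funext => im; apply: eq_bigr => i _; rewrite [LHS]big_mkcond/=.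
  by apply: eq_bigr => j _; case: (j != i); rewrite ?mul1r ?mul0r.
have ms i : mfunT (fun im => sqrt_intr k (scons i im)).
  exact: measurableT_comp (measurable_sqrt_intr k) (measurable_scons i).
apply: measurable_sum => i; apply: measurable_sum => j.
apply: measurable_funM => //; apply: measurable_funM; apply: measurable_funM => //;
  by apply: measurable_sqrt_comp; exact: measurable_q.
Qed.

End nondegeneracy.

Local Notation q := (fun i im => fine (letter_prob i im)).

(** * Total mass 1 *)

Section full_mass.

Local Notation Zk := dens_mass.
Local Notation Z := casc_mass.
Local Notation c := ctot.
Local Notation Qn := densm.

(** If r tended to 0, each step would from some index on decrease e by at least g / 2. *)
Lemma no_nonneg_descent (e r : nat -> R) (g : R) : (0 < g)%R ->
  (forall k, (0 <= e k)%R) -> (forall k, (e k.+1 <= e k - g + r k)%R) ->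
  ~ (r k @[k --> \oo] --> (0 : R)%R).
Proof.
move=> g0 e0 er; have g2 : (0 < g / 2)%R by rewrite divr_gt0.
move/cvgrPdist_le => /(_ _ g2)[N _ HN].
have H n : (e (N + n)%N <= e N - n%:R * (g / 2))%R.
  elim: n => [|n ih]; first by rewrite addn0 mul0r subr0.
  have := er (N + n)%N; have := HN (N + n)%N (leq_addr _ _).
  rewrite /= sub0r normrN ler_norml => /andP[_ h1] h2; rewrite addnS.
  rewrite -natr1; move: (n%:R : R) ih => x ih; lra.
have [n Hn] : exists n : nat, (e N < n%:R * (g / 2))%R.
  exists (Num.truncn (e N / (g / 2))).+1; rewrite -ltr_pdivrMr//.
  by have /andP[] := truncn_itv (divr_ge0 (e0 N) (ltW g2)).
by have := H n; have := e0 (N + n)%N; lra.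
Qed.

Let dens_mass_int (f : S * W -> R) : mfunT f -> (forall p, (0 <= f p)%R) -> forall k,
  \int[Qn k]_p (f p.1)%:E = \int[base]_p (f p * Zk k p)%:E.
Proof.
move=> mf f0 k; rewrite [LHS]integral_skewm.
- apply: eq_integral => p _.
  rewrite (eq_integral (cst (f p)%:E))// integral_cst// EFinM.
  by congr (_ * _); rewrite dens_massE.
- by move=> p; rewrite lee_fin.
- apply/measurable_EFinP; exact: measurableT_comp mf measurable_fst.
Qed.

Let casc_mass_int (f : S * W -> R) : mfunT f -> (forall p, (0 <= f p)%R) ->
  \int[Q]_p (f p.1)%:E = \int[base]_p (f p * Z p)%:E.
Proof.
move=> mf f0; rewrite [LHS]integral_skewm.
- apply: eq_integral => p _.
  rewrite (eq_integral (cst (f p)%:E))// integral_cst// EFinM.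
  by congr (_ * _); rewrite casc_massE.
- by move=> p; rewrite lee_fin.
- apply/measurable_EFinP; exact: measurableT_comp mf measurable_fst.
Qed.

Lemma integral_casc_mass : \int[base]_p (Z p)%:E = c%:E.
Proof.
rewrite ctotE -[RHS]mul1e -integral_cst//.
transitivity (\int[base]_p ((cst 1 p : R) * Z p)%R%:E).
  by apply: eq_integral => p _; rewrite mul1r.
by rewrite -(@casc_mass_int (cst 1%R)).
Qed.

Lemma dens_mass_level k im w w' : (forall u, (size u < k)%N -> w u = w' u) ->
  Zk k (im, w) = Zk k (im, w').
Proof.
move=> ww'; rewrite /dens_mass /density_kernel /= /finite_measure_of.
rewrite /density_kernel_measure /= /density_measure; congr fine.
apply: eq_integral => x _; congr EFin; apply: eq_bigr => j _.
by rewrite ww'// size_prefix_word.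
Qed.

Let mZk k : mfunT (Zk k). Proof. exact: measurable_dens_mass. Qed.
Let mZ : mfunT Z. Proof. exact: measurable_casc_mass. Qed.
Let max1_gt0 (z : R) : (0 < Num.max z 1)%R.
Proof. by rewrite lt_max ltr01 orbT. Qed.

Let mmax (f : S * W -> R) : mfunT f -> mfunT (fun p => (Num.max (f p) 1)^-1%R).
Proof.
move=> mf; have -> : (fun p => (Num.max (f p) 1)^-1%R) = (fun p => expR (- ln (Num.max (f p) 1)))%R.
  by apply/funext => p; rewrite expRN lnK// posrE.
apply: measurableT_comp => //; apply: measurableT_comp => //.
by apply: measurable_ln_comp; exact: measurable_maxr.
Qed.

(* Testing the level k identity with 1 / max(Z_k, 1) gives c l = l, where l is
   the integral of Z / max(Z, 1). *)
Lemma ctot1 : (0 < c)%R -> c = 1%R.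
Proof.
move=> c0.
pose h (x y : R) := ((Num.max x 1)^-1 * y)%R.
have E k : \int[base]_p (h (Zk k p) (Z p))%:E = c%:E * \int[base]_p (h (Zk k p) (Zk k p))%:E.
  have mm := mmax (mZk k).
  have m0 p : (0 <= (Num.max (Zk k p) 1)^-1)%R by rewrite invr_ge0 ltW// max1_gt0.
  rewrite -(casc_mass_int mm m0) -(dens_mass_int mm m0).
  apply: integral_cascm_level.
  - by move=> p; rewrite lee_fin.
  - apply/measurable_EFinP; exact: measurableT_comp mm measurable_fst.
  - by move=> im w w' x ww'; rewrite (dens_mass_level im ww').
have hh : {ae base, forall p, (Num.max (Zk k p) 1)^-1%R @[k --> \oo] --> (Num.max (Z p) 1)^-1%R}.
  apply: filterS ae_dens_mass_cvg => p Zp.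
  apply: cvgV; first by rewrite gt_eqF// max1_gt0.
  under eq_fun do rewrite maxr_absE; rewrite maxr_absE; apply: cvgMl.
  apply: cvgD; first by apply: cvgD => //; exact: cvg_cst.
  by apply: cvg_norm; apply: cvgB => //; exact: cvg_cst.
have iZ : base.-integrable setT (EFin \o Z).
  apply/integrableP; split; first exact/measurable_EFinP.
  rewrite (eq_integral (EFin \o Z)) ?integral_casc_mass ?ltry// => p _.
  by rewrite gee0_abs// lee_fin casc_mass_ge0.
have L1 : \int[base]_p (h (Zk k p) (Z p))%:E @[k --> \oo] --> \int[base]_p (h (Z p) (Z p))%:E.
  apply: (@dominated_cvg_real _ _ _ base (fun k p => h (Zk k p) (Z p)) (fun p => h (Z p) (Z p)) Z) => //.
  - by move=> k; apply: measurable_funM => //; exact: mmax.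
  - by apply: measurable_funM => //; exact: mmax.
  - by apply: filterS hh => p hp; apply: cvgM => //; exact: cvg_cst.
  - apply: nearW => p k; rewrite ger0_norm; last first.
      by rewrite mulr_ge0 ?casc_mass_ge0// invr_ge0 ltW// max1_gt0.
    by rewrite ler_piMl ?casc_mass_ge0// invf_le1 ?max1_gt0// le_max lexx orbT.
have L2 : \int[base]_p (h (Zk k p) (Zk k p))%:E @[k --> \oo] --> \int[base]_p (h (Z p) (Z p))%:E.
  apply: (@dominated_cvg_real _ _ _ base (fun k p => h (Zk k p) (Zk k p)) (fun p => h (Z p) (Z p)) (cst 1%R)) => //.
  - by move=> k; apply: measurable_funM => //; exact: mmax.
  - by apply: measurable_funM => //; exact: mmax.
  - apply: filterS2 hh ae_dens_mass_cvg => p hp Zp; exact: cvgM.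
  - by apply: (@integrable_bounded _ _ _ _ _ 1) => //; rewrite ?basemT ?ltry// => x; rewrite normr1.
  - apply: nearW => p k; rewrite ger0_norm; last first.
      by rewrite mulr_ge0 ?dens_mass_ge0// invr_ge0 ltW// max1_gt0.
    by rewrite /h /cst mulrC ler_pdivrMr ?max1_gt0// mul1r le_max lexx.
pose l := \int[base]_p (h (Z p) (Z p))%:E.
have lE : l = c%:E * l.
  apply: (@cvg_unique _ _ (\int[base]_p (h (Zk k p) (Z p))%:E @[k --> \oo])) => //.
  rewrite (funext E); exact: cvgeZl.
have h0 p : (0 <= h (Z p) (Z p))%R.
  by rewrite mulr_ge0 ?casc_mass_ge0// invr_ge0 ltW// max1_gt0.
have mh : mfunT (fun p => (h (Z p) (Z p))%:E).
  by apply/measurable_EFinP; apply: measurable_funM => //; exact: mmax.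
have l0 : 0 <= l by apply: integral_ge0 => p _; rewrite lee_fin.
have lfin : l \is a fin_num.
  rewrite ge0_fin_numE//; apply: (@le_lt_trans _ _ (\int[base]_p (Z p)%:E)).
    apply: ge0_le_integral => //; first by move=> p _; rewrite lee_fin.
      exact/measurable_EFinP.
    move=> p _; rewrite lee_fin ler_piMl ?casc_mass_ge0// invf_le1 ?max1_gt0//.
    by rewrite le_max lexx orbT.
  by rewrite integral_casc_mass ltry.
have ln0 : l != 0.
  apply/negP => /eqP lz.
  have : {ae base, forall p, setT p -> (h (Z p) (Z p))%:E = 0}.
    apply/(ae_eq_integral_abs base measurableT mh).
    by rewrite -[RHS]lz; apply: eq_integral => p _; rewrite gee0_abs// lee_fin.
  move=> hz; move: c0; rewrite -lte_fin -integral_casc_mass.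
  rewrite (ge0_ae_eq_integral (g := cst 0))//.
  - by rewrite integral0 ltxx.
  - exact/measurable_EFinP.
  - by move=> p _; rewrite lee_fin casc_mass_ge0.
  - apply: filterS hz => p /(_ I) [/eqP]; rewrite mulf_eq0 invr_eq0 gt_eqF ?max1_gt0//=.
    by move=> /eqP -> _.
have := lE; rewrite -(fineK lfin) -EFinM => -[] /eqP.
have : fine l != 0%R by apply: contra ln0 => /eqP l0'; rewrite -(fineK lfin) l0'.
move: (fine l) => y y0; rewrite -subr_eq0 -{1}[y]mul1r -mulrBl mulf_eq0 (negbTE y0) orbF.
by rewrite subr_eq0 => /eqP.
Qed.

(** If the total mass were 0, the limit masses would vanish, the cross terms would tend to 0, and
    the mean of psi would drop at each step by nearly the gap between the two sides of the
    hypothesis, although it stays nonnegative. *)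
Lemma ctot_gt0 : \int[P]_x (psi (V x))%:E < 1 + \int[pastm]_im letter_entropy im -> (0 < c)%R.
Proof.
move=> gap; rewrite lt0r fine_ge0// andbT; apply/negP => /eqP c0.
have Z0 : {ae base, forall p, Z p = 0%R}.
  have : {ae base, forall p, setT p -> (Z p)%:E = 0}.
    apply/(ae_eq_integral_abs base measurableT); first exact/measurable_EFinP.
    have := integral_casc_mass; rewrite c0 => i0; rewrite -[RHS]i0.
    by apply: eq_integral => p _; rewrite gee0_abs// lee_fin casc_mass_ge0.
  by apply: filterS => p /(_ I) [].
have {}Z0 : {ae pastm, forall im, {ae Pa, forall w, Z (im, w) = 0%R}} by exact: ae_mprod Z0.
have r0 : {ae pastm, forall im, crossr k im @[k --> \oo] --> (0 : R)%R}.
  apply: filterS (ae_scons Z0) => im H.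
  rewrite -[X in _ --> X](_ : \sum_(i : letter) (0 : R) = 0)%R; last by rewrite big1.
  rewrite /crossr; apply: cvg_sum_seq => i.
  rewrite -[X in _ --> X](_ : \sum_(j : letter | j != i) (0 : R) = 0)%R; last by rewrite big1.
  under eq_fun do rewrite -big_filter; rewrite -big_filter; apply: cvg_sum_seq => j.
  (* A prepended letter either has probability 0 or leads to a past for which the limit mass
     vanishes. *)
  have [pi0|Zi] := H i.
    by rewrite pi0 sqrtr0; under eq_fun do rewrite !mul0r; exact: cvg_cst.
  have [pj0|Zj] := H j.
    by rewrite pj0 sqrtr0; under eq_fun do rewrite mulr0 mul0r; exact: cvg_cst.
  have si := sqrt_intr_cvg0 Zi.
  have sj := sqrt_intr_cvg0 Zj.
  rewrite -[X in _ --> X](mulr0 (Num.sqrt (fine (letter_prob i im)) *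
    Num.sqrt (fine (letter_prob j im)))%R).
  apply: cvgM; first exact: cvg_cst.
  rewrite -[X in _ --> X](mulr0 (0 : R)%R); exact: cvgM si sj.
pose r k := \int[pastm]_im (crossr k im)%:E.
have pT : pastm setT < +oo by rewrite pastmT ltry.
have mc k : mfunT (crossr k) by exact: measurable_crossr.
have c_ge0 k im : (0 <= crossr k im)%R by exact: crossr_ge0.
have rcvg : r k @[k --> \oo] --> 0.
  rewrite -(integral0 pastm setT).
  apply: (@dominated_cvg_real _ _ _ pastm crossr (cst 0%R) (cst cross_bound)) => //.
  - apply: (@integrable_bounded _ _ _ _ _ `|cross_bound|%R) => //.
  - by apply: nearW => im k; rewrite ger0_norm// crossr_le.
have rfin k : r k \is a fin_num.
  rewrite ge0_fin_numE; last by apply: integral_ge0 => im _; rewrite lee_fin.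
  apply: (@le_lt_trans _ _ (\int[pastm]_im (cst cross_bound%:E im))).
    apply: ge0_le_integral => //; first by move=> im _; rewrite lee_fin.
      exact/measurable_EFinP.
    by move=> im _; rewrite lee_fin crossr_le.
  by rewrite integral_cst// pastmT mule1 ltry.
pose e k := \int[pastm]_im psi_int k im.
have psi_int0 k im : 0 <= psi_int k im.
  by apply: integral_ge0 => w _; rewrite lee_fin psi_ge0// dens_mass_ge0.
have e0 k : 0 <= e k by apply: integral_ge0.
have H0 im : 0 <= letter_entropy im.
  rewrite lee_fin; apply: sumr_ge0 => i _.
  by rewrite -mulrN mulr_ge0// ?q_ge0// oppr_ge0 ln_le0// q_le1.
set Psi := \int[P]_x _ in gap; set H := \int[pastm]_im _ in gap.
have mH := measurable_letter_entropy.
have Psi0 : 0 <= Psi by apply: integral_ge0 => x _; rewrite lee_fin psi_ge0.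
have H00 : 0 <= H by apply: integral_ge0.
have Psifin : Psi \is a fin_num.
  by rewrite ge0_fin_numE// (lt_le_trans gap)// leey.
have mpsi k : mfunT (psi_int k) by exact: measurable_psi_int.
have mqp k i : mfunT (fun im => psi_int k (scons i im) * letter_prob i im).
  apply: emeasurable_funM; last exact: measurable_letter_prob.
  exact: measurableT_comp (mpsi k) (measurable_scons i).
have step k : e k.+1 + H + 2%:E <= 1 + (Psi + (e k + r k)).
  have mA : mfunT (fun im => \sum_i psi_int k (scons i im) *
    letter_prob i im) by apply: emeasurable_sum.
  have A0 im : 0 <= \sum_i psi_int k (scons i im) * letter_prob i im.
    by apply: sume_ge0 => i _; rewrite mule_ge0.
  have -> : e k.+1 + H + 2%:E = \int[pastm]_im (psi_int k.+1 im + letter_entropy im + 2%:E).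
    rewrite (ge0_integralD _ measurableT (f2 := cst 2%:E))//; last 3 first.
    - by move=> im _; rewrite adde_ge0.
    - exact: emeasurable_funD.
    - by move=> im _; rewrite lee_fin.
    by rewrite ge0_integralD// integral_cst// -[X in _ = _ + _ * X]/(pastm setT) pastmT mule1.
  have -> : 1 + (Psi + (e k + r k)) = \int[pastm]_im (1 + (Psi +
      (\sum_i psi_int k (scons i im) * letter_prob i im + (crossr k im)%:E))).
    have mB : mfunT (fun im => \sum_i psi_int k (scons i im) * letter_prob i im + (crossr k im)%:E).
      by apply: emeasurable_funD => //; exact/measurable_EFinP.
    have B0 im : 0 <= \sum_i psi_int k (scons i im) * letter_prob i im +
        (crossr k im)%:E by rewrite adde_ge0// lee_fin.
    rewrite (ge0_integralD _ measurableT (f1 := cst 1))//; last 2 first.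
    - by move=> im _; rewrite adde_ge0.
    - exact: emeasurable_funD.
    rewrite (ge0_integralD _ measurableT (f1 := cst Psi))//.
    rewrite (ge0_integralD _ measurableT (f2 := fun im => (crossr k im)%:E))//; last 2 first.
    - by move=> im _; rewrite lee_fin.
    - exact/measurable_EFinP.
    rewrite !integral_cst// -[X in _ = _ * X + _]/(pastm setT) pastmT mul1e ?mule1.
    by rewrite /e integral_pastm_scons.
  have mC : mfunT (fun im => 1 + (Psi + (\sum_i psi_int k (scons i im) * letter_prob i im +
       (crossr k im)%:E))).
    apply: emeasurable_funD => //; apply: emeasurable_funD => //.
    by apply: emeasurable_funD => //; exact/measurable_EFinP.
  have mD : mfunT (fun im => psi_int k.+1 im + letter_entropy im + 2%:E).
    by apply: emeasurable_funD => //; exact: emeasurable_funD.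
  apply: ae_ge0_le_integral => //.
  - by move=> im _; apply: adde_ge0; [exact: adde_ge0|rewrite lee_fin].
  - by move=> im _; apply: adde_ge0 => //; apply: adde_ge0 => //; apply: adde_ge0 => //;
      rewrite lee_fin.
  apply: filterS disintegration_scons => im gim _.
  rewrite (le_trans (psi_int_step k gim))// crossE leeD2l// leeD2l// leeD2r//; apply: lee_sum => i _.
  by rewrite muleC fineK// letter_prob_fin.
(* Finiteness of all [e k] and of [H] is read off the step inequality itself, starting from e 0 =
   1. *)
have stepfin k : e k \is a fin_num -> e k.+1 + H + 2%:E < +oo.
  move=> ek; apply: le_lt_trans (step k) _.
  by rewrite -(fineK ek) -(fineK (rfin k)) -(fineK Psifin) -!EFinD ltry.
have efin k : e k \is a fin_num.
  elim: k => [|k ih].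
    rewrite /e (eq_integral (cst 1)).
      by rewrite integral_cst// pastmT mul1e.
    move=> im _; rewrite /psi_int (eq_integral (cst 1)); first exact: integral_prob_cst.
    by move=> w _; rewrite dens_mass0 /psi ln1 mulr0 add0r.
  rewrite ge0_fin_numE//; apply: le_lt_trans (stepfin k ih).
  by rewrite -addeA leeDl// adde_ge0.
have Hfin : H \is a fin_num.
  rewrite ge0_fin_numE//; apply: le_lt_trans (stepfin 0%N (efin 0%N)).
  by rewrite addeAC leeDr// adde_ge0.
apply: (@no_nonneg_descent (fine \o e) (fine \o r) (1 + fine H - fine Psi)%R).
- by rewrite subr_gt0 -lte_fin EFinD !fineK.
- by move=> k /=; rewrite fine_ge0.
- move=> k; move: (step k) (efin k.+1) (efin k) (rfin k) Hfin Psifin.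
  rewrite /comp; generalize (e k.+1) (e k) (r k) H Psi => -[x| |] [y| |] [z| |] [h| |] [p| |]//.
  by rewrite -!EFinD lee_fin /fine => le _ _ _ _ _; exact: descent_rearrange.
- by have /fine_cvg := rcvg.
Qed.

End full_mass.

Hypothesis Q1 : Q setT = 1.

(** * Ergodicity of the skew shift *)

Section ergodicity.

Lemma cascm_endsE A : measurable A -> Q (ends @^-1` A) = extm A.
Proof.
move=> mA; rewrite [LHS](cascm_ends mA).
by rewrite ctotE [X in X * _]Q1 mul1e.
Qed.

Section invariant_set.
Variable A : set X.
Hypothesis mA : measurable A.
Hypothesis TA : T @^-1` A = A.

Let QA : {measure set X -> \bar R} := mrestr Q mA.

Let QAle B : measurable B -> QA B <= Q B.
Proof. by move=> mB; rewrite /QA/= /mrestr le_measure ?inE//; exact: measurableI. Qed.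

Let restr_ends B : measurable B -> QA (ends @^-1` B) = Q A * extm B.
Proof.
move=> mB; pose rho := image_measure QA measurable_ends.
have mpre (C : set (S * S)) : measurable C -> measurable (ends @^-1` C).
  by move=> mC; exact: (measurable_preimage measurable_ends).
have -> : Q A = rho setT by rewrite /rho /= /pushforward /QA /= /mrestr preimage_setT setTI.
rewrite -[LHS]/(rho B).
apply: (@ergodic_invariant_measure _ _ _ extm ext_shift) => //.
- exact: extmT.
- exact: measurable_ext_shift.
- by move=> C mC; exact: ext_shift_inv.
- by move=> C mC; exact: ext_ergodic.
- by move=> C mC; rewrite -(cascm_endsE mC); exact: QAle (mpre _ mC).
- move=> C mC; rewrite /rho /= /pushforward /QA /= /mrestr.
  rewrite -[in LHS]TA -[LHS]/(Q (T @^-1` (ends @^-1` C `&` A))).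
  rewrite cascm_skew//; apply: measurableI => //; exact: mpre.
Qed.

Let QA1 : (0 <= fine (Q A))%R. Proof. exact: fine_ge0. Qed.

Let QAE : (fine (Q A))%:E = Q A.
Proof. by rewrite fineK//; apply: pmeasure_fin. Qed.

(** At level 0 the restriction of Q to A is a multiple of Q because the ends form an ergodic system.
    The transfer carries this to every level, since the indicator of the invariant set A is
    unchanged by T. *)
Lemma restr_level k f : (forall p, 0 <= f p) -> mfunT f ->
  level k f -> \int[Q]_(p in A) f p = Q A * \int[Q]_p f p.
Proof.
elim: k f => [|k ih] f f0 mf lf.
  have mfp := measurable_at_point mf.
  rewrite (integral_cascm_level0 f0 mf lf) ctotE [X in _ * (X * _)]Q1 mul1e.
  rewrite -ge0_integral_mrestr// -QAE -(ge0_integral_mscale _ measurableT (NngNum QA1))//.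
  rewrite -(@ge0_integral_image _ _ _ _ _ QA _ ends)//; last first.
    by move=> B mB; rewrite -[RHS]/((fine (Q A))%:E * extm B) QAE; exact: restr_ends.
  by apply: eq_integral => -[[im w] x] _; exact: lf.
have tf0 q : 0 <= transfer f q by exact: transfer_ge0.
have mtf : mfunT (transfer f) by exact: measurable_transfer.
have mi : mfunT (fun p => (\1_A p)%:E : \bar R).
  exact: measurable_EFin_indic.
have i0 p : 0 <= (\1_A p)%:E :> \bar R by rewrite lee_fin.
have inv g : \int[Q]_(p in A) g p = \int[Q]_p ((\1_A p)%:E * g p).
  rewrite integral_mkcond; apply: eq_integral => p _.
  by rewrite patchE indicE; case: (p \in A); rewrite ?mul1e ?mul0e.
have H := integral_cascm_transfer.
transitivity (Q A * \int[Q]_p transfer f p).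
  rewrite -(ih _ tf0 mtf (level_transfer lf)) !inv -(H _ _ i0 mi f0 mf).
  by apply: eq_integral => p _; rewrite -[in LHS]TA.
congr (_ * _); transitivity (\int[Q]_p (cst 1 p * transfer f p)).
  by apply: eq_integral => p _; rewrite mul1e.
rewrite -H//.
by apply: eq_integral => p _; rewrite mul1e.
Qed.

(** A box whose tree factor is a finite cylinder has finite level, so A is independent of every
    measurable B, and of itself in particular. *)
Lemma restr_cascm B : measurable B -> Q (B `&` A) = Q A * Q B.
Proof.
move=> mB; rewrite -[LHS]/(QA B) -QAE.
rewrite -[RHS]/(mscale (NngNum QA1) Q B).
apply: (eq_measure_box (Pi := @finite_cylinders _ _ Omega)) => //.
- by move=> _ [s [C [_ mC ->]]]; exact: measurable_finite_cylinder.
- move=> n1 n2 n1oo H; apply: eq_measure_finite_cylinder => // s C us mC.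
  by apply: H; exists s, C.
- by rewrite (le_lt_trans (QAle _))// Q1 ltry.
move=> D _ C mD [s [F [us mF ->]]] mC.
set B' := _ `*` C.
have mB' : measurable B'.
  by apply: measurableX => //; apply: measurableX => //; exact: measurable_finite_cylinder.
have mi : mfunT (fun p => (\1_B' p)%:E : \bar R).
  exact: measurable_EFin_indic.
have := restr_level (k := (\max_(u <- s) size u).+1) (f := fun p => (\1_B' p)%:E).
rewrite !integral_indic// setIT -[X in _ -> _ = X]/((fine (Q A))%:E * Q B') QAE; apply => //.
- move=> im w w' x ww'; congr (_%:E); rewrite !indicE; congr ((nat_of_bool _)%:R).
  have E u : u \in s -> w u = w' u.
    by move=> us'; apply: ww'; rewrite ltnS; exact: leq_bigmax_seq.
  apply/idP/idP; rewrite !inE /B' /finite_cylinder /= => -[[Dim Fw] Cx]; do !split => //.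
    by move=> i si; rewrite -E//; exact: Fw.
  by move=> i si; rewrite E//; exact: Fw.
Qed.

End invariant_set.

Lemma cascm_ergodic A : measurable A -> T @^-1` A = A -> Q A = 0 \/ Q A = 1.
Proof.
move=> mA TA; have := restr_cascm mA TA mA; rewrite setIid.
have : Q A \is a fin_num by exact: pmeasure_fin.
case: (Q A) => // x _; rewrite -EFinM => -[] /eqP.
rewrite -subr_eq0 -{1}[x]mulr1 -mulrBr mulf_eq0 => /orP[/eqP ->|]; first by left.
by rewrite subr_eq0 => /eqP <-; right.
Qed.

End ergodicity.

Let mT : mfunT (T : X -> X). Proof. exact: measurable_skew. Qed.
Let Tinv A : measurable A -> Q (T @^-1` A) = Q A. Proof. exact: cascm_skew. Qed.
Let Terg A : measurable A -> T @^-1` A = A -> Q A = 0 \/ Q A = 1.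
Proof. by move=> *; apply: cascm_ergodic. Qed.

(** * The entropy as a mean over the past *)

Section entropy.

Let pm_fin A : measurable A -> pm A \is a fin_num.
Proof. exact: fin_num_of_lty. Qed.

(** The reversal is due to the past listing its letters from the latest to the oldest. *)
Lemma extm_words u v : extm (cylinder u `*` cylinder v) = mup (cylinder (catrev u v)).
Proof.
elim: u v => [|i u ih] v.
  rewrite cylinder_nil; apply: extm_future; exact: measurable_cylinder.
rewrite -ih -ext_shift_inv; last by apply: measurableX; exact: measurable_cylinder.
congr (extm _); rewrite ext_shift_cylinder; congr (_ `*` _).
by rewrite (cylinder_cons i v) cylinder_cons cylinder_nil preimage_setT setIT.
Qed.

Lemma extm_past A : measurable A -> extm (A `*` setT) = pm A.
Proof.
move=> mA; rewrite extmX//; under eq_integral do rewrite kappaT.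
by rewrite integral_cst// mul1e.
Qed.

Lemma pastm_word u : pm (cylinder u) = mup (cylinder (rev u)).
Proof.
rewrite -extm_past; last exact: measurable_cylinder.
by rewrite -cylinder_nil extm_words.
Qed.

Lemma q01 i im : (0 <= q i im <= 1)%R.
Proof. by rewrite fine_ge0//= -lee_fin fineK ?letter_prob_fin// letter_prob_le1. Qed.

Lemma measurable_qi i : mfunT (q i).
Proof. apply: measurableT_comp => //; exact: measurable_letter_prob. Qed.

Let Pu (u : seq letter) : R := fine (pm (cylinder u)).

Let PE u : (Pu u)%:E = pm (cylinder u).
Proof. by rewrite fineK//; apply: pm_fin; exact: measurable_cylinder. Qed.

Let P0 u : (0 <= Pu u)%R. Proof. exact: fine_ge0. Qed.

(** The conditional probability of the next letter i given only the last letters u, the latest one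
    first. *)
Local Notation B := (fun u i => cylinder_ratio pm (q i) u).

Let B01 u i : (0 <= B u i <= 1)%R.
Proof.
apply/andP; split; first by apply: cylinder_ratio_ge0; exact: q01.
by apply: cylinder_ratio_le1 => //; [exact: measurable_qi|exact: q01].
Qed.

Let BP u i : (B u i * Pu u)%R = Pu (i :: u).
Proof.
apply: EFin_inj; rewrite EFinM PE cylinder_ratioM//; first last.
- exact: q01.
- exact: measurable_qi.
rewrite PE -extm_past; last exact: measurable_cylinder.
rewrite -ext_shift_inv; last by apply: measurableX => //; exact: measurable_cylinder.
rewrite ext_shift_cylinder preimage_setT setIT extmX; [|exact: measurable_cylinder..].
by apply: eq_integral => im _; rewrite fineK// letter_prob_fin.
Qed.

Let sumP u : (\sum_i Pu (i :: u))%R = Pu u.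
Proof.
apply: EFin_inj; rewrite -sumEFin PE.
rewrite (eq_bigr (fun i => \int[pm]_(x in cylinder u) (q i x)%:E)) => [|i _]; last first.
  rewrite -BP EFinM PE; apply: cylinder_ratioM => //; [exact: measurable_qi|exact: q01].
have mc := @measurable_cylinder a ha u.
have -> : \sum_i \int[pm]_(x in cylinder u) (q i x)%:E =
    \int[pm]_(x in cylinder u) \sum_i (q i x)%:E.
  rewrite ge0_integral_sum// => i.
    by apply/measurable_EFinP; apply: measurable_funTS; exact: measurable_qi.
  by move=> x _; rewrite lee_fin; have /andP[] := q01 i x.
rewrite (eq_integral (cst 1)) ?integral_cst ?mul1e// => im _.
by rewrite -(sum_letter_prob im); apply: eq_bigr => i _; rewrite fineK// letter_prob_fin.
Qed.

Let sumB u : (\sum_i B u i <= 1)%R.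
Proof.
have [p0|pn0] := eqVneq (Pu u) 0%R.
  rewrite big1// => i _; rewrite /cylinder_ratio -/(Pu u) p0 invr0 mulr0//.
rewrite -(ler_pM2r (x := Pu u)); last by rewrite lt_def pn0 P0.
by rewrite mulr_suml mul1r (eq_bigr _ (fun i _ => BP u i)) sumP.
Qed.

Let Bcvg : {ae pm, forall im i, B (prefix_word im n) i @[n --> \oo] --> q i im}.
Proof.
suff H : forall s : seq letter, {ae pm, forall im i, i \in s ->
    B (prefix_word im n) i @[n --> \oo] --> q i im}.
  by apply: filterS (H (enum (predT : pred letter))) => im Him i; apply: Him; rewrite mem_enum.
elim => [|j s ih]; first exact: aeW.
have Hj := cylinder_differentiation pmoo (measurable_qi j) (q01 j).
by apply: filterS2 ih Hj => im h1 h2 i; rewrite inE => /predU1P[->//|]; exact: h1.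
Qed.

Let eta (x : R) : R := (- (x * ln x))%R.
Let E u : R := (\sum_i eta (B u i))%R.
Let H n : R := (\sum_(u : n.-tuple letter) eta (Pu u))%R.

Let E0 u : (0 <= E u)%R. Proof. by apply: sumr_ge0 => i _; exact: xlnx_ge0. Qed.

Let E_le u : (E u <= #|{: letter}|%:R)%R.
Proof.
rewrite -sumr_const; apply: ler_sum => i _; exact: xlnx_le1.
Qed.

Let etaM x y : (0 <= x)%R -> (0 <= y)%R -> eta (x * y) = (x * eta y + y * eta x)%R.
Proof.
move=> x0 y0; rewrite /eta.
have [->|xn] := eqVneq x 0%R; first by rewrite !mul0r oppr0 mulr0 addr0.
have [->|yn] := eqVneq y 0%R; first by rewrite !mul0r !mulr0 !mul0r oppr0 !mulr0 addr0.
by rewrite lnM ?posrE ?lt_def ?xn ?yn//; ring.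
Qed.

(** The chain rule for the entropy of words. *)
Let HS n : H n.+1 = (H n + \sum_(u : n.-tuple letter) Pu u * E u)%R.
Proof.
rewrite /H (sum_tupleS _ (fun u => eta (Pu u))) exchange_big -big_split/=; apply: eq_bigr => u _.
have B0 i : (0 <= B u i)%R by have /andP[] := B01 u i.
under eq_bigr do rewrite -BP etaM//.
rewrite big_split/= -mulr_suml -mulr_sumr; congr (_ + _)%R.
have [p0|pn0] := eqVneq (Pu u) 0%R; first by rewrite /eta p0 mul0r oppr0 mulr0.
rewrite -[RHS]mul1r; congr (_ * _)%R; apply: (mulIf pn0).
by rewrite mul1r mulr_suml (eq_bigr _ (fun i _ => BP u i)) sumP.
Qed.

Let H0 : H 0 = 0%R.
Proof.
rewrite /H big1// => u _; have -> : tval u = [::] by case: u => -[].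
by rewrite /Pu cylinder_nil pastmT /eta ln1 mulr0 oppr0.
Qed.

Let mE n : mfunT (fun im : S => E (prefix_word im n)).
Proof. exact: measurable_prefix_real. Qed.

Lemma letter_entropy_ge0 im : 0 <= letter_entropy im.
Proof. by rewrite lee_fin; apply: sumr_ge0 => i _; apply: xlnx_ge0; exact: q01. Qed.

Lemma letter_entropy_le im : letter_entropy im <= #|{: letter}|%:R%:E.
Proof.
rewrite lee_fin -sumr_const; apply: ler_sum => i _; apply: xlnx_le1; exact: q01.
Qed.

Definition fiber_entropy : R := fine (\int[pm]_im letter_entropy im).

Lemma fiber_entropyE : fiber_entropy%:E = \int[pm]_im letter_entropy im.
Proof.
rewrite fineK// ge0_fin_numE; last by apply: integral_ge0 => im _; exact: letter_entropy_ge0.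
apply: (@le_lt_trans _ _ (\int[pm]_im (cst #|{: letter}|%:R%:E im))).
  apply: ge0_le_integral => //.
  - by move=> im _; exact: letter_entropy_ge0.
  - exact: measurable_letter_entropy.
  - by move=> im _; exact: letter_entropy_le.
by rewrite integral_cst// pastmT mule1 ltry.
Qed.

Let const_int (c : R) : pm.-integrable setT (EFin \o cst c).
Proof. by apply: (@integrable_bounded _ _ _ _ _ `|c|%R). Qed.

Let increment_cvg : (fun n => \sum_(u : n.-tuple letter) Pu u * E u)%R @ \oo --> fiber_entropy.
Proof.
have L : \int[pm]_im (E (prefix_word im n))%:E @[n --> \oo] --> \int[pm]_im letter_entropy im.
  apply: (@dominated_cvg_real _ _ _ pm (fun n im => E (prefix_word im n))
    (fun im => (\sum_i - (q i im * ln (q i im)))%R) (cst #|{: letter}|%:R)) => //.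
  - by apply/measurable_EFinP; exact: measurable_letter_entropy.
  - apply: filterS Bcvg => im Him; apply: cvg_sum_seq => i; apply: xlnx_cvg => //.
  - by apply: nearW => im n; rewrite ger0_norm.
have HE n : \int[pm]_im (E (prefix_word im n))%:E = (\sum_(u : n.-tuple letter) Pu u * E u)%R%:E.
  rewrite ge0_integral_prefix_fun// -sumEFin; apply: eq_bigr => u _.
  by rewrite mulrC EFinM PE.
rewrite -fiber_entropyE (funext HE) in L; exact: (fine_cvg L).
Qed.

(** By the chain rule the increments of [H] are the conditional entropies given n letters of the
    past. They converge to the one given the whole past, and the entropy is their Cesaro limit. *)
Lemma entropyE : entropy mup = fiber_entropy.
Proof.
have HP n : H n = (- \sum_(u : n.-tuple letter)
    fine (mup (cylinder u)) * ln (fine (mup (cylinder u))))%R.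
  have ri : injective (fun u : n.-tuple letter => [tuple of rev u]).
    by move=> u v /(congr1 val)/= uv; apply: val_inj; rewrite /= -(revK u) uv revK.
  rewrite -sumrN /H (reindex_inj ri)/=.
  by apply: eq_bigr => u _; rewrite /eta /Pu pastm_word revK.
have Hn n : H n = (\sum_(0 <= k < n) \sum_(u : k.-tuple letter) Pu u * E u)%R.
  by elim: n => [|n ih]; [rewrite H0 big_nil|rewrite HS big_nat_recr//= -ih].
apply: cvg_lim => //; rewrite -(cvg_shiftS (fun n : nat => - (n%:R^-1 * \sum_(u : n.-tuple letter)
         fine (mup (cylinder u)) * ln (fine (mup (cylinder u)))))%R).
have := cesaro increment_cvg; apply: cvg_trans; apply: near_eq_cvg; apply: nearW => n.
by rewrite /= /arithmetic_mean/= -mulrN -HP Hn /series/=.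
Qed.

(** A conditional law of finite memory whose cross entropy is within e of the optimum. The ratios B
    are mixed with a constant so that the logarithms stay bounded: the factor t = exp (- e / 2)
    costs e / 2, and c = (1 - t) / N keeps the sums at most 1. *)
Lemma approximate_conditional (e : R) : (0 < e)%R -> exists (m : nat) (g : seq letter -> letter -> R)
  (c : R), [/\ (0 < c)%R, forall v i, (c <= g v i <= 1)%R, forall v, (\sum_i g v i <= 1)%R &
   \int[pm]_im (\sum_i q i im * - ln (g (prefix_word im m) i))%R%:E <= (fiber_entropy + e)%:E].
Proof.
move=> e0; pose t := expR (- (e / 2)); have t0 : (0 < t)%R by exact: expR_gt0.
have t1 : (t < 1)%R by rewrite expR_lt1 oppr_lt0 divr_gt0.
have N0 : (0 < #|{: letter}|)%N by apply/card_gt0P; exists point.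
pose N : R := #|{: letter}|%:R; have NR : (0 < N)%R by rewrite ltr0n.
pose c := ((1 - t) / N)%R; have c0 : (0 < c)%R by rewrite divr_gt0 ?subr_gt0.
pose g v i := (t * B v i + c)%R.
have gc v i : (c <= g v i)%R by rewrite lerDr mulr_ge0 ?(ltW t0)//; have /andP[] := B01 v i.
have gsum v : (\sum_i g v i <= 1)%R.
  rewrite big_split/= -mulr_sumr sumr_const -[X in (_ + X)%R]mulr_natr -/N mulfVK ?gt_eqF//.
  by rewrite -lerBrDr opprB addrC subrK ler_piMr// ltW.
have g1 v i : (g v i <= 1)%R.
  rewrite (le_trans _ (gsum v))// (bigD1 i)//= lerDl; apply: sumr_ge0 => j _.
  by rewrite (le_trans (ltW c0)).
have g0 v i : (0 < g v i)%R by rewrite (lt_le_trans c0).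
pose F n (im : S) := (\sum_i q i im * - ln (g (prefix_word im n) i))%R.
pose G (im : S) := (\sum_i q i im * - ln (t * q i im + c))%R.
have c1 : (c <= 1)%R by rewrite (le_trans (gc [::] point)).
have lnc x : (c <= x)%R -> (x <= 1)%R -> (0 <= - ln x <= - ln c)%R.
  by move=> cx x1; rewrite oppr_ge0 ln_le0//= lerN2 ler_ln// posrE (lt_le_trans c0).
have q0 i im : (0 <= q i im)%R by have /andP[] := q01 i im.
have q1 i im : (q i im <= 1)%R by have /andP[] := q01 i im.
have tq im i : (c <= t * q i im + c)%R by rewrite lerDr mulr_ge0// ltW.
have mF n : mfunT (F n).
  apply: measurable_sum => i; apply: measurable_funM; first exact: measurable_qi.
  exact: (measurable_prefix_real (fun u => - ln (g u i))%R).
have mG : mfunT G.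
  apply: measurable_sum => i; apply: measurable_funM; first exact: measurable_qi.
  apply: measurableT_comp => //; apply: measurable_ln_comp; apply: measurable_funD => //.
  by apply: measurable_funM => //; exact: measurable_qi.
have L : \int[pm]_im (F n im)%:E @[n --> \oo] --> \int[pm]_im (G im)%:E.
  apply: (@dominated_cvg_real _ _ _ pm F G (cst (\sum_(i : letter) - ln c)%R)) => //.
  - apply: filterS Bcvg => im Him; apply: cvg_sum_seq => i.
    apply: cvgM; first exact: cvg_cst.
    apply: cvgN; apply: continuous_cvg.
      by apply: continuous_ln; rewrite (lt_le_trans c0).
    apply: cvgD; last exact: cvg_cst.
    by apply: cvgM; [exact: cvg_cst|exact: Him].
  - apply: nearW => im n; rewrite ger0_norm; last first.
      apply: sumr_ge0 => i _; rewrite mulr_ge0//.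
      by have /andP[] := lnc _ (gc (prefix_word im n) i) (g1 _ i).
    apply: ler_sum => i _; have /andP[h1 h2] := lnc _ (gc (prefix_word im n) i) (g1 _ i).
    by rewrite (le_trans _ h2)// ler_piMl.
have GE : \int[pm]_im (G im)%:E <= (fiber_entropy + e / 2)%:E.
  rewrite EFinD fiber_entropyE.
  have -> : (e / 2)%:E = \int[pm]_im (cst (e / 2)%:E im) by rewrite integral_cst// pastmT mule1.
  rewrite -ge0_integralD//; first last.
  - by move=> im _; rewrite lee_fin divr_ge0// ltW.
  - exact: measurable_letter_entropy.
  - by move=> im _; exact: letter_entropy_ge0.
  have lt0 : (0 <= e / 2)%R by rewrite divr_ge0// ltW.
  have ptw im : (G im <= \sum_i - (q i im * ln (q i im)) + e / 2)%R.
    have -> : (e / 2 = \sum_i q i im * (e / 2))%R.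
      rewrite -mulr_suml (_ : \sum_i q i im = 1)%R ?mul1r//.
      apply: EFin_inj; rewrite -sumEFin -(sum_letter_prob im).
      by apply: eq_bigr => i _; rewrite fineK// letter_prob_fin.
    rewrite -big_split/=; apply: ler_sum => i _.
    rewrite -mulrN -mulrDr; have [z|nz] := eqVneq (q i im) 0%R; first by rewrite z !mul0r.
    have qp : (0 < q i im)%R by rewrite lt_def nz q0.
    apply: ler_wpM2l => //; rewrite lerNl opprD opprK -(expRK (- (e / 2))%R) -/t.
    by rewrite -lnM ?posrE// ler_ln ?posrE ?mulr_gt0// ?(lt_le_trans c0)// mulrC lerDl ltW.
  apply: le_trans (_ : \int[pm]_im (\sum_i - (q i im * ln (q i im)) + e / 2)%:E <= _).
    apply: ge0_le_integral => //.
    - move=> im _; rewrite lee_fin; apply: sumr_ge0 => i _; rewrite mulr_ge0// oppr_ge0 ln_le0//.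
      have cN : (c <= 1 - t)%R by rewrite ler_pdivrMr// ler_peMr ?subr_ge0 ?(ltW t1)// ler1n.
      have := q1 i im; move: (q i im) => y y1; have : (t * y <= t)%R by rewrite ler_piMr// ltW.
      by move: cN; move: (c) (t) (t * y)%R => c' t' z; lra.
    - exact/measurable_EFinP.
    - apply/measurable_EFinP; apply: measurable_funD => //; apply/measurable_EFinP.
      exact: measurable_letter_entropy.
    - by move=> im _; rewrite lee_fin.
  by rewrite le_eqVlt; apply/orP; left; apply/eqP; apply: eq_integral.
have gfin : fiber_entropy%:E + (e / 2)%:E < (fiber_entropy + e)%:E.
  by rewrite -EFinD lte_fin ltrD2l ltr_pdivrMr// ltr_pMr// ltr1n.
have [n Fn] : exists n, \int[pm]_im (F n im)%:E <= (fiber_entropy + e)%:E.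
  apply: contrapT => /forallNP Fn; move: (le_lt_trans GE gfin); apply/negP; rewrite -leNgt.
  rewrite -(cvg_lim _ L)//; apply: lime_ge; first by apply/cvg_ex; eexists; exact: L.
  by apply: nearW => n; rewrite ltW// ltNge; apply/negP; exact: Fn.
by exists n, g, c; split => // v i; rewrite gc g1.
Qed.

End entropy.

(** * Means of the logarithmic factors *)

Section logarithms.

Let q0 i im : (0 <= q i im)%R. Proof. exact: fine_ge0. Qed.
Let qE i im : (q i im)%:E = letter_prob i im.
Proof. by rewrite fineK// letter_prob_fin. Qed.

Lemma cascm_null (A : set X) : measurable A -> (forall p, K p (xsection A p) = 0) -> Q A = 0.
Proof.
move=> mA K0; rewrite -[LHS]/(\int[base]_p K p (xsection A p)).
by rewrite (eq_integral (cst 0)) ?integral0// => p _; exact: K0.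
Qed.

Lemma measurable_root_label : mfunT (fun p : X => p.1.2 [::]).
Proof.
exact: measurableT_comp (measurableT_comp (@measurable_eval _ _ _ [::]) measurable_snd) measurable_fst.
Qed.

(** Under Q the root label follows the law P biased by V; this is how the mean of V ln V enters. *)
Lemma integral_cascm_root (h : Omega -> \bar R) : (forall z, 0 <= h z) ->
  mfunT h -> \int[Q]_p h (p.1.2 [::]) = \int[P]_z ((V z)%:E * h z).
Proof.
move=> h0 mh; pose f (p : X) := h (p.1.2 [::]).
have mf : mfunT f.
  exact: measurableT_comp mh measurable_root_label.
have f0 p : 0 <= f p by exact: h0.
transitivity (\int[Q]_p (cst 1 (T p) * f p)); first by apply: eq_integral => p _; rewrite mul1e.
rewrite integral_cascm_transfer//.
have E p : transfer f p = \int[P]_z ((V z)%:E * h z).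
  rewrite -(integral_eval hPa [::] (f := fun z => (V z)%:E * h z))//.
    by move=> z; rewrite mule_ge0// lee_fin.
  by apply: emeasurable_funM => //; exact/measurable_EFinP.
rewrite (eq_integral (cst (\int[P]_z ((V z)%:E * h z)))) => [|p _]; last by rewrite mul1e E.
by rewrite integral_cst// -[X in _ * X]/(Q setT) Q1 mule1.
Qed.

Lemma measurable_letter_fun (h : S -> letter -> \bar R) : (forall i, mfunT (h ^~ i)) ->
  mfunT (fun p : S * S => h p.1 (p.2 0%N)).
Proof.
move=> mh; apply: (measurable_fun_case (g := fun p : S * S => p.2 0%N)
  (f := fun i (p : S * S) => h p.1 i)) => i.
  rewrite (_ : _ @^-1` _ = snd @^-1` [set x : S | x 0%N = i])//.
  by rewrite -[X in measurable X]setTI; apply: measurable_snd => //; exact: measurable_coordinate.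
exact: measurableT_comp (mh i) measurable_fst.
Qed.

Lemma integral_cascm_letter (h : S -> letter -> \bar R) : (forall im i, 0 <= h im i) ->
  (forall i, mfunT (h ^~ i)) ->
  \int[Q]_p h p.1.1 (p.2 0%N) = \int[pm]_im \sum_i h im i * letter_prob i im.
Proof.
move=> h0 mh; have mh2 := measurable_letter_fun mh.
rewrite (ge0_integral_image (mu := Q) (m := extm) (g := fun p : X => (p.1.1, p.2))
  (f := fun p : S * S => h p.1 (p.2 0%N)))//.
- rewrite integral_extm//; apply: eq_integral => im _; exact: integral_letter.
by move=> A mA; exact: cascm_endsE.
Qed.

(** Under Q the ends are distributed as [extm], so each letter is drawn with its conditional
    probability. *)
Lemma ae_letter_prob_gt0 : {ae Q, forall p : X, (0 < q (p.2 0%N) p.1.1)%R}.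
Proof.
pose h (im : S) i : \bar R := (q i im == 0%R)%:R%:E.
have mh i : mfunT (h ^~ i).
  rewrite (_ : h ^~ i = (fun im => (\1_([set 0%R] : set R) (q i im))%:E)); last first.
    apply/funext => im; rewrite /h indicE; congr (_%:R%:E); congr nat_of_bool.
    by apply/eqP/idP => [->|]; rewrite inE.
  apply/measurable_EFinP; apply: measurableT_comp (measurable_qi i).
  by apply: measurable_indic; exact: measurable_set1.
have H := integral_cascm_letter (fun im i => _ : 0 <= h im i) mh.
have {}H : \int[Q]_p h p.1.1 (p.2 0%N) = 0.
  rewrite H => [|im i]; last by rewrite lee_fin.
  rewrite (eq_integral (cst 0)) ?integral0// => im _; rewrite big1// => i _.
  by rewrite -qE /h; case: eqP => [->|_]; rewrite ?mule0 ?mul0e.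
have mH : mfunT (fun p : X => h p.1.1 (p.2 0%N)).
  exact: measurableT_comp (measurable_letter_fun mh) measurable_ends.
have : {ae Q, forall p : X, setT p -> h p.1.1 (p.2 0%N) = 0}.
  apply/(ae_eq_integral_abs Q measurableT mH); rewrite -[RHS]H.
  by apply: eq_integral => p _; rewrite gee0_abs// lee_fin.
apply: filterS => p /(_ I) [/eqP]; rewrite pnatr_eq0 eqb0 => qn0.
by rewrite lt_def qn0 q0.
Qed.

Let mVroot : mfunT (fun p : X => V (p.1.2 [::])).
Proof.
exact: measurableT_comp mV measurable_root_label.
Qed.

Lemma ae_root_gt0 : {ae Q, forall p : X, (0 < V (p.1.2 [::]))%R}.
Proof.
have mA : measurable [set p : X | (V (p.1.2 [::]) <= 0)%R] by exact: measurable_ler_set.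
exists [set p : X | (V (p.1.2 [::]) <= 0)%R]; split => //.
  apply: cascm_null => // -[im w]; rewrite cascade_kernelE.
  have [v|v] := leP (V (w [::])) 0%R.
    by rewrite (_ : V (w [::]) = 0%R) ?mul0e//; apply/eqP; rewrite eq_le v V0.
  rewrite (_ : xsection _ _ = set0) ?measure0 ?mule0//.
  apply/seteqP; split => // x; rewrite /xsection /= inE /= => v'.
  by move: v; rewrite ltNge v'.
by move=> p /= /negP; rewrite -leNgt.
Qed.

Lemma integrable_ln_root : P.-integrable setT (fun z => (V z * ln (V z))%:E) ->
  Q.-integrable setT (fun p : X => (ln (V (p.1.2 [::])))%:E) /\
  \int[Q]_p (ln (V (p.1.2 [::])))%:E = \int[P]_z (V z * ln (V z))%:E.
Proof.
move=> Vi; have mln : mfunT (fun z => (ln (V z))%:E : \bar R).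
  by apply/measurable_EFinP; exact: measurable_ln_comp.
have mlnQ : mfunT (fun p : X => (ln (V (p.1.2 [::])))%:E : \bar R).
  by apply/measurable_EFinP; exact: measurable_ln_comp.
split.
- apply/integrableP; split => //.
  rewrite (integral_cascm_root (h := fun z => `|(ln (V z))%:E|))//.
    have /integrableP[_] := Vi; apply: le_lt_trans; rewrite le_eqVlt; apply/orP; left; apply/eqP.
    by apply: eq_integral => z _; rewrite EFinM abseM (gee0_abs (x := (V z)%:E))// lee_fin.
  exact: measurableT_comp.
- rewrite [LHS]integralE [RHS]integralE; congr (_ - _).
  + transitivity (\int[Q]_p (fun z => (ln (V z))%:E)^\+ (p.1.2 [::])); first by apply: eq_integral => p _; rewrite !(funeposE, funenegE).
    rewrite (integral_cascm_root (h := (fun z => (ln (V z))%:E)^\+))//.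
      apply: eq_integral => z _; rewrite !funeposE; have [l0|/ltW l0] := leP 0%R (ln (V z)).
        by rewrite !max_l ?lee_fin ?mulr_ge0// EFinM.
      by rewrite !max_r ?lee_fin ?mulr_ge0_le0// mule0.
    exact: measurable_funepos.
  + transitivity (\int[Q]_p (fun z => (ln (V z))%:E)^\- (p.1.2 [::])); first by apply: eq_integral => p _; rewrite !(funeposE, funenegE).
    rewrite (integral_cascm_root (h := (fun z => (ln (V z))%:E)^\-))//.
      apply: eq_integral => z _; rewrite !funenegE -!EFinN; have [l0|/ltW l0] := leP 0%R (ln (V z)).
        by rewrite !max_r ?lee_fin ?oppr_le0 ?mulr_ge0// mule0.
      by rewrite !max_l ?lee_fin ?oppr_ge0 ?mulr_ge0_le0// -EFinM mulrN.
    exact: measurable_funeneg.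
Qed.

Lemma integrable_ln_letter (g : S -> letter -> R) : (forall im i, 0 <= g im i <= 1)%R ->
  (forall i, mfunT (g ^~ i)) -> \int[pm]_im (\sum_i q i im * - ln (g im i))%R%:E < +oo ->
  Q.-integrable setT (fun p : X => (ln (g p.1.1 (p.2 0%N)))%:E) /\
  \int[Q]_p (ln (g p.1.1 (p.2 0%N)))%:E = - \int[pm]_im (\sum_i q i im * - ln (g im i))%R%:E.
Proof.
move=> g01 mg gfin.
have ng0 im i : (0 <= - ln (g im i))%R by rewrite oppr_ge0 ln_le0//; have /andP[] := g01 im i.
have mng i : mfunT (fun im => (- ln (g im i))%:E : \bar R).
  by apply/measurable_EFinP; apply: measurableT_comp => //; exact: measurable_ln_comp.
have E : \int[Q]_p (- ln (g p.1.1 (p.2 0%N)))%:E = \int[pm]_im (\sum_i q i im * - ln (g im i))%R%:E.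
  rewrite (integral_cascm_letter (h := fun im i => (- ln (g im i))%:E))//.
    apply: eq_integral => im _; rewrite -sumEFin; apply: eq_bigr => i _.
    by rewrite -qE -EFinM mulrC.
have mlng : mfunT (fun p : X => (ln (g p.1.1 (p.2 0%N)))%:E : \bar R).
  apply: (measurableT_comp (measurable_letter_fun (h := fun im i => (ln (g im i))%:E) _) measurable_ends).
  by move=> i; apply/measurable_EFinP; exact: measurable_ln_comp.
split.
- apply/integrableP; split => //; move: gfin; rewrite -E; apply: le_lt_trans.
  rewrite le_eqVlt; apply/orP; left; apply/eqP; apply: eq_integral => p _.
  by rewrite abse_EFin ler0_norm// -oppr_ge0.
- rewrite -E -integral_ge0N; last by move=> p _; rewrite lee_fin.
  by apply: eq_integral => p _; rewrite -EFinN opprK.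
Qed.

End logarithms.

Variables r t : letter -> R.
Hypothesis hr : forall i, (0 < r i < 1)%R.
Hypothesis Vi : P.-integrable setT (fun z => (V z * ln (V z))%:E).

(** * Masses of balls along the orbit *)

Section orbit.

Local Notation ball n x := (coding_ball r t x (window r t n x)).
Local Notation G n := (fun p : X => gain r t (K p.1) n p.2).
Local Notation G8 := (fun p : X => gain_lim r t (K p.1) p.2).
Local Notation lv := (fun p : X => ln (V (p.1.2 [::]))).
Local Notation lq := (fun p : X => ln (q (p.2 0%N) p.1.1)).
Local Notation lz := (fun p : X => ln (casc_mass p.1)).

Let Koo (p : X) : K p.1 setT < +oo. Proof. exact: finite_kernel_lty. Qed.

Let mK U : measurable U -> mfunT (fun p : X => K p.1 U).
Proof.
by move=> mU; exact: measurableT_comp (measurable_cascade_kernel mU) measurable_fst.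
Qed.

Lemma measurable_gain_cascm n : mfunT (G n).
Proof. exact: (measurable_gain t hr (k := fun p : X => K p.1) (xi := snd)). Qed.

Lemma measurable_gain_lim_cascm : mfunT G8.
Proof. exact: (measurable_gain_lim t hr (k := fun p : X => K p.1) (xi := snd)). Qed.

Lemma ae_cascm (A : X -> Prop) : {ae Q, forall p, A p} ->
  {ae base, forall p, {ae K p, forall x, A (p, x)}}.
Proof. exact: ae_mprod. Qed.

Lemma ae_cascm_fiber (A : set X) : measurable A ->
  (forall p : S * W, {ae K p, forall x, A (p, x)}) -> {ae Q, forall p, A p}.
Proof. by move=> mA H; apply: ae_mprodT => //; exact: nearW. Qed.

Lemma ae_cascm_base (A : S * W -> Prop) : {ae base, forall p, A p} -> {ae Q, forall p : X, A p.1}.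
Proof.
move=> [N [mN N0 AN]]; exists (N `*` setT); split.
- exact: measurableX.
- by rewrite [LHS]mprodX//; apply: null_set_integral => //; exact: measurable_funTS (measurable_cascade_kernel measurableT).
- by move=> p /= /AN.
Qed.

Lemma gain_cvg_cascm : {ae Q, forall p : X, G n p @[n --> \oo] --> G8 p}.
Proof.
have mG n := measurable_gain_cascm n.
have mA : measurable [set p : X | G n p @[n --> \oo] --> G8 p].
  by apply: measurable_cvg_to => //; exact: measurable_gain_lim_cascm.
apply: (ae_cascm_fiber mA) => p; exact: (gain_cvg t hr (finite_kernel_lty K p)).
Qed.

(** The dominating function for Maker's theorem is 1 plus the number of integers k exceeded by some
    gain. It is integrable because the tail in [gain_tail] decays exponentially in k. *)
Lemma integrable_sup_gain : exists h : X -> R, Q.-integrable setT (EFin \o h) /\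
  {ae Q, forall p n, (`|G n p| <= h p)%R}.
Proof.
pose U (k : nat) := [set p : X | exists n, (k%:R < G n p)%R].
have mU k : measurable (U k).
  have -> : U k = \bigcup_n [set p : X | (k%:R < G n p)%R].
    by apply/seteqP; split => p [n]; exists n.
  apply: bigcupT_measurable => n; apply: measurable_ltr_set => //.
  exact: measurable_gain_cascm.
pose C : R := (#|{: letter}|%:R * 2)%R.
have C0 : (0 <= C)%R by rewrite mulr_ge0.
have QU k : Q (U k) <= (C * expR (- (1 * k%:R)))%:E.
  have e0 : (0 <= C * expR (- (1 * k%:R)))%R by rewrite mulr_ge0// expR_ge0.
  rewrite -[Q (U k)]/(\int[base]_p K p (xsection (U k) p)).
  apply: (@le_trans _ _ (\int[base]_p ((C * expR (- (1 * k%:R)))%:E * K p setT))).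
    apply: ge0_le_integral => //.
    - exact: (measurable_xsection_kernel measurable_cascade_kernel (finite_kernel_lty K) (mU k)).
    - by apply: measurable_funeM; exact: measurable_cascade_kernel.
    - move=> p _; rewrite /C -mulrA mul1r.
      have := gain_tail t hr (finite_kernel_lty K p) (ler0n R k); apply: le_trans.
      by rewrite le_eqVlt; apply/orP; left; apply/eqP; congr (K p _);
        apply/seteqP; split => x; rewrite /xsection /= inE.
  rewrite ge0_integralZl//; last exact: measurable_cascade_kernel.
  rewrite -[leRHS]mule1; apply: lee_wpmul2l => //.
  have <- : Q setT = \int[base]_p K p setT; last by rewrite Q1.
  by rewrite -[LHS]/(\int[base]_p K p (xsection setT p)); apply: eq_integral => p _;
    congr (K p _); apply/seteqP; split => x //; rewrite /xsection /= inE.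
pose H p := \sum_(0 <= k <oo) (\1_(U k) p)%:E : \bar R.
have mi k : mfunT (fun p => (\1_(U k) p)%:E : \bar R).
  exact: measurable_EFin_indic.
have i0 k p : 0 <= (\1_(U k) p)%:E :> \bar R by rewrite lee_fin.
have H0 p : 0 <= H p by apply: nneseries_ge0.
have mH : mfunT H by apply: ge0_emeasurable_sum.
have intH : \int[Q]_p H p < +oo.
  rewrite /H integral_nneseries//.
  apply: le_lt_trans (nneseries_exp_lty C0 ltr01).
  apply: lee_nneseries => k _ //; first by move=> _; exact: integral_ge0.
  by rewrite integral_indic// setIT; exact: QU.
have Hi : Q.-integrable setT H.
  apply/integrableP; split => //; move: intH; congr (_ < _); apply: eq_integral => p _.
  by rewrite gee0_abs.
have Hfin := integrable_ae measurableT Hi.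
pose h p := (1 + fine (H p))%R.
exists h; split.
  have -> : EFin \o h = (fun p => (EFin \o cst 1%R) p + (fine (H p))%:E).
    by apply/funext.
  apply: integrableD => //.
    by apply: (@integrable_bounded _ _ _ _ _ 1) => //; rewrite ?Q1 ?ltry// => p; rewrite normr1.
  apply/integrableP; split.
    by apply/measurable_EFinP; exact: measurableT_comp.
  apply: le_lt_trans intH; apply: ge0_le_integral => //.
  - by do 2 apply: measurableT_comp => //; exact: measurableT_comp.
  - move=> p _; rewrite abse_EFin ger0_norm ?fine_ge0//.
    by case: (H p) (H0 p) => [x| |]//=; rewrite leey.
apply: filterS Hfin => p /(_ I) Hp n; rewrite ger0_norm; last exact: (gain_ge0 t hr (Koo p)).
set g := gain _ _ _ _ _.
have g0 : (0 <= g)%R by exact: (gain_ge0 t hr (Koo p)).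
have /andP[h1 h2] := truncn_itv g0.
apply: (@le_trans _ _ (1 + (Num.truncn g)%:R)%R).
  by rewrite addrC natr1 ltW.
rewrite lerD2l -lee_fin fineK//.
apply: (@le_trans _ _ (\sum_(0 <= k < Num.truncn g) (\1_(U k) p)%:E)); last first.
  by apply: nneseries_lim_ge.
rewrite sumEFin lee_fin big_nat (eq_bigr (fun=> 1%R)) => [|k /andP[_ kg]]; last first.
  by rewrite indicE mem_set//; exists n; rewrite -/g (lt_le_trans _ h1)// ltr_nat.
by rewrite -(big_nat _ _ _ _ (fun=> 1%R)) sumr_const_nat subn0.
Qed.

Let qp_int : Q.-integrable setT (EFin \o lq) /\ \int[Q]_p (lq p)%:E = - fiber_entropy%:E.
Proof.
have E : \int[pm]_im (\sum_i q i im * - ln (q i im))%R%:E = fiber_entropy%:E.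
  rewrite fiber_entropyE//; apply: eq_integral => im _; congr EFin; apply: eq_bigr => i _.
  by rewrite mulrN.
have := integrable_ln_letter (g := fun im i => q i im).
rewrite E; apply => [im i|i|]; last exact: ltry.
- exact: q01.
- exact: measurable_qi.
Qed.

(** The logarithm of the recursion on a ball, where the gain accounts for the part of the ball
    outside the first cylinder. The equation for the total masses is the case of the largest radius,
    at which the ball is the whole space. *)
Definition log_step (p : X) : Prop := lz p = (G 0 p + (lv p + lq p) + lz (T p))%R /\ forall n,
  [/\ (0 < fine (K p.1 (ball n p.2)))%R, (0 < fine (K (T p).1 (ball n (T p).2)))%R &
   ln (fine (K p.1 (ball n.+1 p.2))) =
    (G n.+1 p + (lv p + lq p) + ln (fine (K (T p).1 (ball n (T p).2))))%R].

Let Kfin p (A : set S) : measurable A -> K p A \is a fin_num.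
Proof. by move=> mA; apply: fin_num_of_lty => //; exact: finite_kernel_lty. Qed.

Lemma ae_ball_gt0 : {ae Q, forall p : X, forall n, (0 < fine (K p.1 (ball n p.2)))%R}.
Proof.
pose A := [set p : X | forall n, (0 < fine (K p.1 (ball n p.2)))%R].
have mA : measurable A.
  have -> : A = \bigcap_n [set p : X | (0 < fine (K p.1 (ball n p.2)))%R].
    by apply/seteqP; split => p H n; [move=> _; exact: H|exact: H].
  apply: bigcapT_measurable => n; apply: measurable_ltr_set => //.
  apply: eq_measurable_fun (measurable_ball_section t hr mK Koo measurable_snd n measurableT) => p _.
  by rewrite setTI.
apply: (ae_cascm_fiber mA) => p.
have H := measure_itv_gt0 (image_measure (K p) (measurable_coding t hr)).
have [N [mN N0 HN]] := H.
exists (coding r t @^-1` N); split => //.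
  exact: (measurable_preimage (measurable_coding t hr)).
move=> x /= nA; apply: HN => /= Hx; apply: nA => n.
rewrite fine_gt0//; apply/andP; split; first exact: Hx (window_gt0 t hr n x).
by rewrite ltey_eq Kfin//; exact: measurable_coding_ball.
Qed.

Lemma ae_log_step : {ae Q, forall p, log_step p}.
Proof.
have h1 := ae_ball_gt0; have h2 := ae_inv mT Tinv ae_ball_gt0.
have h3 := ae_root_gt0.
have h4 := ae_letter_prob_gt0.
have h5 := ae_cascm_base ae_good_point.
apply: filterS3 (filterI h1 h2) (filterI h3 h4) h5 => p [p1 p2] [p3 p4] p5.
have mb := measurable_coding_ball t hr.
have rec n : fine (K p.1 (cylinder [:: p.2 0%N] `&` ball n.+1 p.2)) =
    (V (p.1.2 [::]) * q (p.2 0%N) p.1.1 * fine (K (T p).1 (ball n (T p).2)))%R.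
  rewrite coding_ballS// (cascade_kernel_recursion p5 _ (mb _ _)).
  set k1 := K (_, _) _; have k1fin : k1 \is a fin_num by apply: Kfin; exact: mb.
  by rewrite -(fineK (letter_prob_fin (p.2 0%N) p.1.1)) -(fineK k1fin) -!EFinM.
have logE n m : fine (K p.1 (cylinder [:: p.2 0%N] `&` ball m p.2)) =
    (V (p.1.2 [::]) * q (p.2 0%N) p.1.1 * fine (K (T p).1 (ball n (T p).2)))%R ->
    ln (fine (K p.1 (ball m p.2))) =
    (G m p + (lv p + lq p) + ln (fine (K (T p).1 (ball n (T p).2))))%R.
  move=> recm; rewrite /gain /ratio recm; have b1 := p1 m; have b2 := p2 n.
  by rewrite lnM ?posrE ?mulr_gt0 ?invr_gt0// lnV ?posrE// !lnM ?posrE ?mulr_gt0//; ring.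
split=> [|n]; last by split => //; exact: logE.
have := logE 0%N 0%N; rewrite -rec coding_ballS// !coding_ball0//; apply.
by rewrite preimage_setT.
Qed.

(** After n steps the ball has become the whole space, which leaves the logarithm of the total mass
    as a boundary term. *)
Lemma log_average_formula n p : (forall l, log_step (iter l T p)) ->
  ln (fine (K p.1 (ball n p.2))) = (\sum_(l < n) G (n - l)%N (iter l T p) +
    birkhoff_sum T (fun p => lv p + lq p) n p + lz (iter n T p))%R.
Proof.
elim: n p => [|n ih] p H.
  by rewrite /birkhoff_sum !big_ord0 !add0r coding_ball0.
have [_ /(_ n)[_ _ ->]] := H 0%N.
rewrite ih => [|l]; last by rewrite -iterSr; exact: H.
have -> : (\sum_(l < n.+1) G (n.+1 - l)%N (iter l T p) =
    G n.+1 p + \sum_(l < n) G (n - l)%N (iter l T (T p)))%R.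
  by rewrite big_ord_recl; congr (_ + _)%R; apply: eq_bigr => l _; rewrite lift0 subSS iterSr.
rewrite birkhoff_sumS iterSr; exact: add_rearrange.
Qed.

Let lv_int := integrable_ln_root Vi.

(** By [log_step] the increment of the logarithm of the mass along T is integrable, and
    [coboundary_average] asks for nothing about the logarithm itself beyond measurability. *)
Lemma log_mass_average : {ae Q, forall p, n%:R^-1 * lz (iter n T p) @[n --> \oo] --> (0 : R)}%R.
Proof.
have [lvi _] := lv_int; have [lqi _] := qp_int; have [h [hi hG]] := integrable_sup_gain.
apply: (coboundary_average Q1 mT Tinv Terg (f := fun p => (- G 0 p - (lv p + lq p))%R) (g := lz)).
- by apply: measurable_ln_comp; exact: measurableT_comp measurable_casc_mass measurable_fst.
- have -> : EFin \o (fun p => (- G 0 p - (lv p + lq p))%R) =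
      (fun p => - (G 0 p)%:E - ((lv p)%:E + (lq p)%:E)) by apply/funext.
  have Gi : Q.-integrable setT (EFin \o G 0).
    have mG := measurable_gain_cascm 0.
    have mh := measurable_int _ hi.
    apply/integrableP; split; first exact/measurable_EFinP.
    have /integrableP[_] := hi; apply: le_lt_trans; apply: ae_ge0_le_integral => //.
    + by apply: measurableT_comp => //; exact/measurable_EFinP.
    + exact: measurableT_comp.
    + apply: filterS hG => p /(_ 0%N) h0 _ /=; rewrite lee_fin (le_trans h0)// ler_norm//.
  by apply: integrableB => //; [exact: integrableN|exact: integrableD].
- apply: filterS ae_log_step => p [-> _]; ring.
Qed.

Definition log_V_mean : R := fine (\int[P]_z (V z * ln (V z))%:E).

(** The gain at time l is taken at the scale n - l, which is the form that Maker's theorem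
    treats. *)
Lemma ball_average : {ae Q, forall p, n%:R^-1 * ln (fine (K p.1 (ball n p.2))) @[n --> \oo] -->
  fine (\int[Q]_p (G8 p)%:E) + (log_V_mean - fiber_entropy)}%R.
Proof.
have [lvi lvE] := lv_int; have [lqi lqE] := qp_int; have [h [hi hG]] := integrable_sup_gain.
have li : Q.-integrable setT (EFin \o (fun p => (lv p + lq p)%R)).
  have -> : EFin \o (fun p => (lv p + lq p)%R) = (fun p => (lv p)%:E + (lq p)%:E) by apply/funext.
  exact: integrableD.
have IE : fine (\int[Q]_p (lv p + lq p)%:E) = (log_V_mean - fiber_entropy)%R.
  under eq_integral do rewrite EFinD.
  rewrite integralD// lvE lqE fineD//; rewrite -lvE; exact: integrable_fin_num.
have B := birkhoff Q1 mT Tinv Terg li; rewrite IE in B.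
have M := maker Q1 mT Tinv Terg measurable_gain_cascm measurable_gain_lim_cascm hi hG gain_cvg_cascm.
have S0 := ae_inv_iter mT Tinv ae_log_step.
apply: filterS3 (filterI B M) log_mass_average S0 => p [pB pM] pz pS.
have -> : (fun n : nat => n%:R^-1 * ln (fine (K p.1 (ball n p.2))))%R =
  (fun n : nat => n%:R^-1 * \sum_(l < n) G (n - l)%N (iter l T p) +
    n%:R^-1 * birkhoff_sum T (fun p => lv p + lq p) n p + n%:R^-1 * lz (iter n T p))%R.
  by apply/funext => n; rewrite log_average_formula// !mulrDr.
rewrite -[X in _ --> X]addr0; apply: cvgD pz; exact: cvgD pM pB.
Qed.

Lemma letter_prob_mean i : \int[pm]_im (q i im)%:E = mup (cylinder [:: i]).
Proof.
rewrite -(extm_future (measurable_cylinder _)) extmX//; last exact: measurable_cylinder.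
by apply: eq_integral => im _; rewrite fineK// letter_prob_fin.
Qed.

Lemma lyapunov_mean : \int[pm]_im (\sum_i q i im * - ln (r i))%R%:E = (lyapunov r mup)%:E.
Proof.
have lr0 i : (0 <= - ln (r i))%R by rewrite oppr_ge0 ln_le0//; have /andP[_ /ltW] := hr i.
transitivity (\sum_i \int[pm]_im (q i im * - ln (r i))%:E).
  under eq_integral do rewrite -sumEFin.
  rewrite ge0_integral_sum// => i.
    by apply/measurable_EFinP; apply: measurable_funM => //; exact: measurable_qi.
  by move=> im _; rewrite lee_fin mulr_ge0// fine_ge0.
rewrite /lyapunov -sumrN -sumEFin; apply: eq_bigr => i _.
under eq_integral do rewrite EFinM muleC.
rewrite ge0_integralZl//.
- rewrite letter_prob_mean -[mup _]fineK ?fin_num_measure//; last exact: measurable_cylinder.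
  by rewrite -EFinM mulNr mulrC.
- by apply/measurable_EFinP; exact: measurable_qi.
- by move=> im _; rewrite lee_fin fine_ge0.
- by rewrite lee_fin.
Qed.

Lemma lyapunov_gt0 : (0 < lyapunov r mup)%R.
Proof.
have lr0 i : (0 < - ln (r i))%R by rewrite oppr_gt0 ln_lt0.
pose e := \big[Num.min/1%R]_i (- ln (r i))%R.
have e0 : (0 < e)%R by apply: lt_bigmin.
rewrite (lt_le_trans e0)// -lee_fin -lyapunov_mean.
have -> : e%:E = \int[pm]_im (cst e%:E im) by rewrite integral_cst// pastmT mule1.
apply: ge0_le_integral => //.
- by move=> im _; rewrite lee_fin ltW.
- apply/measurable_EFinP; apply: measurable_sum => i; apply: measurable_funM => //.
  exact: measurable_qi.
- move=> im _; rewrite lee_fin.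
  have <- : (\sum_i q i im * e = e)%R.
    rewrite -mulr_suml (_ : \sum_i q i im = 1)%R ?mul1r//.
    apply: EFin_inj; rewrite -sumEFin -(sum_letter_prob im).
    by apply: eq_bigr => i _; rewrite fineK// letter_prob_fin.
  by apply: ler_sum => i _; apply: ler_wpM2l; [rewrite fine_ge0|exact: bigmin_le_cond].
Qed.

Lemma window_average : {ae Q, forall p : X, n%:R^-1 * ln (window r t n p.2) @[n --> \oo] -->
  - lyapunov r mup}%R.
Proof.
have g01 (im : S) i : (0 <= r i <= 1)%R by have /andP[/ltW -> /ltW ->] := hr i.
have rfin : \int[pm]_im (\sum_i q i im * - ln (r i))%R%:E < +oo by rewrite lyapunov_mean ltry.
have [li lE] := integrable_ln_letter g01 (fun i => measurable_cst (r i)) rfin.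
rewrite lyapunov_mean in lE.
have := birkhoff Q1 mT Tinv Terg (f := fun p : X => ln (r (p.2 0%N))) li; rewrite lE/=.
apply: filterS => p pB.
have c0 := window_factor_gt0 t hr.
have E n : ln (window r t n p.2) = (ln (2 * coding_bound r t + 1) +
    birkhoff_sum T (fun p : X => ln (r (p.2 0%N))) n p)%R.
  rewrite /window lnM ?posrE ?scale_gt0//; congr (_ + _)%R.
  elim: n p {pB} => [|n ih] p; first by rewrite /scale /birkhoff_sum !big_ord0 ln1.
  rewrite scaleS birkhoff_sumS lnM ?posrE ?scale_gt0//; last by have /andP[] := hr (p.2 0%N).
  by rewrite -ih.
have -> : (fun n : nat => n%:R^-1 * ln (window r t n p.2))%R =
    (fun n : nat => n%:R^-1 * ln (2 * coding_bound r t + 1) +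
      n%:R^-1 * birkhoff_sum T (fun p : X => ln (r (p.2 0%N))) n p)%R.
  by apply/funext => n; rewrite E mulrDr.
rewrite -[X in _ --> X]add0r; apply: cvgD pB.
rewrite -[X in _ --> X](mul0r (ln (2 * coding_bound r t + 1))); apply: cvgM; last exact: cvg_cst.
by rewrite -(cvg_shiftS (fun n : nat => n%:R^-1 : R)%R); exact: cvg_harmonic.
Qed.

End orbit.

(** * Identification of the conditional entropy term *)

Section conditional_entropy.

Lemma cascade_off_root (lam : measure_on S) (w w' : W) :
  (forall u, u != [::] -> w u = w' u) -> cascade V lam w = cascade V lam w'.
Proof.
move=> ww'; have dE k x : cascade_density V k w x = cascade_density V k w' x.
  by apply: eq_bigr => j _; rewrite ww'// -size_eq0 size_prefix_word.
rewrite /cascade; suff -> : is_cascade V lam w = is_cascade V lam w' by [].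
apply/funext => m; apply/propext; rewrite /is_cascade.
have E (f : S -> R) : (fun k => \int[lam]_x (f x * cascade_density V k w x)%:E) =
    (fun k => \int[lam]_x (f x * cascade_density V k w' x)%:E).
  by apply/funext => k; apply: eq_integral => x _; rewrite dE.
by split => H f cf; have := H f cf; rewrite E.
Qed.

Lemma eq_integral_measure d1 (Y : measurableType d1) (m1 m2 : measure_on Y)
    (f : Y -> \bar R) : (forall A, measurable A -> m1 A = m2 A) ->
  (forall x, 0 <= f x) -> mfunT f -> \int[m1]_x f x = \int[m2]_x f x.
Proof. by move=> m12 f0 mf; exact: (ge0_integral_image (g := id)). Qed.

Let gain_integral (lam : {finite_measure set S -> \bar R}) := \int[lam]_x (gain_lim r t lam x)%:E.

Let lamoo (lam : {finite_measure set S -> \bar R}) : lam setT < +oo.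
Proof. by rewrite ltey_eq fin_num_measure. Qed.

Let mgain (lam : {finite_measure set S -> \bar R}) : mfunT (fun x : S => (gain_lim r t lam x)%:E).
Proof.
apply/measurable_EFinP; apply: (measurable_gain_lim t hr (k := fun=> lam) (xi := id)) => //.
by move=> _; exact: lamoo.
Qed.

Let gain_lim_scale (lam lam' : set S -> \bar R) (c : R) x : (0 < c)%R ->
  (forall A, measurable A -> lam A = c%:E * lam' A) ->
  (forall A, measurable A -> lam' A \is a fin_num) -> gain_lim r t lam x = gain_lim r t lam' x.
Proof.
move=> c0 H fin; rewrite /gain_lim; congr (- ln (clamp (limn_sup _)))%R.
by apply/funext => n; exact: (ratio_scale t hr _ _ c0 H fin).
Qed.

Let gain_integral_scale (lam lam' : {finite_measure set S -> \bar R}) (c : R) : (0 <= c)%R ->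
  (forall A, measurable A -> lam A = c%:E * lam' A) ->
  gain_integral lam = c%:E * gain_integral lam'.
Proof.
move=> c0 H; have [cz|cn0] := eqVneq c 0%R.
  rewrite cz mul0e; have mg := mgain lam; apply: null_set_integral => //.
  by have lamT := H _ measurableT; rewrite cz mul0e in lamT; exact: lamT.
have cp : (0 < c)%R by rewrite lt_def cn0.
rewrite /gain_integral (eq_integral (fun x : S => (gain_lim r t lam' x)%:E)) => [|x _]; last first.
  by rewrite (gain_lim_scale x cp H)// => A mA; exact: fin_num_measure.
rewrite -(ge0_integral_mscale _ measurableT (NngNum c0))//.
  by apply: eq_integral_measure => //= x; rewrite lee_fin gain_lim_ge0.
by move=> x _; rewrite lee_fin gain_lim_ge0.
Qed.

(** Gains do not change when the measure is scaled, so normalising only divides their integral by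
    the total mass. For mass 0 both sides vanish. *)
Lemma conditional_entropy_mass (lam : measure_on S) w :
  conditional_entropy r t (cascade_bar V lam w) * cascade V lam w setT =
  \int[cascade V lam w]_x (gain_lim r t (cascade V lam w) x)%:E.
Proof.
set m := cascade V lam w.
have mfin : m setT \is a fin_num by exact: fin_num_measure.
have [m0|mn0] := eqVneq (fine (m setT)) 0%R.
  have mz : m setT = 0 by rewrite -(fineK mfin) m0.
  by rewrite mz mule0; apply/esym; have mg := mgain m; apply: null_set_integral.
rewrite conditional_entropy_gain// -[RHS]/(gain_integral m).
have mE A : measurable A -> m A = (fine (m setT))%:E * cascade_bar V lam w A.
  move=> mA; have mAfin : m A \is a fin_num by exact: fin_num_measure.
  have -> : cascade_bar V lam w A = m A * ((fine (m setT))^-1)%:E.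
    rewrite -[LHS]/(mnormalize m \d_(point : S) A) /mnormalize; case: ifPn => // /orP[] /eqP e.
      by rewrite e eqxx in mn0.
    by rewrite e in mfin.
  by rewrite -(fineK mAfin) -!EFinM mulrCA mulfV// mulr1.
by rewrite (gain_integral_scale (lam' := cascade_bar V lam w) _ mE) ?fine_ge0// fineK// muleC.
Qed.

Let mcasc U : measurable U -> mfunT (fun p : S * W => cascade V (kappa p.1) p.2 U).
Proof.
by move=> mU; apply: (measurable_cascade mV V0 (lam := fun im => kappa im)).
Qed.

Let J (p : S * W) := gain_integral (cascade V (kappa p.1) p.2).

Let J0 p : 0 <= J p. Proof. by apply: integral_ge0 => x _; rewrite lee_fin gain_lim_ge0. Qed.

Let mJ : mfunT J.
Proof.
apply: (@measurable_integral_kernel _ _ _ _ _ (fun p : S * W => cascade V (kappa p.1) p.2) _ _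
  (fun q : X => (gain_lim r t (cascade V (kappa q.1.1) q.1.2) q.2)%:E)).
- exact: mcasc.
- by move=> p; exact: lamoo.
- by move=> q; rewrite lee_fin gain_lim_ge0.
- apply/measurable_EFinP.
  apply: (measurable_gain_lim t hr (k := fun q : X => cascade V (kappa q.1.1) q.1.2) (xi := snd)) => //.
    by move=> U mU; exact: measurableT_comp (mcasc mU) measurable_fst.
  by move=> q; exact: lamoo.
Qed.

(** The root weight factors out of the inner integral, is independent of the rest of the tree and
    has mean 1; the two outer integrals are then exchanged. *)
Lemma integral_gain_lim :
  \int[Q]_p (gain_lim r t (K p.1) p.2)%:E = cascade_conditional_entropy r t V mu kappa Pa.
Proof.
rewrite integral_cascm//; last 2 first.
- by move=> p; rewrite lee_fin gain_lim_ge0.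
- apply/measurable_EFinP.
  apply: (measurable_gain_lim t hr (k := fun p : X => K p.1) (xi := snd)) => //.
    by move=> U mU; exact: measurableT_comp (measurable_cascade_kernel mU) measurable_fst.
  by move=> p; exact: lamoo.
transitivity (\int[pm]_im \int[Pa]_w J (im, w)).
  apply: eq_integral => im _.
  transitivity (\int[Pa]_w (J (im, w) * (V (w [::]))%:E)).
    apply: eq_integral => w _; rewrite muleC.
    by apply: (gain_integral_scale (V0 _)) => A mA; rewrite cascade_kernelE.
  etransitivity.
    apply: (integral_indep_coordinate hPa (v := [::]) (g := fun w => J (im, w))
      (h := fun z => (V z)%:E)).
    - by move=> w; exact: J0.
    - exact: (measurable_fun_pair2 im mJ).
    - by move=> z; rewrite lee_fin.
    - exact/measurable_EFinP.
    - by move=> w w' ww'; rewrite /J [_.1]/= [_.2]/= (cascade_off_root _ ww').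
  by rewrite V1 mule1.
etransitivity; first exact: (fubini_tonelli (m1 := finite_measure_of pmoo) (m2 := finite_measure_of Paoo) _ mJ J0).
rewrite /cascade_conditional_entropy; apply: eq_integral => w _.
by apply: eq_integral => im _; rewrite conditional_entropy_mass.
Qed.

End conditional_entropy.

(** * The cascade of mu^+ as a mixture over the past *)

Section mixture.

Lemma integral_base_swap (f : S * W -> \bar R) : (forall p, 0 <= f p) -> mfunT f ->
  \int[base]_p f p = \int[Pa]_w \int[pm]_im f (im, w).
Proof.
move=> f0 mf; rewrite integral_basem//.
exact: (fubini_tonelli (m1 := finite_measure_of pmoo) (m2 := finite_measure_of Paoo) _ mf f0).
Qed.

Lemma measurable_past_integral (f : S * W -> \bar R) : (forall p, 0 <= f p) ->
  mfunT f -> mfunT (fun w : W => \int[pm]_im f (im, w)).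
Proof.
move=> f0 mf; apply: (@measurable_integral_kernel _ _ W S R (fun=> pm)
  (fun _ _ => measurable_cst _) (fun=> pmoo) (fun p : W * S => f (p.2, p.1))) => //.
by apply: measurableT_comp mf _; apply: measurable_fun_pair; [exact: measurable_snd|exact: measurable_fst].
Qed.

Lemma ae_base_swap (A : S * W -> Prop) : {ae base, forall p, A p} ->
  {ae Pa, forall w, {ae pm, forall im, A (im, w)}}.
Proof.
move=> [N [mN N0 AN]].
have mi : mfunT (fun p : S * W => (\1_N p)%:E : \bar R).
  exact: measurable_EFin_indic.
have i0 (p : S * W) : 0 <= (\1_N p)%:E :> \bar R by rewrite lee_fin.
have mI := measurable_past_integral i0 mi.
have : {ae Pa, forall w, setT w -> \int[pm]_im (\1_N (im, w))%:E = 0}.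
  apply/(ae_eq_integral_abs Pa measurableT mI).
  rewrite (eq_integral (fun w => \int[pm]_im (\1_N (im, w))%:E)) => [|w _]; last first.
    by rewrite gee0_abs//; exact: integral_ge0.
  by rewrite -(integral_base_swap i0 mi) integral_indic// setIT.
apply: filterS => w /(_ I) Nw.
have mNw : mfunT (fun im => (\1_N (im, w))%:E : \bar R).
  exact: measurable_fun_pair1 w mi.
have : {ae pm, forall im, setT im -> (\1_N (im, w))%:E = 0 :> \bar R}.
  apply/(ae_eq_integral_abs pm measurableT mNw); rewrite -[RHS]Nw.
  by apply: eq_integral => im _; rewrite gee0_abs.
apply: filterS => im /(_ I) [/eqP]; rewrite indicE pnatr_eq0 eqb0 => /negP nN.
by apply: contrapT => nA; apply: nN; rewrite inE; exact: AN.
Qed.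

Let mKw w U : measurable U -> mfunT (fun im => K (im, w) U).
Proof. by move=> mU; exact: measurable_fun_pair1 w (measurable_cascade_kernel mU). Qed.

Let Koo w im : K (im, w) setT < +oo. Proof. exact: finite_kernel_lty. Qed.

Definition mixm (w : W) : measure_on S :=
  image_measure (mprod pm (mKw w) (Koo w)) (@measurable_snd _ _ S S).

Lemma mixmE w B : measurable B -> mixm w B = \int[pm]_im K (im, w) B.
Proof.
move=> mB; rewrite /mixm /= /pushforward.
rewrite (_ : _ @^-1` _ = setT `*` B); first exact: mprodX.
by apply/seteqP; split => -[im x] //= -[].
Qed.

Lemma measurable_mixm B : measurable B -> mfunT (fun w => mixm w B).
Proof.
move=> mB; rewrite (_ : (fun w => mixm w B) = (fun w => \int[pm]_im K (im, w) B)).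
  apply: (measurable_past_integral (f := fun p => K p B)) => //.
  exact: measurable_cascade_kernel.
by apply/funext => w; exact: mixmE.
Qed.

(** The total mass 1 of Q enters here: in the mean, no mass is lost in the limit. *)
Lemma integral_mixm B : measurable B -> \int[Pa]_w mixm w B = mup B.
Proof.
move=> mB; under eq_integral do rewrite mixmE//.
rewrite -(integral_base_swap (f := fun p => K p B))//; last exact: measurable_cascade_kernel.
rewrite -(extm_future mB) -cascm_endsE; last exact: measurableX.
rewrite -[RHS]/(\int[base]_p K p (xsection _ p)); apply: eq_integral => p _.
by congr (K p _); apply/seteqP; split => x; rewrite /xsection /= inE //= => -[].
Qed.

Let mupoo : (mup : measure_on S) setT < +oo.
Proof. by rewrite [X in X < _](_ : _ = 1) ?ltry//; exact: probability_setT. Qed.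

Lemma mass_past k w u : mass V mup k w u = \int[pm]_im mass V (kappa im) k w u.
Proof.
under eq_integral do rewrite massE//.
rewrite massE// ge0_integral_sum//.
- apply: eq_bigr => v _.
  have mv : measurable (cylinder u `&` cylinder v : set S).
    by apply: measurableI; exact: measurable_cylinder.
  rewrite ge0_integralZl//; last by rewrite lee_fin; exact: weight_ge0.
    congr (_ * _); rewrite -[LHS](extm_future mv) extmX//.
  exact: measurable_kernel.
- move=> v; apply: measurable_funeM; apply: measurable_kernel.
  by apply: measurableI; exact: measurable_cylinder.
- by move=> v im _; rewrite mule_ge0// lee_fin; exact: weight_ge0.
Qed.

Let rootcasc w B : \bar R := (V (w [::]))%:E * cascade V mup w B.

Let mrootcasc B : measurable B -> mfunT (fun w : W => rootcasc w B).
Proof.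
move=> mB; apply: emeasurable_funM.
  by apply/measurable_EFinP; exact: measurableT_comp mV (@measurable_eval _ _ _ [::]).
exact: (measurable_cascade_fixed mV V0).
Qed.

Let rootcasc0 w B : 0 <= rootcasc w B. Proof. by rewrite mule_ge0// lee_fin. Qed.

Let mixm_le u : {ae Pa, forall w, mixm w (cylinder u) <= rootcasc w (cylinder u)}.
Proof.
have mu' := @measurable_cylinder a ha u.
have h1 := ae_base_swap ae_good_point.
have h2 := ae_cascade_mass hPa mV V0 V1 mupoo.
apply: filterS2 h1 h2 => w h1 /(_ u) h2; rewrite mixmE//.
set c := rootcasc w _.
have cfin : c \is a fin_num by rewrite fin_numM// fin_num_measure.
have vm : (V (w [::]))%:E * mass V mup k w u @[k --> \oo] --> c by exact: cvgeZl.
apply/lee_addgt0Pr => e e0.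
have [N _ HN] : \forall k \near \oo, (V (w [::]))%:E * mass V mup k w u <= c + e%:E.
  move: vm; rewrite -(fineK cfin) => /fine_cvgP[fk /cvgrPdist_le/(_ _ e0)].
  apply: filterS2 fk => k kfin; rewrite ler_norml => /andP[+ _].
  rewrite -(fineK kfin) -EFinD lee_fin /comp /=.
  by move: (fine c) (fine _) => x y; lra.
have mmass k : mfunT (fun im => mass V (kappa im) k w u).
  have := @measurable_mass_kernel R a ha d Omega V mV V0 _ S (fun im => kappa im)
    (fun U mU => measurable_kernel kappa U mU) k u.
  by move/(measurable_fun_pair1 w).
have V0w : 0 <= (V (w [::]))%:E by rewrite lee_fin.
(* Dropping the first N terms does not change the limit and bounds all the integrals by c + e. *)
apply: (@fatou_ae _ _ _ pm (fun k im => (V (w [::]))%:E * mass V (kappa im) (N + k)%N w u)).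
- by move=> k; exact: measurable_funeM.
- by move=> k im; rewrite mule_ge0// mass_ge0.
- exact: mKw.
- by move=> im.
- apply: filterS h1 => im [_ cim _]; rewrite cascade_kernelE; apply: cvgeZl => //.
  rewrite (_ : (fun k => mass V (kappa im) (N + k)%N w u) =
    [sequence mass V (kappa im) (k + N)%N w u]_k); last by apply/funext => k; rewrite addnC.
  by rewrite (cvg_shiftn N (fun k => mass V (kappa im) k w u)); exact: cascade_cylinder.
- move=> k; rewrite ge0_integralZl// -?mass_past; last by move=> im _; exact: mass_ge0.
  by apply: HN; exact: leq_addr.
Qed.

(** The limit along the levels cannot be exchanged directly with the integral over the past. Fatou
    gives an inequality on cylinders ([mixm_le]); the smaller side has mean mup, and the mean of the
    larger one is at most mup, so equality holds almost surely. *)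
Lemma mixm_cascade : {ae Pa, forall w, forall B, measurable B ->
  mixm w B = (V (w [::]))%:E * cascade V mup w B}.
Proof.
have H u : {ae Pa, forall w, mixm w (cylinder u) = rootcasc w (cylinder u)}.
  have mu' := @measurable_cylinder a ha u.
  apply: (ae_eq_of_le (measurable_mixm mu') (mrootcasc mu') (fun=> measure_ge0 _ _) (mixm_le u) _ _
    (fun w => rootcasc0 w _)).
    rewrite integral_mixm// (eq_integral (fun w => cascade V mup w (cylinder u) * (V (w [::]))%:E)).
      rewrite (integral_indep_coordinate hPa (v := [::]) (g := fun w => cascade V mup w (cylinder u))
        (h := fun z => (V z)%:E)).
      - by rewrite V1 mule1; exact: (integral_cascade_cylinder_le hPa).
      - by [].
      - exact: (measurable_cascade_fixed mV V0).
      - by move=> z; rewrite lee_fin.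
      - exact/measurable_EFinP.
      - by move=> w w' ww'; rewrite (cascade_off_root _ ww').
    by move=> w _; rewrite muleC.
  by rewrite integral_mixm// (le_lt_trans _ mupoo)// le_measure ?inE.
have {}H : {ae Pa, forall w, forall n : nat, forall u, @unpickle (seq letter) n = Some u ->
    mixm w (cylinder u) = rootcasc w (cylinder u)}.
  apply: ae_foralln => n; case: unpickle => [u|]; last exact: nearW.
  by apply: filterS (H u) => w h v [<-].
apply: filterS H => w H.
have {}H u : mixm w (cylinder u) = rootcasc w (cylinder u).
  by apply: (H (pickle u)); rewrite pickleK.
have Vw := V0 (w [::]).
move=> B mB; rewrite -[RHS]/(mscale (NngNum Vw) (cascade V mup w) B).
apply: eq_measure_cylinder => //.
have : rootcasc w (cylinder [::]) \is a fin_num.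
  by rewrite fin_numM// fin_num_measure//; exact: measurable_cylinder.
by rewrite -H cylinder_nil => h; rewrite ltey_eq h.
Qed.

End mixture.

(** * Cylinders: fibre cascade against mixture *)

Section comparison.

Local Notation mix := mixm.
Local Notation lz := (fun p : X => ln (casc_mass p.1)).

Lemma integral_root_density k x : \int[Pa]_w (root_density k w x)%:E = 1.
Proof.
elim: k x => [|k ih] x.
  rewrite (eq_integral (cst 1)) ?integral_prob_cst// => w _.
  by rewrite /root_density big_ord0.
under eq_integral do rewrite root_densityS.
rewrite (integral_root_subtree (x 0%N) (f := V) (g := fun w => root_density k w (sshift x)))//.
- by rewrite V1 mul1e ih.
- have := @measurable_root_density k.
  move/(measurable_fun_pair1 (sshift x)) => h.
  exact: (measurable_fun_pair2 (point : S) h).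
- by move=> w; exact: root_density_ge0.
Qed.

Section markov_weight.
Variables (m : nat) (g : seq letter -> letter -> R).
Hypothesis g01 : forall v i, (0 < g v i <= 1)%R.
Hypothesis gsum : forall v, (\sum_i g v i <= 1)%R.

(** The weight of the word u for the chain with transition weights g and memory m, started from the
    past v. *)
Fixpoint markov_weight (v u : seq letter) : R :=
  if u is i :: u' then (g v i * markov_weight (take m (i :: v)) u')%R else 1%R.

Let g0 v i : (0 < g v i)%R. Proof. by have /andP[] := g01 v i. Qed.

Lemma markov_weight_gt0 v u : (0 < markov_weight v u)%R.
Proof. by elim: u v => [|i u ih] v //=; rewrite mulr_gt0. Qed.

Lemma sum_markov_weight n v : (\sum_(u : n.-tuple letter) markov_weight v u <= 1)%R.
Proof.
elim: n v => [|n ih] v.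
  rewrite (eq_bigr (fun=> 1%R)) => [|u _]; last by case: u => -[].
  by rewrite sumr_const card_tuple expn0.
rewrite (sum_tupleS _ (markov_weight v)) (le_trans _ (gsum v))//.
apply: ler_sum => i _; rewrite /= -mulr_sumr ler_piMr//; exact: ltW.
Qed.

Lemma prefix_scons i (im : S) : prefix_word (scons i im) m = take m (i :: prefix_word im m).
Proof.
case: m => [|k]; first by rewrite take0.
by rewrite prefix_wordS /= -(take_prefix_word (m := k) (n := k.+1)).
Qed.

Local Notation weight n p := (markov_weight (prefix_word p.1.1 m) (prefix_word p.2 n)).
Local Notation lr := (fun p : X => (ln (q (p.2 0%N) p.1.1) - ln (g (prefix_word p.1.1 m) (p.2 0%N)))%R).

(** Replacing the true conditional probabilities by g costs the Birkhoff sum of the logarithms of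
    their ratios; for the g of [approximate_conditional] its mean is small. *)
Lemma cascade_prefix_formula n p :
  (forall l, good_point (iter l T p).1 /\ (0 < q ((iter l T p).2 0%N) (iter l T p).1.1)%R) ->
  fine (K p.1 (cylinder (prefix_word p.2 n))) =
  (root_density n p.1.2 p.2 * weight n p * expR (birkhoff_sum T lr n p) *
   casc_mass (iter n T p).1)%R.
Proof.
elim: n p => [|n ih] p H.
  rewrite /root_density /birkhoff_sum !big_ord0 expR0 !mul1r /=.
  by rewrite (_ : cylinder _ = setT)// -cylinder_nil.
have [good qp] := H 0%N; rewrite /= in good qp.
have recK : fine (K p.1 (cylinder (prefix_word p.2 n.+1))) =
    (V (p.1.2 [::]) * q (p.2 0%N) p.1.1 * fine (K (T p).1 (cylinder (prefix_word (T p).2 n))))%R.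
  have mc := @measurable_cylinder a ha (prefix_word (sshift p.2) n).
  rewrite prefix_wordS cylinder_cons -[[set x : S | _]](_ : cylinder [:: p.2 0%N] = _); last first.
    by rewrite cylinder_cons cylinder_nil preimage_setT setIT.
  rewrite (cascade_kernel_recursion good _ mc).
  set k1 := K (_, _) _; have k1fin : k1 \is a fin_num by exact: fin_num_measure.
  by rewrite -(fineK (letter_prob_fin (p.2 0%N) p.1.1)) -(fineK k1fin) -!EFinM.
rewrite recK ih => [|l]; last by rewrite -iterSr; exact: H.
rewrite -[iter n T (T p)]iterSr root_densityS [prefix_word p.2 n.+1]prefix_wordS birkhoff_sumS expRD.
rewrite [markov_weight _ (_ :: _)]/= -prefix_scons expRB !lnK ?posrE//.
have gn0 : g (prefix_word p.1.1 m) (p.2 0%N) != 0%R by rewrite gt_eqF.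
by field.
Qed.

Let bad c n := [set p : X | (fine (mix p.1.2 (cylinder (prefix_word p.2 n))) <
  c * (root_density n p.1.2 p.2 * weight n p))%R].

Let mix_fin : {ae Pa, forall w : W, forall A, measurable A -> mix w A \is a fin_num}.
Proof.
apply: filterS mixm_cascade => w' H B mB.
by rewrite H// fin_numM// fin_num_measure.
Qed.

Let measurable_word_fun d1 (Y : measurableType d1)
    (xi : Y -> S) (f : seq letter -> Y -> R) n : mfunT xi -> (forall u, mfunT (f u)) ->
  mfunT (fun y => f (prefix_word (xi y) n) y).
Proof.
move=> mxi mf; apply: (measurable_fun_case (g := fun y => prefix_word (xi y) n) (f := f)) => // u.
have := mxi measurableT _ (measurable_pred (measurable_prefix_fun (ha := ha) n (fun v => v == u))).
by rewrite setTI; congr measurable; apply/seteqP; split => y /= /eqP.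
Qed.

Let measurable_bad c n : measurable (bad c n).
Proof.
apply: measurable_ltr_set.
- apply: (measurable_word_fun (xi := snd)
    (f := fun u (p : X) => fine (mix p.1.2 (cylinder u)))) => // u.
  apply: measurableT_comp => //.
  apply: (measurableT_comp (measurable_mixm (measurable_cylinder u))).
  exact: measurableT_comp measurable_snd measurable_fst.
- apply: measurable_funM => //; apply: measurable_funM; first exact: measurable_root_density.
  apply: (measurable_word_fun (xi := fun p : X => p.1.1)
    (f := fun v (p : X) => markov_weight v (prefix_word p.2 n))) => [|v].
    exact: measurableT_comp measurable_fst measurable_fst.
  exact: measurableT_comp (measurable_prefix_real (markov_weight v) n) measurable_snd.
Qed.

(* K restricted to a past of length m is dominated by its mixture, so that the
   conditional weight may depend on finitely many letters of the past. *)
Lemma bad_measure c n : (0 <= c)%R -> Q (bad c n) <= (#|{: m.-tuple letter}|%:R * c)%:E.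
Proof.
move=> c0.
pose D (v : seq letter) (w : W) (u : seq letter) : R :=
  (c * (root_density n w (extend_word u) * markov_weight v u))%R.
have D0 v w u : (0 <= D v w u)%R.
  by rewrite mulr_ge0// mulr_ge0 ?root_density_ge0// ltW// markov_weight_gt0.
have rdE w x : root_density n w x = root_density n w (extend_word (prefix_word x n)).
  apply: eq_bigr => j _; congr (V (w _)).
  have jn : (j <= n)%N by exact: ltnW.
  by rewrite -!(take_prefix_word (m := j) (n := n))// prefix_extend_word.
pose B v (w : W) := [set x : S | (fine (mix w (cylinder (prefix_word x n))) < D v w (prefix_word x n))%R].
have mB v w : measurable (B v w).
  exact: (measurable_pred (measurable_prefix_fun n
    (fun u => fine (mix w (cylinder u)) < D v w u)%R)).
have mcyl (u : seq letter) : measurable (cylinder u : set S) by exact: measurable_cylinder.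
have secE im w : xsection (bad c n) (im, w) = B (prefix_word im m) w.
  by apply/seteqP; split => x; rewrite /xsection /= inE /bad /B /D /= -rdE.
have mKB : mfunT (fun p : S * W => K p (xsection (bad c n) p)).
  apply: (measurable_xsection_kernel measurable_cascade_kernel) => //.
  by move=> p; exact: finite_kernel_lty.
have -> : Q (bad c n) = \int[Pa]_w \int[pm]_im K (im, w) (xsection (bad c n) (im, w)).
  by rewrite -(integral_base_swap (f := fun p => K p (xsection (bad c n) p))).
have mD v u : mfunT (fun w : W => (D v w u)%:E : \bar R).
  apply/measurable_EFinP; apply: measurable_funM => //; apply: measurable_funM => //.
  have := @measurable_root_density n.
  move/(measurable_fun_pair1 (extend_word u)) => h.
  exact: (measurable_fun_pair2 (point : S) h).
have intD v u : \int[Pa]_w (D v w u)%:E = (c * markov_weight v u)%:E.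
  rewrite (eq_integral (fun w => (c * markov_weight v u)%:E * (root_density n w (extend_word u))%:E)).
    rewrite ge0_integralZl//.
    - by rewrite integral_root_density mule1.
    - apply/measurable_EFinP; have := @measurable_root_density n.
      move/(measurable_fun_pair1 (extend_word u)) => h.
      exact: (measurable_fun_pair2 (point : S) h).
    - by move=> w _; rewrite lee_fin root_density_ge0.
    - by rewrite lee_fin mulr_ge0// ltW// markov_weight_gt0.
  by move=> w _; rewrite -EFinM /D; congr EFin; ring.
have step1 w : \int[pm]_im K (im, w) (xsection (bad c n) (im, w)) <=
    \sum_(v : m.-tuple letter) mix w (B v w).
  under eq_bigr do rewrite mixmE//.
  rewrite -ge0_integral_sum//; last first.
    by move=> v; exact: measurable_fun_pair1 w (measurable_cascade_kernel (mB v w)).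
  apply: ge0_le_integral => //.
  - exact: measurable_fun_pair1 w mKB.
  - apply: emeasurable_sum => v.
    exact: measurable_fun_pair1 w (measurable_cascade_kernel (mB v w)).
  - move=> im _; rewrite secE.
    pose v0 : m.-tuple letter := Tuple (introT eqP (size_prefix_word m im)).
    by rewrite (bigD1 v0)//= leeDl//; exact: sume_ge0.
have step2 : {ae Pa, forall w : W, \sum_(v : m.-tuple letter) mix w (B v w) <=
    \sum_(v : m.-tuple letter) \sum_(u : n.-tuple letter) (D v w u)%:E}.
  apply: filterS mix_fin => w mfin; apply: lee_sum => v _.
  pose b u : R := (fine (mix w (cylinder u)) < D v w u)%R%:R.
  have b0 u : (0 <= b u)%R by [].
  have -> : mix w (B v w) = \int[mix w]_x (b (prefix_word x n))%:E.
    rewrite -[X in mix w X]setIT -integral_indic//; apply: eq_integral => x _; congr EFin.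
    rewrite indicE /b; congr (_%:R); congr nat_of_bool; apply/idP/idP; rewrite inE//.
  rewrite ge0_integral_prefix_fun//.
  apply: lee_sum => u _; rewrite -(fineK (mfin _ (mcyl u))) -EFinM lee_fin /b.
  by case: ltP => h; rewrite ?mul1r ?mul0r// ltW.
apply: (@le_trans _ _ (\int[Pa]_w \sum_(v : m.-tuple letter) \sum_(u : n.-tuple letter) (D v w u)%:E)).
  apply: ae_ge0_le_integral => //.
  - by move=> w _; exact: integral_ge0.
  - exact: (measurable_past_integral (f := fun p => K p (xsection (bad c n) p))).
  - by move=> w _; apply: sume_ge0 => v _; apply: sume_ge0 => u _; rewrite lee_fin.
  - by apply: emeasurable_sum => v; exact: emeasurable_sum.
  - by apply: filterS step2 => w h _; exact: le_trans (step1 w) h.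
rewrite ge0_integral_sum//; last 2 first.
- by move=> v; exact: emeasurable_sum.
- by move=> v w _; apply: sume_ge0 => u _; rewrite lee_fin.
rewrite mulr_natl -sumr_const -sumEFin; apply: lee_sum => v _.
rewrite ge0_integral_sum//; last by move=> u w _; rewrite lee_fin.
under eq_bigr do rewrite intD.
by rewrite sumEFin lee_fin -mulr_sumr ler_piMr// sum_markov_weight.
Qed.

(** Borel-Cantelli with c = exp (- e n), for which the bounds of [bad_measure] are summable. *)
Lemma ae_not_bad (e : R) : (0 < e)%R -> {ae Q, forall p : X, \forall n \near \oo,
  (expR (- (e * n%:R)) * (root_density n p.1.2 p.2 * weight n p) <=
   fine (mix p.1.2 (cylinder (prefix_word p.2 n))))%R}.
Proof.
move=> e0; pose F n := bad (expR (- (e * n%:R))) n.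
have mF n : measurable (F n) by exact: measurable_bad.
have F0 : Q (lim_sup_set F) = 0.
  apply: lim_sup_set_cvg0 => //.
  pose C : R := #|{: m.-tuple letter}|%:R.
  apply: le_lt_trans (nneseries_exp_lty (ler0n R #|{: m.-tuple letter}|) e0).
  by apply: lee_nneseries => n _ //=; rewrite bad_measure// expR_ge0.
exists (lim_sup_set F); split => //.
  rewrite /lim_sup_set; apply: bigcapT_measurable => n.
  by apply: bigcup_measurable => k _; exact: mF.
move=> p /= np; rewrite /lim_sup_set => N _; apply: contrapT => nF; apply: np.
exists N => // k /= Nk; rewrite leNgt; apply/negP => bk; apply: nF.
by exists k.
Qed.

End markov_weight.

(** The exponent e n is shared in four equal parts: the mean of [lr], its fluctuation in Birkhoff's
    theorem, the total mass along the orbit, and the loss allowed in [ae_not_bad]. *)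
Lemma cascade_mixture_comparison : {ae Q, forall p : X, forall e : R, (0 < e)%R ->
  \forall n \near \oo, (fine (K p.1 (cylinder (prefix_word p.2 n))) <=
    expR (e * n%:R) * fine (mix p.1.2 (cylinder (prefix_word p.2 n))))%R}.
Proof.
suff H (e : R) : (0 < e)%R -> {ae Q, forall p : X,
  \forall n \near \oo, (fine (K p.1 (cylinder (prefix_word p.2 n))) <=
    expR (e * n%:R) * fine (mix p.1.2 (cylinder (prefix_word p.2 n))))%R}.
  have : {ae Q, forall p : X, forall j : nat,
      \forall n \near \oo, (fine (K p.1 (cylinder (prefix_word p.2 n))) <=
      expR (j.+1%:R^-1 * n%:R) * fine (mix p.1.2 (cylinder (prefix_word p.2 n))))%R}.
    by apply: ae_foralln => j; exact: H.
  apply: filterS => p Hp e e0; have := Hp (Num.truncn e^-1).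
  apply: filterS => n /le_trans; apply; apply: ler_wpM2r; first exact: fine_ge0.
  rewrite ler_expR ler_wpM2r//.
  have /andP[_ h] := truncn_itv (ltW (eqbRL (invr_gt0 e) e0)).
  by rewrite -[leRHS](invrK e) lef_pV2 ?posrE ?invr_gt0// ltW.
move=> e0; have e4 : (0 < e / 4)%R by rewrite divr_gt0.
have [m [g [c [c0 gc gsum gent]]]] := approximate_conditional e4.
have g01 v i : (0 < g v i <= 1)%R.
  by have /andP[h ->] := gc v i; rewrite (lt_le_trans c0 h).
have g01' (im : S) i : (0 <= g (prefix_word im m) i <= 1)%R.
  by have /andP[/ltW -> ->] := g01 (prefix_word im m) i.
have q01' (im : S) i : (0 <= q i im <= 1)%R by exact: q01.
have lqE : \int[pm]_im (\sum_i q i im * - ln (q i im))%R%:E = fiber_entropy%:E.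
  rewrite fiber_entropyE//; apply: eq_integral => im _; congr EFin; apply: eq_bigr => i _.
  by rewrite mulrN.
have lqfin : \int[pm]_im (\sum_i q i im * - ln (q i im))%R%:E < +oo by rewrite lqE ltry.
have [lqi lqI] := integrable_ln_letter q01' measurable_qi lqfin.
have mgp i : mfunT (fun im : S => g (prefix_word im m) i).
  exact: (measurable_prefix_real (fun u => g u i)).
have lgfin := le_lt_trans gent (ltry _).
have [lgi lgI] := integrable_ln_letter g01' mgp lgfin.
pose lr (p : X) := (ln (q (p.2 0%N) p.1.1) - ln (g (prefix_word p.1.1 m) (p.2 0%N)))%R.
have lri : Q.-integrable setT (EFin \o lr).
  rewrite (_ : EFin \o lr = (fun p => (ln (q (p.2 0%N) p.1.1))%:E -
    (ln (g (prefix_word p.1.1 m) (p.2 0%N)))%:E)); last by apply/funext.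
  exact: integrableB.
have lrI : (fine (\int[Q]_p (lr p)%:E) <= e / 4)%R.
  under eq_integral do rewrite EFinB.
  rewrite integralB_EFin// lqI lqE lgI oppeK.
  have gfin : \int[pm]_im (\sum_i q i im * - ln (g (prefix_word im m) i))%R%:E \is a fin_num.
    rewrite ge0_fin_numE//; apply: integral_ge0 => im _; rewrite lee_fin; apply: sumr_ge0 => i _.
    by rewrite mulr_ge0 ?fine_ge0// oppr_ge0 ln_le0//; have /andP[] := g01' im i.
  move: gent; rewrite -(fineK gfin) -EFinN -EFinD !lee_fin /=.
  by move: (fine _) fiber_entropy => x y; lra.
have B := birkhoff Q1 mT Tinv Terg lri.
have good : {ae Q, forall p : X, good_point p.1 /\ (0 < q (p.2 0%N) p.1.1)%R}.
  apply: filterS2 (ae_cascm_base ae_good_point) ae_letter_prob_gt0 => p h1 h2; split => //.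
have NB := ae_not_bad m g01 gsum e4.
apply: filterS3 (filterI B NB) log_mass_average (ae_inv_iter mT Tinv good) => p [pB pN] pz pgood.
have near_le (u : nat -> R) (l : R) : u n @[n --> \oo] --> l ->
    \forall n \near \oo, (u n <= l + e / 4)%R.
  move/cvgrPdist_le => /(_ _ e4); apply: filterS => n; rewrite ler_norml => /andP[h _].
  by move: (u n) h => x; lra.
have n0 : \forall n \near \oo, (0 < n)%N by exists 1%N.
apply: filterS3 (filterI pN n0) (near_le _ _ pB) (near_le _ _ pz) => n [pNn n_gt0] hB hz.
rewrite (cascade_prefix_formula m g01)//.
set Bn := birkhoff_sum _ _ _ _ in hB *; set z := casc_mass _.
move: pNn; set D := (root_density _ _ _ * _)%R => pNn.
have D0 : (0 <= D)%R by rewrite mulr_ge0 ?root_density_ge0// ltW// markov_weight_gt0.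
(* True also for z = 0, where the default value of the logarithm makes the right-hand side 1. *)
have zle : (z <= expR (lz (iter n T p)))%R.
  have [zp|z0] := ltP 0%R z; first by rewrite lnK.
  exact: le_trans z0 (expR_ge0 _).
have N0 : (0 < n%:R :> R)%R by rewrite ltr0n.
have BE : Bn = (n%:R * (n%:R^-1 * Bn))%R by rewrite mulVKf// gt_eqF.
have zE : lz (iter n T p) = (n%:R * (n%:R^-1 * lz (iter n T p)))%R by rewrite mulVKf// gt_eqF.
apply: (@le_trans _ _ (D * expR Bn * expR (lz (iter n T p))))%R.
  by apply: ler_wpM2l => //; rewrite mulr_ge0// expR_ge0.
apply: (@le_trans _ _ (expR (e * n%:R) * (expR (- (e / 4 * n%:R)) * D)))%R; last first.
  by apply: ler_wpM2l => //; exact: expR_ge0.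
rewrite mulrA -expRD -mulrA -expRD mulrC; apply: ler_wpM2r => //.
by rewrite ler_expR BE zE; exact: three_quarters_bound (ltW N0) lrI hB hz.
Qed.

End comparison.

(** * The dimension of the mixture *)

Section mixture_dimension.

Local Notation mix := mixm.
Local Notation ball := (coding_ball r t).

Local Notation centered z s := (coding r t @^-1` `](z - s)%R, (z + s)%R[%classic).

Let mcentered z s : measurable (centered z s).
Proof. exact: (measurable_preimage (measurable_coding t hr)). Qed.

Let measurable_ball_mass (m : measure_on S) s : m setT < +oo ->
  mfunT (fun z : R => fine (m (centered z s))).
Proof.
move=> moo; apply: measurableT_comp => //.
pose A := [set p : R * S | `|coding r t p.2 - p.1| < s]%R.
have mP := measurable_coding t hr.
have mA : measurable A.
  apply: measurable_ltr_set => //; apply: measurableT_comp => //.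
  by apply: measurable_funB => //; exact: measurableT_comp mP measurable_snd.
rewrite (_ : (fun z => _) = fun z => m (xsection A z)).
  exact: (measurable_xsection_kernel (fun U _ => measurable_cst (m U)) (fun=> moo)).
apply/funext => z; congr (m _); apply/seteqP.
by split => y; rewrite /xsection /= inE /A /= in_itv /= ltr_distl.
Qed.

Definition cascade_dimension : R :=
  ((fiber_entropy - log_V_mean - fine (\int[Q]_p (gain_lim r t (K p.1) p.2)%:E)) /
   lyapunov r mup)%R.

Let ball_mono (m : measure_on S) : m setT < +oo ->
  forall z s s', (s <= s')%R -> (fine (m (centered z s)) <= fine (m (centered z s')))%R.
Proof.
move=> moo z s s' ss'.
have mfin u : m (centered z u) \is a fin_num.
  by rewrite ge0_fin_numE// (le_lt_trans _ moo)// le_measure ?inE.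
apply: fine_le; rewrite ?mfin// le_measure ?inE// => y; rewrite /= !in_itv /= => /andP[h1 h2].
by rewrite (le_lt_trans _ h1) ?lerD2l ?lerN2// (lt_le_trans h2)// lerD2l.
Qed.

(** A set that is null for almost every fibre cascade is null for their mixture, provided that it is
    measurable. The good set [L] is therefore phrased along the scales e^(-n), with countably many
    conditions, and monotonicity of the ball masses restores all radii. *)
Lemma ae_mixture_ball_mass : {ae Pa, forall w : W,
  {ae image_measure (mix w) (measurable_coding t hr), forall z : R,
  ln (fine (mix w (centered z rho))) / ln rho @[rho --> 0^'+] --> cascade_dimension}%R}.
Proof.
pose D := cascade_dimension.
have chi0 : (0 < lyapunov r mup)%R by exact: lyapunov_gt0.
have H1 := cascade_mixture_comparison.
have H2 := ball_average.
have H3 := window_average.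
have H4 := ae_ball_gt0.
have FQ : Filter (nbhs (almost_everywhere Q)) by exact _.
have H := ae_base_swap (ae_cascm (@filterI _ _ FQ _ _ (@filterI _ _ FQ _ _ H1 H2) (@filterI _ _ FQ _ _ H3 H4))).
apply: filterS2 H mixm_cascade => w H mixE.
have moo : mix w setT < +oo.
  by rewrite mixE// ltey_eq fin_numM// fin_num_measure.
pose G z s : R := fine (mix w (centered z s)).
have mG s : mfunT (fun z => G z s) by exact: measurable_ball_mass.
pose h (n : nat) : R := expR (- n%:R).
pose L := [set x : R | forall n, (0 < G x (h n))%R] `&`
  [set x : R | n%:R^-1 * ln (G x (h n)) @[n --> \oo] --> - D]%R.
have mL : measurable L.
  apply: measurableI.
    rewrite (_ : [set x | _] = \bigcap_n [set x | (0 < G x (h n))%R]).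
      by apply: bigcapT_measurable => n; apply: measurable_ltr_set.
    by apply/seteqP; split => x hx n; [move=> _; exact: hx|exact: hx].
  apply: measurable_cvg_to => // n; apply: measurable_funM => //.
  by apply: measurable_ln_comp; exact: mG.
have hto0 : h n @[n --> \oo] --> (0 : R)^'+.
  have h0 : h n @[n --> \oo] --> (0 : R)%R.
    rewrite (_ : h = fun n => expR (-1) ^+ n)%R; last first.
      by apply/funext => n; rewrite /h -expRM_natl mulrN1.
    by apply: cvg_expr; rewrite gtr0_norm ?expR_gt0// expR_lt1 oppr_lt0.
  move=> A; rewrite /at_right /within/= => -[e /= e0 He].
  move/cvgrPdist_lt : h0 => /(_ _ e0); apply: filterS => n /= hn.
  by apply: He => //; exact: expR_gt0.
have hto0' : h n @[n --> \oo] --> (0 : R)%R by apply: cvg_trans hto0 _; exact: cvg_within.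
exists (~` L); split; first exact: measurableC.
have mL' : measurable (coding r t @^-1` (~` L)).
  by rewrite -[X in measurable X]setTI; apply: measurable_coding => //; exact: measurableC.
- rewrite image_measureE mixmE//.
  rewrite (ae_eq_integral (cst 0)) ?integral0//.
    exact: measurable_fun_pair1 w (measurable_cascade_kernel mL').
  apply: filterS H => im Him _.
  have Koo : K (im, w) setT < +oo by exact: finite_kernel_lty.
  suff : {ae K (im, w), forall x : S, L (coding r t x)}.
    move=> [N [mN N0 LN]]; apply/eqP; rewrite eq_le measure_ge0 andbT -N0.
    by rewrite le_measure ?inE//; exact: measurableC.
  have C : {ae K (im, w), forall x : S, forall e : R, (0 < e)%R -> \forall n \near \oo,
      (fine (K (im, w) (cylinder (prefix_word x n))) <=
       expR (e * n%:R) * fine (mix w (cylinder (prefix_word x n))))%R}.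
    by apply: filterS Him => x [[? _] _].
  apply: filterS2 Him (ae_coding_comparison t hr Koo moo C) => x [[_ Fav] [wav Fw0]] [GF FG].
  rewrite /= in Fav wav Fw0.
  pose F s : R := fine (K (im, w) (ball x s)).
  have wcvg0 : window r t n x @[n --> \oo] --> (0 : R)%R.
    by apply: cvg_trans (window_cvg t hr x) _; exact: cvg_within.
  have F0 s : (0 < s)%R -> (0 < F s)%R.
    move=> s0; have [n _ /(_ n (leqnn n)) /= wn] := cvgr_lt 0%R wcvg0 _ s0.
    exact: lt_le_trans (Fw0 n) (ball_mono Koo (coding r t x) (ltW wn)).
  have G0 s : (0 < s)%R -> (0 < G (coding r t x) s)%R.
    move=> s0; have [c c0 Hc] := FG _ ltr01.
    have m0 : (0 < Num.min s 1)%R by rewrite lt_min s0 ltr01.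
    have m2 : (0 < Num.min s 1 / 2 < 1)%R.
      by rewrite divr_gt0//= ltr_pdivrMr// mul1r gt_min ltr1n orbT.
    have := Hc _ m2; have /andP[m20 _] := m2; move/(lt_le_trans (F0 _ m20)).
    rewrite mulrC [(2 * _)%R]mulrC divfK// pmulr_lgt0 ?mulr_gt0 ?expR_gt0// => /lt_le_trans; apply.
    by apply: ball_mono => //; rewrite ge_min lexx.
  have FD : (ln (F rho) / ln rho @[rho --> 0^'+] --> D)%R.
    apply: (log_ratio_interpolation (s := fun n => window r t n x)) => //.
    - by move=> y z _; exact: ball_mono.
    - by move=> n; exact: window_gt0.
    - move=> n; rewrite /window ler_pM2l ?window_factor_gt0// /scale big_ord_recr /=.
      rewrite ler_piMr//; last by have /andP[_ /ltW] := hr (x n).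
      by apply: prodr_ge0 => j _; have /andP[/ltW] := hr (x j).
    - have -> : (- (fiber_entropy - log_V_mean - fine (\int[Q]_p (gain_lim r t (K p.1) p.2)%:E)) =
        fine (\int[Q]_p (gain_lim r t (K p.1) p.2)%:E) + (log_V_mean - fiber_entropy))%R.
        by ring.
      exact: Fav.
  have GD := log_ratio_comparison F0 G0 GF FG FD.
  split => [n|]; first by apply: G0; exact: expR_gt0.
  have /cvgN : (ln (G (coding r t x) (h n)) / ln (h n) @[n --> \oo] --> D)%R by exact: cvg_comp hto0 GD.
  apply: cvg_trans; apply: near_eq_cvg; apply: nearW => n /=.
  by rewrite -[LHS]/(- (ln (G (coding r t x) (h n)) / ln (h n)))%R expRK invrN mulrN opprK mulrC.
- move=> x /= nD [G0 GL]; apply: nD.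
  rewrite -[cascade_dimension]divr1.
  apply: (log_ratio_interpolation (s := h)) => //.
  + move=> s s0; have [n _ /(_ n (leqnn n)) /= hn] := cvgr_lt 0%R hto0' _ s0.
    exact: lt_le_trans (G0 n) (ball_mono moo x (ltW hn)).
  + by move=> y z _; exact: ball_mono.
  + by move=> n; exact: expR_gt0.
  + by move=> n; rewrite ler_expR lerN2 ler_nat.
  + apply: cvg_near_cst; near=> n; rewrite expRK mulrN mulVf// pnatr_eq0 -lt0n.
    by near: n; exists 1%N.
Unshelve. all: by end_near. Qed.

End mixture_dimension.

End cascade.

Theorem theorem4p2 (R : realType)
  (a : nat) (ha : (2 <= a)%N)
  (r t : letter ha -> R)
  (hr : forall i, 0 < r i < 1)
  (mup : probability (symbolic nat ha) R)
  (hmup : shift_ergodic mup)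
  (mu : probability (symbolic int ha) R)
  (hmu : natural_extension mup mu)
  (kappa : R.-pker (symbolic nat ha) ~> (symbolic nat ha))
  (hkappa : is_disintegration mu kappa)
  (d : measure_display) (Omega : measurableType d)
  (P : probability Omega R)
  (hP : standard_probability P)
  (V : {RV P >-> R})
  (hV0 : forall w, 0 <= V w)
  (hV1 : ('E_P[V] = 1)%E)
  (hV : ('E_P[fun w => (V w * ln (V w))%R] < (entropy mup)%:E)%E)
  (Pa : probability (product_space (seq (letter ha)) Omega) R)
  (hPa : is_product_measure P Pa) :
  {ae Pa, forall w,
    (0 < cascade V mup w setT)%E ->
    exact_dimensional (pushforward (cascade V mup w) (coding r t))
      ((entropy mup - fine 'E_P[fun w => (V w * ln (V w))%R]
        - fine (cascade_conditional_entropy r t V mu kappa Pa))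
       / lyapunov r mup)}.
Proof.
have mV : mfunT V by [].
have V1 : (\int[P]_x (V x)%:E)%E = 1%E by rewrite -hV1 unlock.
have EE : ('E_P[fun w => (V w * ln (V w))%R] = \int[P]_x (V x * ln (V x))%:E)%E by rewrite unlock.
rewrite EE in hV *.
have mVl : mfunT (fun z => V z * ln (V z)).
  by apply: measurable_funM => //; exact: measurable_ln_comp.
(* As V ln V is at least -1, a mean below +oo is enough. *)
have Vi : P.-integrable setT (fun z => (V z * ln (V z))%:E).
  apply: (integrable_lower_bound (c := 1)) => // [z|]; last exact: lt_trans hV (ltry _).
  by have := psi_ge0 (hV0 z); rewrite /psi -lerBlDr sub0r.
have PT : (P : {measure set Omega -> \bar R}) setT = 1%E by exact: probability_setT.
(* The mean of psi (V) is h_V + 1, so the gap that excludes total mass 0 is the hypothesis h_V <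
   h_mu. *)
have Q1 : cascm mu kappa Pa mV hV0 setT = 1%E.
  rewrite -(ctotE mu kappa hPa mV hV0 V1) (ctot1 hmup hmu hkappa hPa V1)//.
  apply: (ctot_gt0 hmu hkappa hPa mV hV0 V1).
  rewrite -fiber_entropyE -(entropyE hmu hkappa).
  under eq_integral do rewrite /psi EFinD.
  rewrite integralD//; last exact: finite_measure_integrable_cst.
  rewrite integral_cst// [X in (_ * X)%E](_ : _ = 1%E)// mule1 addeC.
  by rewrite lteD2lE.
have DE : cascade_dimension mup mu kappa P Pa mV hV0 r t = ((entropy mup - fine (\int[P]_x (V x * ln (V x))%:E)
    - fine (cascade_conditional_entropy r t V mu kappa Pa)) / lyapunov r mup).
  by rewrite /cascade_dimension (entropyE hmu hkappa) (integral_gain_lim mu kappa hPa mV hV0 V1 t hr).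
rewrite -DE.
(* The mixture is the root weight times the cascade, and the root weight may be 0 where the cascade
   is not. Since the cascade does not depend on the root label, this label is redrawn so as to be
   positive while the tree stays outside the null sets. *)
pose off_root := [pred u : seq (letter ha) | u != [::]].
have rho_inj (u v : seq (letter ha)) : ~~ off_root u -> ~~ off_root v -> u = v -> u = v by [].
have H1 := ae_merge (rho := id) hPa rho_inj (mixm_cascade hmup hmu hkappa hPa V1 Q1).
have H2 := ae_merge (rho := id) hPa rho_inj
  (ae_mixture_ball_mass hmup hmu hkappa hPa V1 Q1 t hr Vi).
apply: filterS2 H1 H2 => w Hw1 Hw2 _.
have FPa : Filter (nbhs (almost_everywhere Pa)) by exact _.
have [w' [mE mD] Vw'] := exists_root_gt0 hPa mV hV0 V1 (@filterI _ _ FPa _ _ Hw1 Hw2).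
have off : cascade V mup (merge off_root id (w, w')) = cascade V mup w.
  by apply: cascade_off_root => u u0; rewrite /merge /= u0.
apply: exact_dimensional_scale Vw' _ mD => A mA.
by rewrite mE// off.
Qed.
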